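(* Let $\alpha\in(0,1)$, $T>0$, and let $\Omega\subset\mathbb R^d$ be a bounded domain with smooth boundary. Let $a\in D(\mathcal A^\beta)$ with $\beta\ge0$ and $\beta>d/4-1$. If $a\ge0$ and $a\not\equiv0$ in $\Omega$, then the solution $u$ to $$\begin{cases}\partial_t^\alpha(u-a)+\mathcal A u=0 & \text{in }\Omega\times(0,T),\\ u=0 & \text{on }\partial\Omega\times(0,T)\end{cases}$$ satisfies $u>0$ in $\Omega\times(0,T)$.
   Context: Here $d\in\mathbb N=\{1,2,\dots\}$. $\mathcal A f=-\mathrm{div}(\boldsymbol A\nabla f)+cf$ with domain $D(\mathcal A)=H^2(\Omega)\cap H_0^1(\Omega)$, where $\boldsymbol A\in C^1(\overline\Omega;\mathbb R^{d\times d}_{\mathrm{sym}})$, $0\le c\in C(\overline\Omega)$, and there is $\theta>0$ with $\theta|\boldsymbol\xi|^2\le\boldsymbol\xi\cdot\boldsymbol A(\boldsymbol x)\boldsymbol\xi$ for all $\boldsymbol x\in\overline\Omega$, $\boldsymbol\xi\in\mathbb R^d$. Let $\{(\lambda_n,\varphi_n)\}_{n\ge1}$ be its eigensystem: $0<\lambda_1<\lambda_2\le\cdots\to\infty$, $\{\varphi_n\}$ a complete orthonormal basis of $L^2(\Omega)$. For $\gamma\ge0$, $\mathcal A^\gamma f=\sum_n\lambda_n^\gamma(f,\varphi_n)\varphi_n$ and $D(\mathcal A^\gamma)=\{f\in L^2(\Omega):\|f\|_{D(\mathcal A^\gamma)}:=\|\mathcal A^\gamma f\|_{L^2(\Omega)}<\infty\}$.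 $\partial_t^\alpha$ is the inverse of the Riemann–Liouville integral operator $J^\alpha:L^2(0,T)\to L^2(0,T)$, $J^\alpha f(t)=\int_0^t\frac{s^{\alpha-1}}{\Gamma(\alpha)}f(t-s)\,ds$. With $E_{\alpha,\beta}(z)=\sum_{k=0}^\infty\frac{z^k}{\Gamma(\alpha k+\beta)}$, the problem has a unique solution, given by $$u(t)=\sum_{n=1}^\infty E_{\alpha,1}(-\lambda_nt^\alpha)(a,\varphi_n)\varphi_n ,$$ which lies in $L^{1/\gamma}(0,T;D(\mathcal A^{\beta+\gamma}))$ for all $0\le\gamma\le1$ ($1/\gamma=\infty$ if $\gamma=0$). The function $u(\cdot,t)\in D(\mathcal A^{\beta+1})$ is represented by a function continuous in $\boldsymbol x$. *)

(* Defs.v *)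
From HB Require Import structures.
From mathcomp Require Import all_boot all_order all_algebra.
From mathcomp Require Import all_classical all_reals all_analysis.
From mathcomp Require Import measurable_realfun.

Set Implicit Arguments.
Unset Strict Implicit.
Unset Printing Implicit Defensive.
Import Order.TTheory GRing.Theory Num.Theory.
Import numFieldNormedType.Exports.
Local Open Scope classical_set_scope.
Local Open Scope ring_scope.

(* Lebesgue measure on R^d, as the image of the d-fold product of the Lebesgue
   measure on R under the identification of d-tuples with row vectors. *)

Section ImageMeasure.
Context d1 d2 (T1 : measurableType d1) (T2 : measurableType d2) (R : realType).
Variables (m : {measure set T1 -> \bar R}) (f : T1 -> T2) (g : T2 -> T1).
Hypotheses (mf : measurable_fun setT f) (mg : measurable_fun setT g).
Hypothesis fK : cancel f g.

Let pushforward_measure : {measure set T2 -> \bar R} :=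
  measure_function_pushforward__canonical__measure_function_Measure m mf.

Hypothesis sfm : sigma_finite setT m.

Definition image_measure of measurable_fun setT f & measurable_fun setT g &
  cancel f g & sigma_finite setT m : set T2 -> \bar R := pushforward m f.
Local Notation nu := (image_measure mf mg fK sfm).

HB.instance Definition _ := Measure.copy nu pushforward_measure.

Lemma image_measure_sigma_finite : sigma_finite setT nu.
Proof.
have [F TF Foo] := sfm.
exists (fun n => g @^-1` F n) => [|n].
  by rewrite -preimage_bigcup -TF preimage_setT.
have [mF moo] := Foo n; split.
  by rewrite -[X in measurable X]setTI; exact: mg.
rewrite /image_measure /pushforward.
suff -> : f @^-1` (g @^-1` F n) = F n by [].
by apply/seteqP; split=> x /=; rewrite fK.
Qed.

HB.instance Definition _ :=
  @Measure_isSigmaFinite.Build _ _ _ nu image_measure_sigma_finite.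
End ImageMeasure.

Section LebesgueTuple.
Context {R : realType}.
Notation tupR n := (n.-tuple (measurableTypeR R)).

Definition cons_pair n (p : measurableTypeR R * tupR n) : tupR n.+1 :=
  [the tupR n.+1 of p.1 :: p.2].

Lemma measurable_cons_pair n : measurable_fun setT (@cons_pair n).
Proof. by apply: measurable_cons; [exact: measurable_fst | exact: measurable_snd]. Qed.

Definition uncons_pair n (t : tupR n.+1) : measurableTypeR R * tupR n :=
  (thead t, [tuple of behead t]).

Lemma measurable_uncons_pair n : measurable_fun setT (@uncons_pair n).
Proof.
apply/measurable_fun_pairP; split.
  exact: measurable_tnth.
exact: measurable_behead.
Qed.

Lemma cons_pairK n : cancel (@cons_pair n) (@uncons_pair n).
Proof. by case=> x t; congr pair; apply/val_inj. Qed.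

Lemma sigma_finite_prod n (mu : {sigma_finite_measure set (tupR n) -> \bar R}) :
  sigma_finite setT (@lebesgue_measure R \x mu)%E.
Proof.
have /sigma_finiteP[F [TF ndF Foo]] := sigma_finiteT (@lebesgue_measure R).
have /sigma_finiteP[G [TG ndG Goo]] := sigma_finiteT mu.
exists (fun n => F n `*` G n).
  rewrite -setXTT TF TG predeqE => -[x y]; split.
    move=> [/= [i _ Fnx] [k _ Gky]]; exists (maxn i k) => //; split.
    - by move: x Fnx; exact/subsetPset/ndF/leq_maxl.
    - by move: y Gky; exact/subsetPset/ndG/leq_maxr.
  by move=> [i _ []/= ? ?]; split; exists i.
move=> k; have [? ?] := Foo k; have [? ?] := Goo k.
split; first exact: measurableX.
by rewrite product_measure1E// lte_mul_pinfty// ge0_fin_numE.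
Qed.

Definition leb_cons n (mu : {sigma_finite_measure set (tupR n) -> \bar R}) :
    {sigma_finite_measure set (tupR n.+1) -> \bar R} :=
  image_measure (@measurable_cons_pair n) (@measurable_uncons_pair n)
    (@cons_pairK n) (sigma_finite_prod mu).

Fixpoint leb_tuple n : {sigma_finite_measure set (tupR n) -> \bar R} :=
  match n with
  | 0%N => \d_([tuple] : tupR 0)
  | n.+1 => leb_cons (leb_tuple n)
  end.

End LebesgueTuple.

Section LebesgueRV.
Variables (R : realType) (d : nat).
Notation tupR := (d.-tuple (measurableTypeR R)).

(* R^d with its Borel sets *)
Definition borelRV := g_sigma_algebraType (@open 'rV[R]_d).

Definition rv_of_tuple (t : tupR) : borelRV := \row_i tnth t i.
Definition tuple_of_rv (x : borelRV) : tupR :=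
  [tuple (x : 'rV[R]_d) ord0 i | i < d].

Lemma rv_of_tupleK : cancel rv_of_tuple tuple_of_rv.
Proof. by move=> t; apply: eq_from_tnth => i; rewrite tnth_mktuple mxE. Qed.

Lemma measurable_tuple_of_rv : measurable_fun setT tuple_of_rv.
Proof.
apply/measurable_fun_tnthP => i.
have -> : (fun x => tnth x i) \o tuple_of_rv = (fun x : 'rV[R]_d => x ord0 i).
  by apply/funext => x /=; rewrite tnth_mktuple.
apply: (measurability _ (RGenOpens.measurableE R)) => //.
move=> _ [_ [x [y ->]] <-]; rewrite setTI; apply: sub_sigma_algebra.
apply: open_comp; last exact: interval_open.
by move=> z _; exact: coord_continuous.
Qed.

Let box (q : 'rV[rat]_d) (k : nat) : set 'rV[R]_d :=
  [set x | forall i, `|x ord0 i - ratr (q ord0 i)| < k.+1%:R^-1].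

Lemma measurable_rv_of_tuple : measurable_fun setT rv_of_tuple.
Proof.
apply: (measurability (@open 'rV[R]_d : set (set borelRV))); first by [].
move=> _ [U oU <-]; rewrite setTI.
pose I : set ('rV[rat]_d * nat) := [set qk | box qk.1 qk.2 `<=` U].
have -> : U = \bigcup_(qk in I) box qk.1 qk.2.
  apply/seteqP; split=> [x Ux|x [qk Iqk]]; last exact: Iqk.
  have /nbhs_ballP[e /= e0 xeU] : nbhs x U by exact: open_nbhs_nbhs.
  have [k ke] : exists k, k.+1%:R^-1 < e / 2.
    have e20 : 0 < e / 2 by rewrite divr_gt0.
    exists (Num.trunc (e / 2)^-1).
    by rewrite invf_plt ?posrE// truncnS_gt // invr_ge0 ltW.
  have /= qP i : exists q : rat, `|x ord0 i - ratr q| < k.+1%:R^-1.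
    have : x ord0 i - k.+1%:R^-1 < x ord0 i + k.+1%:R^-1.
      by rewrite ltrBlDr -addrA ltrDl addr_gt0.
    move=> /rat_in_itvoo[q]; rewrite in_itv/= => /andP[q1 q2]; exists q.
    by rewrite distrC ltr_distl q1 q2.
  exists (\row_i sval (cid (qP i)), k) => [y /= yq|i]; last first.
    by rewrite /= mxE; exact: (svalP (cid (qP i))).
  apply: xeU; split=> // i0 i; rewrite ord1 /ball /=.
  have := yq i; rewrite mxE; case: cid => q /= xq yq'.
  rewrite (le_lt_trans (ler_distD (ratr q) _ _))//.
  rewrite [ltRHS](splitr e) ltrD//; last by rewrite distrC (lt_trans yq').
  exact: lt_trans xq ke.
rewrite preimage_bigcup bigcup_mkcond; apply: countable_bigcupT_measurable.
  exact: countableP.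
move=> [q k]; case: ifP => // _; rewrite /box /=.
have -> : rv_of_tuple @^-1`
    [set x | forall i, `|x ord0 i - ratr (q ord0 i)| < k.+1%:R^-1] =
  \bigcap_(i in [set: 'I_d]) [set t : tupR |
    ball (ratr (q ord0 i) : R) k.+1%:R^-1 (tnth t i)].
  apply/seteqP; split=> t /= tP i; [move=> _|]; have := tP i.
    by rewrite mxE /ball/= distrC.
  by rewrite mxE /ball/= distrC; exact.
apply: fin_bigcap_measurable => // i _.
rewrite -[X in measurable X]setTI.
apply: (@measurable_tnth _ (measurableTypeR R) d i) => //.
by apply: open_measurable; exact: ball_open.
Qed.

Definition leb : {sigma_finite_measure set borelRV -> \bar R} :=
  image_measure measurable_rv_of_tuple measurable_tuple_of_rv rv_of_tupleK
    (sigma_finiteT (leb_tuple d)).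

End LebesgueRV.

Arguments leb {R d}.

Section L2.
Context disp (X : measurableType disp) (R : realType).
Variables (mu : {measure set X -> \bar R}) (D : set X).

Definition L2 (f : X -> R) : Prop :=
  measurable_fun D f /\ mu.-integrable D (fun x => (f x ^+ 2)%:E).

Definition inner (f g : X -> R) : R := (\int[mu]_(x in D) (f x * g x))%R.

Definition L2dist2 (f g : X -> R) : \bar R :=
  (\int[mu]_(x in D) ((f x - g x) ^+ 2)%:E)%E.

Definition L2cvg (f_ : nat -> X -> R) (f : X -> R) : Prop :=
  L2dist2 (f_ n) f @[n --> \oo] --> 0%E.

End L2.

Section Domains.
Context {R : realType} {d : nat}.
Implicit Types (U Omega : set 'rV[R]_d) (f : 'rV[R]_d -> R).

Definition basis_vec (i : 'I_d) : 'rV[R]_d := delta_mx ord0 i.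

Definition pd (i : 'I_d) f : 'rV[R]_d -> R := fun x => 'D_(basis_vec i) f x.

Fixpoint Ck (k : nat) U f : Prop :=
  (forall x, U x -> {for x, continuous f}) /\
  match k with
  | 0%N => True
  | k'.+1 => forall i, (forall x, U x -> derivable f x (basis_vec i)) /\
                       Ck k' U (pd i f)
  end.

Definition Cinfty U f : Prop := forall k, Ck k U f.

Definition bounded_domain Omega : Prop :=
  [/\ open Omega, connected Omega, bounded_set Omega & Omega !=set0].

(* Near each boundary point, Omega is a strict sublevel set {rho < 0} of a
   smooth function rho without critical points; Omega is meant to be open. *)
Definition smooth_boundary Omega : Prop :=
  forall p, closure Omega p -> ~ Omega p ->
  exists (U : set 'rV[R]_d) (rho : 'rV[R]_d -> R),
    [/\ open U /\ U p, Cinfty U rho,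
        forall x, U x -> exists i, pd i rho x != 0 &
        Omega `&` U = [set x | U x /\ rho x < 0]].

Definition C1_closure Omega f : Prop :=
  {within closure Omega, continuous f} /\
  forall i, (forall x, Omega x -> derivable f x (basis_vec i)) /\
    exists g, {within closure Omega, continuous g} /\
              forall x, Omega x -> pd i f x = g x.

Definition elliptic_coefficients Omega (A : 'rV[R]_d -> 'M[R]_d)
    (c : 'rV[R]_d -> R) : Prop :=
  [/\ forall i j, C1_closure Omega (fun x => A x i j),
      forall x, closure Omega x -> (A x)^T = A x,
      exists theta : R, 0 < theta /\
        forall x (xi : 'rV[R]_d), closure Omega x ->
          theta * (\sum_i xi ord0 i ^+ 2) <= (xi *m A x *m xi^T) ord0 ord0,
      {within closure Omega, continuous c} &
      forall x, closure Omega x -> 0 <= c x].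

End Domains.

Section EllipticOperator.
Context {R : realType} {d : nat}.
Variable Omega : set 'rV[R]_d.
Implicit Types (f g h v : 'rV[R]_d -> R).

Definition L2O f : Prop := L2 (@leb R d) Omega f.
Definition innerO f g : R := inner (@leb R d) Omega f g.
Definition L2dist2O f g : \bar R := L2dist2 (@leb R d) Omega f g.
Definition L2cvgO (f_ : nat -> 'rV[R]_d -> R) f : Prop :=
  L2cvg (@leb R d) Omega f_ f.

Definition test_function (psi : 'rV[R]_d -> R) : Prop :=
  Cinfty setT psi /\
  exists K, [/\ compact K, K `<=` Omega & forall x, ~ K x -> psi x = 0].

Definition weak_pd (i : 'I_d) f g : Prop :=
  forall psi, test_function psi -> innerO f (pd i psi) = - innerO g psi.

(* f is in H^1(Omega), with weak gradient G *)
Definition H1_grad f (G : 'I_d -> 'rV[R]_d -> R) : Prop :=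
  L2O f /\ forall i, L2O (G i) /\ weak_pd i f (G i).

Definition H2 f : Prop :=
  exists G, H1_grad f G /\ forall i, exists K, H1_grad (G i) K.

(* closure of the test functions in H^1(Omega) *)
Definition H10 f : Prop :=
  exists G, H1_grad f G /\
    exists psi : nat -> 'rV[R]_d -> R,
      [/\ forall k, test_function (psi k), L2cvgO psi f &
          forall i, L2cvgO (fun k => pd i (psi k)) (G i)].

Variables (A : 'rV[R]_d -> 'M[R]_d) (c : 'rV[R]_d -> R).

Definition domA f : Prop := H2 f /\ H10 f.

(* h = - div (A grad f) + c f with f in H^2 /\ H^1_0: G is the weak gradient
   of f and W i the weak i-th derivative of the i-th component of A grad f *)
Definition opA f h : Prop :=
  domA f /\ L2O h /\
  exists (G W : 'I_d -> 'rV[R]_d -> R),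
    [/\ H1_grad f G,
        forall i, L2O (W i) /\
          weak_pd i (fun x => \sum_j A x i j * G j x) (W i) &
        {ae (@leb R d), forall x, Omega x ->
           h x = - (\sum_i W i x) + c x * f x}].

(* eigenpairs are numbered from 0, repeated according to multiplicity *)
Record eigensystem (lam : nat -> R) (phi : nat -> 'rV[R]_d -> R) : Prop := {
  eig_pos : 0 < lam 0%N;
  eig_simple : lam 0%N < lam 1%N;
  eig_nondecr : forall n, lam n.+1 <= lam n.+2;
  eig_infty : lam n @[n --> \oo] --> +oo;
  eig_eq : forall n, opA (phi n) (fun x => lam n * phi n x);
  eig_orthonormal : forall m n, innerO (phi m) (phi n) = (m == n)%:R;
  eig_complete : forall f, L2O f ->
    L2cvgO (fun N x => \sum_(n < N) innerO f (phi n) * phi n x) f }.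

Variables (lam : nat -> R) (phi : nat -> 'rV[R]_d -> R).

(* g = A^gamma f *)
Definition powA (gamma : R) f g : Prop :=
  L2O g /\
  L2cvgO (fun N x => \sum_(n < N) lam n `^ gamma * innerO f (phi n) * phi n x) g.

Definition dom_powA (gamma : R) f : Prop := L2O f /\ exists g, powA gamma f g.

End EllipticOperator.

Section FractionalDerivative.
Context {R : realType}.

Definition Gamma (x : R) : R :=
  (\int[@lebesgue_measure R]_(t in `]0%R, +oo[) (t `^ (x - 1) * expR (- t)))%R.

Definition RL_integral (alpha : R) (f : R -> R) (t : R) : R :=
  (\int[@lebesgue_measure R]_(s in `]0%R, t[)
    (s `^ (alpha - 1) / Gamma alpha * f (t - s)))%R.

Definition L2T (T : R) (f : R -> R) : Prop := L2 (@lebesgue_measure R) `]0, T[ f.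

(* f is in the range of J^alpha on L^2(0,T) and g is its inverse image *)
Definition frac_deriv (alpha T : R) (f g : R -> R) : Prop :=
  [/\ L2T T f, L2T T g &
      {ae (@lebesgue_measure R), forall t, t \in `]0, T[ ->
         f t = RL_integral alpha g t}].

End FractionalDerivative.

Section Problem.
Context {R : realType} {d : nat}.
Variables (Omega : set 'rV[R]_d) (A : 'rV[R]_d -> 'M[R]_d) (c : 'rV[R]_d -> R).

(* u t stands for u(.,t). The L^2(Omega)-valued equation is read through its
   pairings with the elements v of D(A): for rough initial data, t |-> A u(t)
   need not be square integrable on (0,T) as an L^2(Omega)-valued function,
   whereas t |-> (A u(t), v) = (u(t), A v) is. The boundary condition is part
   of u(t) in D(A). *)
Definition solution (alpha T : R) (a : 'rV[R]_d -> R)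
    (u : R -> 'rV[R]_d -> R) : Prop :=
  exists Au : R -> 'rV[R]_d -> R,
    (forall t, 0 < t < T -> opA Omega A c (u t) (Au t)) /\
    forall v, domA Omega v ->
      frac_deriv alpha T (fun t => innerO Omega (fun x => u t x - a x) v)
                         (fun t => - innerO Omega (Au t) v).

Definition L2_time_continuous (T : R) (u : R -> 'rV[R]_d -> R) : Prop :=
  forall t, 0 < t < T -> L2dist2O Omega (u s) (u t) @[s --> t] --> 0%E.

End Problem.

(* Main.v *)
(* Write E(t) for the solution operator of the equation, so that u(t) = E(t) a. It
   acts on the n-th eigenfunction as E_{al,1}(-lam_n t^al): this coefficient
   solves a scalar Volterra equation whose solution is unique, and the continuity
   of u in time turns the almost everywhere identity into an identity for every t.

   Nonnegativity is preserved by the resolvents (A + m)^-1 (weak maximum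
   principle), hence, by Yosida approximation and a Neumann series for the
   Volterra equation, by the operator r(t) with symbol
   rho(t) = t^(al-1) E_{al,al}(-lam t^al), and by E(t) = (r * g)(t), where g is
   the kernel of J^(1-al). The identity t rho(t) = al (rho * E)(t) gives
   E(t1 + tau) >= k (int_0^tau r) (int_0^t1 E) in the sense of operators, and a
   splitting of the Laplace transform of rho gives
   int_0^tau r >= (A + p^al)^-1 - exp(-p tau/2) (A + (p/2)^al)^-1 for every p > 0.

   If u >= delta on a ball B for s in a set of positive measure in (0,t1), then
   (int_0^t1 E) a dominates a multiple of the indicator of B. Comparison with a
   smooth bump that decays at rate sqrt m bounds (A + m)^-1 1_B below by
   exp(-C sqrt m)/(C' m) on half of any concentric ball contained in Omega; with
   m = p^al and al < 2 this beats exp(-p tau/2) for large p. So positivity spreads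
   between concentric balls, at every later time. A first ball comes from u(s)
   being nonzero, nonnegative and continuous, by a countable covering of (0,t1),
   and connectedness of Omega concludes. *)

(* The equation has memory, so no semigroup law E(t+s) = E(t)E(s) carries positivity from one time
   to the next. The inequality E(t1+tau) >= k (int_0^tau r)(int_0^t1 E) stands in for it, with the
   integrated past as the new datum. Operators are not constructed. An operator is the sequence of
   values of its symbol at the eigenvalues, acting on square-summable coefficient sequences; a
   sequence counts as nonnegative when it pairs nonnegatively with every nonnegative L^2 function.
   Integrals and limits of operators thus reduce to scalar ones with bounds uniform in the
   eigenvalue, and an operator inequality says that a difference of symbols preserves nonnegativity.
   Partial sums of a nonnegative expansion need not be nonnegative, while it is to finite sums that
   the weak elliptic equation is applied; hence the maximum principle carries an L^2 error that
   vanishes in the limit. A spreading step shrinks balls and consumes time, but an arbitrarily small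
   amount of it, so a closedness argument with no count of the steps is possible. *)
Require Import Defs.
From HB Require Import structures.
From mathcomp Require Import all_boot all_order all_algebra.
From mathcomp Require Import all_classical all_reals all_analysis.
From mathcomp Require Import measurable_realfun ring lra.

Set Implicit Arguments.
Unset Strict Implicit.
Unset Printing Implicit Defensive.
Import Order.TTheory GRing.Theory Num.Theory.
Import numFieldNormedType.Exports.
Local Open Scope classical_set_scope.
Local Open Scope ring_scope.

(** * Square integrable functions *)

Section RealIntegrals.
Context d (T : measurableType d) (R : realType).
Variables (mu : {measure set T -> \bar R}) (D : set T).
Hypothesis mD : measurable D.
Implicit Types f g h : T -> R.

Definition rint f : Prop := mu.-integrable D (EFin \o f).

Lemma rint_meas f : rint f -> measurable_fun D f.
Proof. by move=> /(@measurable_int _ _ _ mu) /measurable_EFinP. Qed.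

Lemma rint_eq f g : (forall x, D x -> f x = g x) -> rint f -> rint g.
Proof.
move=> fg; apply: eq_integrable => // x; rewrite inE => Dx /=.
by rewrite fg.
Qed.

Lemma rint_le f g : measurable_fun D f -> (forall x, D x -> `|f x| <= g x) ->
  rint g -> rint f.
Proof.
move=> mf fg ig; apply: (le_integrable mD _ _ ig); first exact/measurable_EFinP.
by move=> x Dx /=; rewrite lee_fin (le_trans (fg _ Dx))// ler_norm.
Qed.

Lemma rintD f g : rint f -> rint g -> rint (fun x => f x + g x).
Proof. by move=> h1 h2; have := integrableD mD h1 h2. Qed.

Lemma rintB f g : rint f -> rint g -> rint (fun x => f x - g x).
Proof. by move=> h1 h2; have := integrableB mD h1 h2. Qed.

Lemma rintZ (k : R) f : rint f -> rint (fun x => k * f x).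
Proof. by move=> h; have := integrableZl mD k h. Qed.

Lemma rintN f : rint f -> rint (fun x => - f x).
Proof. by move=> h; have := integrableN h. Qed.

Lemma rint0 : rint (fun=> 0).
Proof. exact: integrable0. Qed.

Lemma rint_norm f : rint f -> rint (fun x => `|f x|).
Proof. exact: integrable_norm. Qed.

Lemma rint_sum I (s : seq I) (P : pred I) (h : I -> T -> R) :
  (forall i, P i -> rint (h i)) -> rint (fun x => \sum_(i <- s | P i) h i x).
Proof.
move=> hi; elim: s => [|i s IH].
  by apply: rint_eq rint0 => x _; rewrite big_nil.
have [Pi|Pi] := boolP (P i).
  by apply: rint_eq (rintD (hi _ Pi) IH) => x _; rewrite big_cons Pi.
by apply: rint_eq IH => x _; rewrite big_cons (negPf Pi).
Qed.

Lemma RintegralN f : rint f ->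
  \int[mu]_(x in D) (- f x) = - \int[mu]_(x in D) f x.
Proof.
move=> h; rewrite -mulN1r -RintegralZl//.
by apply: eq_Rintegral => x _; rewrite mulN1r.
Qed.

Lemma Rintegral_sum I (s : seq I) (P : pred I) (h : I -> T -> R) :
  (forall i, P i -> rint (h i)) ->
  \int[mu]_(x in D) (\sum_(i <- s | P i) h i x) =
  \sum_(i <- s | P i) \int[mu]_(x in D) h i x.
Proof.
move=> hi; elim: s => [|i s IH].
  rewrite big_nil -[RHS](mul0r (fine (mu D))) -Rintegral_cst//.
  by apply: eq_Rintegral => x _; rewrite big_nil.
rewrite big_cons; case: ifPn => Pi.
  rewrite -IH -RintegralD//; [|exact: hi|exact: rint_sum].
  by apply: eq_Rintegral => x _; rewrite big_cons Pi.
by rewrite -IH; apply: eq_Rintegral => x _; rewrite big_cons (negPf Pi).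
Qed.

Lemma EFin_Rintegral f : rint f ->
  (\int[mu]_(x in D) f x)%:E = (\int[mu]_(x in D) (f x)%:E)%E.
Proof. by move=> h; rewrite /Rintegral fineK//; exact: integrable_fin_num. Qed.

Lemma Rdct (f_ : nat -> T -> R) f g :
  (forall n, measurable_fun D (f_ n)) -> measurable_fun D f ->
  (forall x, D x -> f_ n x @[n --> \oo] --> f x) ->
  rint g -> (forall n x, D x -> `|f_ n x| <= g x) ->
  rint f /\ \int[mu]_(x in D) f_ n x @[n --> \oo] --> \int[mu]_(x in D) f x.
Proof.
move=> mf_ mf cf ig fg.
have [] := @dominated_convergence _ _ _ mu _ mD (fun n => EFin \o f_ n)
   (EFin \o f) (EFin \o g).
- by move=> n; exact/measurable_EFinP.
- exact/measurable_EFinP.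
- by apply/aeW => x Dx; apply/cvg_EFin; [exact: nearW|exact: cf].
- exact: ig.
- by apply/aeW => x n Dx /=; rewrite lee_fin fg.
move=> i1 _ /= c; split => //.
rewrite /Rintegral; apply: fine_cvg.
rewrite fineK; last exact: integrable_fin_num.
exact: c.
Qed.

Lemma Rintegral_ae_eq f g : measurable_fun D f -> measurable_fun D g ->
  {ae mu, forall x, D x -> f x = g x} ->
  \int[mu]_(x in D) f x = \int[mu]_(x in D) g x.
Proof.
move=> mf mg fg; congr fine; apply: ae_eq_integral => //.
- exact/measurable_EFinP.
- exact/measurable_EFinP.
- by apply: filterS fg => x /= + Dx => ->.
Qed.

(** [g] agrees almost everywhere with the maximum of [f] and [g], which dominates [f] at every
    point. *)
Lemma le_Rintegral_ae f g : rint f -> rint g ->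
  {ae mu, forall x, D x -> f x <= g x} ->
  \int[mu]_(x in D) f x <= \int[mu]_(x in D) g x.
Proof.
move=> jf jg fg.
have mf := rint_meas jf; have mg := rint_meas jg.
have mm : measurable_fun D (fun x => Num.max (f x) (g x)).
  exact: measurable_maxr.
have -> : \int[mu]_(x in D) g x = \int[mu]_(x in D) Num.max (f x) (g x).
  apply: Rintegral_ae_eq => //; apply: filterS fg => x h Dx.
  by rewrite max_r// h.
apply: le_Rintegral => //.
  apply: rint_le (rintD (rint_norm jf) (rint_norm jg)) => // x Dx.
  by rewrite /Num.max; case: ifP => _; rewrite ?lerDr ?lerDl.
by move=> x Dx; rewrite le_max lexx.
Qed.

Lemma Rintegral_ge0_ae f : rint f -> {ae mu, forall x, D x -> 0 <= f x} ->
  0 <= \int[mu]_(x in D) f x.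
Proof.
move=> jf h; have := le_Rintegral_ae rint0 jf h.
by rewrite Rintegral_cst// mul0r.
Qed.

Lemma Rintegral0_ae f : measurable_fun D f ->
  (forall x, D x -> 0 <= f x) -> rint f -> \int[mu]_(x in D) f x = 0 ->
  {ae mu, forall x, D x -> f x = 0}.
Proof.
move=> mf f0 jf h.
have := (@ae_eq_integral_abs _ _ _ mu _ mD (EFin \o f)).
case.
  exact/measurable_EFinP.
move=> + _; move=> h'; have {h'} := h' _.
have hz : (\int[mu]_(x in D) `|(EFin \o f) x| = 0)%E.
  transitivity (\int[mu]_(x in D) (f x)%:E)%E.
    by apply: eq_integral => x; rewrite inE => Dx /=; rewrite ger0_norm// f0.
  by rewrite -EFin_Rintegral// h.
by move=> /(_ hz); apply: filterS => x hx Dx; apply: EFin_inj; exact: hx.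
Qed.

Section LTwo.
Notation L2 := (L2 mu D).
Notation inner := (inner mu D).

Lemma L2_meas f : L2 f -> measurable_fun D f. Proof. by case. Qed.

Lemma L2_sqr f : L2 f -> rint (fun x => f x ^+ 2).
Proof. by case. Qed.

Lemma rint_mul f g : L2 f -> L2 g -> rint (fun x => f x * g x).
Proof.
move=> [mf if2] [mg ig2]; apply: rint_le (rintD if2 ig2).
  exact: measurable_funM.
move=> x Dx; rewrite normrM.
have := sqr_ge0 (`|f x| - `|g x|).
rewrite sqrrB !real_normK ?num_real// => h.
have h2 : 0 <= `|f x| * `|g x| by rewrite mulr_ge0.
lra.
Qed.

Lemma L2Z k f : L2 f -> L2 (fun x => k * f x).
Proof.
move=> [mf if2]; split; first exact: measurable_funM.
by apply: rint_eq (rintZ (k ^+ 2) if2) => x _; rewrite exprMn.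
Qed.

Lemma L2D f g : L2 f -> L2 g -> L2 (fun x => f x + g x).
Proof.
move=> Lf Lg; split; first by apply: measurable_funD; [case: Lf|case: Lg].
have := rintD (rintD (L2_sqr Lf) (rintZ 2 (rint_mul Lf Lg))) (L2_sqr Lg).
by apply: rint_eq => x _; rewrite sqrrD mulr_natl.
Qed.

Lemma L2_eq f g : (forall x, D x -> f x = g x) -> L2 f -> L2 g.
Proof.
move=> fg [mf if2]; split.
  by apply: eq_measurable_fun mf => x; rewrite inE => /fg.
by apply: rint_eq if2 => x Dx; rewrite fg.
Qed.

Lemma L2N f : L2 f -> L2 (fun x => - f x).
Proof. by move=> /(L2Z (-1)); apply: L2_eq => x _; rewrite mulN1r. Qed.

Lemma L2B f g : L2 f -> L2 g -> L2 (fun x => f x - g x).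
Proof. by move=> Lf Lg; exact: (L2D Lf (L2N Lg)). Qed.

Lemma L20 : L2 (fun=> 0).
Proof.
by split => //; apply: rint_eq rint0 => x _; rewrite expr0n.
Qed.

Lemma L2_sum I (s : seq I) (P : pred I) (h : I -> T -> R) :
  (forall i, P i -> L2 (h i)) -> L2 (fun x => \sum_(i <- s | P i) h i x).
Proof.
move=> hi; elim: s => [|i s IH].
  by apply: L2_eq L20 => x _; rewrite big_nil.
have [Pi|Pi] := boolP (P i).
  by apply: L2_eq (L2D (hi _ Pi) IH) => x _; rewrite big_cons Pi.
by apply: L2_eq IH => x _; rewrite big_cons (negPf Pi).
Qed.

Lemma L2_le f g : measurable_fun D f -> (forall x, D x -> `|f x| <= `|g x|) ->
  L2 g -> L2 f.
Proof.
move=> mf fg [mg ig]; split => //; apply: rint_le ig; first exact: measurable_funX.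
move=> x Dx; rewrite normrX -[leRHS]ger0_norm ?sqr_ge0// [leRHS]normrX.
by rewrite lerXn2r ?nnegrE ?fg.
Qed.

Lemma L2_bounded f M : (mu D < +oo)%E -> measurable_fun D f ->
  (forall x, D x -> `|f x| <= M) -> L2 f.
Proof.
move=> muD mf fM; split => //.
apply: measurable_bounded_integrable => //.
  exact: measurable_funX.
exists (M ^+ 2); split; first exact: num_real.
move=> y My x Dx; rewrite /= normrX; apply: le_trans (ltW My).
by rewrite lerXn2r ?nnegrE ?fM// (le_trans _ (fM _ Dx)).
Qed.

Lemma L2_bmul f (b : T -> R) M : measurable_fun D b -> (forall x, D x -> `|b x| <= M) ->
  L2 f -> L2 (fun x => b x * f x).
Proof.
move=> mb bM Lf; apply: L2_le (L2Z M Lf).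
  by apply: measurable_funM => //; case: Lf.
move=> x Dx; rewrite !normrM ler_wpM2r//.
by rewrite (le_trans (bM _ Dx))// ler_norm.
Qed.

Lemma innerC f g : inner f g = inner g f.
Proof. by apply: eq_Rintegral => x _; rewrite mulrC. Qed.

Lemma inner_eq f f' g g' : (forall x, D x -> f x = f' x) ->
  (forall x, D x -> g x = g' x) -> inner f g = inner f' g'.
Proof.
by move=> ff gg; apply: eq_Rintegral => x; rewrite inE => Dx; rewrite ff// gg.
Qed.

Lemma innerDl f f' g : L2 f -> L2 f' -> L2 g ->
  inner (fun x => f x + f' x) g = inner f g + inner f' g.
Proof.
move=> Lf Lf' Lg; rewrite -RintegralD//; try exact: rint_mul.
by apply: eq_Rintegral => x _; rewrite mulrDl.
Qed.

Lemma innerZl k f g : L2 f -> L2 g -> inner (fun x => k * f x) g = k * inner f g.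
Proof.
move=> Lf Lg; rewrite -RintegralZl//; last exact: rint_mul.
by apply: eq_Rintegral => x _; rewrite mulrA.
Qed.

Lemma innerNl f g : L2 f -> L2 g -> inner (fun x => - f x) g = - inner f g.
Proof.
move=> Lf Lg; rewrite -mulN1r -innerZl//.
by apply: inner_eq => // x _; rewrite mulN1r.
Qed.

Lemma innerBl f f' g : L2 f -> L2 f' -> L2 g ->
  inner (fun x => f x - f' x) g = inner f g - inner f' g.
Proof.
by move=> Lf Lf' Lg; rewrite innerDl ?innerNl//; exact: L2N.
Qed.

Lemma innerDr f g g' : L2 f -> L2 g -> L2 g' ->
  inner f (fun x => g x + g' x) = inner f g + inner f g'.
Proof. by move=> *; rewrite innerC innerDl// !(innerC f). Qed.

Lemma innerZr k f g : L2 f -> L2 g -> inner f (fun x => k * g x) = k * inner f g.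
Proof. by move=> *; rewrite innerC innerZl// (innerC f). Qed.

Lemma innerBr f g g' : L2 f -> L2 g -> L2 g' ->
  inner f (fun x => g x - g' x) = inner f g - inner f g'.
Proof. by move=> *; rewrite innerC innerBl// !(innerC f). Qed.

Lemma inner_suml I (s : seq I) (P : pred I) (h : I -> T -> R) g :
  (forall i, P i -> L2 (h i)) -> L2 g ->
  inner (fun x => \sum_(i <- s | P i) h i x) g = \sum_(i <- s | P i) inner (h i) g.
Proof.
move=> hi Lg; rewrite -Rintegral_sum; last by move=> i Pi; apply: rint_mul => //; exact: hi.
by apply: eq_Rintegral => x _; rewrite mulr_suml.
Qed.

Lemma inner_ge0 f : 0 <= inner f f.
Proof. by apply: Rintegral_ge0 => x _; rewrite -expr2 sqr_ge0. Qed.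

Lemma inner_sqr f : inner f f = \int[mu]_(x in D) f x ^+ 2.
Proof. by apply: eq_Rintegral => x _; rewrite expr2. Qed.

Lemma inner_nonneg f g : L2 f -> L2 g ->
  {ae mu, forall x, D x -> 0 <= f x} -> {ae mu, forall x, D x -> 0 <= g x} ->
  0 <= inner f g.
Proof.
move=> Lf Lg f0 g0; apply: Rintegral_ge0_ae; first exact: rint_mul.
by apply: filterS2 f0 g0 => x a b Dx; rewrite mulr_ge0 ?a ?b.
Qed.

Definition nrm f := Num.sqrt (inner f f).

Lemma nrm_ge0 f : 0 <= nrm f. Proof. exact: sqrtr_ge0. Qed.

Lemma nrm_sqr f : nrm f ^+ 2 = inner f f.
Proof. by rewrite sqr_sqrtr// inner_ge0. Qed.

(* The quadratic [s |-> inner (s f + g) (s f + g)] is nonnegative. *)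
Lemma CauchySchwarz f g : L2 f -> L2 g -> `|inner f g| <= nrm f * nrm g.
Proof.
move=> Lf Lg.
have q s : 0 <= s ^+ 2 * inner f f + 2 * s * inner f g + inner g g.
  have := inner_ge0 (fun x => s * f x + g x).
  rewrite innerDl ?innerDr ?innerZl ?innerZr//; try by [exact: L2Z|exact: L2D (L2Z _ _) _].
  rewrite (innerC g f); set a := inner _ _; set b := inner _ _; set e := inner _ _.
  by move=> h; apply: le_trans h _; rewrite le_eqVlt; apply/orP; left; apply/eqP; ring.
have key : inner f g ^+ 2 <= inner f f * inner g g.
  have [f0|f0] := eqVneq (inner f f) 0.
    (* When [inner f f] is 0 the quadratic is affine in [s]; at this [s] it would equal -1 unless
       [inner f g] vanishes. *)
    rewrite f0 mul0r; have := q (- (inner g g + 1) / (2 * inner f g)).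
    have [->|n0] := eqVneq (inner f g) 0; first by rewrite expr0n.
    rewrite f0 mulr0 add0r => h; exfalso; move: h.
    have -> : 2 * (- (inner g g + 1) / (2 * inner f g)) * inner f g + inner g g = -1.
      by field; rewrite n0.
    by rewrite ler0N1.
  have fp : 0 < inner f f by rewrite lt0r f0 inner_ge0.
  have := q (- inner f g / inner f f).
  have -> : (- inner f g / inner f f) ^+ 2 * inner f f +
      2 * (- inner f g / inner f f) * inner f g + inner g g =
      (inner f f * inner g g - inner f g ^+ 2) / inner f f by field.
  by rewrite pmulr_lge0 ?invr_gt0// subr_ge0.
rewrite -(@ler_pXn2r _ 2) ?nnegrE ?mulr_ge0 ?nrm_ge0//.
by rewrite real_normK ?num_real// exprMn !nrm_sqr.
Qed.

Lemma inner_le_nrm f g : L2 f -> L2 g -> inner f g <= nrm f * nrm g.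
Proof. by move=> Lf Lg; apply: le_trans (CauchySchwarz Lf Lg); rewrite ler_norm. Qed.

Lemma L2dist2E f g : L2 f -> L2 g ->
  L2dist2 mu D f g = (inner (fun x => f x - g x) (fun x => f x - g x))%:E.
Proof.
move=> Lf Lg; rewrite inner_sqr EFin_Rintegral//; apply: L2_sqr; exact: L2B.
Qed.

Lemma nrm_cvg0 (f_ : nat -> T -> R) :
  inner (f_ n) (f_ n) @[n --> \oo] --> 0 <-> nrm (f_ n) @[n --> \oo] --> 0.
Proof.
split=> h.
  rewrite -(sqrtr0 R); apply: (cvg_comp _ _ h).
  exact: sqrt_continuous.
rewrite (_ : (fun n => inner (f_ n) (f_ n)) = (fun n => nrm (f_ n) * nrm (f_ n))).
  have h2 := cvgM h h; rewrite mulr0 in h2; exact: h2.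
by apply/funext => n; rewrite -nrm_sqr expr2.
Qed.

(** Trades the extended-real squared distance of the definitions for a real norm. *)
Lemma L2cvgP (f_ : nat -> T -> R) f : (forall n, L2 (f_ n)) -> L2 f ->
  L2cvg mu D f_ f <-> nrm (fun x => f_ n x - f x) @[n --> \oo] --> 0.
Proof.
move=> Lf_ Lf; rewrite -nrm_cvg0 /L2cvg.
under eq_fun do rewrite L2dist2E//.
split; last by move=> h; apply/cvg_EFin => //; exact: nearW.
by move=> /fine_cvg.
Qed.

Lemma inner_cvg (f_ : nat -> T -> R) f g : (forall n, L2 (f_ n)) -> L2 f ->
  L2 g -> nrm (fun x => f_ n x - f x) @[n --> \oo] --> 0 ->
  inner (f_ n) g @[n --> \oo] --> inner f g.
Proof.
move=> Lf_ Lf Lg h; apply/subr_cvg0/norm_cvg0P.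
apply: (@squeeze_cvgr _ _ _ _ (fun=> 0) (fun n => nrm (fun x => f_ n x - f x) * nrm g)).
- apply: nearW => n; rewrite normr_ge0 /= -innerBl//.
  by apply: CauchySchwarz => //; exact: L2B.
- exact: cvg_cst.
- by rewrite -[X in _ --> X](mul0r (nrm g)); apply: cvgMl.
Qed.

End LTwo.
End RealIntegrals.

(** * Nonnegativity through eigenfunction coefficients *)

Section CvgBounds.
Context (R : realType) (u : nat -> R).

Lemma cvg_le_cst (l a : R) : u n @[n --> \oo] --> l ->
  (\forall n \near \oo, u n <= a) -> l <= a.
Proof.
move=> c h; rewrite -(cvg_lim _ c)//; apply: limr_le => //.
by apply/cvg_ex; exists l.
Qed.

Lemma cvg_ge_cst (l a : R) : u n @[n --> \oo] --> l ->
  (\forall n \near \oo, a <= u n) -> a <= l.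
Proof.
move=> c h; rewrite -(cvg_lim _ c)//; apply: limr_ge => //.
by apply/cvg_ex; exists l.
Qed.

End CvgBounds.

Lemma cvg_bigsum (R : realType) (T : Type) (F : set_system T) {FF : Filter F}
    (N : nat) (u : 'I_N -> T -> R) (l : 'I_N -> R) :
  (forall i, true -> u i t @[t --> F] --> l i) ->
  \sum_(i < N) u i t @[t --> F] --> \sum_(i < N) l i.
Proof.
move=> h; rewrite (_ : (fun t => _) = \sum_(i < N) (u i)); last first.
  by apply/funext => t; rewrite fct_sumE.
elim/big_rec2 : _ => [|i a b _ IH]; first exact: cvg_cst.
by apply: cvgD => //; exact: h.
Qed.

(** * Square-summable sequences *)

Section SquareSummable.
Context (R : realType).
Implicit Types x y : nat -> R.

Definition l2b x := exists M, forall N, \sum_(n < N) x n ^+ 2 <= M.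

Definition bseq x := exists K, forall n, `|x n| <= K.

Lemma l2bM F x : bseq F -> l2b x -> l2b (fun n => F n * x n).
Proof.
move=> [K FK] [M xM]; exists (K ^+ 2 * M) => N.
apply: (@le_trans _ _ (K ^+ 2 * \sum_(n < N) x n ^+ 2)).
  rewrite mulr_sumr ler_sum// => n _; rewrite exprMn ler_wpM2r ?sqr_ge0//.
  by rewrite -[leLHS]ger0_norm ?sqr_ge0// normrX lerXn2r ?nnegrE// (le_trans _ (FK n)).
by rewrite ler_wpM2l ?sqr_ge0.
Qed.

Lemma l2bZ (k : R) x : l2b x -> l2b (fun n => k * x n).
Proof. by move=> lx; apply: (@l2bM (fun=> k)) => //; exists `|k|. Qed.

Lemma l2bD x y : l2b x -> l2b y -> l2b (fun n => x n + y n).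
Proof.
move=> [M xM] [M' yM]; exists (2 * (M + M')) => N.
apply: (@le_trans _ _ (2 * (\sum_(n < N) x n ^+ 2 + \sum_(n < N) y n ^+ 2))).
  rewrite -big_split mulr_sumr ler_sum// => n _ /=.
  by have := sqr_ge0 (x n - y n); rewrite sqrrB sqrrD; lra.
by rewrite ler_wpM2l// lerD.
Qed.

Lemma cvg_nd_bounded (u : nat -> R) M : (forall n, 0 <= u n) ->
  (forall N, \sum_(n < N) u n <= M) ->
  exists2 s, (\sum_(n < N) u n) @[N --> \oo] --> s &
    forall N, \sum_(n < N) u n <= s.
Proof.
move=> u0 uM.
have nd : nondecreasing_seq (fun N => \sum_(n < N) u n).
  by apply/nondecreasing_seqP => n; rewrite big_ord_recr /= lerDl.
have c : cvgn (fun N => \sum_(n < N) u n).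
  apply: nondecreasing_is_cvgn => //.
  by exists M => _ [N _ <-]; exact: uM.
exists (limn (fun N => \sum_(n < N) u n)) => // N.
exact: (nondecreasing_cvgn_le nd c N).
Qed.

Lemma l2b_abs x y : l2b x -> l2b y ->
  exists2 s, (\sum_(n < N) `|x n * y n|) @[N --> \oo] --> s &
    forall N, \sum_(n < N) `|x n * y n| <= s.
Proof.
move=> [M xM] [M' yM]; apply: (@cvg_nd_bounded (fun n => `|x n * y n|) (M + M')) => // N.
apply: le_trans (lerD (xM N) (yM N)); rewrite -big_split ler_sum// => n _ /=.
have := sqr_ge0 (`|x n| - `|y n|); rewrite sqrrB !real_normK ?num_real// normrM.
have h2 : 0 <= `|x n| * `|y n| by rewrite mulr_ge0.
lra.
Qed.

Lemma sum_tail (u : nat -> R) N M : (N <= M)%N ->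
  \sum_(n < M) u n - \sum_(n < N) u n = \sum_(N <= n < M) u n.
Proof.
move=> NM; rewrite -!(big_mkord xpredT u).
by rewrite (big_cat_nat (leq0n N) NM)/= addrAC subrr add0r.
Qed.

(** The remainder depends on [F] only through its bound [K]; this uniformity is what later lets
    limits of symbols pass through the series. *)
Lemma abs_tail (w F : nat -> R) (K s : R) : (forall n, `|F n| <= K) ->
  (\sum_(n < N) `|w n|) @[N --> \oo] --> s ->
  (forall N, \sum_(n < N) `|w n| <= s) ->
  exists2 l, (\sum_(n < N) F n * w n) @[N --> \oo] --> l &
    forall N, `|l - \sum_(n < N) F n * w n| <= K * (s - \sum_(n < N) `|w n|).
Proof.
move=> FK cs bs.
have K0 : 0 <= K by apply: le_trans (FK 0%N).
have tail N M : (N <= M)%N -> `|\sum_(n < M) F n * w n - \sum_(n < N) F n * w n|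
    <= K * (s - \sum_(n < N) `|w n|).
  move=> NM; rewrite (@sum_tail (fun n => F n * w n))//.
  apply: le_trans (ler_norm_sum _ _ _) _.
  apply: (@le_trans _ _ (\sum_(N <= n < M) K * `|w n|)).
    by apply: ler_sum => n _; rewrite normrM ler_wpM2r.
  by rewrite -mulr_sumr ler_wpM2l// -(@sum_tail (fun n => `|w n|))// lerD2r.
have c : cvgn (series (fun n => F n * w n)).
  apply: normed_cvg; apply: (@series_le_cvg _ _ (fun n => K * `|w n|)).
  - by move=> n; exact: normr_ge0.
  - by move=> n; rewrite mulr_ge0.
  - by move=> n /=; rewrite normrM ler_wpM2r.
  - apply: is_cvg_seriesZ; apply/cvg_ex; exists s.
    by rewrite /series /=; under eq_fun do rewrite big_mkord.
exists (limn (series (fun n => F n * w n))).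
  by move: c; rewrite /series /=; under eq_fun do rewrite big_mkord.
move=> N.
have c2 : \sum_(n < M) F n * w n @[M --> \oo] --> limn (series (fun n => F n * w n)).
  by move: c; rewrite /series /=; under eq_fun do rewrite big_mkord.
have c3 : `|\sum_(n < M) F n * w n - \sum_(n < N) F n * w n| @[M --> \oo] -->
   `|limn (series (fun n => F n * w n)) - \sum_(n < N) F n * w n|.
  by apply: cvg_norm; apply: cvgB => //; exact: cvg_cst.
by apply: (cvg_le_cst c3); near=> M; apply: tail; near: M; exact: nbhs_infty_ge.
Unshelve. all: by end_near. Qed.

End SquareSummable.

(** * Coefficient sequences, their nonnegativity and positive multipliers *)

Section Basis.
Context d (T : measurableType d) (R : realType).
Variables (mu : {measure set T -> \bar R}) (D : set T).
Hypothesis mD : measurable D.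
Variable phi : nat -> T -> R.
Notation L2 := (L2 mu D).
Notation inner := (inner mu D).
Notation nrm := (nrm mu D).
Hypothesis Lphi : forall n, L2 (phi n).
Hypothesis orth : forall m n, inner (phi m) (phi n) = (m == n)%:R.
Hypothesis compl : forall f, L2 f ->
  L2cvg mu D (fun N x => \sum_(n < N) inner f (phi n) * phi n x) f.
Implicit Types (f g chi : T -> R) (x y F : nat -> R).

Definition co f n := inner f (phi n).

Definition S x N : T -> R := fun t => \sum_(n < N) x n * phi n t.

Lemma L2_S x N : L2 (S x N).
Proof. by apply: L2_sum => // n _; exact: L2Z. Qed.
Hint Resolve L2_S : core.

Lemma inner_S x N chi : L2 chi -> inner (S x N) chi = \sum_(n < N) x n * co chi n.
Proof.
move=> Lc; rewrite inner_suml//; last by move=> n _; exact: L2Z.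
by apply: eq_bigr => n _; rewrite innerZl// innerC.
Qed.

Lemma co_S x N n : co (S x N) n = if (n < N)%N then x n else 0.
Proof.
rewrite /co inner_S//; under eq_bigr do rewrite /co orth.
case: ltnP => nN.
  rewrite (bigD1 (Ordinal nN))//= eqxx mulr1 big1 ?addr0// => i /eqP ni.
  by case: eqP; rewrite ?mulr0// => e; case: ni; apply/val_inj.
rewrite big1// => i _; case: eqP; rewrite ?mulr0// => e.
by move: (ltn_ord i); rewrite -e ltnNge nN.
Qed.

Lemma inner_SS x N : inner (S x N) (S x N) = \sum_(n < N) x n ^+ 2.
Proof.
rewrite inner_S//; apply: eq_bigr => n _.
by rewrite co_S ltn_ord expr2.
Qed.

Lemma bessel f N : L2 f -> \sum_(n < N) co f n ^+ 2 <= inner f f.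
Proof.
move=> Lf; have := inner_ge0 mu D (fun t => f t - S (co f) N t).
rewrite innerBl ?innerBr//; [|exact: L2B..].
rewrite inner_SS inner_S// (innerC _ _ f) inner_S//.
under [in X in 0 <= X - _]eq_bigr do rewrite -expr2.
under [in X in 0 <= _ - (X - _)]eq_bigr do rewrite -expr2.
by rewrite subrr subr0 subr_ge0.
Qed.

Lemma l2b_co f : L2 f -> l2b (co f).
Proof. by move=> Lf; exists (inner f f) => N; exact: bessel. Qed.

(** The inner product with [chi] of the function whose coefficients are [x], without building that
    function. *)
Definition pair x chi := limn (fun N => \sum_(n < N) x n * co chi n).

Lemma pair_cvg x chi : l2b x -> L2 chi ->
  \sum_(n < N) x n * co chi n @[N --> \oo] --> pair x chi.
Proof.
move=> lx Lc; have [s cs bs] := l2b_abs lx (l2b_co Lc).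
have h1 : forall n : nat, `|(fun=> 1) n| <= 1 :> R by move=> n; rewrite normr1.
have [l cl _] := @abs_tail _ (fun n => x n * co chi n) _ _ _ h1 cs bs.
have cl' : \sum_(n < N) x n * co chi n @[N --> \oo] --> l.
  have e N : \sum_(n < N) x n * co chi n = \sum_(n < N) 1 * (x n * co chi n).
    by apply: eq_bigr => n _; rewrite mul1r.
  by under eq_fun do rewrite e.
by rewrite /pair (cvg_lim _ cl').
Qed.

Lemma pairD x y chi : l2b x -> l2b y -> L2 chi ->
  pair (fun n => x n + y n) chi = pair x chi + pair y chi.
Proof.
move=> lx ly Lc; apply/cvg_lim => //.
under eq_fun do [under eq_bigr do rewrite mulrDl; rewrite big_split].
by apply: cvgD; exact: pair_cvg.
Qed.

Lemma pairZ k x chi : l2b x -> L2 chi ->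
  pair (fun n => k * x n) chi = k * pair x chi.
Proof.
move=> lx Lc; apply/cvg_lim => //.
under eq_fun do [under eq_bigr do rewrite -mulrA; rewrite -mulr_sumr].
by apply: cvgMl_tmp; exact: pair_cvg.
Qed.

Lemma pairB x y chi : l2b x -> l2b y -> L2 chi ->
  pair (fun n => x n - y n) chi = pair x chi - pair y chi.
Proof.
move=> lx ly Lc; have <- : pair (fun n => -1 * y n) chi = - pair y chi.
  by rewrite pairZ// mulN1r.
rewrite -pairD//; last exact: l2bZ.
by congr pair; apply/funext => n; rewrite mulN1r.
Qed.

Lemma compl_nrm f : L2 f -> nrm (fun t => S (co f) N t - f t) @[N --> \oo] --> 0.
Proof. by move=> Lf; apply/(L2cvgP mD) => //; exact: compl. Qed.

Lemma parseval f chi : L2 f -> L2 chi -> pair (co f) chi = inner f chi.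
Proof.
move=> Lf Lc; apply/cvg_lim => //.
under eq_fun do rewrite -inner_S//.
by apply: inner_cvg => //; exact: compl_nrm.
Qed.

(* [x] is the coefficient sequence of a nonnegative function. *)
Definition nv x := l2b x /\ forall chi, L2 chi ->
  {ae mu, forall t, D t -> 0 <= chi t} -> 0 <= pair x chi.

Lemma nvD x y : nv x -> nv y -> nv (fun n => x n + y n).
Proof.
move=> [lx px] [ly py]; split; first exact: l2bD.
by move=> chi Lc c0; rewrite pairD// addr_ge0 ?px ?py.
Qed.

Lemma nvZ k x : 0 <= k -> nv x -> nv (fun n => k * x n).
Proof.
move=> k0 [lx px]; split; first exact: l2bZ.
by move=> chi Lc c0; rewrite pairZ// mulr_ge0 ?px.
Qed.

Lemma nv_eq x y : x =1 y -> nv x -> nv y.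
Proof. by move=> /funext ->. Qed.

Lemma nv_co f : L2 f -> {ae mu, forall t, D t -> 0 <= f t} -> nv (co f).
Proof.
move=> Lf f0; split; first exact: l2b_co.
by move=> chi Lc c0; rewrite parseval// inner_nonneg.
Qed.

Definition negp f : T -> R := fun t => Num.max (- f t) 0.

Lemma negp_ge0 f t : 0 <= negp f t. Proof. by rewrite le_max lexx orbT. Qed.

Lemma L2_negp f : L2 f -> L2 (negp f).
Proof.
move=> Lf; apply: (L2_le _ _ _ Lf) => //.
  apply: measurable_maxr => //; apply: measurableT_comp => //.
  by case: Lf.
move=> t Dt; rewrite ger0_norm ?negp_ge0// /negp ge_max normr_ge0 andbT.
by rewrite -normrN ler_norm.
Qed.

Lemma inner_negp f : L2 f -> inner f (negp f) = - inner (negp f) (negp f).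
Proof.
move=> Lf; rewrite -innerNl//; [|exact: L2_negp..].
apply: eq_Rintegral => t _; rewrite /negp /Num.max; case: ifP => h.
  by rewrite !mulr0.
by rewrite opprK.
Qed.

(** Pairing [f] with its own negative part gives minus the squared norm of that part. *)
Lemma nv_ge0 f : L2 f -> nv (co f) -> {ae mu, forall t, D t -> 0 <= f t}.
Proof.
move=> Lf [_ /(_ (negp f) (L2_negp Lf))].
move=> /(_ (aeW _ (fun t _ => negp_ge0 f t))).
rewrite parseval ?inner_negp ?oppr_ge0//; [|exact: L2_negp..].
move=> h; have {h} h0 : inner (negp f) (negp f) = 0.
  by apply/eqP; rewrite eq_le h inner_ge0.
have : {ae mu, forall t, D t -> negp f t ^+ 2 = 0}.
  apply: Rintegral0_ae => //.
  - by apply: measurable_funX; case: (L2_negp Lf).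
  - by move=> t _; rewrite sqr_ge0.
  - exact: L2_sqr (L2_negp Lf).
apply: filterS => t + Dt => /(_ Dt) /eqP; rewrite sqrf_eq0 => /eqP e.
have : - f t <= negp f t by rewrite le_max lexx.
by rewrite e oppr_le0.
Qed.

(* The negative part of the partial sums is controlled by the tail of [x]. *)
Lemma nv_neg x : nv x -> nrm (negp (S x N)) @[N --> \oo] --> 0.
Proof.
move=> [lx px].
have [M xM] := lx.
have [s cs bs] := cvg_nd_bounded (fun n => sqr_ge0 (x n)) xM.
have key N : nrm (negp (S x N)) <= Num.sqrt (s - \sum_(n < N) x n ^+ 2).
  set m := negp _; have Lm : L2 m by exact: L2_negp.
  (* Since [inner (S x N) m] is [- inner m m], nonnegativity of [pair x m] bounds [inner m m] by the
     tail of the series for [pair x m]. *)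
  have mm : inner m m <= pair x m - \sum_(n < N) x n * co m n.
    rewrite -inner_S// inner_negp// -/m opprK lerDr.
    by apply: px => //; apply: aeW => t _; exact: negp_ge0.
  (* Cauchy-Schwarz for the partial sums between [N] and [K], whose squared norm is a piece of the
     convergent sum of the squares of [x]. *)
  have tl : pair x m - \sum_(n < N) x n * co m n <=
      Num.sqrt (s - \sum_(n < N) x n ^+ 2) * nrm m.
    have c := cvgB (pair_cvg lx Lm) (cvg_cst (\sum_(n < N) x n * co m n)).
    have c3 : \sum_(n < M) x n * co m n - \sum_(n < N) x n * co m n @[M --> \oo]
       --> pair x m - \sum_(n < N) x n * co m n by exact: c.
    apply: (cvg_le_cst c3); near=> K.
    have NK : (N <= K)%N by near: K; exact: nbhs_infty_ge.
    have e : forall t, S x K t - S x N t = S (fun n => if (n < N)%N then 0 else x n) K t.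
      move=> t; rewrite /S (@sum_tail _ (fun n => x n * phi n t))//.
      rewrite -(big_mkord xpredT (fun n => (if (n < N)%N then 0 else x n) * phi n t)).
      rewrite [RHS](big_cat_nat (leq0n N) NK)/= [X in _ = X + _]big_nat_cond [X in _ = X + _]big1 ?add0r.
        by rewrite !big_nat; apply: eq_bigr => i /andP[Ni _]; rewrite ltnNge Ni.
      by move=> i /andP[/andP[_ iN] _]; rewrite iN mul0r.
    rewrite -!inner_S// -innerBl//.
    apply: le_trans (inner_le_nrm mD _ Lm) _; first exact: L2B.
    rewrite ler_wpM2r ?nrm_ge0// ler_wsqrtr//.
    rewrite (inner_eq _ (fun t _ => e t) (fun t _ => e t)) inner_SS.
    rewrite lerBrDr; apply: le_trans (bs K).
    rewrite -(big_mkord xpredT (fun n => (if (n < N)%N then 0 else x n)^+2)).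
    rewrite -!(big_mkord xpredT (fun n => x n ^+ 2)).
    rewrite (big_cat_nat (leq0n N) NK)/= [X in X + _ + _]big_nat_cond.
    rewrite [X in X + _ + _]big1 ?add0r; last first.
      by move=> i /andP[/andP[_ iN] _]; rewrite iN expr0n.
    rewrite addrC [leRHS](big_cat_nat (leq0n N) NK)/= lerD2l.
    by rewrite big_nat [leRHS]big_nat; apply: ler_sum => i /andP[Ni _]; rewrite ltnNge Ni.
  have := le_trans mm tl; rewrite -nrm_sqr expr2.
  have [->|n0] := eqVneq (nrm m) 0; first by rewrite sqrtr_ge0.
  by rewrite ler_pM2r// lt0r n0 nrm_ge0.
apply: (@squeeze_cvgr _ _ _ _ (fun=> 0) (fun N => Num.sqrt (s - \sum_(n < N) x n ^+ 2))).
- by apply: nearW => N; rewrite nrm_ge0 key.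
- exact: cvg_cst.
- have cz : s - \sum_(n < N) x n ^+ 2 @[N --> \oo] --> s - s.
    by apply: cvgB => //; exact: cvg_cst.
  have h2 : Num.sqrt (s - \sum_(n < N) x n ^+ 2) @[N --> \oo] --> Num.sqrt (s - s).
    exact: (continuous_cvg _ (@sqrt_continuous R (s - s)) cz).
  by rewrite subrr sqrtr0 in h2.
Unshelve. all: by end_near. Qed.

(* The operator acting on coefficients as multiplication by [F] preserves
   nonnegativity. *)
Definition pm F := bseq F /\ forall x, nv x -> nv (fun n => F n * x n).

Lemma pmM F G : pm F -> pm G -> pm (fun n => F n * G n).
Proof.
move=> [[K FK] pF] [[K' GK] pG]; split.
  exists (K * K') => n; rewrite normrM ler_pM//.
by move=> x nx; apply: nv_eq (pF _ (pG _ nx)) => n; rewrite mulrA.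
Qed.

Lemma pmD F G : pm F -> pm G -> pm (fun n => F n + G n).
Proof.
move=> [[K FK] pF] [[K' GK] pG]; split.
  by exists (K + K') => n; rewrite (le_trans (ler_normD _ _))// lerD.
by move=> x nx; apply: nv_eq (nvD (pF _ nx) (pG _ nx)) => n; rewrite mulrDl.
Qed.

Lemma pmZ k F : 0 <= k -> pm F -> pm (fun n => k * F n).
Proof.
move=> k0 [[K FK] pF]; split.
  by exists (k * K) => n; rewrite normrM ger0_norm// ler_wpM2l.
by move=> x nx; apply: nv_eq (nvZ k0 (pF _ nx)) => n; rewrite mulrA.
Qed.

Lemma pm_eq F G : F =1 G -> pm F -> pm G.
Proof. by move=> /funext ->. Qed.

Lemma pm_cst k : 0 <= k -> pm (fun=> k).
Proof. by move=> k0; split; [by exists `|k| |move=> x nx; exact: nvZ]. Qed.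

(** For each [k] the partial sum up to [N] misses a nonnegative limit by at most [K] times the tail
    of the sum of [|x n * co chi n|]. This bound does not depend on [k], so it passes to [F] at
    fixed [N]; then [N] tends to infinity. *)
Lemma pm_lim (F_ : nat -> nat -> R) F K : (forall k n, `|F_ k n| <= K) ->
  (forall n, F_ k n @[k --> \oo] --> F n) -> (forall k, pm (F_ k)) -> pm F.
Proof.
move=> bF cF pF.
have FK n : `|F n| <= K.
  by apply: (cvg_le_cst (cvg_norm (cF n))); apply: nearW => k; exact: bF.
split; first by exists K.
move=> x nx; have [lx px] := nx; split; first by apply: l2bM => //; exists K.
move=> chi Lc c0.
have [s cs bs] := l2b_abs lx (l2b_co Lc).
have K0 : 0 <= K by apply: le_trans (FK 0%N).
have bound N : - (K * (s - \sum_(n < N) `|x n * co chi n|)) <=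
    \sum_(n < N) F n * x n * co chi n.
  have c : \sum_(n < N) F_ k n * x n * co chi n @[k --> \oo] -->
      \sum_(n < N) F n * x n * co chi n.
    apply: cvg_bigsum => n _; apply: cvgMr_tmp; apply: cvgMr_tmp; exact: cF.
  apply: (cvg_ge_cst c); apply: nearW => k; have [l cl hl] := @abs_tail _ (fun n => x n * co chi n) _ _ _ (bF k) cs bs.
  have ln : l = pair (fun n => F_ k n * x n) chi.
    apply/esym/cvg_lim => //.
    by under eq_fun do [under eq_bigr do rewrite -mulrA].
  have l0 : 0 <= l by rewrite ln; apply (proj2 (proj2 (pF k) _ nx)).
  have := hl N; under [in X in X <= _ -> _]eq_bigr do rewrite mulrA.
  rewrite ler_norml => /andP[_ h]; rewrite lerNl.
  by apply: le_trans h; rewrite lerDr.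
have cz : - (K * (s - \sum_(n < N) `|x n * co chi n|)) @[N --> \oo] --> - (K * (s - s)).
  by apply: cvgN; apply: cvgMl_tmp; apply: cvgB => //; exact: cvg_cst.
rewrite subrr mulr0 oppr0 in cz.
have cp := pair_cvg (l2bM (ex_intro _ K FK) lx) Lc.
by apply: (ler_cvg_to cz cp); apply: nearW => N; exact: bound.
Qed.

(** The series and the time integral are exchanged by dominated convergence: the partial sums at
    time [t] are bounded by [k t] times the sum of [|x n * co chi n|]. *)
Lemma pair_int (E : set (measurableTypeR R)) (F : measurableTypeR R -> nat -> R)
    (k : measurableTypeR R -> R) x chi :
  measurable E -> (forall n, measurable_fun E (F ^~ n)) ->
  rint (@lebesgue_measure R) E k ->
  (forall t n, E t -> `|F t n| <= k t) -> l2b x -> L2 chi ->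
  rint (@lebesgue_measure R) E (fun t => pair (fun n => F t n * x n) chi) /\
  pair (fun n => \int[@lebesgue_measure R]_(t in E) F t n * x n) chi =
  \int[@lebesgue_measure R]_(t in E) pair (fun n => F t n * x n) chi.
Proof.
move=> mE mF ik Fk lx Lc.
have iF n : rint (@lebesgue_measure R) E (F ^~ n).
  by apply: (rint_le mE _ _ ik) => // t Et; exact: Fk.
have [s cs bs] := l2b_abs lx (l2b_co Lc).
have pc t : E t -> \sum_(n < N) F t n * x n * co chi n @[N --> \oo] -->
     pair (fun n => F t n * x n) chi.
  by move=> Et; apply: pair_cvg => //; apply: l2bM => //; exists (k t) => n; exact: Fk.
have mS N : measurable_fun E (fun t => \sum_(n < N) F t n * x n * co chi n).
  apply: measurable_sum => n; apply: measurable_funM => //.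
  exact: measurable_funM.
have [] := @Rdct _ _ _ (@lebesgue_measure R) E mE
  (fun N t => \sum_(n < N) F t n * x n * co chi n)
  (fun t => pair (fun n => F t n * x n) chi) (fun t => s * k t).
- exact: mS.
- exact: (measurable_fun_cvg mS).
- exact: pc.
- exact: rintZ.
- move=> N t Et; apply: le_trans (ler_norm_sum _ _ _) _.
  apply: (@le_trans _ _ (\sum_(n < N) `|x n * co chi n| * k t)).
    apply: ler_sum => n _; rewrite -mulrA normrM mulrC ler_wpM2l//; exact: Fk.
  rewrite -mulr_suml ler_wpM2r//; apply: le_trans (Fk t 0%N Et) => //.
move=> i1 c1; split => //.
apply/cvg_lim => //; apply: cvg_trans c1; apply: near_eq_cvg; apply: nearW => N.
rewrite Rintegral_sum//; last first.
  move=> n _; apply: (rint_eq mE _ (rintZ mE (x n * co chi n) (iF n))) => t _; ring.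
apply: eq_bigr => n _; rewrite -mulrA mulrC -RintegralZl//.
  by apply: eq_Rintegral => t _; ring.
exact: iF.
Qed.

Lemma pm_int (E : set (measurableTypeR R)) (F : measurableTypeR R -> nat -> R)
    (k : measurableTypeR R -> R) :
  measurable E -> (forall n, measurable_fun E (F ^~ n)) ->
  rint (@lebesgue_measure R) E k ->
  (forall t n, E t -> `|F t n| <= k t) -> (forall t, E t -> pm (F t)) ->
  pm (fun n => \int[@lebesgue_measure R]_(t in E) F t n).
Proof.
move=> mE mF ik Fk pF.
have iF n : rint (@lebesgue_measure R) E (F ^~ n).
  by apply: (rint_le mE _ _ ik) => // t Et; exact: Fk.
have FK n : `|\int[@lebesgue_measure R]_(t in E) F t n| <=
    \int[@lebesgue_measure R]_(t in E) k t.
  apply: le_trans (le_normr_Rintegral mE (iF n)) _.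
  by apply: le_Rintegral => //; [exact: rint_norm|move=> t Et; exact: Fk].
split; first by eexists; exact: FK.
move=> x nx; have [lx px] := nx; split; first by apply: l2bM => //; eexists; exact: FK.
move=> chi Lc c0; have [_ ->] := pair_int mE mF ik Fk lx Lc.
by apply: Rintegral_ge0 => t Et; apply (proj2 (proj2 (pF t Et) _ nx)).
Qed.

End Basis.

(** * Laplace transforms and fractional kernels *)

Section AffineChange.
Context {R : realType}.
Notation lebR := (@lebesgue_measure R).
Notation mR := (measurableTypeR R).

Lemma measurable_affine (a b : R) :
  measurable_fun setT ((fun x => a * x + b) : mR -> mR).
Proof. by apply: measurable_funD => //; exact: measurable_funM. Qed.

Definition affine_push (a b : R) : {measure set mR -> \bar R} :=
  measure_function_pushforward__canonical__measure_function_Measure lebR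
    (measurable_affine a b).

(** The rescaled image measure agrees with Lebesgue measure on half-open intervals, which
    characterizes the latter. *)
Lemma lebesgue_affine (a b : R) (A : set mR) : 0 < a -> measurable A ->
  lebR A = (a%:E * lebR [set x | A (a * x + b)%R])%E.
Proof.
move=> a0 mA.
transitivity (mscale (NngNum (ltW a0)) (affine_push a b) A); last first.
  by [].
apply: (@lebesgue_measure_unique R (mscale (NngNum (ltW a0)) (affine_push a b))) => //= _ [[x y]] _ <-.
have pre : (fun x => a * x + b) @^-1` `]x, y] = `](x - b) / a, (y - b) / a]%classic.
  by apply/seteqP; split => z /=;
    rewrite !in_itv /= ltr_pdivrMr// ler_pdivlMr// ltrBlDr lerBrDr (mulrC z).
rewrite /mscale /= /pushforward pre.
rewrite !lebesgue_measure_itv /= !lte_fin ltr_pM2r ?invr_gt0// ltrD2r.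
case: ifPn => _; last by rewrite mule0.
by rewrite -!EFinB -EFinM; congr EFin; field; rewrite gt_eqF.
Qed.

Lemma ge0_integral_affine (a b : R) (E : set mR) (f : mR -> \bar R) :
  0 < a -> measurable E -> measurable_fun E f -> (forall x, E x -> (0 <= f x)%E) ->
  (\int[lebR]_(x in E) f x =
   a%:E * \int[lebR]_(x in [set x | E (a * x + b)%R]) f (a * x + b)%R)%E.
Proof.
move=> a0 mE mf f0; have ma := measurable_affine a b.
transitivity (\int[mscale (NngNum (ltW a0)) (affine_push a b)]_(x in E) f x)%E.
  apply: eq_measure_integral => A mA _.
  exact: lebesgue_affine.
rewrite ge0_integral_mscale//; congr (_ * _)%E.
by rewrite ge0_integral_pushforward// => x; rewrite inE; exact: f0.
Qed.

Lemma ge0_RZl (E : set mR) (f : mR -> R) (k : R) : measurable E ->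
  measurable_fun E f -> (forall x, E x -> 0 <= f x) -> 0 <= k ->
  (\int[lebR]_(x in E) (k * f x)%:E = k%:E * \int[lebR]_(x in E) (f x)%:E)%E.
Proof.
move=> mE mf f0 k0; rewrite -(ge0_integralZl_EFin lebR mE _ _ k0).
- by apply: eq_integral => x _; rewrite EFinM.
- by move=> x Ex; rewrite lee_fin f0.
- exact/measurable_EFinP.
Qed.

Lemma ge0_Raffine (a b : R) (E : set mR) (f : mR -> R) :
  0 < a -> measurable E -> measurable_fun E f -> (forall x, E x -> 0 <= f x) ->
  (\int[lebR]_(x in E) (f x)%:E =
   a%:E * \int[lebR]_(x in [set x | E (a * x + b)%R]) (f (a * x + b)%R)%:E)%E.
Proof.
move=> a0 mE mf f0; apply: (@ge0_integral_affine a b E (EFin \o f)) => //.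
exact/measurable_EFinP.
Qed.

Lemma measurable_expRN (E : set mR) (p : R) :
  measurable_fun E (fun t : mR => expR (- (p * t))).
Proof.
apply: measurable_funTS; apply: measurableT_comp => //.
by apply: measurableT_comp => //; exact: measurable_funM.
Qed.

End AffineChange.

Section Laplace.
Context {R : realType}.
Notation lebR := (@lebesgue_measure R).
Notation mR := (measurableTypeR R).
Local Open Scope ereal_scope.

Definition P : set mR := `]0%R, +oo[%classic.

Lemma PE (x : R) : P x <-> (0 < x)%R.
Proof. by rewrite /P /= in_itv /= andbT. Qed.

Lemma mP : measurable P. Proof. exact: measurable_itv. Qed.

(** Laplace transform with extended-real values: for nonnegative [f] it can be manipulated before it
    is known to be finite. *)
Definition lap (p : R) (f : mR -> R) : \bar R :=
  \int[lebR]_(t in P) (expR (- (p * t)) * f t)%:E.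

Definition econv (f h : mR -> R) (t : R) : \bar R :=
  \int[lebR]_(s in `]0%R, t[) (f s * h (t - s))%:E.

Lemma measurable_refl (h : mR -> R) (t : R) : measurable_fun P h ->
  measurable_fun (`]0%R, t[%classic : set mR) (fun s => h (t - s)%R).
Proof.
move=> mh; rewrite (_ : (fun s => h (t - s)%R) = h \o (fun s => t - s)%R)//.
apply: (measurable_comp mP _ mh); last exact: measurable_funB.
by move=> _ [s /= + <-]; rewrite PE in_itv /= subr_gt0 => /andP[].
Qed.

(** Tonelli's theorem. Measurability of the convolution comes out of the same argument and is needed
    wherever an inequality between convolutions is integrated. *)
Lemma lap_conv_meas (p : R) (f h : mR -> R) :
  measurable_fun P f -> measurable_fun P h ->
  (forall x, P x -> (0 <= f x)%R) -> (forall x, P x -> (0 <= h x)%R) ->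
  measurable_fun P (fun t => (expR (- (p * t)))%:E * econv f h t) /\
  \int[lebR]_(t in P) ((expR (- (p * t)))%:E * econv f h t) = lap p f * lap p h.
Proof.
move=> mf mh f0 h0.
(* Extension by zero replaces the region 0 < s < t by the whole plane. *)
pose f' : mR -> R := (f \_ P); pose h' : mR -> R := (h \_ P).
have mf' : measurable_fun setT f' by apply/(measurable_restrictT f) => //; exact: mP.
have mh' : measurable_fun setT h' by apply/(measurable_restrictT h) => //; exact: mP.
have f'0 x : (0 <= f' x)%R.
  by rewrite /f' patchE; case: ifPn => //; rewrite inE => /f0.
have h'0 x : (0 <= h' x)%R.
  by rewrite /h' patchE; case: ifPn => //; rewrite inE => /h0.
pose F : mR * mR -> \bar R :=
  fun z => (expR (- (p * z.1)) * (f' z.2 * h' (z.1 - z.2)))%:E.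
have mF : measurable_fun setT F.
  apply/measurable_EFinP; apply: measurable_funM.
    apply: measurableT_comp => //; apply: measurableT_comp => //.
    by apply: measurable_funM => //; exact: measurable_fst.
  apply: measurable_funM.
    by apply: measurableT_comp => //; exact: measurable_snd.
  apply: measurableT_comp => //; apply: measurable_funB.
    exact: measurable_fst.
  exact: measurable_snd.
have F0 z : 0 <= F z by rewrite lee_fin mulr_ge0 ?expR_ge0// mulr_ge0.
have E1 t : fubini_F lebR F t = (if (t \in P) then (expR (- (p * t)))%:E * econv f h t else 0).
  rewrite /fubini_F /F /=.
  case: ifPn => tP; last first.
    apply: integral0_eq => s _ /=.
    have t0 : (t <= 0)%R by move: tP; rewrite notin_setE /P/= in_itv/= andbT => /negP; rewrite -leNgt.
    rewrite /f' /h' !patchE; case: ifPn => sP; last by rewrite mul0r mulr0.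
    case: ifPn => tsP; last by rewrite !mulr0.
    move: sP tsP; rewrite !inE !PE => s0 ts.
    by exfalso; lra.
  have g0 s : `]0%R, t[%classic s -> 0 <= (f s * h (t - s))%:E.
    rewrite /= in_itv /= => /andP[s0 st].
    by rewrite lee_fin mulr_ge0 ?f0 ?h0 ?PE ?subr_gt0.
  have gm : measurable_fun (`]0%R, t[%classic : set mR) (fun s => (f s * h (t - s))%:E).
    apply/measurable_EFinP; apply: measurable_funM.
      by apply: measurable_funS mf => //; [exact: mP|move=> s; rewrite PE /= in_itv /= => /andP[]].
    exact: measurable_refl.
  rewrite /econv -ge0_integralZl_EFin ?expR_ge0//.
  rewrite [RHS]integral_mkcond; apply: eq_integral => s _.
  rewrite patchE; case: ifPn.
    rewrite inE /= in_itv /= => /andP[s0 st].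
    by rewrite /f' /h' !patchE !mem_set ?PE ?subr_gt0// EFinM.
  rewrite notin_setE /= in_itv /= => /negP st.
  rewrite /f' /h' !patchE; case: ifPn => sP; last by rewrite mul0r mulr0.
  case: ifPn => tsP; last by rewrite !mulr0.
  by exfalso; move/negP: st; apply; move: sP tsP; rewrite !inE !PE subr_gt0 => -> ->.
have E2 s : fubini_G lebR F s = (if s \in P then (expR (- (p * s)) * f s)%:E * lap p h else 0).
  rewrite /fubini_G /F /=; case: ifPn => sP; last first.
    apply: integral0_eq => t _ /=.
    by rewrite /f' patchE (negPf sP) mul0r mulr0.
  have mm : measurable_fun P (fun r => (expR (- (p * r)) * h r)%:E).
    apply/measurable_EFinP; apply: measurable_funM => //.
    exact: measurable_expRN.
  have n0 r : P r -> 0 <= (expR (- (p * r)) * h r)%:E.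
    by move=> rP; rewrite lee_fin mulr_ge0 ?expR_ge0 ?h0.
  have k0 : (0 <= expR (- (p * s)) * f s)%R.
    by rewrite mulr_ge0 ?expR_ge0// f0//; move: sP; rewrite inE.
  rewrite /lap -ge0_integralZl_EFin//; last exact: mP.
  have mm2 : measurable_fun P (fun r => (expR (- (p * s)) * f s)%:E * (expR (- (p * r)) * h r)%:E).
    exact: measurable_funeM.
  have n2 r : P r -> 0 <= (expR (- (p * s)) * f s)%:E * (expR (- (p * r)) * h r)%:E.
    by move=> rP; rewrite mule_ge0 ?lee_fin// -lee_fin n0.
  rewrite [RHS](ge0_integral_affine (- s) ltr01 mP mm2 n2) mul1e [RHS]integral_mkcond; apply: eq_integral => t _.
  rewrite patchE /=; case: ifPn.
    rewrite inE /= mul1r => ts.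
    rewrite /f' /h' !patchE sP mem_set// -EFinM; congr EFin.
    have -> : (- (p * t) = - (p * s) + - (p * (t - s)))%R by ring.
    rewrite expRD; ring.
  rewrite notin_setE /= mul1r => ts.
  by rewrite /h' patchE memNset// !mulr0.
split.
  apply: (eq_measurable_fun (fubini_F lebR F)); first by move=> t tP; rewrite E1 tP.
  apply: measurable_funTS.
  exact: (measurable_fun_fubini_tonelli_F (m2 := lebR) F mF F0).
transitivity (\int[lebR]_t fubini_F lebR F t).
  by rewrite integral_mkcond; apply: eq_integral => t _; rewrite E1 patchE.
rewrite (fubini_tonelli (m1 := lebR) (m2 := lebR) F mF F0).
transitivity (\int[lebR]_s (((fun s => (expR (- (p * s)) * f s)%:E * lap p h) \_ P) s)).
  by apply: eq_integral => s _; have := E2 s; rewrite /fubini_G patchE => ->.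
have mf3 : measurable_fun P (fun s => (expR (- (p * s)) * f s)%:E).
  by apply/measurable_EFinP; apply: measurable_funM => //; exact: measurable_expRN.
have f3 s : P s -> 0 <= (expR (- (p * s)) * f s)%:E.
  by move=> sP; rewrite lee_fin mulr_ge0 ?expR_ge0 ?f0.
have l0 : 0 <= lap p h.
  by apply: integral_ge0 => s sP; rewrite lee_fin mulr_ge0 ?expR_ge0 ?h0.
by rewrite -integral_mkcond (ge0_integralZr lebR mP mf3 f3 l0).
Qed.

Lemma lap_conv (p : R) (f h : mR -> R) :
  measurable_fun P f -> measurable_fun P h ->
  (forall x, P x -> (0 <= f x)%R) -> (forall x, P x -> (0 <= h x)%R) ->
  \int[lebR]_(t in P) ((expR (- (p * t)))%:E * econv f h t) = lap p f * lap p h.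
Proof. by move=> mf mh f0 h0; case: (lap_conv_meas p mf mh f0 h0). Qed.

End Laplace.

Section GammaFunction.
Context {R : realType}.
Notation lebR := (@lebesgue_measure R).
Notation mR := (measurableTypeR R).

Lemma int_powR_eps (x eps t : R) : 0 < x -> 0 < eps -> eps < t ->
  (\int[lebR]_(s in `[eps, t]) (s `^ (x - 1))%:E = (t `^ x / x)%:E - (eps `^ x / x)%:E)%E.
Proof.
move=> x0 e0 et.
have D (s : R) : 0 < s -> is_derive s (1:R) (fun s => s `^ x / x) (s `^ (x - 1)).
  move=> s0.
  have -> : (fun s => s `^ x / x) = x^-1 *: (fun s => s `^ x).
    by apply/funext => z; rewrite /= mulrC.
  have -> : s `^ (x - 1) = x^-1 *: (x * s `^ (x - 1)).
    by rewrite /GRing.scale /= mulrA mulVf ?mul1r// gt_eqF.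
  exact: (is_deriveZ _ (is_derive1_powR x s0)).
have C (y s : R) : 0 < s -> {for s, continuous (fun s : R => s `^ y)}.
  move=> s0; apply: differentiable_continuous; apply/derivable1_diffP.
  by apply: derivable_powR; rewrite in_itv/= andbT.
have C2 (s : R) : 0 < s -> {for s, continuous (fun s : R => s `^ x / x)}.
  by move=> s0; apply: cvgMr_tmp; exact: C.
apply: (@continuous_FTC2 _ _ (fun s => s `^ x / x)) => //.
- apply/continuous_within_itvP => //; split.
  + by move=> s; rewrite in_itv /= => /andP[es _]; apply: C; exact: lt_trans es.
  + by apply: cvg_at_right_filter; exact: C.
  + by apply: cvg_at_left_filter; apply: C; exact: lt_trans et.
- split.
  + by move=> s; rewrite in_itv /= => /andP[es _]; apply: ex_derive; apply: D; exact: lt_trans es.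
  + by apply: cvg_at_right_filter; exact: C2.
  + by apply: cvg_at_left_filter; apply: C2; exact: lt_trans et.
- move=> s; rewrite in_itv /= => /andP[es _].
  by rewrite derive1E; apply: derive_val; apply: D; exact: lt_trans es.
Qed.

Lemma measurable_powRE (E : set mR) (y : R) : measurable_fun E (fun s : mR => s `^ y).
Proof. by apply: measurable_funTS; exact: measurable_powR. Qed.

Lemma int_powR (x t : R) : 0 < x -> 0 < t ->
  (\int[lebR]_(s in `]0%R, t[) (s `^ (x - 1))%:E = (t `^ x / x)%:E)%E.
Proof.
move=> x0 t0.
(* Dividing by [n.+2] keeps every [e n] strictly below [t], the first one included. *)
pose e n := t / n.+2%:R.
have e0 n : 0 < e n by rewrite divr_gt0.
have et n : e n < t by rewrite ltr_pdivrMr// ltr_pMr// ltr1n.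
have ec : e n @[n --> \oo] --> 0.
  rewrite -[X in _ --> X](mulr0 t); apply: cvgMl_tmp.
  by have := @cvg_harmonic R; rewrite -(cvg_shiftS (@harmonic R)); exact.
rewrite integral_itv_bndo_bndc; last by apply/measurable_EFinP; exact: measurable_powRE.
rewrite (_ : `]0, t]%classic = \bigcup_n `[e n, t]%classic); last first.
  apply/seteqP; split => s /=.
    rewrite in_itv /= => /andP[s0 st].
    have [N _ hN] := cvgr_lt 0 ec s s0.
    by exists N => //=; rewrite in_itv /= st andbT ltW// hN /=.
  move=> [n _ /=]; rewrite !in_itv /= => /andP[h ->]; rewrite andbT.
  exact: lt_le_trans h.
have c1 := @ge0_nondecreasing_set_cvg_integral _ mR R (fun n => `[e n, t]%classic)
  (fun s => (s `^ (x - 1))%:E) lebR _ _ _ _.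
have {}c1 := c1 _ _ _ _.
have c2 : (\int[lebR]_(s in `[e n, t]) (s `^ (x - 1))%:E)%E @[n --> \oo] --> (t `^ x / x)%:E.
  under eq_fun do rewrite int_powR_eps//.
  have c3 : t `^ x / x - e n `^ x / x @[n --> \oo] --> t `^ x / x - 0 / x.
    apply: cvgB; first exact: cvg_cst.
    apply: cvgMr_tmp.
    have /cvg_at_rightP := powR_cvg0 x0.
    by apply; split.
  rewrite mul0r subr0 in c3.
  by apply: cvg_EFin; [exact: nearW|exact: c3].
rewrite -(cvg_lim _ c2)//; apply/esym/cvg_lim => //; apply: c1.
- apply/nondecreasing_seqP => n; rewrite subsetEset => s /=; rewrite !in_itv /= => /andP[h ->].
  rewrite andbT; apply: le_trans h.
  by rewrite ler_pM2l// lef_pV2 ?posrE// ler_nat.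
- by [].
- by move=> n; apply/measurable_EFinP; exact: measurable_powRE.
- by move=> n s _; rewrite lee_fin powR_ge0.
Qed.

Lemma rint_powR (x t : R) : 0 < x -> 0 < t -> rint lebR `]0, t[ (fun s => s `^ (x - 1)).
Proof.
move=> x0 t0; apply/integrableP; split.
  by apply/measurable_EFinP; exact: measurable_powRE.
under eq_integral do rewrite /= ger0_norm ?powR_ge0//.
by rewrite int_powR// ltry.
Qed.

Lemma pow_le_expR (n : nat) (t : R) : 0 <= t -> t ^+ n <= n`!%:R * expR t.
Proof.
move=> t0; case: n => [|n]; first by rewrite expr0 fact0 mul1r -expR0 ler_expR.
have := expR_ge1Dxn n t0 => h.
rewrite -ler_pdivrMl ?ltr0n ?fact_gt0// mulrC; apply: le_trans h.
by rewrite lerDr.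
Qed.

(** The exponential density of rate [p] has total mass 1. *)
Lemma int_expR (p : R) : 0 < p ->
  (\int[lebR]_(t in `]0%R, +oo[) (expR (- (p * t)))%:E = (p^-1)%:E)%E.
Proof.
move=> p0; have := integral_exponential_pdf p0.
rewrite (_ : \int[_]_x _ = \int[lebR]_(x in `[0%R, +oo[) (p%:E * (expR (- (p * x)))%:E))%E; last first.
  rewrite [RHS]integral_mkcond; apply: eq_integral => x _.
  rewrite /exponential_pdf !patchE; case: ifPn => // _.
  by rewrite -EFinM mulNr.
rewrite -integral_itv_obnd_cbnd; last first.
  apply: measurable_funeM; apply/measurable_EFinP; apply: measurableT_comp => //.
  by apply: measurableT_comp => //; exact: measurable_funM.
rewrite ge0_integralZl_EFin//; last 2 first.
  - apply/measurable_EFinP; apply: measurableT_comp => //.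
    by apply: measurableT_comp => //; exact: measurable_funM.
  - exact: ltW.
move=> h.
have : (0 <= \int[lebR]_(t in `]0%R, +oo[) (expR (- (p * t)))%:E)%E.
  by apply: integral_ge0 => t _; rewrite lee_fin expR_ge0.
move: h; case: (\int[lebR]_(t in `]0%R, +oo[) _)%E => [r|h|//].
  move=> [] h _; congr EFin; apply: (mulfI (lt0r_neq0 p0)).
  by rewrite h mulfV// gt_eqF.
by rewrite gt0_muley ?lte_fin// in h.
Qed.

Lemma rint_expR (p : R) : 0 < p -> rint lebR P (fun t => expR (- (p * t))).
Proof.
move=> p0; apply/integrableP; split.
  apply/measurable_EFinP; apply: measurableT_comp => //.
  by apply: measurableT_comp => //; exact: measurable_funM.
under eq_integral do rewrite /= ger0_norm ?expR_ge0//.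
by rewrite int_expR// ltry.
Qed.

End GammaFunction.

(** * The Gamma function and the kernels of fractional integration *)

Section PowerKernels.
Context {R : realType}.
Notation lebR := (@lebesgue_measure R).
Notation mR := (measurableTypeR R).

Lemma rint_restrict (E : set mR) (f : mR -> R) : measurable E ->
  rint lebR E f -> rint lebR P (f \_ E).
Proof.
move=> mE h; apply: (@integrableS _ _ _ _ setT) => //; first exact: mP.
by move/(integrable_mkcond _ mE) : h; rewrite restrict_EFin.
Qed.

(** The majorant is t^(x-1) on (0,1) and a multiple of exp(-t/2) beyond. There half of the
    exponential absorbs the power: (t/2)^n <= n! exp(t/2) is the origin of the constant 2^n n!. *)
Lemma rint_Gamma (x : R) : 0 < x ->
  rint lebR P (fun t : mR => t `^ (x - 1) * expR (- t)).
Proof.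
move=> x0.
pose n := (Num.truncn x).+1.
have xn : x - 1 <= n%:R.
  by rewrite lerBlDr (le_trans (ltW (truncnS_gt x)))// lerDl.
pose C := 2 ^+ n * n`!%:R : R.
have h1 := rint_restrict (measurable_itv _) (rint_powR x0 ltr01).
have h2 : rint lebR P (fun t => C * expR (- (2^-1 * t))).
  by apply: rintZ; [exact: mP|apply: rint_expR].
apply: (rint_le mP _ _ (rintD mP h1 h2)).
  apply: measurable_funM; first exact: measurable_powRE.
  by apply: measurableT_comp.
move=> t /PE t0; rewrite ger0_norm ?mulr_ge0 ?powR_ge0 ?expR_ge0//.
have [t1|t1] := ltP t 1.
  rewrite patchE mem_set /= ?in_itv /= ?t0//.
  rewrite -[leLHS]addr0 lerD ?mulr_ge0 ?expR_ge0 ?exprn_ge0//.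
  by rewrite ler_piMr ?powR_ge0// -expR0 ler_expR oppr_le0 ltW.
rewrite patchE memNset /= ?in_itv /= ?t0 ?ltNge ?t1// add0r.
have -> : expR (- t) = expR (- (2^-1 * t)) * expR (- (2^-1 * t)).
  by rewrite -expRD; congr expR; field.
rewrite mulrA ler_wpM2r ?expR_ge0//.
rewrite expRN ler_pdivrMr ?expR_gt0// /C -mulrA.
apply: (@le_trans _ _ (t ^+ n)).
  by rewrite -powR_mulrn ?(ltW t0)// ler_powR.
have -> : t ^+ n = 2 ^+ n * (2^-1 * t) ^+ n.
  by rewrite -exprMn mulrA divff ?mul1r.
by rewrite ler_wpM2l ?exprn_ge0// pow_le_expR// mulr_ge0 ?invr_ge0// ltW.
Qed.

Lemma Rint_lower (f : mR -> R) (a b c : R) : rint lebR P f ->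
  (forall t, P t -> 0 <= f t) -> 0 <= a -> a < b ->
  (forall t, a < t < b -> c <= f t) -> 0 <= c -> c * (b - a) <= \int[lebR]_(t in P) f t.
Proof.
move=> jf f0 a0 ab cf c0.
have sub : (`]a, b[%classic : set mR) `<=` P.
  by move=> t; rewrite PE /= in_itv /= => /andP[/(le_lt_trans a0)].
rewrite -lee_fin EFin_Rintegral//; last exact: mP.
have -> : ((c * (b - a))%:E = \int[lebR]_(t in (`]a, b[%classic : set mR)) c%:E)%E.
  rewrite integral_cst//= lebesgue_measure_itv /= lte_fin ab -EFinB -EFinM//.
apply: (@le_trans _ _ (\int[lebR]_(t in (`]a, b[%classic : set mR)) (f t)%:E)%E).
  have mfab : measurable_fun (`]a, b[%classic : set mR) (EFin \o f).
    by apply/measurable_EFinP; apply: measurable_funS (rint_meas jf) => //; exact: mP.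
  by apply: ge0_le_integral.
apply: ge0_subset_integral => //; first exact: mP.
by apply/measurable_EFinP; exact: rint_meas jf.
Qed.

(** Only the interval (N, N+1) of the defining integral is kept, where t^(x-1) = t^x / t >= N^x /
    (N+1). As [N] is free, Gamma outgrows every geometric sequence. *)
Lemma Gamma_lower (x N : R) : 0 < x -> 0 < N ->
  N `^ x / (N + 1) * expR (- (N + 1)) <= Gamma x.
Proof.
move=> x0 N0.
have := @Rint_lower (fun t : mR => t `^ (x - 1) * expR (- t)) N (N + 1)
  (N `^ x / (N + 1) * expR (- (N + 1))) (rint_Gamma x0).
rewrite (_ : N + 1 - N = 1) ?mulr1; last by ring.
apply.
- by move=> t _; rewrite mulr_ge0 ?powR_ge0 ?expR_ge0.
- exact: ltW.
- by rewrite ltrDl.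
- move=> t /andP[Nt tN]; have t0 := lt_trans N0 Nt.
  have N10 : 0 < N + 1 by rewrite addr_gt0.
  apply: ler_pM.
  + by rewrite divr_ge0 ?powR_ge0// ltW.
  + exact: expR_ge0.
  + rewrite powRB; last by rewrite (gt_eqF t0) implybT.
    rewrite (powRr1 (ltW t0)); apply: ler_pM.
    * exact: powR_ge0.
    * by rewrite invr_ge0 ltW.
    * by apply: ge0_ler_powR; rewrite ?nnegrE ?(ltW x0) ?(ltW t0) ?(ltW N0) ?(ltW Nt).
    * by rewrite lef_pV2 ?posrE ?(ltW tN).
  + by rewrite ler_expR lerN2 ltW.
- by rewrite mulr_ge0 ?expR_ge0// divr_ge0 ?powR_ge0// addr_ge0// ltW.
Qed.

Lemma Gamma_gt0 (x : R) : 0 < x -> 0 < Gamma x.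
Proof.
move=> x0; apply: lt_le_trans (Gamma_lower x0 ltr01).
by rewrite powR1 mulr_gt0 ?expR_gt0// divr_gt0.
Qed.

Lemma Gamma1 : Gamma (1 : R) = 1.
Proof.
rewrite /Gamma /Rintegral (_ : (\int[_]_(x in _) _)%E = (1%:E : \bar R))//.
rewrite -[in RHS](invr1 R) -(int_expR (ltr01)).
by apply: eq_integral => t _; rewrite subrr powRr0 !mul1r.
Qed.

(** The kernel of the Riemann-Liouville integral of order [x]; orders add under convolution. *)
Definition gk (x : R) (t : mR) : R := t `^ (x - 1) / Gamma x.

Lemma gk_ge0 x t : 0 < x -> 0 <= gk x t.
Proof. by move=> x0; rewrite divr_ge0 ?powR_ge0// ltW// Gamma_gt0. Qed.

Lemma gk_gt0 x t : 0 < x -> 0 < t -> 0 < gk x t.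
Proof. by move=> x0 t0; rewrite divr_gt0 ?powR_gt0// Gamma_gt0. Qed.

Lemma measurable_gk E x : measurable_fun E (gk x).
Proof. by apply: measurable_funM => //; exact: measurable_powRE. Qed.

Lemma gk1 t : gk 1 t = 1.
Proof. by rewrite /gk subrr powRr0 Gamma1 divr1. Qed.

Lemma lap_powR (p x : R) : 0 < p -> 0 < x ->
  lap p (fun t : mR => t `^ (x - 1)) = (Gamma x * p `^ (- x))%:E.
Proof.
move=> p0 x0; rewrite /lap.
have pi0 : 0 < p^-1 by rewrite invr_gt0.
have mF : measurable_fun P (fun t : mR => expR (- (p * t)) * t `^ (x - 1)).
  by apply: measurable_funM; [exact: measurable_expRN|exact: measurable_powRE].
have F0 (t : mR) : P t -> 0 <= expR (- (p * t)) * t `^ (x - 1).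
  by move=> _; rewrite mulr_ge0 ?powR_ge0 ?expR_ge0.
rewrite (ge0_Raffine 0 pi0 mP mF F0).
have -> : [set t : mR | P (p^-1 * t + 0)] = P.
  by apply/seteqP; split => t /=; rewrite !PE addr0 pmulr_rgt0.
have eG : (Gamma x)%:E = (\int[lebR]_(t in P) (t `^ (x - 1) * expR (- t))%:E)%E.
  exact: EFin_Rintegral mP _ (rint_Gamma x0).
have eI : (\int[lebR]_(t in P) (expR (- (p * (p^-1 * t + 0))) * (p^-1 * t + 0) `^ (x - 1))%:E)%E =
   ((p `^ (- (x - 1)))%:E * (Gamma x)%:E)%E.
  rewrite eG -(ge0_RZl mP (rint_meas (rint_Gamma x0)) _ (powR_ge0 _ _)); last first.
    by move=> t _; rewrite mulr_ge0 ?powR_ge0 ?expR_ge0.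
  apply: eq_integral => t; rewrite inE => /PE t0.
  rewrite addr0 powRM ?(ltW pi0) ?(ltW t0)//; congr EFin.
  have -> : p * (p^-1 * t) = t by rewrite mulrA mulfV ?mul1r// gt_eqF.
  rewrite -(powR_inv1 (ltW p0)) -powRrM mulN1r; ring.
rewrite eI -!EFinM; congr EFin.
have <- : p^-1 * p `^ (- (x - 1)) = p `^ (- x).
  rewrite -(powR_inv1 (ltW p0)) -powRD ?(gt_eqF p0) ?implybT//.
  by congr (_ `^ _); ring.
by move: (Gamma x) => G; ring.
Qed.

Lemma lapZ (p k : R) (f : mR -> R) : measurable_fun P f ->
  (forall t, P t -> 0 <= f t) -> 0 <= k ->
  lap p (fun t => k * f t) = (k%:E * lap p f)%E.
Proof.
move=> mf f0 k0; rewrite /lap -(ge0_RZl mP _ _ k0).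
- by apply: eq_integral => t _; congr EFin; ring.
- by apply: measurable_funM => //; exact: measurable_expRN.
- by move=> t /f0 h; rewrite mulr_ge0 ?expR_ge0.
Qed.

Lemma lap_gk (p x : R) : 0 < p -> 0 < x -> lap p (gk x) = (p `^ (- x))%:E.
Proof.
move=> p0 x0.
rewrite (_ : gk x = fun t => (Gamma x)^-1 * t `^ (x - 1)); last first.
  by apply/funext => t; rewrite mulrC.
rewrite lapZ//; [|exact: measurable_powRE|by move=> t _; exact: powR_ge0|].
  by rewrite lap_powR// -EFinM mulrA mulVf ?mul1r// gt_eqF// Gamma_gt0.
by rewrite invr_ge0 ltW// Gamma_gt0.
Qed.

(** Euler's beta integral, kept extended-real because its finiteness is only obtained in
    [beta_Gamma]. *)
Let beta (x y : R) := (\int[lebR]_(s in (`]0%R, 1%R[%classic : set mR))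
   (s `^ (x - 1) * (1 - s) `^ (y - 1))%:E)%E.

Let beta_ge0 x y : (0 <= beta x y)%E.
Proof. by apply: integral_ge0 => s _; rewrite lee_fin mulr_ge0 ?powR_ge0. Qed.

Let meas_beta E (x y t : R) :
  measurable_fun E (fun s : mR => (s `^ (x - 1) * (t - s) `^ (y - 1))).
Proof.
apply: measurable_funTS; apply: measurable_funM; first exact: measurable_powRE.
by apply: (measurableT_comp (measurable_powR _)); exact: measurable_funB.
Qed.

Lemma econv_pow_scale (x y t : R) : 0 < x -> 0 < y -> 0 < t ->
  econv (fun s : mR => s `^ (x - 1)) (fun s : mR => s `^ (y - 1)) t =
  ((t `^ (x + y - 1))%:E * beta x y)%E.
Proof.
move=> x0 y0 t0; rewrite /econv.
have mI : measurable (`]0%R, t[%classic : set mR) by [].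
have mI1 : measurable (`]0%R, 1%R[%classic : set mR) by [].
have n0 (u : R) (E : set mR) s : E s -> 0 <= s `^ (x - 1) * (u - s) `^ (y - 1).
  by move=> _; rewrite mulr_ge0 ?powR_ge0.
rewrite (ge0_Raffine 0 t0 mI (@meas_beta _ x y t) (n0 t _)).
have -> : [set s : mR | (`]0%R, t[%classic : set mR) (t * s + 0)] = (`]0%R, 1%R[%classic : set mR).
  by apply/seteqP; split => s /=; rewrite !in_itv /= addr0 pmulr_rgt0// gtr_pMr.
have -> : (\int[lebR]_(s in (`]0%R, 1%R[%classic : set mR))
    ((t * s + 0) `^ (x - 1) * (t - (t * s + 0)) `^ (y - 1))%:E)%E =
    ((t `^ (x - 1) * t `^ (y - 1))%:E * beta x y)%E.
  rewrite /beta -(ge0_RZl mI1 (@meas_beta _ x y 1) (n0 1 _)) ?mulr_ge0 ?powR_ge0//.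
  apply: eq_integral => s; rewrite inE /= in_itv /= => /andP[s0 s1].
  congr EFin; have -> : t - (t * s + 0) = t * (1 - s) by ring.
  rewrite addr0 !powRM ?(ltW t0) ?(ltW s0) ?subr_ge0 ?(ltW s1)//; ring.
rewrite muleA -EFinM; congr (_%:E * _)%E.
have -> : x + y - 1 = 1 + (x - 1) + (y - 1) by ring.
have hh r s : t `^ (r + s) = t `^ r * t `^ s.
  by rewrite powRD// (gt_eqF t0) implybT.
by rewrite (hh (1 + (x - 1))) (hh 1) powRr1 ?mulrA// ltW.
Qed.

(** The Laplace transform at 1 of a convolution of two powers is computed twice: by the product rule
    and by scaling. *)
Lemma beta_Gamma (x y : R) : 0 < x -> 0 < y ->
  beta x y = (Gamma x * Gamma y / Gamma (x + y))%:E.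
Proof.
move=> x0 y0; have xy0 := addr_gt0 x0 y0.
have h := @lap_conv R 1 (fun s : mR => s `^ (x - 1)) (fun s : mR => s `^ (y - 1))
  (@measurable_powRE R P _) (@measurable_powRE R P _) (fun _ _ => powR_ge0 _ _) (fun _ _ => powR_ge0 _ _).
rewrite (lap_powR ltr01 x0) (lap_powR ltr01 y0) in h.
have e1 : (\int[lebR]_(t in P) ((expR (- (1 * t)))%:E *
    econv (fun s : mR => (s `^ (x - 1))%R) (fun s : mR => (s `^ (y - 1))%R) t))%E =
    (lap 1 (fun t : mR => (t `^ (x + y - 1))%R) * beta x y)%E.
  rewrite /lap -(ge0_integralZr lebR mP _ _ (beta_ge0 x y)).
  - by apply: eq_integral => t; rewrite inE => /PE t0; rewrite econv_pow_scale// EFinM muleA.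
  - apply/measurable_EFinP; apply: measurable_funM; last exact: measurable_powRE.
    exact: measurable_expRN.
  - by move=> t _; rewrite lee_fin mulr_ge0 ?powR_ge0 ?expR_ge0.
rewrite e1 (lap_powR ltr01 xy0) !powR1 !mulr1 in h.
have G0 := Gamma_gt0 xy0.
move: (Gamma x) (Gamma y) (Gamma (x + y)) G0 h => Gx Gy Gz G0.
have := beta_ge0 x y; case: (beta x y) => [r _|_|//].
  move=> [] h; congr EFin; rewrite -h mulrAC mulfV ?mul1r// gt_eqF//.
by rewrite gt0_muley ?lte_fin.
Qed.

Lemma econv_gk (x y t : R) : 0 < x -> 0 < y -> 0 < t ->
  econv (gk x) (gk y) t = (gk (x + y) t)%:E.
Proof.
move=> x0 y0 t0.
have Gx := Gamma_gt0 x0; have Gy := Gamma_gt0 y0; have Gz := Gamma_gt0 (addr_gt0 x0 y0).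
have mI : measurable (`]0%R, t[%classic : set mR) by [].
have k0 : 0 <= (Gamma x)^-1 * (Gamma y)^-1 by rewrite mulr_ge0 ?invr_ge0 ?(ltW Gx) ?(ltW Gy).
have -> : econv (gk x) (gk y) t = (((Gamma x)^-1 * (Gamma y)^-1)%:E *
   econv (fun s : mR => (s `^ (x - 1))%R) (fun s : mR => (s `^ (y - 1))%R) t)%E.
  rewrite /econv -(ge0_RZl mI (@meas_beta _ x y t) _ k0).
    apply: eq_integral => s _; rewrite /gk; congr EFin.
    by move: (Gamma x) (Gamma y) => a b; ring.
  by move=> s _; rewrite mulr_ge0 ?powR_ge0.
rewrite econv_pow_scale// beta_Gamma// -!EFinM /gk; congr EFin.
move: (Gamma x) (Gamma y) (Gamma (x + y)) Gx Gy Gz => a b c a0 b0 c0.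
by field; rewrite !gt_eqF.
Qed.

Lemma rint_econv (f h : mR -> R) (t : R) :
  measurable_fun P f -> measurable_fun P h ->
  (forall x, P x -> (0 <= f x)%R) -> (forall x, P x -> (0 <= h x)%R) ->
  (econv f h t < +oo)%E ->
  rint lebR `]0, t[ (fun s => f s * h (t - s)).
Proof.
move=> mf mh f0 h0 fin.
have mm : measurable_fun (`]0%R, t[%classic : set mR) (fun s => f s * h (t - s)).
  apply: measurable_funM.
    by apply: measurable_funS mf => //; [exact: mP|move=> s; rewrite PE /= in_itv /= => /andP[]].
  exact: measurable_refl.
apply/integrableP; split; first exact/measurable_EFinP.
apply: le_lt_trans fin; rewrite le_eqVlt; apply/orP; left; apply/eqP.
apply: eq_integral => s; rewrite inE /= in_itv /= => /andP[s0 st] /=.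
by rewrite ger0_norm// mulr_ge0 ?f0 ?h0 ?PE ?subr_gt0.
Qed.

Definition conv (f h : mR -> R) (t : R) : R :=
  \int[lebR]_(s in (`]0%R, t[%classic : set mR)) (f s * h (t - s)).

Lemma rint_gk2 (x y t : R) : 0 < x -> 0 < y -> 0 < t ->
  rint lebR `]0, t[ (fun s => gk x s * gk y (t - s)).
Proof.
move=> x0 y0 t0; apply: rint_econv; rewrite ?econv_gk ?ltry//.
- exact: measurable_gk.
- exact: measurable_gk.
- by move=> s _; exact: gk_ge0.
- by move=> s _; exact: gk_ge0.
Qed.

Lemma conv_gk (x y t : R) : 0 < x -> 0 < y -> 0 < t ->
  conv (gk x) (gk y) t = gk (x + y) t.
Proof. by move=> x0 y0 t0; rewrite /conv /Rintegral -/(econv _ _ _) econv_gk. Qed.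

(** Read off from the convolution of [gk x] with [gk 1] at time 1. *)
Lemma GammaS (x : R) : 0 < x -> Gamma (x + 1) = x * Gamma x.
Proof.
move=> x0; have Gx := Gamma_gt0 x0.
have mI : measurable (`]0%R, 1%R[%classic : set mR) by [].
have k0 : 0 <= (Gamma x)^-1 by rewrite invr_ge0 (ltW Gx).
have e : econv (gk x) (gk 1) 1 = ((Gamma x)^-1 * x^-1)%:E.
  have -> : econv (gk x) (gk 1) 1 = (\int[lebR]_(s in (`]0%R, 1%R[%classic : set mR))
      ((Gamma x)^-1 * s `^ (x - 1))%:E)%E.
    by apply: eq_integral => s _; rewrite gk1 mulr1 /gk mulrC.
  rewrite (ge0_RZl mI (@measurable_powRE R _ _) _ k0).
    by rewrite int_powR// powR1 -EFinM mul1r.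
  by move=> s _; rewrite powR_ge0.
rewrite econv_gk// in e; case: e; rewrite /gk powR1 mul1r => e.
by apply: invr_inj; rewrite e invfM mulrC.
Qed.

(** Multiplication by [t] raises the order by one. Applied termwise this is the source of the
    identity for t rho(t). *)
Lemma mul_gk (x t : R) : 0 < x -> 0 < t -> t * gk x t = x * gk (x + 1) t.
Proof.
move=> x0 t0; rewrite /gk GammaS// addrK.
have -> : t `^ x = t `^ (x - 1) * t.
  by rewrite -[X in _ * X](powRr1 (ltW t0)) -powRD ?(gt_eqF t0) ?implybT// subrK.
have := Gamma_gt0 x0; move: (Gamma x) => G G0.
by field; rewrite !gt_eqF.
Qed.

(** In [Gamma_lower], [N] is taken so large that N^al >= M, which absorbs M^k, and N >= 1, which
    makes the remaining factor N^z harmless. *)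
Lemma Gamma_coef (al z M : R) : 0 < al -> 0 < z -> 0 <= M ->
  exists C, forall k, M ^+ k / Gamma (k%:R * al + z) <= C.
Proof.
move=> al0 z0 M0; pose N := Num.max 1 (M `^ al^-1).
have N1 : 1 <= N by rewrite le_max lexx.
have N0 : 0 < N by apply: lt_le_trans N1.
have MN : M <= N `^ al.
  rewrite -[leLHS]powRr1// -(mulVf (lt0r_neq0 al0)) powRrM.
  apply: ge0_ler_powR; rewrite ?nnegrE ?powR_ge0 ?(ltW al0) ?(ltW N0)//.
  by rewrite /N le_max lexx orbT.
exists ((N + 1) * expR (N + 1)) => k.
have kz : 0 < k%:R * al + z by rewrite ltr_wpDl// mulr_ge0// ltW.
rewrite ler_pdivrMr ?Gamma_gt0//.
apply: le_trans (ler_wpM2l _ (Gamma_lower kz N0)); last first.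
  by rewrite mulr_ge0 ?expR_ge0// addr_ge0// ltW.
have -> : (N + 1) * expR (N + 1) * (N `^ (k%:R * al + z) / (N + 1) * expR (- (N + 1))) =
   N `^ (k%:R * al + z).
  rewrite expRN; field; rewrite !gt_eqF ?expR_gt0// addr_gt0//.
rewrite powRD ?(gt_eqF N0) ?implybT//.
apply: (@le_trans _ _ ((N `^ al) ^+ k)).
  by rewrite lerXn2r ?nnegrE// powR_ge0.
rewrite -powR_mulrn ?powR_ge0// -powRrM (mulrC al) ler_peMr ?powR_ge0//.
by rewrite -[leLHS](powRr0 N) ler_powR// ltW.
Qed.

End PowerKernels.

(** * Mittag-Leffler functions *)

Section MittagLefflerSeries.
Context {R : realType}.
Notation lebR := (@lebesgue_measure R).
Notation mR := (measurableTypeR R).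
Variable al : R.
Hypothesis al0 : 0 < al.

(** At most geometric growth: enough for the series below to converge at every positive time, and
    stable under shifts and Cauchy products. *)
Definition geo (u : nat -> R) :=
  exists CM : R * R, [/\ 0 <= CM.1, 0 <= CM.2 & forall k, `|u k| <= CM.1 * CM.2 ^+ k].

Lemma geo_pow (l : R) : geo (fun k => l ^+ k).
Proof. by exists (1, `|l|); split => //= k; rewrite mul1r normrX. Qed.

Lemma geo_delta : geo (fun k => (k == 0%N)%:R).
Proof.
exists (1, 0); split => //= -[|k]; first by rewrite expr0 mulr1 normr1.
by rewrite normr0 mul1r exprn_ge0.
Qed.

Lemma geo_shift u : geo u -> geo (fun k => u k.+1).
Proof.
move=> [[C M] [/= C0 M0 h]]; exists (C * M, M); split => /= [||k]//.
  by rewrite mulr_ge0.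
by rewrite -mulrA -exprS h.
Qed.

Lemma geoZ c u : geo u -> geo (fun k => c * u k).
Proof.
move=> [[C M] [/= C0 M0 h]]; exists (`|c| * C, M); split => /= [||k]//.
  by rewrite mulr_ge0.
by rewrite normrM -mulrA ler_wpM2l.
Qed.

Lemma geo2 u v : geo u -> geo v -> exists C M, [/\ 0 <= C, 0 <= M,
  forall k, `|u k| <= C * M ^+ k & forall k, `|v k| <= C * M ^+ k].
Proof.
move=> [[C M] [/= C0 M0 h]] [[C' M'] [/= C'0 M'0 h']].
exists (C + C'), (M + M'); split; rewrite ?addr_ge0// => k.
  apply: le_trans (h k) _; apply: ler_pM; rewrite ?exprn_ge0 ?lerDl//.
  by rewrite lerXn2r ?nnegrE ?addr_ge0// lerDl.
apply: le_trans (h' k) _; apply: ler_pM; rewrite ?exprn_ge0 ?lerDr//.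
by rewrite lerXn2r ?nnegrE ?addr_ge0// lerDr.
Qed.

Lemma geoB u v : geo u -> geo v -> geo (fun k => u k - v k).
Proof.
move=> gu gv; have [C [M [C0 M0 h h']]] := geo2 gu gv.
exists (2 * C, M); split => /= [||k]//; first by rewrite mulr_ge0.
apply: le_trans (ler_normB _ _) _; rewrite -mulrA mulr2n mulrDl !mul1r.
by rewrite lerD.
Qed.

Definition cauchy (u v : nat -> R) (k : nat) := \sum_(i < k.+1) u i * v (k - i)%N.

Lemma geo_cauchy u v : geo u -> geo v -> geo (cauchy u v).
Proof.
move=> gu gv; have [C [M [C0 M0 h h']]] := geo2 gu gv.
(* The factor 2 in the ratio absorbs the number of terms, as k + 1 <= 2^k. *)
exists (C * C, 2 * M); split => /= [||k]//; rewrite ?mulr_ge0//.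
apply: le_trans (ler_norm_sum _ _ _) _.
apply: (@le_trans _ _ (\sum_(i < k.+1) C * C * M ^+ k)).
  apply: ler_sum => i _; rewrite normrM.
  have -> : C * C * M ^+ k = (C * M ^+ i) * (C * M ^+ (k - i)).
    by rewrite mulrACA -exprD subnKC// -ltnS.
  by rewrite ler_pM.
rewrite sumr_const card_ord exprMn mulrCA -[X in X <= _]mulr_natl.
rewrite ler_wpM2r ?mulr_ge0 ?exprn_ge0//.
by rewrite -natrX ler_nat; exact: ltn_expl.
Qed.

(* [u k * term x k t] is the [k]-th term of a Mittag-Leffler series with
   coefficients [u], multiplied by [t `^ (x - 1)]. *)
Definition term (x : R) (k : nat) (t : mR) : R := gk (k%:R * al + x) t.

Lemma index_gt0 (x : R) k : 0 < x -> 0 < k%:R * al + x.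
Proof. by move=> x0; rewrite ltr_wpDl// mulr_ge0// ltW. Qed.

Lemma term_ge0 x k t : 0 < x -> 0 <= term x k t.
Proof. by move=> x0; rewrite gk_ge0// index_gt0. Qed.

Lemma termE x k t : 0 < t -> term x k t = t `^ (x - 1) * (t `^ al) ^+ k / Gamma (k%:R * al + x).
Proof.
move=> t0; rewrite /term /gk; congr (_ / _).
rewrite -powR_mulrn ?powR_ge0// -powRrM -powRD ?(gt_eqF t0) ?implybT//.
by congr (_ `^ _); ring.
Qed.

(** Any ratio [q] can be reached, because [Gamma_coef] applies to M T^al / q for every [q]. *)
Lemma term_dom (u : nat -> R) (x T q : R) : geo u -> 0 < x -> 0 < T -> 0 < q ->
  exists2 K, 0 <= K & forall t k, 0 < t <= T ->
    `|u k| * term x k t <= K * t `^ (x - 1) * q ^+ k.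
Proof.
move=> [[C M] [/= C0 M0 h]] x0 T0 q0.
have M'0 : 0 <= M * T `^ al / q by rewrite divr_ge0 ?mulr_ge0 ?powR_ge0 ?(ltW q0).
have [B hB] := Gamma_coef al0 x0 M'0.
have B0 : 0 <= B.
  by apply: le_trans (hB 0%N); rewrite expr0 divr_ge0// ltW// Gamma_gt0// index_gt0.
exists (C * B) => [|t k /andP[t0 tT]]; first by rewrite mulr_ge0.
rewrite termE//.
apply: (@le_trans _ _ (C * M ^+ k * (t `^ (x - 1) * (T `^ al) ^+ k / Gamma (k%:R * al + x)))).
  apply: ler_pM => //.
    by rewrite !mulr_ge0 ?powR_ge0 ?exprn_ge0 ?powR_ge0// invr_ge0 ltW// Gamma_gt0// index_gt0.
  rewrite ler_wpM2r ?invr_ge0 ?(ltW (Gamma_gt0 (index_gt0 k x0)))//.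
  rewrite ler_wpM2l ?powR_ge0// lerXn2r ?nnegrE ?powR_ge0//.
  by apply: ge0_ler_powR; rewrite ?nnegrE ?(ltW al0) ?(ltW t0) ?(ltW T0).
have := hB k; rewrite !exprMn exprVn => hk.
have := ler_wpM2l (mulr_ge0 C0 (mulr_ge0 (powR_ge0 t (x - 1)) (exprn_ge0 k (ltW q0)))) hk.
have qk : q ^+ k != 0 by rewrite expf_neq0// gt_eqF.
have := Gamma_gt0 (index_gt0 k x0); move: (Gamma _) => G G0.
set lhs := (X in X <= _ -> _); set rhs := (X in _ <= X -> _) => hh.
have -> : C * B * t `^ (x - 1) * q ^+ k = rhs by rewrite /rhs; ring.
apply: le_trans hh; rewrite le_eqVlt; apply/orP; left; apply/eqP.
by rewrite /lhs; field; rewrite qk gt_eqF.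
Qed.

Local Opaque term.

Definition psumM (u : nat -> R) (x : R) (N : nat) (t : mR) : R :=
  \sum_(k < N) u k * term x k t.

Definition ML u x (t : mR) : R := limn (fun N => psumM u x N t).

Lemma sum_half N : \sum_(k < N) (2^-1 : R) ^+ k <= 2.
Proof.
suff -> : \sum_(k < N) (2^-1 : R) ^+ k = 2 - 2 * 2^-1 ^+ N.
  by rewrite gerBl mulr_ge0// exprn_ge0.
elim: N => [|N IH]; first by rewrite big_ord0 expr0 mulr1 subrr.
by rewrite big_ord_recr /= IH exprS; field.
Qed.

Lemma abs_psum_dom (u : nat -> R) (x T : R) : geo u -> 0 < x -> 0 < T ->
  exists2 K, 0 <= K & forall t N, 0 < t <= T ->
    \sum_(k < N) `|u k * term x k t| <= K * t `^ (x - 1).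
Proof.
move=> gu x0 T0; have [K K0 hK] := @term_dom u x T 2^-1 gu x0 T0 (ltac:(by [])).
exists (K * 2) => [|t N tT]; first by rewrite mulr_ge0.
apply: (@le_trans _ _ (\sum_(k < N) K * t `^ (x - 1) * 2^-1 ^+ k)).
  by apply: ler_sum => k _; rewrite normrM (ger0_norm (term_ge0 k t x0)) hK.
rewrite -mulr_sumr (mulrAC K 2); apply: ler_wpM2l; first by rewrite mulr_ge0 ?powR_ge0.
exact: sum_half.
Qed.

Lemma ML_cvg u x t : geo u -> 0 < x -> 0 < t ->
  psumM u x N t @[N --> \oo] --> ML u x t.
Proof.
move=> gu x0 t0; have [K K0 hK] := abs_psum_dom gu x0 t0.
have h N : \sum_(k < N) `|u k * term x k t| <= K * t `^ (x - 1).
  by apply: hK; rewrite t0 lexx.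
have [s cs bs] := cvg_nd_bounded (fun k => normr_ge0 (u k * term x k t)) h.
have h1 : forall n : nat, `|(fun=> 1) n| <= 1 :> R by move=> n; rewrite normr1.
have [l cl _] := @abs_tail _ (fun k => u k * term x k t) _ _ _ h1 cs bs.
have e N : \sum_(n < N) 1 * (u n * term x n t) = psumM u x N t.
  by apply: eq_bigr => n _; rewrite mul1r.
rewrite (_ : (fun N => \sum_(n < N) _) = (fun N => psumM u x N t)) in cl; last first.
  exact/funext.
by rewrite /ML (cvg_lim _ cl).
Qed.

Lemma ML_unique u x t l : psumM u x N t @[N --> \oo] --> l -> ML u x t = l.
Proof. exact: cvg_lim. Qed.

Lemma psum_dom (u : nat -> R) (x T : R) : geo u -> 0 < x -> 0 < T ->
  exists2 K, 0 <= K & forall t, 0 < t <= T ->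
    (forall N, `|psumM u x N t| <= K * t `^ (x - 1)) /\
    `|ML u x t| <= K * t `^ (x - 1).
Proof.
move=> gu x0 T0; have [K K0 hK] := abs_psum_dom gu x0 T0.
exists K => // t tT.
have h N : `|psumM u x N t| <= K * t `^ (x - 1).
  by apply: le_trans (hK t N tT); exact: ler_norm_sum.
split => //; have /andP[t0 _] := tT.
apply: (cvg_le_cst (cvg_norm (ML_cvg gu x0 t0))); exact: nearW.
Qed.

Lemma measurable_psumM E u x N : measurable_fun E (psumM u x N).
Proof.
apply: measurable_sum => k; apply: measurable_funM => //.
exact: measurable_gk.
Qed.

Lemma measurable_ML u x : geo u -> 0 < x -> measurable_fun P (ML u x).
Proof.
move=> gu x0; apply: (@measurable_fun_cvg _ _ _ P (fun N => psumM u x N)).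
  by move=> N; exact: measurable_psumM.
by move=> t /PE t0; exact: ML_cvg.
Qed.

Lemma MLZ c u x t : geo u -> 0 < x -> 0 < t ->
  ML (fun k => c * u k) x t = c * ML u x t.
Proof.
move=> gu x0 t0; apply: ML_unique.
rewrite (_ : (fun N => _) = (fun N => c * psumM u x N t)).
  by apply: cvgMl_tmp; exact: ML_cvg.
apply/funext => N; rewrite /psumM mulr_sumr; apply: eq_bigr => k _.
by rewrite mulrA.
Qed.

Lemma MLB u v x t : geo u -> geo v -> 0 < x -> 0 < t ->
  ML (fun k => u k - v k) x t = ML u x t - ML v x t.
Proof.
move=> gu gv x0 t0; apply: ML_unique.
rewrite (_ : (fun N => _) = (fun N => psumM u x N t - psumM v x N t)).
  by apply: cvgB; exact: ML_cvg.
apply/funext => N; rewrite /psumM -sumrB; apply: eq_bigr => k _.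
by rewrite mulrBl.
Qed.

Local Transparent term.

Lemma ML_delta x t : ML (fun k => (k == 0%N)%:R) x t = gk x t.
Proof.
apply: ML_unique.
have h : forall N, psumM (fun k => (k == 0%N)%:R) x N.+1 t = gk x t.
  move=> N; rewrite /psumM big_ord_recl /= mul1r /term mul0r add0r big1 ?addr0//.
  by move=> i _; rewrite /bump /= mul0r.
rewrite -cvg_shiftS /=; under eq_fun do rewrite h.
exact: cvg_cst.
Qed.

Lemma ML_shift u x t : geo u -> 0 < x -> 0 < t ->
  ML u x t = u 0%N * gk x t + ML (fun k => u k.+1) (x + al) t.
Proof.
move=> gu x0 t0; apply: ML_unique.
rewrite -cvg_shiftS /=.
have h N : psumM u x N.+1 t = u 0%N * gk x t + psumM (fun k => u k.+1) (x + al) N t.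
  rewrite /psumM big_ord_recl /= /term mul0r add0r; congr (_ + _).
  apply: eq_bigr => k _; rewrite /bump /= add1n; congr (_ * gk _ _).
  by rewrite -natr1; ring.
under eq_fun do rewrite h.
apply: cvgD; first exact: cvg_cst.
apply: ML_cvg => //; [exact: geo_shift|exact: addr_gt0].
Qed.

Lemma continuous_term x k t : 0 < t -> {for t, continuous (term x k : R -> R)}.
Proof.
move=> t0; have C (y : R) : {for t, continuous (fun s : R => s `^ y)}.
  apply: differentiable_continuous; apply/derivable1_diffP.
  by apply: derivable_powR; rewrite in_itv/= andbT.
by rewrite /term /gk /continuous_at; apply: cvgMr_tmp; exact: C.
Qed.

Local Opaque term.

(** The series converges uniformly on (t/2, 2t), away from the singularity at 0. *)
Lemma ML_continuous u x t : geo u -> 0 < x -> 0 < t ->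
  {for t, continuous (ML u x : R -> R)}.
Proof.
move=> gu x0 t0; have T0 : 0 < 2 * t by rewrite mulr_gt0.
have [K K0 hK] := @term_dom u x (2 * t) 2^-1 gu x0 T0 (ltac:(by [])).
(* The exponent [x - 1] may have either sign; writing the power as s^x / s treats both cases at
   once. *)
have [B B0 hB] : exists2 B, 0 <= B & forall s, t / 2 < s < 2 * t -> s `^ (x - 1) <= B.
  exists ((2 * t) `^ x / (t / 2)); first by rewrite divr_ge0 ?powR_ge0// divr_ge0// ltW.
  move=> s /andP[s1 s2]; have s0 : 0 < s by apply: lt_trans s1; rewrite divr_gt0.
  rewrite powRB; last by rewrite (gt_eqF s0) implybT.
  rewrite (powRr1 (ltW s0)); apply: ler_pM.
  - exact: powR_ge0.
  - by rewrite invr_ge0 ltW.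
  - by apply: ge0_ler_powR; rewrite ?nnegrE ?(ltW x0) ?(ltW s0) ?(ltW T0) ?(ltW s2).
  - by rewrite lef_pV2 ?posrE ?divr_gt0// ltW.
have tail N s : t / 2 < s < 2 * t ->
    `|ML u x s - psumM u x N s| <= K * B * (2 * 2^-1 ^+ N).
  move=> hs; have /andP[s1 s2] := hs.
  have s0 : 0 < s by apply: lt_trans s1; rewrite divr_gt0.
  have c : `|psumM u x M s - psumM u x N s| @[M --> \oo] --> `|ML u x s - psumM u x N s|.
    by apply: cvg_norm; apply: cvgB; [exact: ML_cvg|exact: cvg_cst].
  apply: (cvg_le_cst c); near=> M.
  have NM : (N <= M)%N by near: M; exact: nbhs_infty_ge.
  rewrite /= /psumM (@sum_tail _ (fun k => u k * term x k s))//.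
  apply: le_trans (ler_norm_sum _ _ _) _.
  apply: (@le_trans _ _ (\sum_(N <= k < M) K * B * 2^-1 ^+ k)).
    apply: ler_sum => k _; rewrite normrM (ger0_norm (term_ge0 k s x0)).
    apply: le_trans (hK s k _) _; first by rewrite s0 ltW.
    by rewrite -!mulrA ler_wpM2l// ler_wpM2r ?exprn_ge0// hB.
  rewrite -mulr_sumr ler_wpM2l ?mulr_ge0//.
  rewrite -{1}(add0n N) big_addn.
  under eq_bigr do rewrite exprD.
  by rewrite -mulr_suml ler_wpM2r ?exprn_ge0// big_mkord sum_half.
apply/cvgrPdist_lt => e e0.
have e3 : 0 < e / 3 by rewrite divr_gt0.
have [N hN] : exists N, K * B * (2 * 2^-1 ^+ N) < e / 3.
  have c : K * B * (2 * 2^-1 ^+ N) @[N --> \oo] --> K * B * (2 * 0).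
    apply: cvgMl_tmp; apply: cvgMl_tmp; apply: cvg_expr.
    by rewrite ger0_norm// invf_lt1// ltr1n.
  rewrite !mulr0 in c.
  by have [N _ /(_ N (leqnn N))] := cvgr_lt 0 c _ e3; exists N.
have cS : {for t, continuous (psumM u x N : R -> R)}.
  rewrite /psumM /continuous_at; apply: cvg_bigsum => k _.
  by apply: cvgMl_tmp; exact: continuous_term.
have tt : t / 2 < t < 2 * t.
  by rewrite ltr_pdivrMr// ltr_pMr// ltr_pMl// !ltr1n.
have nt : \forall s \near t, t / 2 < s < 2 * t.
  have [t1 t2] := andP tt.
  by near=> s; apply/andP; split; near: s; [exact: lt_nbhsr|exact: lt_nbhsl].
near=> s.
have hs : t / 2 < s < 2 * t by near: s; exact: nt.
have h1 := tail N t tt; have h2 := tail N s hs.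
have h3 : `|psumM u x N t - psumM u x N s| < e / 3.
  by near: s; move/cvgrPdist_lt : cS; apply.
have -> : ML u x t - ML u x s = (ML u x t - psumM u x N t) +
   (psumM u x N t - psumM u x N s) - (ML u x s - psumM u x N s) by ring.
apply: le_lt_trans (ler_normB _ _) _.
apply: le_lt_trans (lerD (ler_normD _ _) (lexx _)) _.
lra.
Unshelve. all: by end_near. Qed.

Lemma triangle (F : nat -> nat -> R) N :
  \sum_(i < N) \sum_(j < N - i) F i j = \sum_(k < N) \sum_(i < k.+1) F i (k - i)%N.
Proof.
elim: N => [|N IH]; first by rewrite !big_ord0.
rewrite [RHS]big_ord_recr /= -IH.
transitivity (\sum_(i < N.+1) (\sum_(j < N - i) F i j + F i (N - i)%N)).
  apply: eq_bigr => i _; have iN : (i <= N)%N by rewrite -ltnS.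
  by rewrite (subSn iN) big_ord_recr.
rewrite big_split /=; congr (_ + _).
by rewrite big_ord_recr /= subnn big_ord0 addr0.
Qed.

Local Transparent term.

Lemma conv_psumM u v x y N t : 0 < x -> 0 < y -> 0 < t ->
  conv (psumM u x N) (psumM v y N) t =
  \sum_(i < N) \sum_(j < N) u i * v j * term (x + y) (i + j) t.
Proof.
move=> x0 y0 t0; rewrite /conv.
have mI : measurable (`]0%R, t[%classic : set mR) by [].
transitivity (\int[lebR]_(s in (`]0%R, t[%classic : set mR))
  (\sum_(i < N) \sum_(j < N) u i * v j * (term x i s * term y j (t - s)))).
  apply: eq_Rintegral => s _; rewrite /psumM mulr_suml; apply: eq_bigr => i _.
  by rewrite mulr_sumr; apply: eq_bigr => j _; rewrite mulrACA.
have jj i j : rint lebR (`]0%R, t[%classic : set mR) (fun s => u i * v j * (term x i s * term y j (t - s))).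
  by apply: rintZ => //; apply: rint_gk2 => //; exact: index_gt0.
rewrite Rintegral_sum//; last by move=> i _; apply: rint_sum.
apply: eq_bigr => i _; rewrite Rintegral_sum//; apply: eq_bigr => j _.
have ix := index_gt0 i x0; have jy := index_gt0 j y0.
rewrite (RintegralZl _ mI (rint_gk2 ix jy t0)).
congr (_ * _); have -> : term (x + y) (i + j) t = gk ((i%:R * al + x) + (j%:R * al + y)) t.
  by congr (gk _ _); rewrite natrD; ring.
exact: conv_gk.
Qed.

Local Opaque term.

(** The two power bounds multiply to a constant times [gk x s * gk y (t - s)], an integrable
    majorant. *)
Lemma conv_dct (f_ h_ : nat -> mR -> R) (f h : mR -> R) (x y K K' t : R) :
  0 < x -> 0 < y -> 0 < t ->
  (forall N, measurable_fun P (f_ N)) -> (forall N, measurable_fun P (h_ N)) ->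
  measurable_fun P f -> measurable_fun P h ->
  (forall s, 0 < s <= t -> f_ N s @[N --> \oo] --> f s) ->
  (forall s, 0 < s <= t -> h_ N s @[N --> \oo] --> h s) ->
  (forall N s, 0 < s <= t -> `|f_ N s| <= K * s `^ (x - 1)) ->
  (forall N s, 0 < s <= t -> `|h_ N s| <= K' * s `^ (y - 1)) ->
  rint lebR `]0, t[ (fun s => f s * h (t - s)) /\
  conv (f_ N) (h_ N) t @[N --> \oo] --> conv f h t.
Proof.
move=> x0 y0 t0 mf_ mh_ mf mh cf ch bf bh.
have mI : measurable (`]0%R, t[%classic : set mR) by [].
have sub : (`]0%R, t[%classic : set mR) `<=` P.
  by move=> s; rewrite PE /= in_itv /= => /andP[].
have mm (f' h' : mR -> R) : measurable_fun P f' -> measurable_fun P h' ->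
    measurable_fun (`]0%R, t[%classic : set mR) (fun s => f' s * h' (t - s)).
  move=> mf' mh'; apply: measurable_funM; last exact: measurable_refl.
  by apply: measurable_funS mf' => //; exact: mP.
have sI s : (`]0%R, t[%classic : set mR) s -> (0 < s <= t) /\ (0 < t - s <= t).
  rewrite /= in_itv /= => /andP[s0 st]; rewrite s0 (ltW st) subr_gt0 st; split => //=.
  by rewrite gerBl ltW.
apply: (@Rdct _ _ _ lebR _ mI (fun N s => f_ N s * h_ N (t - s)) _
  (fun s => K * Gamma x * (K' * Gamma y) * (gk x s * gk y (t - s)))).
- by move=> N; exact: mm.
- exact: mm.
- by move=> s /sI[s1 s2]; apply: cvgM; [exact: cf|exact: ch].
- by apply: rintZ => //; exact: rint_gk2.
- move=> N s /sI[s1 s2]; rewrite normrM.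
  have -> : K * Gamma x * (K' * Gamma y) * (gk x s * gk y (t - s)) =
     (K * s `^ (x - 1)) * (K' * (t - s) `^ (y - 1)).
    rewrite /gk; have := Gamma_gt0 x0; have := Gamma_gt0 y0.
    by move: (Gamma x) (Gamma y) => a b b0 a0; field; rewrite !gt_eqF.
  by apply: ler_pM => //; [exact: bf|exact: bh].
Qed.

Lemma rint_ML u v x y t : geo u -> geo v -> 0 < x -> 0 < y -> 0 < t ->
  rint lebR `]0, t[ (fun s => ML u x s * ML v y (t - s)).
Proof.
move=> gu gv x0 y0 t0.
have [K K0 hK] := psum_dom gu x0 t0; have [K' K'0 hK'] := psum_dom gv y0 t0.
have [] := @conv_dct (psumM u x) (psumM v y) (ML u x) (ML v y) x y K K' t x0 y0 t0.
- by move=> N; exact: measurable_psumM.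
- by move=> N; exact: measurable_psumM.
- exact: measurable_ML.
- exact: measurable_ML.
- by move=> s /andP[s0 _]; exact: ML_cvg.
- by move=> s /andP[s0 _]; exact: ML_cvg.
- by move=> N s /hK[].
- by move=> N s /hK'[].
- by [].
Qed.

(** The convolution of two partial sums exceeds the partial sum of the Cauchy product by the terms
    with i, j < N <= i + j. There are at most N^2 <= 4^N of them, each of size 8^-N, so the excess
    is of order 2^-N. *)
Lemma conv_ML u v x y t : geo u -> geo v -> 0 < x -> 0 < y -> 0 < t ->
  conv (ML u x) (ML v y) t = ML (cauchy u v) (x + y) t.
Proof.
move=> gu gv x0 y0 t0.
have [K K0 hK] := psum_dom gu x0 t0; have [K' K'0 hK'] := psum_dom gv y0 t0.
have [] := @conv_dct (psumM u x) (psumM v y) (ML u x) (ML v y) x y K K' t x0 y0 t0.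
- by move=> N; exact: measurable_psumM.
- by move=> N; exact: measurable_psumM.
- exact: measurable_ML.
- exact: measurable_ML.
- by move=> s /andP[s0 _]; exact: ML_cvg.
- by move=> s /andP[s0 _]; exact: ML_cvg.
- by move=> N s /hK[].
- by move=> N s /hK'[].
move=> _ c1.
have c2 : psumM (cauchy u v) (x + y) N t @[N --> \oo] --> ML (cauchy u v) (x + y) t.
  by apply: ML_cvg => //; [exact: geo_cauchy|exact: addr_gt0].
apply: (cvg_unique _ c1); first exact: Rhausdorff.
suff c3 : conv (psumM u x N) (psumM v y N) t - psumM (cauchy u v) (x + y) N t @[N --> \oo] --> 0.
  have c4 : conv (psumM u x N) (psumM v y N) t - psumM (cauchy u v) (x + y) N t +
     psumM (cauchy u v) (x + y) N t @[N --> \oo] --> 0 + ML (cauchy u v) (x + y) t.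
    exact: cvgD.
  rewrite add0r in c4; move: c4.
  rewrite (_ : (fun N => _) = (fun N => conv (psumM u x N) (psumM v y N) t))//.
  by apply/funext => N; rewrite subrK.
have [C [M [C0 M0 hu hv]]] := geo2 gu gv.
have [B B0 hB] := @term_dom (fun k => M ^+ k) (x + y) t 8^-1 (geo_pow M) (addr_gt0 x0 y0) t0
  (ltac:(by rewrite invr_gt0)).
pose D := C * C * (B * t `^ (x + y - 1)).
have D0 : 0 <= D by rewrite !mulr_ge0 ?powR_ge0.
have bound N : `|conv (psumM u x N) (psumM v y N) t - psumM (cauchy u v) (x + y) N t|
    <= D * 2^-1 ^+ N.
  have -> : psumM (cauchy u v) (x + y) N t =
      \sum_(i < N) \sum_(j < N - i) u i * v j * term (x + y) (i + j) t.
    rewrite (@triangle (fun i j => u i * v j * term (x + y) (i + j) t)).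
    apply: eq_bigr => k _; rewrite /cauchy mulr_suml; apply: eq_bigr => i _.
    by rewrite subnKC// -ltnS.
  rewrite conv_psumM// -sumrB; apply: le_trans (ler_norm_sum _ _ _) _.
  apply: (@le_trans _ _ (\sum_(i < N) N%:R * (D * 8^-1 ^+ N))).
    apply: ler_sum => i _.
    rewrite (@sum_tail _ (fun j => u i * v j * term (x + y) (i + j) t)) ?leq_subr//.
    apply: le_trans (ler_norm_sum _ _ _) _.
    apply: (@le_trans _ _ (\sum_(N - i <= j < N) D * 8^-1 ^+ N)).
      rewrite big_nat [leRHS]big_nat; apply: ler_sum => j /andP[Nij jN].
      have Nij' : (N <= i + j)%N by rewrite -leq_subLR.
      rewrite normrM (ger0_norm (term_ge0 _ _ (addr_gt0 x0 y0))) normrM.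
      apply: (@le_trans _ _ (C * C * (`|M ^+ (i + j)| * term (x + y) (i + j) t))).
        rewrite [leRHS]mulrA; apply: ler_wpM2r; first exact: (term_ge0 _ _ (addr_gt0 x0 y0)).
        rewrite (ger0_norm (exprn_ge0 _ M0)) exprD.
        have -> : C * C * (M ^+ i * M ^+ j) = (C * M ^+ i) * (C * M ^+ j) by ring.
        exact: ler_pM.
      rewrite /D -[leRHS]mulrA ler_wpM2l ?mulr_ge0//.
      apply: le_trans (hB t (i + j)%N _) _; first by rewrite t0 lexx.
      rewrite ler_wpM2l ?mulr_ge0 ?powR_ge0//.
      by rewrite ler_wiXn2l ?invr_ge0// invf_le1// ler1n.
    rewrite big_const_nat iter_addr_0 -[X in X <= _]mulr_natl.
    apply: ler_wpM2r; first by rewrite mulr_ge0// exprn_ge0.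
    by rewrite ler_nat leq_subr.
  rewrite sumr_const card_ord -[X in X <= _]mulr_natl.
  have N2 : (N%:R : R) <= 2 ^+ N by rewrite -natrX ler_nat ltnW// ltn_expl.
  have -> : D * 2^-1 ^+ N = 2 ^+ N * (2 ^+ N * (D * 8^-1 ^+ N)).
    have -> : (2^-1 : R) = 2 * (2 * 8^-1) by field.
    by rewrite !exprMn; ring.
  have Q0 : 0 <= D * 8^-1 ^+ N by rewrite mulr_ge0// exprn_ge0.
  by apply: ler_pM => //; [rewrite mulr_ge0|rewrite ler_wpM2r].
apply/norm_cvg0P; apply: (@squeeze_cvgr _ _ _ _ (fun=> 0) (fun N => D * 2^-1 ^+ N)).
- by apply: nearW => N; rewrite normr_ge0 bound.
- exact: cvg_cst.
- rewrite -[X in _ --> X](mulr0 D); apply: cvgMl_tmp; apply: cvg_expr.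
  by rewrite ger0_norm// invf_lt1// ltr1n.
Qed.

End MittagLefflerSeries.

(** * Relaxation functions of the scalar fractional equation *)

Section Relaxation.
Context {R : realType}.
Notation lebR := (@lebesgue_measure R).
Notation mR := (measurableTypeR R).
Variable al : R.
Hypothesis al01 : 0 < al < 1.

Let al0 : 0 < al. Proof. by case/andP: al01. Qed.
Let al1 : 0 < 1 - al. Proof. by case/andP: al01 => _; rewrite subr_gt0. Qed.
Let alp1 : 0 < al + 1. Proof. exact: addr_gt0. Qed.
Let al2 : 0 < al + al. Proof. exact: addr_gt0. Qed.

Definition alt (l : R) (k : nat) : R := (- l) ^+ k.

Lemma geo_alt l : geo (alt l). Proof. exact: geo_pow. Qed.
Hint Resolve geo_alt : core.

(* In the notation E_{al,be} of Mittag-Leffler functions: [rho l t] is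
   t^(al-1) E_{al,al}(-l t^al), [ee l t] is E_{al,1}(-l t^al), [FF] and [EE] are
   the primitives of [rho] and [ee] vanishing at [0]. *)
Definition rho l := ML al (alt l) al.
Definition ee l := ML al (alt l) 1.
Definition FF l := ML al (alt l) (al + 1).
Definition EE l := ML al (alt l) 2.

Lemma cauchy_deltar u : cauchy u (fun k => (k == 0%N)%:R : R) = u.
Proof.
apply/funext => k; rewrite /cauchy big_ord_recr /= subnn mulr1 big1 ?add0r// => i _.
by rewrite subn_eq0 leqNgt ltn_ord mulr0.
Qed.

Lemma cauchy_deltal u : cauchy (fun k => (k == 0%N)%:R : R) u = u.
Proof.
apply/funext => k; rewrite /cauchy big_ord_recl /= subn0 mul1r big1 ?addr0// => i _.
by rewrite mul0r.
Qed.

(** A kernel is itself a series of this kind, with the unit of the Cauchy product as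
    coefficients. *)
Lemma conv_ML_gk u x y t : geo u -> 0 < x -> 0 < y -> 0 < t ->
  conv (ML al u x) (gk y) t = ML al u (x + y) t.
Proof.
move=> gu x0 y0 t0; have -> : gk y = ML al (fun k => (k == 0%N)%:R) y.
  by apply/funext => s; rewrite ML_delta.
by rewrite conv_ML// ?cauchy_deltar//; exact: geo_delta.
Qed.

Lemma conv_gk_ML u x y t : geo u -> 0 < x -> 0 < y -> 0 < t ->
  conv (gk y) (ML al u x) t = ML al u (y + x) t.
Proof.
move=> gu x0 y0 t0; have -> : gk y = ML al (fun k => (k == 0%N)%:R) y.
  by apply/funext => s; rewrite ML_delta.
by rewrite conv_ML// ?cauchy_deltal//; exact: geo_delta.
Qed.

Lemma rint_ML_gk u x y t : geo u -> 0 < x -> 0 < y -> 0 < t ->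
  rint lebR `]0, t[ (fun s => ML al u x s * gk y (t - s)).
Proof.
move=> gu x0 y0 t0; have -> : gk y = ML al (fun k => (k == 0%N)%:R) y.
  by apply/funext => s; rewrite ML_delta.
by apply: rint_ML => //; exact: geo_delta.
Qed.

Lemma rint_gk_ML u x y t : geo u -> 0 < x -> 0 < y -> 0 < t ->
  rint lebR `]0, t[ (fun s => gk y s * ML al u x (t - s)).
Proof.
move=> gu x0 y0 t0; have -> : gk y = ML al (fun k => (k == 0%N)%:R) y.
  by apply/funext => s; rewrite ML_delta.
by apply: rint_ML => //; exact: geo_delta.
Qed.

Lemma ML_shift_alt l x t : 0 < x -> 0 < t ->
  ML al (alt l) x t = gk x t - l * ML al (alt l) (x + al) t.
Proof.
move=> x0 t0; rewrite ML_shift// /alt expr0 mul1r; congr (_ + _).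
rewrite -mulNr -MLZ//; last exact: addr_gt0.
  by congr (ML _ _ _ _); apply/funext => k; rewrite exprS.
exact: geo_alt.
Qed.

Lemma ee_FF l t : 0 < t -> ee l t = 1 - l * FF l t.
Proof.
move=> t0; rewrite /ee (ML_shift_alt l ltr01 t0) gk1 /FF.
by rewrite (addrC al).
Qed.

Lemma rho_eq l t : 0 < t -> rho l t = gk al t - l * conv (gk al) (rho l) t.
Proof.
by move=> t0; rewrite /rho ML_shift_alt// conv_gk_ML.
Qed.

Lemma ee_volterra l t : 0 < t -> ee l t = 1 - l * conv (gk al) (ee l) t.
Proof.
by move=> t0; rewrite ee_FF// /ee conv_gk_ML.
Qed.

Lemma ee_rho l t : 0 < t -> ee l t = conv (rho l) (gk (1 - al)) t.
Proof.
move=> t0; rewrite /rho (conv_ML_gk (geo_alt l) al0 al1 t0) /ee.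
by rewrite (addrC al) subrK.
Qed.

Lemma FF_conv l t : 0 < t -> FF l t = conv (rho l) (gk 1) t.
Proof. by move=> t0; rewrite /rho conv_ML_gk. Qed.

Lemma FF_int l t : 0 < t -> FF l t = \int[lebR]_(s in (`]0%R, t[%classic : set mR)) rho l s.
Proof.
move=> t0; rewrite FF_conv//; apply: eq_Rintegral => s _.
by rewrite gk1 mulr1.
Qed.

Lemma rint_rho l t : 0 < t -> rint lebR `]0, t[ (rho l).
Proof.
move=> t0; have := @rint_ML_gk (alt l) al 1 t (geo_alt l) al0 ltr01 t0.
by apply: rint_eq => // s _; rewrite gk1 mulr1.
Qed.

Lemma EE_int l t : 0 < t -> EE l t = \int[lebR]_(s in (`]0%R, t[%classic : set mR)) ee l s.
Proof.
move=> t0; rewrite /EE (_ : 2 = 1 + 1 :> R)// -conv_ML_gk//.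
by apply: eq_Rintegral => s _; rewrite gk1 mulr1.
Qed.

(** As [rho l] has Laplace transform 1/(l + p^al), this mirrors the resolvent identity. On
    coefficients it is the factorization of a difference of powers. *)
Lemma resolvent_rho a b t : 0 < t -> rho a t - rho b t = (b - a) * conv (rho a) (rho b) t.
Proof.
move=> t0; rewrite /rho conv_ML// (ML_shift al0 (geo_alt a) al0 t0) (ML_shift al0 (geo_alt b) al0 t0).
rewrite /alt !expr0 opprD addrACA subrr add0r.
have ga := geo_shift (geo_alt a); have gb := geo_shift (geo_alt b).
rewrite -(MLB al0 ga gb al2 t0) -(MLZ al0 (b - a) (geo_cauchy (geo_alt a) (geo_alt b)) al2 t0).
congr (ML _ _ _ _); apply/funext => k; rewrite /alt.
rewrite -opprB subrXX -mulNr /cauchy; congr (_ * _); first by rewrite opprD !opprK addrC.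
by apply: eq_bigr => i _; rewrite mulrC.
Qed.

Lemma cauchy_alt l k : cauchy (alt l) (alt l) k = k.+1%:R * alt l k.
Proof.
rewrite /cauchy (eq_bigr (fun=> alt l k)); last first.
  by move=> i _; rewrite /alt -exprD subnKC// -ltnS.
by rewrite sumr_const card_ord mulr_natl.
Qed.

(** Termwise, multiplying the kernel of order (k+1) al by [t] produces the factor (k+1) al, and k +
    1 is what the Cauchy square contributes. *)
Lemma ML_mult l t : 0 < t ->
  t * rho l t = al * ML al (cauchy (alt l) (alt l)) (al + 1) t.
Proof.
move=> t0.
have gc : geo (cauchy (alt l) (alt l)) by exact: geo_cauchy.
have c1 : t * psumM al (alt l) al N t @[N --> \oo] --> t * rho l t.
  by apply: cvgMl_tmp; exact: ML_cvg.
have c2 : al * psumM al (cauchy (alt l) (alt l)) (al + 1) N t @[N --> \oo] -->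
    al * ML al (cauchy (alt l) (alt l)) (al + 1) t.
  by apply: cvgMl_tmp; exact: ML_cvg.
apply: (cvg_unique _ c1); first exact: Rhausdorff.
have E : (fun N => al * psumM al (cauchy (alt l) (alt l)) (al + 1) N t) =
    (fun N => t * psumM al (alt l) al N t); last by rewrite E in c2.
apply/funext => N; rewrite /psumM !mulr_sumr; apply: eq_bigr => k _.
rewrite cauchy_alt /term.
have h := mul_gk (index_gt0 al0 k al0) t0.
rewrite [RHS]mulrCA h -natr1 (addrA _ al 1).
by move: (gk _ _) => g; ring.
Qed.

Lemma t_rho l t : 0 < t -> t * rho l t = al * conv (rho l) (ee l) t.
Proof. by move=> t0; rewrite ML_mult// /rho /ee conv_ML. Qed.

(** Integrated form of the identity for t rho(t): one more integration raises the order of [ee] by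
    one and turns it into [EE]. *)
Lemma int_t_rho l t : 0 < t ->
  \int[lebR]_(s in (`]0%R, t[%classic : set mR)) (s * rho l s) = al * conv (rho l) (EE l) t.
Proof.
move=> t0.
have gc : geo (cauchy (alt l) (alt l)) by exact: geo_cauchy.
have mI : measurable (`]0%R, t[%classic : set mR) by [].
transitivity (\int[lebR]_(s in (`]0%R, t[%classic : set mR))
  (al * (ML al (cauchy (alt l) (alt l)) (al + 1) s * gk 1 (t - s)))).
  apply: eq_Rintegral => s; rewrite inE /= in_itv /= => /andP[s0 _].
  by rewrite ML_mult// gk1 mulr1.
rewrite (RintegralZl _ mI (rint_ML_gk gc alp1 ltr01 t0)); congr (_ * _).
transitivity (conv (ML al (cauchy (alt l) (alt l)) (al + 1)) (gk 1) t); first by [].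
have R2 : (0 : R) < 2 by [].
apply: (etrans (conv_ML_gk gc alp1 ltr01 t0)).
transitivity (ML al (cauchy (alt l) (alt l)) (al + 2) t); first by rewrite -addrA.
exact/esym/(conv_ML al0 (geo_alt l) (geo_alt l) al0 R2 t0).
Qed.

Lemma Rint_gt0 (a b c e : R) (f : mR -> R) : a <= c -> c < e -> e <= b ->
  rint lebR `]a, b[ f -> (forall s, a < s < b -> 0 <= f s) ->
  (forall s, c < s < e -> 0 < f s) ->
  0 < \int[lebR]_(s in (`]a, b[%classic : set mR)) f s.
Proof.
move=> ac ce eb jf f0 fp.
have mI : measurable (`]a, b[%classic : set mR) by [].
have f0' s : (`]a, b[%classic : set mR) s -> 0 <= f s.
  by rewrite /= in_itv /=; exact: f0.
rewrite lt0r Rintegral_ge0 ?andbT//; apply/eqP => h.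
have [N [mN N0 sub]] := Rintegral0_ae mI (rint_meas jf) f0' jf h.
have : (lebR (`]c, e[%classic : set mR) <= lebR N)%E.
  apply: le_measure; rewrite ?inE// => s /= /[!in_itv] /= /andP[cs se].
  apply: sub => /= hs.
  have := fp s; rewrite cs se hs ?ltxx ?in_itv /=; first by move=> /(_ isT).
  by rewrite (le_lt_trans ac cs) (lt_le_trans se eb).
by rewrite N0 lebesgue_measure_itv /= lte_fin ce -EFinB lee_fin leNgt subr_gt0 ce.
Qed.

Lemma powR_small (c : R) : 0 < c -> exists2 eta, 0 < eta & forall t, 0 < t < eta -> t `^ al < c.
Proof.
move=> c0; exists (c `^ al^-1); first exact: powR_gt0.
move=> t /andP[t0 tc].
have -> : c = (c `^ al^-1) `^ al by rewrite -powRrM mulVf ?gt_eqF// powRr1// ltW.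
by apply: gt0_ltr_powR; rewrite ?nnegrE ?(ltW t0) ?powR_ge0.
Qed.

(** The leading term t^(al-1) / Gamma(al) beats the remainder, which is of order t^(2 al - 1). *)
Lemma rho_near0 l : exists2 eta, 0 < eta & forall t, 0 < t < eta -> 0 < rho l t.
Proof.
have gs : geo (fun k => alt l k.+1) by exact: geo_shift.
have [K K0 hK] := psum_dom al0 gs al2 ltr01.
have G0 := Gamma_gt0 al0.
have c0 : 0 < (Gamma al * (K + 1))^-1 by rewrite invr_gt0 mulr_gt0// ltr_wpDl.
have [eta e0 he] := powR_small c0.
exists (Num.min 1 eta); first by rewrite lt_min ltr01.
move=> t /andP[t0]; rewrite lt_min => /andP[t1 te].
have t01 : 0 < t <= 1 by rewrite t0 ltW.
have [_ h] := hK t t01.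
have h2 : t `^ al < (Gamma al * (K + 1))^-1 by apply: he; rewrite t0.
rewrite /rho ML_shift// /alt expr0 mul1r /gk.
have e1 : t `^ (al + al - 1) = t `^ (al - 1) * t `^ al.
  by rewrite -powRD ?(gt_eqF t0) ?implybT//; congr (_ `^ _); ring.
have p0 : 0 < t `^ (al - 1) by exact: powR_gt0.
rewrite e1 ler_norml in h; case/andP: h => h _.
have h3 : K * (t `^ (al - 1) * t `^ al) < t `^ (al - 1) / Gamma al.
  rewrite mulrCA ltr_pM2l//.
  apply: (@le_lt_trans _ _ ((K + 1) * t `^ al)).
    by rewrite ler_wpM2r ?powR_ge0// lerDl.
  have K1 : 0 < K + 1 by rewrite ltr_wpDl.
  by rewrite -ltr_pdivlMl// (lt_le_trans h2)// invfM mulrC.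
by move: h h3; set A := K * _; set B := ML _ _ _ _; lra.
Qed.

Lemma ee_near0 l : exists2 eta, 0 < eta & forall t, 0 < t < eta -> 2^-1 < ee l t.
Proof.
have [K K0 hK] := psum_dom al0 (geo_alt l) alp1 ltr01.
have L0 : 0 < `|l| * K + 1 by rewrite ltr_wpDl// mulr_ge0.
have c0 : 0 < (2 * (`|l| * K + 1))^-1 by rewrite invr_gt0 mulr_gt0.
have [eta e0 he] := powR_small c0.
exists (Num.min 1 eta); first by rewrite lt_min ltr01.
move=> t /andP[t0]; rewrite lt_min => /andP[t1 te].
have t01 : 0 < t <= 1 by rewrite t0 ltW.
have [_ h] := hK t t01.
have h2 : t `^ al < (2 * (`|l| * K + 1))^-1 by apply: he; rewrite t0.
rewrite addrK in h; rewrite ee_FF//.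
have h3 : `|l * FF l t| < 2^-1.
  rewrite normrM; apply: (@le_lt_trans _ _ ((`|l| * K + 1) * t `^ al)).
    apply: (@le_trans _ _ (`|l| * (K * t `^ al))); first by rewrite ler_wpM2l.
    by rewrite mulrA ler_wpM2r ?powR_ge0// lerDl.
  by rewrite -ltr_pdivlMl// (lt_le_trans h2)// invfM mulrC.
by rewrite ltr_norml in h3; case/andP: h3 => h3 h4; lra.
Qed.

(* At a first zero [t1], the identity [t1 rho(t1) = al (rho * ee)(t1)] would have a
   positive right-hand side. *)
Lemma rho_gt0 l t : 0 < t -> 0 < rho l t.
Proof.
move=> t0; rewrite ltNge; apply/negP => rt.
pose Z := [set s : R | 0 < s /\ rho l s <= 0].
have Z0 : Z !=set0 by exists t.
have lbZ : has_lbound Z by exists 0 => s [/ltW].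
have iZ : has_inf Z by split.
pose t1 := inf Z.
have [eta eta0 heta] := rho_near0 l.
have t1eta : eta <= t1.
  apply: lb_le_inf => // s [s0 rs]; rewrite leNgt; apply/negP => se.
  by have := heta s; rewrite s0 se => /(_ isT); rewrite ltNge rs.
have t10 : 0 < t1 by apply: lt_le_trans t1eta.
have pos s : 0 < s < t1 -> 0 < rho l s.
  move=> /andP[s0 st]; rewrite ltNge; apply/negP => rs.
  have : t1 <= s by apply: ge_inf => //; split.
  by rewrite leNgt st.
have rt1 : rho l t1 <= 0.
  rewrite leNgt; apply/negP => r1.
  have c := ML_continuous al0 (geo_alt l) al0 t10.
  have := cvgr_gt _ c _ r1 => -[e /= e0 he].
  have [z [z0 rz] zt] := inf_adherent e0 iZ.
  have tz : t1 <= z by apply: ge_inf => //; split.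
  have : 0 < rho l z.
    apply: he => /=; rewrite /ball_ /= distrC ger0_norm ?subr_ge0//.
    by rewrite ltrBlDl.
  by rewrite ltNge rz.
(* Before [t1], [ee] is a convolution of [rho], positive there, with a nonnegative kernel. *)
have eep s : 0 < s < t1 -> 0 <= ee l s.
  move=> /andP[s0 st]; rewrite ee_rho//; apply: Rintegral_ge0 => r /=.
  rewrite in_itv /= => /andP[r0 rs]; rewrite mulr_ge0 ?gk_ge0// ltW// pos//.
  by rewrite r0 (lt_trans rs st).
have [eta' eta'0 heta'] := ee_near0 l.
have : 0 < conv (rho l) (ee l) t1.
  (* Strict positivity comes from the end of the interval, where [t1 - s] is small enough for
     [ee l (t1 - s)] to exceed 1/2. *)
  apply: (@Rint_gt0 _ _ (Num.max 0 (t1 - eta')) t1) => //.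
  - by rewrite le_max lexx.
  - by rewrite gt_max t10 gtrBl.
  - exact: rint_ML.
  - move=> s /andP[s0 st]; rewrite mulr_ge0//; first by rewrite ltW// pos// s0.
    by rewrite eep// subr_gt0 st gtrBl.
  - move=> s /andP[]; rewrite gt_max => /andP[s0 se] st.
    rewrite mulr_gt0//; first by rewrite pos// s0.
    apply: lt_trans (heta' _ _); first by rewrite invr_gt0.
    by rewrite subr_gt0 st /= ltrBlDr addrC -ltrBlDr.
have := t_rho l t10 => h1 h2.
have : 0 < t1 * rho l t1 by rewrite h1 mulr_gt0.
by rewrite pmulr_rgt0// ltNge rt1.
Qed.

Lemma ee_ge0 l t : 0 < t -> 0 <= ee l t.
Proof.
move=> t0; rewrite ee_rho//; apply: Rintegral_ge0 => r /=.
by rewrite in_itv /= => /andP[r0 rs]; rewrite mulr_ge0 ?gk_ge0// ltW// rho_gt0.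
Qed.

Lemma FF_ge0 l t : 0 < t -> 0 <= FF l t.
Proof.
move=> t0; rewrite FF_int//; apply: Rintegral_ge0 => r /=.
by rewrite in_itv /= => /andP[r0 rs]; rewrite ltW// rho_gt0.
Qed.

Lemma ee_le1 l t : 0 <= l -> 0 < t -> ee l t <= 1.
Proof. by move=> l0 t0; rewrite ee_FF// gerBl mulr_ge0// FF_ge0. Qed.

Lemma rho_le l t : 0 <= l -> 0 < t -> rho l t <= gk al t.
Proof.
move=> l0 t0; rewrite rho_eq// gerBl mulr_ge0//; apply: Rintegral_ge0 => r /=.
rewrite in_itv /= => /andP[r0 rs]; rewrite mulr_ge0 ?gk_ge0// ltW// rho_gt0//.
by rewrite subr_gt0.
Qed.

Lemma measurable_rho l : measurable_fun P (rho l).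
Proof. exact: measurable_ML. Qed.

Lemma measurable_ee l : measurable_fun P (ee l).
Proof. exact: measurable_ML. Qed.

(** The transform of rho + l (gk al * rho) = gk al is a linear equation for [lap p (rho l)],
    solvable once that value is finite; finiteness follows from [rho l <= gk al]. *)
Lemma lap_rho (p l : R) : 0 < p -> 0 <= l -> lap p (rho l) = ((l + p `^ al)^-1)%:E.
Proof.
move=> p0 l0.
have r0 s : P s -> 0 <= rho l s by move=> /PE s0; rewrite ltW// rho_gt0.
have g0 s : P s -> 0 <= gk al s by move=> _; rewrite gk_ge0.
have mr := measurable_rho l; have mg := @measurable_gk R P al.
have me := @measurable_expRN R P p.
have lg := lap_gk p0 al0.
have e1 : lap p (gk al) = (lap p (rho l) + l%:E * (lap p (gk al) * lap p (rho l)))%E.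
  rewrite -(lap_conv p mg mr g0 r0).
  have mc : measurable_fun P (fun t => conv (gk al) (rho l) t).
    apply: (eq_measurable_fun (ML al (alt l) (al + al))); last exact: measurable_ML.
    by move=> t; rewrite inE => /PE t0; rewrite conv_gk_ML.
  have c0 s : P s -> 0 <= conv (gk al) (rho l) s.
    move=> _; apply: Rintegral_ge0 => r; rewrite /= in_itv /= => /andP[r0' rs].
    by rewrite mulr_ge0 ?g0 ?r0 ?PE ?subr_gt0.
  have -> : (\int[lebR]_(t in P) ((expR (- (p * t)))%:E * econv (gk al) (rho l) t) =
      lap p (conv (gk al) (rho l)))%E.
    apply: eq_integral => t; rewrite inE => /PE t0.
    by rewrite EFinM; congr (_ * _)%E; rewrite /conv EFin_Rintegral//; exact: rint_gk_ML.
  rewrite -(lapZ p mc c0 l0) /lap -ge0_integralD//.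
  - apply: eq_integral => t; rewrite inE => /PE t0; rewrite -EFinD; congr EFin.
    by rewrite -mulrDr rho_eq// subrK.
  - exact: mP.
  - by move=> t tP; rewrite lee_fin mulr_ge0 ?expR_ge0 ?r0.
  - by apply/measurable_EFinP; exact: measurable_funM.
  - by move=> t tP; rewrite lee_fin !mulr_ge0 ?expR_ge0 ?c0.
  - by apply/measurable_EFinP; apply: measurable_funM => //; exact: measurable_funM.
have X0 : (0 <= lap p (rho l))%E.
  by apply: integral_ge0 => t tP; rewrite lee_fin mulr_ge0 ?expR_ge0 ?r0.
have Xle : (lap p (rho l) <= lap p (gk al))%E.
  apply: ge0_le_integral.
  - exact: mP.
  - by move=> t tP; rewrite lee_fin mulr_ge0 ?expR_ge0 ?r0.
  - by apply/measurable_EFinP; exact: measurable_funM.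
  - by apply/measurable_EFinP; exact: measurable_funM.
  - by move=> t /PE t0; rewrite lee_fin ler_wpM2l ?expR_ge0// rho_le.
rewrite lg in e1 Xle; move: X0 Xle e1; case: (lap p (rho l)) => [X X0 _ [e1]|//|//].
have P0 : 0 < p `^ al by exact: powR_gt0.
congr EFin; move: e1; rewrite powRN; move: (p `^ al) P0 => Q Q0 e1.
have lQ : l + Q != 0 by rewrite gt_eqF// ltr_wpDl.
apply: (mulIf lQ); rewrite mulVf//.
have : Q * Q^-1 = Q * (X + l * (Q^-1 * X)) by rewrite -e1.
rewrite mulfV ?gt_eqF// => ->.
have -> : Q * (X + l * (Q^-1 * X)) = Q * X + l * X * (Q * Q^-1) by ring.
by rewrite mulfV ?gt_eqF// mulr1; ring.
Qed.

End Relaxation.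

(** * Neumann iterates and uniqueness for the Volterra equation *)

Section RelaxationMore.
Context {R : realType}.
Notation lebR := (@lebesgue_measure R).
Notation mR := (measurableTypeR R).
Variable al : R.
Hypothesis al01 : 0 < al < 1.
Local Notation rho := (rho al).
Local Notation ee := (ee al).

Let al0 : 0 < al. Proof. by case/andP: al01. Qed.
Let al1 : 0 < 1 - al. Proof. by case/andP: al01 => _; rewrite subr_gt0. Qed.

Lemma ee_gt0 l t : 0 < t -> 0 < ee l t.
Proof.
move=> t0; rewrite (ee_rho al01)//.
apply: (@Rint_gt0 R 0 t 0 t) => //.
- exact: (rint_ML_gk al01 (geo_alt l) al0 al1 t0).
- move=> s /andP[s0 st]; apply: mulr_ge0; last exact: gk_ge0.
  exact/ltW/rho_gt0.
- move=> s /andP[s0 st]; apply: mulr_gt0; first exact: rho_gt0.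
  by apply: gk_gt0 => //; rewrite subr_gt0.
Qed.

(** Quantitative dependence on the eigenvalue, for the limit of the Yosida approximations. *)
Lemma rho_lip a b t : 0 <= a -> 0 <= b -> 0 < t ->
  `|rho a t - rho b t| <= `|b - a| * gk (al + al) t.
Proof.
move=> a0 b0 t0; rewrite (resolvent_rho al01)// normrM; apply: ler_wpM2l => //.
have p s : 0 < s < t -> 0 <= rho a s * rho b (t - s).
  move=> /andP[s0 st]; apply: mulr_ge0; apply/ltW/rho_gt0 => //.
  by rewrite subr_gt0.
rewrite ger0_norm; last first.
  by apply: Rintegral_ge0 => s; rewrite /= in_itv /=; exact: p.
rewrite -(conv_gk al0 al0 t0); apply: le_Rintegral => //.
- exact: (rint_ML al0 (geo_alt a) (geo_alt b) al0 al0 t0).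
- exact: rint_gk2.
move=> s; rewrite /= in_itv /= => /andP[s0 st]; apply: ler_pM.
- exact/ltW/rho_gt0.
- by apply/ltW/rho_gt0 => //; rewrite subr_gt0.
- exact: rho_le.
- by apply: rho_le => //; rewrite subr_gt0.
Qed.

Section Neumann.
Variables m n : R.
Hypotheses (n0 : 0 < n) (nm : n <= m).

Let m0 : 0 < m. Proof. exact: lt_le_trans nm. Qed.
Let mn0 : 0 <= m - n. Proof. by rewrite subr_ge0. Qed.

(* Iterates towards the solution [rho (m - n)] of [r = rho m + n (rho m * r)]. *)
Fixpoint neumann (K : nat) (t : mR) : R :=
  if K is K'.+1 then rho m t + n * conv (rho m) (neumann K') t else 0.

(** Keeps the iterates in the class where measurability and convergence of convolutions are
    known. *)
Lemma neumann_ML K : exists2 u, geo u &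
  forall t, 0 < t -> neumann K t = ML al u al t.
Proof.
elim: K => [|K [u gu hu]].
  have g0 : geo (fun=> 0 : R) by exists (0, 0); split => //= k; rewrite normr0 mul0r.
  exists (fun=> 0) => // t t0; apply/esym; apply: ML_unique => //.
  rewrite [X in X @ _ --> _](_ : _ = fun=> 0); first exact: cvg_cst.
  by apply/funext => N; rewrite /psumM big1// => k _; rewrite mul0r.
have gc := geo_cauchy (geo_alt m) gu.
(* Convolution with [rho m] raises the order by [al], so its coefficients enter shifted by one
   index. *)
exists (fun k => alt m k - (if k is k'.+1 then - n * cauchy (alt m) u k' else 0)).
  apply: geoB; first exact: geo_alt.
  have [[C M] [/= C0 M0 h]] := geoZ (- n) gc.
  (* [M + 1] because the shift requires M^k <= (M+1)^(k+1), which can fail for [M] itself when M <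
     1. *)
  exists (C, M + 1); split => /= [||[|k]]//; first by rewrite addr_ge0.
    by rewrite normr0 expr0 mulr1.
  apply: (le_trans (h k)); apply: ler_wpM2l => //.
  apply: (@le_trans _ _ ((M + 1) ^+ k)).
    by apply: lerXn2r; rewrite ?nnegrE ?addr_ge0// lerDl.
  rewrite exprS; apply: ler_peMl; last by rewrite lerDr.
  by apply: exprn_ge0; rewrite addr_ge0.
move=> t t0 /=.
have g1 : geo (fun k => if k is k'.+1 then - n * cauchy (alt m) u k' else 0).
  have [[C M] [/= C0 M0 h]] := geoZ (- n) gc.
  exists (C, M + 1); split => /= [||[|k]]//; first by rewrite addr_ge0.
    by rewrite normr0 expr0 mulr1.
  apply: (le_trans (h k)); apply: ler_wpM2l => //.
  apply: (@le_trans _ _ ((M + 1) ^+ k)).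
    by apply: lerXn2r; rewrite ?nnegrE ?addr_ge0// lerDl.
  rewrite exprS; apply: ler_peMl; last by rewrite lerDr.
  by apply: exprn_ge0; rewrite addr_ge0.
rewrite (MLB al0 (geo_alt m) g1 al0 t0); congr (_ + _).
rewrite (ML_shift al0 g1 al0 t0) mul0r add0r.
rewrite (MLZ al0 (- n) gc (addr_gt0 al0 al0) t0) mulNr opprK; congr (_ * _).
rewrite -(conv_ML al0 (geo_alt m) gu al0 al0 t0).
apply: eq_Rintegral => s; rewrite inE /= in_itv /= => /andP[s0 st].
by rewrite hu// subr_gt0.
Qed.

Lemma rint_neumann K t : 0 < t ->
  rint lebR `]0, t[ (fun s => rho m s * neumann K (t - s)).
Proof.
move=> t0; have [u gu hu] := neumann_ML K.
apply: (rint_eq _ _ (rint_ML al0 (geo_alt m) gu al0 al0 t0)) => //.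
move=> s; rewrite /= in_itv /= => /andP[s0 st].
by rewrite hu// subr_gt0.
Qed.

(* The defect [rho (m - n) - neumann K] solves [d_{K+1} = n (rho m * d_K)]. *)
Lemma neumann_defect K t : 0 < t ->
  0 <= rho (m - n) t - neumann K t <= n ^+ K * gk (K.+1%:R * al) t.
Proof.
elim: K t => [|K IH] t t0.
  rewrite subr0 expr0 !mul1r rho_le// andbT; exact/ltW/rho_gt0.
have mI : measurable (`]0%R, t[%classic : set mR) by [].
have r1 := rint_ML al0 (geo_alt m) (geo_alt (m - n)) al0 al0 t0.
have r2 := rint_neumann K t0.
have -> : rho (m - n) t - neumann K.+1 t =
    n * \int[lebR]_(s in (`]0%R, t[%classic : set mR))
      (rho m s * (rho (m - n) (t - s) - neumann K (t - s))).
  have e := resolvent_rho al01 m (m - n) t0.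
  have -> : \int[lebR]_(s in (`]0%R, t[%classic : set mR))
      (rho m s * (rho (m - n) (t - s) - neumann K (t - s))) =
      conv (rho m) (rho (m - n)) t - conv (rho m) (neumann K) t.
    rewrite /conv -(RintegralB mI r1 r2); apply: eq_Rintegral => s _.
    by rewrite mulrBr.
  rewrite /= mulrBr opprD addrA; congr (_ - _).
  have -> : rho (m - n) t = rho m t - (m - n - m) * conv (rho m) (rho (m - n)) t.
    by rewrite -e; ring.
  by ring.
have r3 : rint lebR `]0%R, t[ (fun s => rho m s * (rho (m - n) (t - s) - neumann K (t - s))).
  by apply: (rint_eq mI _ (rintB mI r1 r2)) => s _; rewrite mulrBr.
have K10 : 0 < K.+1%:R * al by rewrite mulr_gt0.
apply/andP; split.
  apply: mulr_ge0; first exact: ltW.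
  apply: Rintegral_ge0 => s; rewrite /= in_itv /= => /andP[s0 st].
  apply: mulr_ge0; first exact/ltW/rho_gt0.
  have ts0 : 0 < t - s by rewrite subr_gt0.
  by have /andP[] := IH _ ts0.
rewrite exprS -mulrA; apply: ler_wpM2l; first exact: ltW.
have -> : K.+2%:R * al = al + K.+1%:R * al by rewrite -(natr1 K.+1); ring.
rewrite -(conv_gk al0 K10 t0) /conv -(RintegralZl _ mI (rint_gk2 al0 K10 t0)).
apply: le_Rintegral => //.
  by apply: rintZ => //; exact: rint_gk2.
move=> s; rewrite /= in_itv /= => /andP[s0 st].
have ts0 : 0 < t - s by rewrite subr_gt0.
case/andP: (IH _ ts0) => d0 d1; rewrite mulrCA; apply: ler_pM => //.
- exact/ltW/rho_gt0.
- by apply: rho_le => //; exact: ltW.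
Qed.

(** The bound n^K gk((K+1) al) on the defect is the K-th term of a Mittag-Leffler series, so
    [term_dom] gives geometric decay. *)
Lemma neumann_cvg t : 0 < t -> neumann K t @[K --> \oo] --> rho (m - n) t.
Proof.
move=> t0.
have h0 : (0 : R) < 2^-1 by rewrite invr_gt0.
have [C C0 hC] := term_dom al0 (geo_pow n) al0 t0 h0.
apply/subr_cvg0; apply/norm_cvg0P.
apply: (@squeeze_cvgr _ _ _ _ (fun=> 0) (fun K => C * t `^ (al - 1) * 2^-1 ^+ K)).
- apply: nearW => K; rewrite normr_ge0 /= distrC.
  have /andP[d0 d1] := neumann_defect K t0.
  rewrite (ger0_norm d0); apply: (le_trans d1).
  have := hC t K; rewrite t0 lexx => /(_ isT).
  rewrite (ger0_norm (exprn_ge0 _ (ltW n0))) /term.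
  by have -> : K.+1%:R * al = K%:R * al + al by rewrite -(natr1 K); ring.
- exact: cvg_cst.
- rewrite -[X in _ --> X](mulr0 (C * t `^ (al - 1))); apply: cvgMl_tmp; apply: cvg_expr.
  by rewrite ger0_norm ?(ltW h0)// invf_lt1// ltr1n.
Qed.

Lemma neumann_ge0 K t : 0 < t -> 0 <= neumann K t.
Proof.
elim: K t => [//|K IH] t t0 /=; apply: addr_ge0; first exact/ltW/rho_gt0.
apply: mulr_ge0; first exact: ltW.
apply: Rintegral_ge0 => s; rewrite /= in_itv /= => /andP[s0 st].
by apply: mulr_ge0; [exact/ltW/rho_gt0|apply: IH; rewrite subr_gt0].
Qed.

Lemma neumann_le K t : 0 < t -> neumann K t <= gk al t.
Proof.
move=> t0; have /andP[d0 _] := neumann_defect K t0.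
by apply: (@le_trans _ _ (rho (m - n) t)); [rewrite -subr_ge0|exact: rho_le].
Qed.

End Neumann.

(** Let X be the Laplace transform at [p] of [|z|] extended by zero. The inequality yields X <= l
    p^(-al) X with X finite. The choice p^al = 2 l + 1 makes the factor smaller than 1, so X = 0. *)
Lemma volterra_unique (l T : R) (z : mR -> R) : 0 <= l -> 0 < T ->
  L2 lebR (`]0%R, T[%classic : set mR) z ->
  {ae lebR, forall t : mR, 0 < t < T ->
     ((`|z t|)%:E <= l%:E * econv (gk al) (fun s => `|z s|)%R t)%E} ->
  {ae lebR, forall t : mR, 0 < t < T -> z t = 0}.
Proof.
move=> l0 T0 Lz hz.
pose I : set mR := `]0%R, T[%classic.
have mI : measurable I by exact: measurable_itv.
have IE t : I t <-> 0 < t < T by rewrite /I /= in_itv.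
pose h : mR -> R := (fun t => `|z t|) \_ I.
have mz : measurable_fun I (fun t => `|z t|) by apply: measurableT_comp => //; exact: Lz.1.
have mh : measurable_fun setT h by apply/(measurable_restrictT (fun t => `|z t|)).
have mhP : measurable_fun P h by exact: measurable_funTS.
have h0 t : 0 <= h t by rewrite /h patchE; case: ifP.
have h0' t : P t -> 0 <= h t by [].
have hE t : I t -> h t = `|z t| by move=> It; rewrite /h patchE mem_set.
have Iinf : (lebR I < +oo)%E by rewrite lebesgue_measure_itv /= lte_fin T0 -EFinB ltry.
have rz : rint lebR I z.
  have L1 : L2 lebR I (fun=> 1).
    by apply: (L2_bounded mI Iinf (M := 1)) => // x _; rewrite normr1.
  by apply: (rint_eq mI _ (rint_mul mI Lz L1)) => t _; rewrite mulr1.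
have rhP : rint lebR P h.
  apply: rint_restrict => //; exact: rint_norm.
pose Q := (2 * l + 1).
have Q0 : 0 < Q by rewrite ltr_wpDl// mulr_ge0.
pose p := Q `^ al^-1.
have p0 : 0 < p by exact: powR_gt0.
have pal : p `^ al = Q by rewrite /p -powRrM mulVf ?gt_eqF// powRr1// ltW.
have g0 s : P s -> 0 <= gk al s by move=> _; exact: gk_ge0.
have [mc ec] := lap_conv_meas p (@measurable_gk R P al) mhP g0 h0'.
have mexp : measurable_fun P (fun t : mR => expR (- (p * t))) by exact: measurable_expRN.
have k1 : (lap p h <= l%:E * (lap p (gk al) * lap p h))%E.
  have n1 t : P t -> (0 <= (expR (- (p * t)))%:E * econv (gk al) h t)%E.
    by move=> tP; apply: mule_ge0; [rewrite lee_fin expR_ge0|apply: integral_ge0 => s _; rewrite lee_fin mulr_ge0// gk_ge0].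
  rewrite -ec -(ge0_integralZl_EFin lebR mP n1 mc l0).
  apply: ae_ge0_le_integral.
  - exact: mP.
  - by move=> t tP; rewrite lee_fin mulr_ge0 ?expR_ge0.
  - by apply/measurable_EFinP; exact: measurable_funM.
  - move=> t tP; apply: mule_ge0; first by rewrite lee_fin.
    by apply: mule_ge0; [rewrite lee_fin expR_ge0|apply: integral_ge0 => s _; rewrite lee_fin mulr_ge0// gk_ge0].
  - exact: measurable_funeM.
  - apply: filterS hz => t zt /PE t0.
    rewrite muleCA EFinM; apply: lee_pmul.
    + by rewrite lee_fin expR_ge0.
    + by rewrite lee_fin.
    + exact: lexx.
    have [It|nIt] := pselect (I t); last first.
      rewrite /h patchE memNset// ; apply: mule_ge0; first by rewrite lee_fin.
      by apply: integral_ge0 => s _; rewrite lee_fin mulr_ge0// gk_ge0.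
    have tT : 0 < t < T by exact/IE.
    have mIt : measurable (`]0%R, t[%classic : set mR) by [].
    rewrite (hE t It); apply: (le_trans (zt tT)); apply: lee_pmul; rewrite ?lee_fin//.
      by apply: integral_ge0 => s _; rewrite lee_fin mulr_ge0// gk_ge0.
    have sub s : 0 < s < t -> 0 < t - s < T.
      by move=> /andP[s0 st]; rewrite subr_gt0 st /=; case/andP: tT => _; apply: lt_trans; rewrite gtrBl.
    rewrite le_eqVlt; apply/orP; left; apply/eqP.
    apply: eq_integral => s; rewrite inE /= in_itv /= => st.
    by rewrite hE//; apply/IE; exact: sub.
have lf : lap p h = (\int[lebR]_(t in P) (expR (- (p * t)) * h t))%:E.
  rewrite EFin_Rintegral//; first exact: mP.
  apply: (rint_le mP _ _ rhP); first exact: measurable_funM.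
  move=> t /PE t0; rewrite normrM (ger0_norm (expR_ge0 _)) (ger0_norm (h0 t)).
  by apply: ler_piMl => //; rewrite expR_le1 oppr_le0 mulr_ge0// ltW.
have rl : rint lebR P (fun t => expR (- (p * t)) * h t).
  apply: (rint_le mP _ _ rhP); first exact: measurable_funM.
  move=> t /PE t0; rewrite normrM (ger0_norm (expR_ge0 _)) (ger0_norm (h0 t)).
  by apply: ler_piMl => //; rewrite expR_le1 oppr_le0 mulr_ge0// ltW.
have z0 : \int[lebR]_(t in P) (expR (- (p * t)) * h t) = 0.
  move: k1; rewrite (lap_gk p0 al0) lf -!EFinM lee_fin powRN pal.
  set X := \int[_]_(t in _) _ => k1.
  have X0 : 0 <= X by apply: Rintegral_ge0 => t _; rewrite mulr_ge0 ?expR_ge0.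
  apply/eqP; rewrite eq_le X0 andbT.
  have : Q * X <= l * X.
    rewrite -(@ler_pM2l _ Q) // in k1.
    by move: k1; rewrite mulrCA (mulrA Q) mulfV ?mul1r ?gt_eqF//.
  by rewrite /Q => k2; nra.
have := Rintegral0_ae mP (rint_meas rl) _ rl z0.
move=> /(_ (fun t _ => mulr_ge0 (expR_ge0 _) (h0 t))).
apply: filterS => t ht tT; have t0 : P t by apply/PE; case/andP: tT.
have It : I t by exact/IE.
move: (ht t0) => /eqP; rewrite mulf_eq0 (gt_eqF (expR_gt0 _)) /= hE// normr_eq0.
by move/eqP.
Qed.

(* When the convolution fails to converge the Volterra inequality is void. *)
Lemma mild_unique (l T b : R) (w : mR -> R) : 0 < l -> 0 < T ->
  L2 lebR (`]0%R, T[%classic : set mR) w ->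
  {ae lebR, forall t : mR, 0 < t < T -> w t = b - l * conv (gk al) w t} ->
  {ae lebR, forall t : mR, 0 < t < T -> w t = b * ee l t}.
Proof.
move=> l0 T0 Lw hw.
pose I : set mR := `]0%R, T[%classic.
have mI : measurable I by exact: measurable_itv.
have IE t : I t <-> 0 < t < T by rewrite /I /= in_itv.
have Iinf : (lebR I < +oo)%E by rewrite lebesgue_measure_itv /= lte_fin T0 -EFinB ltry.
have Le : L2 lebR I (fun t => b * ee l t).
  apply: L2Z => //; apply: (L2_bounded mI Iinf (M := 1)).
    apply: (measurable_funS mP _ (measurable_ee al01 l)) => t /IE/andP[t0 _]; exact/PE.
  by move=> t /IE/andP[t0 _]; rewrite ger0_norm ?ee_ge0// ee_le1// ltW.
pose z t := w t - b * ee l t.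
have Lz : L2 lebR I z by exact: L2B.
suff : {ae lebR, forall t : mR, 0 < t < T -> z t = 0}.
  by apply: filterS => t h tT; apply/eqP; rewrite -subr_eq0; apply/eqP; exact: h.
apply: (volterra_unique (ltW l0) T0 Lz).
apply: filterS hw => t wt tT; have /andP[t0 tT'] := tT.
have mIt : measurable (`]0%R, t[%classic : set mR) by [].
have sub s : 0 < s < t -> 0 < t - s < T.
  by move=> /andP[s0 st]; rewrite subr_gt0 st /=; apply: lt_trans tT'; rewrite gtrBl.
have mz : measurable_fun (`]0%R, t[%classic : set mR) (fun s => gk al s * z (t - s)).
  apply: measurable_funM; first exact: measurable_gk.
  have mzI : measurable_fun P (z \_ I).
    by apply: measurable_funTS; apply/(measurable_restrictT z) => //; exact: Lz.1.
  have mr := measurable_refl (t := t) mzI.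
  apply: eq_measurable_fun mr.
  move=> s; rewrite inE /= in_itv /= => st; rewrite patchE mem_set//.
  by apply/IE; exact: sub.
have e3 : econv (gk al) (fun s => `|z s|) t =
    (\int[lebR]_(s in (`]0%R, t[%classic : set mR)) `|(gk al s * z (t - s))%:E|)%E.
  by apply: eq_integral => s _; rewrite /= normrM (ger0_norm (gk_ge0 _ al0)).
have j0 : rint lebR (`]0%R, t[%classic : set mR) (fun s => gk al s * (b * ee l (t - s))).
  apply: (rint_eq mIt _ (rintZ mIt b (rint_gk_ML al01 (geo_alt l) ltr01 al0 t0))) => s _.
  by rewrite mulrCA.
have [jz|njz] := pselect (rint lebR (`]0%R, t[%classic : set mR) (fun s => gk al s * z (t - s))).
  have jw : rint lebR (`]0%R, t[%classic : set mR) (fun s => gk al s * w (t - s)).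
    by apply: (rint_eq mIt _ (rintD mIt jz j0)) => s _; rewrite /z; ring.
  have -> : z t = - l * conv (gk al) z t.
    rewrite /z (wt tT) (ee_volterra al01 l t0).
    have -> : conv (gk al) z t = conv (gk al) w t - b * conv (gk al) (ee l) t.
      rewrite /conv -(RintegralZl b mIt (rint_gk_ML al01 (geo_alt l) ltr01 al0 t0)).
      apply: (etrans _ (RintegralB mIt jw (rintZ mIt b (rint_gk_ML al01 (geo_alt l) ltr01 al0 t0)))).
      by apply: eq_Rintegral => s _; rewrite /z mulrBr; congr (_ - _); rewrite mulrCA.
    ring.
  rewrite normrM normrN (gtr0_norm l0) EFinM; apply: lee_pmul; rewrite ?lee_fin ?(ltW l0)//.
  rewrite e3; apply: (@le_trans _ _ (`|(conv (gk al) z t)%:E|)%E); first by [].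
  rewrite /conv (EFin_Rintegral mIt jz); apply: le_abse_integral => //.
  exact/measurable_EFinP.
rewrite e3; have -> : (\int[lebR]_(s in (`]0%R, t[%classic : set mR)) `|(gk al s * z (t - s))%:E| = +oo)%E.
  apply/eqP; rewrite -leye_eq leNgt; apply/negP => lt; apply: njz.
  by apply/integrableP; split => //; exact/measurable_EFinP.
by rewrite gt0_muley ?lte_fin// leey.
Qed.

End RelaxationMore.

(** * Positive multipliers *)

Section Multipliers.
Context d (T : measurableType d) (R : realType).
Variables (mu : {measure set T -> \bar R}) (D : set T).
Hypothesis mD : measurable D.
Variable phi : nat -> T -> R.
Hypothesis Lphi : forall n, L2 mu D (phi n).
Hypothesis orth : forall m n, inner mu D (phi m) (phi n) = (m == n)%:R.
Notation lebR := (@lebesgue_measure R).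
Notation mR := (measurableTypeR R).
Notation pm := (pm mu D phi).
Local Notation cpmZ := (pmZ mD Lphi orth).
Local Notation cpmD := (pmD mD Lphi orth).
Local Notation cpm_cst := (pm_cst mD Lphi orth).
Variables (al : R) (lam : nat -> R).
Hypothesis al01 : 0 < al < 1.
Hypothesis lam0 : forall n, 0 < lam n.
Hypothesis pm_res : forall m, 0 < m -> pm (fun n => (m + lam n)^-1).
Local Notation rho := (rho al).
Local Notation ee := (ee al).
Local Notation FF := (FF al).
Local Notation EE := (EE al).

Let al0 : 0 < al. Proof. by case/andP: al01. Qed.
Let al1 : 0 < 1 - al. Proof. by case/andP: al01 => _; rewrite subr_gt0. Qed.

Section Yosida.
Variable m : R.
Hypothesis m0 : 0 < m.
(** [m - nu n] equals m lam / (m + lam), the symbol of the Yosida approximation. The perturbation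
    [nu] of the constant [m] is a positive multiplier, so the Neumann series has only positive
    terms. *)
Let nu n := m * (m * (m + lam n)^-1).
Let ml0 n : 0 < m + lam n. Proof. exact: addr_gt0. Qed.
Let nu0 n : 0 < nu n. Proof. by rewrite !mulr_gt0// invr_gt0. Qed.
Let num n : nu n <= m.
Proof.
by rewrite /nu ler_piMr ?(ltW m0)// ler_pdivrMr// mul1r lerDl ltW.
Qed.

Lemma pm_neumann K t : 0 < t -> pm (fun n => neumann al m (nu n) K t).
Proof.
elim: K t => [|K IH] t t0; first exact: cpm_cst.
have pnu : pm nu by apply: cpmZ; [exact: ltW|apply: cpmZ; [exact: ltW|exact: pm_res]].
have mI : measurable (`]0%R, t[%classic : set mR) by [].
apply: cpmD.
  by apply: cpm_cst => //; exact/ltW/rho_gt0.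
apply: pmM => //.
apply: (pm_int mD Lphi orth mI (k := fun s => gk al s * gk al (t - s))).
- move=> n; exact: (rint_meas (rint_neumann al01 m (nu n) K t0)).
- exact: rint_gk2.
- move=> s n; rewrite /= in_itv /= => /andP[s0 st].
  have ts0 : 0 < t - s by rewrite subr_gt0.
  have n1 : 0 <= neumann al m (nu n) K (t - s) by apply: neumann_ge0.
  have n2 : 0 <= rho m s by exact/ltW/rho_gt0.
  rewrite ger0_norm; last exact: mulr_ge0.
  apply: ler_pM => //; first by apply: rho_le => //; exact: ltW.
  exact: neumann_le.
- move=> s; rewrite /= in_itv /= => /andP[s0 st].
  apply: cpmZ; first exact/ltW/rho_gt0.
  by apply: IH; rewrite subr_gt0.
Qed.

Lemma pm_yosida t : 0 < t -> pm (fun n => rho (m - nu n) t).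
Proof.
move=> t0.
apply: (pm_lim mD Lphi orth (F_ := fun K n => neumann al m (nu n) K t) (K := gk al t)).
- move=> K n; rewrite ger0_norm; last exact: neumann_ge0.
  exact: neumann_le.
- move=> n; exact: neumann_cvg.
- by move=> K; exact: pm_neumann.
Qed.

End Yosida.

(** The Yosida symbols differ from [lam n] by lam^2 / (k + 1 + lam), so [rho_lip] gives convergence
    for each [n]; [gk al t] is the bound uniform in [n] that [pm_lim] asks for. *)
Lemma pm_rho t : 0 < t -> pm (fun n => rho (lam n) t).
Proof.
move=> t0.
pose nu (k n : nat) : R := k.+1%:R * (k.+1%:R * (k.+1%:R + lam n)^-1).
have kl n k : 0 < k.+1%:R + lam n by rewrite addr_gt0.
have nuE k n : k.+1%:R - nu k n = k.+1%:R * lam n / (k.+1%:R + lam n).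
  by rewrite /nu; have := kl n k; move: (lam n) (k.+1%:R) => a b ab; field; rewrite gt_eqF.
have nu_ge0 k n : 0 <= k.+1%:R - nu k n.
  by rewrite nuE mulr_ge0 ?invr_ge0 ?(ltW (kl _ _))// mulr_ge0// ltW.
apply: (pm_lim mD Lphi orth (F_ := fun k n => rho (k.+1%:R - nu k n) t) (K := gk al t)).
- move=> k n; rewrite ger0_norm; last exact/ltW/rho_gt0.
  exact: rho_le.
- move=> n; apply/subr_cvg0; apply/norm_cvg0P.
  apply: (@squeeze_cvgr _ _ _ _ (fun=> 0)
    (fun k => (lam n ^+ 2 * gk (al + al) t) * (k.+1%:R)^-1)).
  + apply: nearW => k; rewrite normr_ge0 /=.
    apply: (le_trans (rho_lip al01 (nu_ge0 k n) (ltW (lam0 n)) t0)).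
    rewrite [leRHS]mulrAC; apply: ler_wpM2r; first by rewrite gk_ge0// addr_gt0.
    have -> : lam n - (k.+1%:R - nu k n) = lam n ^+ 2 / (k.+1%:R + lam n).
      by rewrite nuE; have := kl n k; move: (lam n) (k.+1%:R) => a b ab; field; rewrite gt_eqF.
    rewrite ger0_norm; last by rewrite mulr_ge0 ?sqr_ge0// invr_ge0 ltW.
    apply: ler_wpM2l; first exact: sqr_ge0.
    by rewrite lef_pV2 ?posrE ?kl// lerDl ltW.
  + exact: cvg_cst.
  + rewrite -[X in _ --> X](mulr0 (lam n ^+ 2 * gk (al + al) t)).
    by apply: cvgMl_tmp; exact: cvg_harmonic.
- by move=> k; exact: pm_yosida.
Qed.

Lemma pm_ee t : 0 < t -> pm (fun n => ee (lam n) t).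
Proof.
move=> t0; have mI : measurable (`]0%R, t[%classic : set mR) by [].
apply: (pm_eq (F := fun n => conv (rho (lam n)) (gk (1 - al)) t)).
  by move=> n; rewrite (ee_rho al01).
apply: (pm_int mD Lphi orth mI (k := fun s => gk al s * gk (1 - al) (t - s))).
- move=> n; exact: (rint_meas (rint_ML_gk al01 (geo_alt _) al0 al1 t0)).
- exact: rint_gk2.
- move=> s n; rewrite /= in_itv /= => /andP[s0 st].
  have r0 : 0 <= rho (lam n) s by exact/ltW/rho_gt0.
  rewrite normrM (ger0_norm r0) (ger0_norm (gk_ge0 _ al1)).
  apply: ler_wpM2r; first exact: gk_ge0.
  by apply: rho_le => //; exact: ltW.
- move=> s; rewrite /= in_itv /= => /andP[s0 st].
  apply: (pm_eq (F := fun n => gk (1 - al) (t - s) * rho (lam n) s)).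
    by move=> n; rewrite mulrC.
  by apply: cpmZ; [exact: gk_ge0|exact: pm_rho].
Qed.

Lemma rint_gk x (t : R) : 0 < x -> 0 < t -> rint lebR `]0, t[ (gk x).
Proof.
move=> x0 t0; apply: (rint_eq _ _ (rint_gk2 x0 ltr01 t0)) => // s _.
by rewrite gk1 mulr1.
Qed.

(* Multiplying [rho] by a weight between the constants [0] and [1] gives a
   positive multiplier. *)
Lemma pm_rho_weight (t : R) (w : mR -> R) (M : R) : 0 < t ->
  measurable_fun (`]0%R, t[%classic : set mR) w -> (forall s, 0 < s < t -> 0 <= w s <= M) ->
  pm (fun n => \int[lebR]_(s in (`]0%R, t[%classic : set mR)) (w s * rho (lam n) s)).
Proof.
move=> t0 mw w0; have mI : measurable (`]0%R, t[%classic : set mR) by [].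
apply: (pm_int mD Lphi orth mI (k := fun s => M * gk al s)).
- move=> n; apply: measurable_funM => //.
  by apply: (rint_meas (rint_rho al01 (lam n) t0)).
- by apply: rintZ => //; exact: rint_gk.
- move=> s n; rewrite /= in_itv /= => st; have /andP[s0 _] := st.
  have /andP[w1 w2] := w0 s st.
  have r0 : 0 <= rho (lam n) s by exact/ltW/rho_gt0.
  rewrite ger0_norm; last exact: mulr_ge0.
  by apply: ler_pM => //; apply: rho_le => //; exact: ltW.
- move=> s; rewrite /= in_itv /= => st; have /andP[s0 _] := st.
  have /andP[w1 w2] := w0 s st.
  by apply: cpmZ => //; exact: pm_rho.
Qed.

Lemma rint_rho_weight (l t : R) (w : mR -> R) (M : R) : 0 < t ->
  measurable_fun (`]0%R, t[%classic : set mR) w -> (forall s, 0 < s < t -> 0 <= w s <= M) ->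
  rint lebR `]0, t[ (fun s => w s * rho l s).
Proof.
move=> t0 mw w0; have mI : measurable (`]0%R, t[%classic : set mR) by [].
have ir := rint_rho al01 l t0.
apply: (rint_le mI _ _ (rintZ mI M ir)).
  by apply: measurable_funM => //; exact: rint_meas ir.
move=> s; rewrite /= in_itv /= => st; have /andP[s0 _] := st.
have /andP[w1 w2] := w0 s st.
have r0 : 0 <= rho l s by exact/ltW/rho_gt0.
rewrite ger0_norm; last exact: mulr_ge0.
exact: ler_wpM2r.
Qed.

Lemma pm_FF t : 0 < t -> pm (fun n => FF (lam n) t).
Proof.
move=> t0; have mI : measurable (`]0%R, t[%classic : set mR) by [].
apply: (pm_eq _ (@pm_rho_weight t (fun=> 1) 1 t0 _ _)) => //.
  by move=> n /=; rewrite FF_int//; apply: eq_Rintegral => s _; rewrite mul1r.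
by move=> s _; rewrite ler01 lexx.
Qed.

(** Puts primitives at different times over one interval, so that their difference becomes a weight
    on [rho]. *)
Lemma FF_indic l (a b : R) : 0 < a -> a <= b ->
  FF l a = \int[lebR]_(s in (`]0%R, b[%classic : set mR)) (((s < a)%R)%:R * rho l s).
Proof.
move=> a0 ab; rewrite (FF_int al01)// /Rintegral integral_mkcond [in RHS]integral_mkcond; congr fine.
apply: eq_integral => s _; rewrite !patchE.
have [sa|sa] := boolP (s \in (`]0%R, a[%classic : set mR)).
  move: sa; rewrite inE /= in_itv /= => /andP[s0 sa].
  rewrite mem_set; first by rewrite sa mul1r.
  by rewrite /= in_itv /= s0 (lt_le_trans sa).
case: ifPn => // sb; move: sa sb; rewrite notin_setE inE /= !in_itv /= => sa /andP[s0 _].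
by have -> : (s < a) = false; [apply/negP => h; apply: sa; rewrite s0|rewrite mul0r].
Qed.

Lemma measurable_lt_indic (E : set mR) (a : R) : measurable E ->
  measurable_fun E (fun s : mR => ((s < a)%R)%:R : R).
Proof.
move=> mE; apply: measurableT_comp => //.
by apply: measurable_fun_ltr.
Qed.

Lemma pm_FF_mono a b : 0 < a -> a <= b -> pm (fun n => FF (lam n) b - FF (lam n) a).
Proof.
move=> a0 ab; have b0 := lt_le_trans a0 ab.
have mI : measurable (`]0%R, b[%classic : set mR) by [].
have mw := measurable_lt_indic a mI.
apply: (pm_eq _ (@pm_rho_weight b (fun s => 1 - ((s < a)%R)%:R) 1 b0 _ _)) => //.
- move=> n /=; rewrite (FF_int al01 _ b0) (FF_indic _ a0 ab) -RintegralB//.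
  + by apply: eq_Rintegral => s _; rewrite mulrBl mul1r.
  + exact: rint_rho.
  + by apply: (@rint_rho_weight _ _ _ 1) => // s _; case: (s < a) => /=; lra.
- exact: measurable_funB.
- by move=> s _; case: (s < a) => /=; lra.
Qed.

Lemma pm_EE_mono a b : 0 < a -> a <= b -> pm (fun n => EE (lam n) b - EE (lam n) a).
Proof.
move=> a0; rewrite le_eqVlt => /predU1P[<-|ab].
  by apply: (pm_eq (F := fun=> 0)); [move=> n; rewrite subrr|exact: cpm_cst].
have b0 := lt_trans a0 ab.
have mI : measurable (`]0%R, b[%classic : set mR) by [].
have mJ : measurable (`[a, b[%classic : set mR) by [].
have je l : rint lebR (`]0%R, b[%classic : set mR) (ee l).
  apply: (rint_eq mI _ (@rint_ML_gk R al al01 (alt l) 1 1 b (geo_alt l) ltr01 ltr01 b0)) => s _.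
  by rewrite gk1 mulr1.
have ji : rint lebR (`]0%R, b[%classic : set mR) (fun=> 1).
  by apply: (rint_eq mI _ (rint_gk ltr01 b0)) => s _; rewrite gk1.
have sub : (`[a, b[%classic : set mR) `<=` `]0%R, b[%classic.
  by move=> s; rewrite /= !in_itv /= => /andP[sa ->]; rewrite (lt_le_trans a0 sa).
apply: (pm_eq (F := fun n => \int[lebR]_(s in (`[a, b[%classic : set mR)) ee (lam n) s)).
  move=> n; rewrite (EE_int al01 _ a0) (EE_int al01 _ b0).
  have U : (`]0%R, b[%classic : set mR) = `]0%R, a[%classic `|` `[a, b[%classic.
    by rewrite -itv_bndbnd_setU// bnd_simp ?ltW.
  have mA : measurable (`]0%R, a[%classic : set mR) by [].
  have jU := je (lam n); rewrite U in jU.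
  have dis : [disjoint (`]0%R, a[%classic : set mR) & `[a, b[%classic].
    apply/disj_setPS => s [] /=; rewrite !in_itv /= => /andP[_ sa] /andP[as' _].
    by move: sa; rewrite ltNge as'.
  by rewrite U (Rintegral_setU mA mJ jU dis) [RHS]addrC addKr.
apply: (pm_int mD Lphi orth mJ (k := fun=> 1)).
- move=> n; apply: (measurable_funS mI sub); exact: rint_meas (je _).
- by apply: (integrableS mI mJ sub).
- move=> s n; rewrite /= in_itv /= => /andP[sa sb]; have s0 := lt_le_trans a0 sa.
  by rewrite ger0_norm ?ee_ge0// ee_le1// ltW.
- by move=> s; rewrite /= in_itv /= => /andP[sa sb]; apply: pm_ee; exact: lt_le_trans sa.
Qed.

(* Both steps of [ee(t) >= gk(1-al)(t) FF(t) >= gk(1-al)(t)/t int_0^t s rho(s) ds]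
   only weaken a positive weight on [rho]. *)
Lemma pm_ee_lower t1 tau : 0 < t1 -> 0 < tau ->
  pm (fun n => ee (lam n) (t1 + tau) -
     al * gk (1 - al) (t1 + tau) / (t1 + tau) * (FF (lam n) tau * EE (lam n) t1)).
Proof.
move=> t10 tau0; set t := t1 + tau.
have t0 : 0 < t by exact: addr_gt0.
have mI : measurable (`]0%R, t[%classic : set mR) by [].
have mJ : measurable (`]0%R, tau[%classic : set mR) by [].
set g := gk (1 - al) t.
have g0 : 0 < g by exact: gk_gt0.
have R2 : (0 : R) < 2 by [].
(* The weight is [gk (1 - al) (t - s) - g], nonnegative because the kernel is decreasing. *)
have p1 : pm (fun n => ee (lam n) t - g * FF (lam n) t).
  apply: (pm_eq (F := fun n => \int[lebR]_(s in (`]0%R, t[%classic : set mR))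
     ((gk (1 - al) (t - s) - g) * rho (lam n) s))).
    move=> n; rewrite (ee_rho al01 _ t0) (FF_int al01 _ t0).
    rewrite -(RintegralZl _ mI (rint_rho al01 _ t0)) /conv -RintegralB//.
    + by apply: eq_Rintegral => s _; ring.
    + exact: (rint_ML_gk al01 (geo_alt _) al0 al1 t0).
    + by apply: rintZ => //; exact: rint_rho.
  apply: (pm_int mD Lphi orth mI (k := fun s => gk al s * gk (1 - al) (t - s) + g * gk al s)).
  - move=> n; apply: measurable_funM; last exact: rint_meas (rint_rho al01 _ t0).
    apply: measurable_funB => //; apply: (measurable_refl (t := t)).
    exact: measurable_gk.
  - by apply: rintD => //; [exact: rint_gk2|apply: rintZ => //; exact: rint_gk].
  - move=> s n; rewrite /= in_itv /= => /andP[s0 st].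
    have r0 : 0 <= rho (lam n) s by exact/ltW/rho_gt0.
    have r1 : rho (lam n) s <= gk al s by apply: rho_le => //; exact: ltW.
    have k0 := gk_ge0 (t - s) al1.
    rewrite normrM (ger0_norm r0).
    apply: (@le_trans _ _ ((gk (1 - al) (t - s) + g) * gk al s)).
      apply: ler_pM; [exact: normr_ge0|exact: r0| |exact: r1].
      apply: le_trans (ler_normB _ _) _.
      by rewrite (ger0_norm k0) (ger0_norm (ltW g0)).
    have -> : (gk (1 - al) (t - s) + g) * gk al s = gk al s * gk (1 - al) (t - s) + g * gk al s.
      by move: (gk al s) (gk _ _) => X Y; ring.
    exact: lexx.
  - move=> s; rewrite /= in_itv /= => /andP[s0 st].
    apply: cpmZ; last exact: pm_rho.
    rewrite subr_ge0 /g /gk; apply: ler_wpM2r; first by rewrite invr_ge0 ltW// Gamma_gt0.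
    have -> : 1 - al - 1 = - al by ring.
    have ts0 : 0 < t - s by rewrite subr_gt0.
    rewrite !powRN lef_pV2 ?posrE ?powR_gt0//.
    apply: ge0_ler_powR; rewrite ?nnegrE ?(ltW al0) ?(ltW ts0) ?(ltW t0)//.
    by rewrite gerBl ltW.
(* The weight is 1 - s/t, and [int_t_rho] turns the integral of s rho(s) into a convolution. *)
have p2 : pm (fun n => g * FF (lam n) t - g / t * (al * conv (rho (lam n)) (EE (lam n)) t)).
  apply: (pm_eq (F := fun n => g * \int[lebR]_(s in (`]0%R, t[%classic : set mR))
     ((1 - s / t) * rho (lam n) s))).
    move=> n; rewrite -(int_t_rho al01 _ t0) (FF_int al01 _ t0) -mulrA -mulrBr; congr (g * _).
    have js : rint lebR (`]0%R, t[%classic : set mR) (fun s => s * rho (lam n) s).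
      apply: (@rint_rho_weight _ _ _ t) => // s /andP[s0 st]; by rewrite !ltW.
    rewrite -(RintegralZl _ mI js) -RintegralB//.
    + by apply: eq_Rintegral => s _; ring.
    + exact: rint_rho.
    + exact: rintZ.
  apply: cpmZ; first exact: ltW.
  apply: (@pm_rho_weight _ _ 1) => //.
    apply: measurable_funB => //; exact: measurable_funM.
  move=> s /andP[s0 st]; rewrite subr_ge0 ler_pdivrMr// mul1r (ltW st) /=.
  by rewrite gerBl divr_ge0// ltW.
(* For s < tau the time t - s exceeds t1, so EE(t - s) dominates EE(t1). The part s >= tau is a
   positive multiplier and is discarded. *)
have p3 : pm (fun n => conv (rho (lam n)) (EE (lam n)) t - FF (lam n) tau * EE (lam n) t1).
  have sub : (`]0%R, tau[%classic : set mR) `<=` `]0%R, t[%classic.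
    move=> s; rewrite /= !in_itv /= => /andP[-> st] /=; apply: (lt_trans st).
    by rewrite /t ltrDr.
  have rE l : rint lebR (`]0%R, t[%classic : set mR) (fun s => rho l s * EE l (t - s)).
    exact: (rint_ML al0 (geo_alt l) (geo_alt l) al0 R2 t0).
  have e1 l s : 0 < s -> 0 <= l -> 0 <= EE l s <= s.
    move=> s0 l0; rewrite (EE_int al01 _ s0).
    have mS : measurable (`]0%R, s[%classic : set mR) by [].
    apply/andP; split.
      apply: Rintegral_ge0 => r; rewrite /= in_itv /= => /andP[r0 _]; exact: ee_ge0.
    apply: (@le_trans _ _ (\int[lebR]_(r in (`]0%R, s[%classic : set mR)) 1)).
      apply: le_Rintegral => //.
      - apply: (rint_eq mS _ (@rint_ML_gk R al al01 (alt l) 1 1 s (geo_alt l) ltr01 ltr01 s0)) => r _.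
        by rewrite gk1 mulr1.
      - by apply: (rint_eq mS _ (rint_gk ltr01 s0)) => r _; rewrite gk1.
      - by move=> r; rewrite /= in_itv /= => /andP[r0 _]; exact: ee_le1.
    have ms : lebR (`]0%R, s[%classic : set mR) = s%:E.
      by rewrite lebesgue_measure_itv /= lte_fin s0 -EFinD subr0.
    by rewrite (Rintegral_cst lebR mS 1) mul1r -[leRHS]/(fine s%:E) -ms.
  apply: (pm_eq (F := fun n => \int[lebR]_(s in (`]0%R, t[%classic : set mR))
     (rho (lam n) s * (EE (lam n) (t - s) - ((s < tau)%R)%:R * EE (lam n) t1)))).
    move=> n; rewrite (@FF_indic _ tau t)//; last by rewrite /t lerDr ltW.
    have jw : rint lebR (`]0%R, t[%classic : set mR) (fun s => ((s < tau)%R)%:R * rho (lam n) s).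
      apply: (@rint_rho_weight _ _ _ 1) => //; first exact: measurable_lt_indic.
      by move=> s _; case: (s < tau) => /=; lra.
    have jz := rintZ mI (EE (lam n) t1) jw.
    have e2 := RintegralZl (EE (lam n) t1) mI jw.
    have e3 := RintegralB mI (rE (lam n)) jz.
    apply/esym; rewrite (mulrC _ (EE _ _)); apply: (etrans (congr1 (fun x => _ - x) (esym e2))).
    apply: (etrans (esym e3)).
    by apply: eq_Rintegral => s _; ring.
  apply: (pm_int mD Lphi orth mI (k := fun s => (t + t1) * gk al s)).
  - move=> n.
    have h1 := rint_meas (rE (lam n)).
    have h2 : measurable_fun (`]0%R, t[%classic : set mR) (fun s => ((s < tau)%R)%:R * EE (lam n) t1 * rho (lam n) s).
      apply: measurable_funM; last exact: rint_meas (rint_rho al01 _ t0).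
      by apply: measurable_funM => //; exact: measurable_lt_indic.
    apply: eq_measurable_fun (measurable_funB h1 h2) => s _ /=; ring.
  - by apply: rintZ => //; exact: rint_gk.
  - move=> s n; rewrite /= in_itv /= => /andP[s0 st].
    have r0 : 0 <= rho (lam n) s by exact/ltW/rho_gt0.
    have r1 : rho (lam n) s <= gk al s by apply: rho_le => //; exact: ltW.
    have ts0 : 0 < t - s by rewrite subr_gt0.
    have /andP[a1 a2] := e1 (lam n) _ ts0 (ltW (lam0 n)).
    have /andP[b1 b2] := e1 (lam n) _ t10 (ltW (lam0 n)).
    have b3 : 0 <= ((s < tau)%R)%:R * EE (lam n) t1 <= t1.
      by case: (s < tau); rewrite /= ?mul1r ?mul0r ?b1 ?b2// lexx ltW.
    case/andP: b3 => b3 b4.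
    rewrite normrM (ger0_norm r0) [leLHS]mulrC; apply: ler_pM; [exact: normr_ge0|exact: r0| |exact: r1].
    apply: (le_trans (ler_normB _ _)); rewrite (ger0_norm a1) (ger0_norm b3); apply: lerD; last exact: b4.
    by apply: (le_trans a2); rewrite gerBl (ltW s0).
  - move=> s; rewrite /= in_itv /= => /andP[s0 st].
    have ts0 : 0 < t - s by rewrite subr_gt0.
    apply: pmM; first exact: pm_rho.
    have [stau|stau] := ltP s tau; rewrite /=.
      apply: (pm_eq (F := fun n => EE (lam n) (t - s) - EE (lam n) t1)).
        by move=> n; rewrite mul1r.
      apply: pm_EE_mono => //; by rewrite /t -addrA lerDl subr_ge0 ltW.
    apply: (pm_eq (F := fun n => \int[lebR]_(r in (`]0%R, (t - s)[%classic : set mR)) ee (lam n) r)).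
      by move=> n; rewrite mul0r subr0 (EE_int al01).
    have mS : measurable (`]0%R, (t - s)[%classic : set mR) by [].
    apply: (pm_int mD Lphi orth mS (k := fun=> 1)).
    + move=> n; apply: (measurable_funS mP _ (measurable_ee al01 (lam n))) => r.
      by rewrite /= in_itv /= => /andP[r0 _]; apply/PE.
    + by apply: (rint_eq mS _ (rint_gk ltr01 ts0)) => r _; rewrite gk1.
    + move=> r n; rewrite /= in_itv /= => /andP[r0 _].
      by rewrite ger0_norm ?ee_ge0// ee_le1// ltW.
    + by move=> r; rewrite /= in_itv /= => /andP[r0 _]; exact: pm_ee.
have c0 : 0 <= al * g / t by apply/ltW/divr_gt0 => //; exact: mulr_gt0.
apply: (pm_eq _ (cpmD (cpmD p1 p2) (cpmZ c0 p3))) => n /=.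
by move: (conv _ _ _) (ee _ _) (FF _ t) => X Y Z; move: t0 => /lt0r_neq0 t0; field.
Qed.

(* Splitting the Laplace integral of [rho] at [tau]. *)
Lemma pm_FF_lower tau p : 0 < tau -> 0 < p ->
  pm (fun n => FF (lam n) tau + expR (- (p * tau / 2)) / (lam n + (p / 2) `^ al) -
     (lam n + p `^ al)^-1).
Proof.
move=> tau0 p0; have p20 : 0 < p / 2 by rewrite divr_gt0.
have rg (q : R) : 0 < q -> rint lebR P (fun s : mR => expR (- (q * s)) * gk al s).
  move=> q0; apply/integrableP; split.
    apply/measurable_EFinP; apply: measurable_funM; last exact: measurable_gk.
    exact: measurable_expRN.
  rewrite (eq_integral (fun s : mR => (expR (- (q * s)) * gk al s)%:E)).
    by rewrite -/(lap q (gk al)) lap_gk// ltry.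
  by move=> s _; rewrite /= ger0_norm// mulr_ge0 ?expR_ge0 ?gk_ge0.
have rr (q l : R) : 0 < q -> 0 <= l -> rint lebR P (fun s : mR => expR (- (q * s)) * rho l s).
  move=> q0 l0; apply: (rint_le mP _ _ (rg q q0)).
    by apply: measurable_funM; [exact: measurable_expRN|exact: measurable_rho].
  move=> s /PE s0; have r0 : 0 <= rho l s by exact/ltW/rho_gt0.
  rewrite ger0_norm; last by rewrite mulr_ge0 ?expR_ge0.
  by apply: ler_wpM2l; [exact: expR_ge0|exact: rho_le].
have rl (q l : R) : 0 < q -> 0 <= l ->
    (l + q `^ al)^-1 = \int[lebR]_(s in P) (expR (- (q * s)) * rho l s).
  move=> q0 l0; apply: EFin_inj; rewrite -(lap_rho al01 q0 l0) EFin_Rintegral//.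
    exact: mP.
  exact: rr.
have mw : measurable_fun P (fun s : mR => ((s < tau)%R)%:R : R).
  by apply: measurable_lt_indic; exact: mP.
have rw0 : rint lebR P (fun s => ((s < tau)%R)%:R * gk al s).
  apply: (rint_eq mP _ (rint_restrict _ (rint_gk al0 tau0))) => // s /PE s0.
  rewrite patchE; case: ifPn.
    by rewrite inE /= in_itv /= => /andP[_ ->]; rewrite mul1r.
  rewrite notin_setE /= in_itv /= s0 /= => /negP/negPf ->; by rewrite mul0r.
have rw l : 0 <= l -> rint lebR P (fun s => ((s < tau)%R)%:R * rho l s).
  move=> l0; apply: (rint_le mP _ _ rw0).
    by apply: measurable_funM => //; exact: measurable_rho.
  move=> s /PE s0; have r0 : 0 <= rho l s by exact/ltW/rho_gt0.
  rewrite ger0_norm; last by rewrite mulr_ge0.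
  by apply: ler_wpM2l => //; exact: rho_le.
have Fe l : 0 <= l -> FF l tau = \int[lebR]_(s in P) (((s < tau)%R)%:R * rho l s).
  move=> l0; rewrite (FF_int al01 _ tau0) /Rintegral integral_mkcond [in RHS]integral_mkcond; congr fine.
  apply: eq_integral => s _; rewrite !patchE.
  have [sa|sa] := boolP (s \in (`]0%R, tau[%classic : set mR)).
    move: sa; rewrite inE /= in_itv /= => /andP[s0 sa].
    rewrite mem_set; first by rewrite sa mul1r.
    exact/PE.
  case: ifPn => // sb; move: sa sb; rewrite notin_setE inE /= !in_itv /= => sa /PE s0.
  by have -> : (s < tau) = false; [apply/negP => h; apply: sa; rewrite s0|rewrite mul0r].
set c := expR (- (p * tau / 2)).
(* Nonnegative: before [tau], exp(-p s) <= 1; from [tau] on, exp(-p s) <= exp(-p tau/2) exp(-p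
   s/2). *)
pose w (s : mR) : R := ((s < tau)%R)%:R + c * expR (- (p / 2 * s)) - expR (- (p * s)).
have w0 s : P s -> 0 <= w s <= ((s < tau)%R)%:R + expR (- (p / 2 * s)).
  move=> /PE s0; have c1 : c <= 1.
    by rewrite /c expR_le1 oppr_le0 !mulr_ge0 ?invr_ge0 ?ltW.
  apply/andP; split; last first.
    rewrite /w; have := expR_ge0 (- (p * s)); have := expR_ge0 (- (p / 2 * s)).
    move: (expR _) (expR _) => A B A0 B0; rewrite -addrA lerD2l.
    by apply: (@le_trans _ _ (c * B)); [rewrite gerBl|exact: ler_piMl].
  rewrite /w; have [st|st] := ltP s tau.
    have e1 : expR (- (p * s)) <= 1 by rewrite expR_le1 oppr_le0 mulr_ge0// ltW.
    have e2 : 0 <= c * expR (- (p / 2 * s)) by rewrite mulr_ge0 ?expR_ge0.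
    by rewrite /=; move: e1 e2; move: (expR _) (c * _) => A B; lra.
  rewrite add0r subr_ge0 /c -expRD ler_expR.
  have : p * tau <= p * s by rewrite ler_pM2l.
  by move=> h; lra.
apply: (pm_eq (F := fun n => \int[lebR]_(s in P) (w s * rho (lam n) s))).
  move=> n; have l0 := ltW (lam0 n).
  rewrite (Fe _ l0) (rl p _ p0 l0) -[X in c * X]/((lam n + (p / 2) `^ al)^-1) (rl (p / 2) _ p20 l0).
  have A1 := rw _ l0; have A2 := rr p _ p0 l0; have A3 := rintZ mP c (rr (p / 2) _ p20 l0).
  rewrite -(RintegralZl _ mP (rr (p / 2) _ p20 l0)) -(RintegralD mP A1 A3).
  rewrite -(RintegralB mP (rintD mP A1 A3) A2).
  by apply: eq_Rintegral => s _; rewrite /w; ring.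
have mws : measurable_fun P w.
  apply: measurable_funB; last exact: measurable_expRN.
  by apply: measurable_funD => //; apply: measurable_funM => //; exact: measurable_expRN.
apply: (pm_int mD Lphi orth mP (k := fun s => ((s < tau)%R)%:R * gk al s + expR (- (p / 2 * s)) * gk al s)).
- by move=> n; apply: measurable_funM => //; exact: measurable_rho.
- by apply: (rintD mP) => //; exact: rg.
- move=> s n sP; have /andP[w1 w2] := w0 s sP; have s0 : 0 < s by exact/PE.
  have r0 : 0 <= rho (lam n) s by exact/ltW/rho_gt0.
  rewrite ger0_norm; last exact: mulr_ge0.
  by rewrite -mulrDl; apply: ler_pM => //; apply: rho_le => //; exact: ltW.
- move=> s sP; have /andP[w1 w2] := w0 s sP; have s0 : 0 < s by exact/PE.
  by apply: cpmZ => //; exact: pm_rho.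
Qed.

End Multipliers.

(** * Integration in R^d *)

Section LebesgueTupleFacts.
Context {R : realType}.
Notation lebR := (@lebesgue_measure R).
Notation mR := (measurableTypeR R).
Notation tupR n := (n.-tuple mR).

Definition tbox n (a b : 'I_n -> R) : set (tupR n) :=
  [set t | forall i, a i < tnth t i < b i].

Lemma tbox_cons n (a b : 'I_n.+1 -> R) :
  @cons_pair R n @^-1` tbox a b =
  `]a ord0, b ord0[ `*` tbox (a \o lift ord0) (b \o lift ord0).
Proof.
apply/seteqP; split => -[x t] /=.
  move=> h; split; first by have := h ord0; rewrite tnth0 in_itv.
  by move=> i; have := h (lift ord0 i); rewrite tnthS.
move=> [h1 h2] i; have [j ->|->] := unliftP ord0 i.
  by rewrite tnthS; exact: h2.
by rewrite tnth0; move: h1; rewrite in_itv.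
Qed.

Lemma measurable_tbox n (a b : 'I_n -> R) : measurable (tbox a b).
Proof.
have -> : tbox a b = \bigcap_(i in [set: 'I_n])
    [set t : tupR n | (`]a i, b i[%classic : set mR) (tnth t i)].
  apply/seteqP; split => t h i; first by move=> _; rewrite /= in_itv; exact: h.
  by have := h i I; rewrite /= in_itv.
apply: fin_bigcap_measurable => // i _.
rewrite -[X in measurable X]setTI.
exact: (@measurable_tnth _ mR n i).
Qed.

Lemma leb_tuple_box n (a b : 'I_n -> R) : (forall i, a i < b i) ->
  leb_tuple n (tbox a b) = (\prod_i (b i - a i))%:E.
Proof.
elim: n a b => [|n IH] a b ab.
  rewrite big_ord0 /= (_ : tbox a b = setT) ?diracT//.
  by apply/seteqP; split => // t _ [].
transitivity ((lebR \x leb_tuple n)%E (@cons_pair R n @^-1` tbox a b)) => //.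
rewrite tbox_cons product_measure1E//; last exact: measurable_tbox.
have i1 : lebR (`]a ord0, b ord0[%classic : set mR) = (b ord0 - a ord0)%:E.
  by rewrite lebesgue_measure_itv /= lte_fin ab -EFinB.
have i2 : leb_tuple n (tbox (a \o lift ord0) (b \o lift ord0)) =
    (\prod_i (b (lift ord0 i) - a (lift ord0 i)))%:E by apply: IH => i; exact: ab.
rewrite big_ord_recl EFinM -i1 -i2; reflexivity.
Qed.

Definition tadd n (v : 'I_n -> R) (t : tupR n) : tupR n :=
  [tuple (tnth t i + v i : mR) | i < n].

Lemma tadd_cons n (v : 'I_n.+1 -> R) (p : mR * tupR n) :
  tadd v (cons_pair p) = cons_pair (p.1 + v ord0, tadd (v \o lift ord0) p.2).
Proof.
apply: eq_from_tnth => i; rewrite tnth_mktuple.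
have [j ->|->] := unliftP ord0 i; last by rewrite !tnth0.
by rewrite !tnthS /= tnth_mktuple.
Qed.

(** By induction on the dimension: sections by hypothesis, the first coordinate by invariance on the
    line. *)
Lemma leb_tuple_tadd n (v : 'I_n -> R) (A : set (tupR n)) : measurable A ->
  leb_tuple n (tadd v @^-1` A) = leb_tuple n A.
Proof.
elim: n v A => [|n IH] v A mA.
  congr (leb_tuple 0 _); apply/seteqP; split => t; rewrite /preimage /=.
    by rewrite (tuple0 (tadd v t)) (tuple0 t).
  by rewrite (tuple0 (tadd v t)) (tuple0 t).
pose B := @cons_pair R n @^-1` A.
have mB : measurable B.
  by rewrite /B -[X in measurable X]setTI; exact: (@measurable_cons_pair R n).
transitivity ((lebR \x leb_tuple n)%E (@cons_pair R n @^-1` (tadd v @^-1` A))) => //.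
transitivity ((lebR \x leb_tuple n)%E B) => //.
pose f : mR -> \bar R := leb_tuple n \o xsection B.
have mf : measurable_fun setT f by exact: measurable_fun_xsection.
transitivity (\int[lebR]_x f (1 * x + v ord0)%R)%E.
  apply: eq_integral => x _; rewrite /f /= mul1r -[RHS](IH (v \o lift ord0)); last first.
    exact: measurable_xsection.
  congr (leb_tuple n _); apply/seteqP; split => t.
    by rewrite /xsection /= !inE /B /= tadd_cons.
  by rewrite /xsection /= !inE /B /= tadd_cons.
have f0 x : (setT : set mR) x -> (0 <= f x)%E by [].
have h := ge0_integral_affine (v ord0) ltr01 measurableT mf f0.
by rewrite mul1e in h; exact: (esym h).
Qed.

End LebesgueTupleFacts.

Section LebesgueFacts.
Context {R : realType} {d : nat}.
Notation V := 'rV[R]_d.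
Notation bV := (borelRV R d).
Notation leb := (@leb R d).

Lemma measurable_open (U : set V) : open U -> measurable (U : set bV).
Proof. by move=> oU; exact: sub_sigma_algebra. Qed.

Lemma measurable_cont (U : set V) (f : V -> R) : open U ->
  (forall x, U x -> {for x, continuous f}) -> measurable_fun (U : set bV) f.
Proof.
move=> oU cf; apply: (measurability _ (RGenOpens.measurableE R)) => //.
move=> _ [_ [a [b ->]] <-]; apply: measurable_open.
rewrite openE => x [Ux fx]; rewrite /interior.
apply: filterI; first exact: open_nbhs_nbhs.
have : nbhs (f x) `]a, b[%classic by apply: open_nbhs_nbhs; split => //; exact: interval_open.
exact: cf.
Qed.

(** The ambient norm is the maximum norm, so this ball is a cube. *)
Lemma leb_ball (z : V) (r : R) : 0 < r -> leb (ball z r) = ((r *+ 2) ^+ d)%:E.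
Proof.
move=> r0.
have -> : leb (ball z r) = leb_tuple d (tbox (fun i => z ord0 i - r) (fun i => z ord0 i + r)).
  rewrite /leb /image_measure /= /pushforward; congr (leb_tuple d _).
  apply/seteqP; split => t h.
    by move=> i; have := h.2 ord0 i; rewrite mxE /ball/= distrC ltr_distl.
  by split => // i j; rewrite ord1 mxE /ball/= distrC ltr_distl; exact: h.
rewrite leb_tuple_box => [|i]; last by rewrite ltrBlDr -addrA ltrDl addr_gt0.
rewrite (eq_bigr (fun=> r *+ 2)) ?prodr_const ?card_ord// => i _.
by ring.
Qed.

Lemma leb_open_gt0 (U : set V) : open U -> U !=set0 -> (0 < leb U)%E.
Proof.
move=> oU [z Uz].
have /nbhs_ballP[e /= e0 zU] : nbhs z U by exact: open_nbhs_nbhs.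
apply: (@lt_le_trans _ _ (leb (ball z e))).
  by rewrite leb_ball// lte_fin exprn_gt0// mulr2n addr_gt0.
by apply: le_measure => //; rewrite inE; apply: measurable_open => //; exact: ball_open.
Qed.

Lemma leb_bounded (B : set V) : measurable (B : set bV) -> bounded_set B ->
  (leb B < +oo)%E.
Proof.
move=> mB [M1 [_ BM1]].
have [M BM] : exists M, forall x, B x -> `|x| <= M.
  by exists (M1 + 1) => x Bx; apply: (BM1 (M1 + 1)) => //; rewrite ltrDl.
have M0 : 0 < `|M| + 1 by rewrite ltr_wpDl.
apply: (@le_lt_trans _ _ (leb (ball 0 (`|M| + 1)))); last by rewrite leb_ball// ltry.
apply: le_measure; rewrite ?inE//; first by apply: measurable_open; exact: ball_open.
move=> x Bx; rewrite -ball_normE /ball_ /= sub0r normrN.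
by apply: le_lt_trans (BM x Bx) _; rewrite ltr_pwDr// ler_norm.
Qed.

Lemma measurable_shift (v : V) : measurable_fun setT ((fun x => x + v) : bV -> bV).
Proof.
apply: (measurability (@open V : set (set bV))); first by [].
move=> _ [U oU <-]; rewrite setTI; apply: measurable_open.
have cs : continuous (fun x : V => x + v).
  by move=> x; apply: (@cvgD _ _ _ (nbhs x) _ id (cst v) x v); [exact: cvg_id|exact: cvg_cst].
by apply: (@open_comp V V (fun x => x + v)) => // x _; exact: cs.
Qed.

Lemma leb_shift (v : V) (A : set bV) : measurable A ->
  leb ((fun x : bV => (x : V) + v : bV) @^-1` A) = leb A.
Proof.
move=> mA; rewrite /leb /image_measure /= /pushforward.
have mA' : measurable (@rv_of_tuple R d @^-1` A).
  by rewrite -[X in measurable X]setTI; exact: measurable_rv_of_tuple.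
rewrite -(leb_tuple_tadd (v ord0) mA'); congr (leb_tuple d _).
have E t : (rv_of_tuple (tadd (v ord0) t) : V) = (rv_of_tuple t : V) + v.
  by apply/rowP => i; rewrite !mxE tnth_mktuple.
by apply/seteqP; split => t; rewrite /preimage /= E.
Qed.

Lemma rint_shift (v : V) (f : bV -> R) : rint leb setT f ->
  rint leb setT (fun x : bV => f ((x : V) + v)) /\
  \int[leb]_x f ((x : V) + v) = \int[leb]_x f x.
Proof.
move=> jf; have ms := measurable_shift v.
have E A : measurable A -> A `<=` setT ->
    leb A = pushforward leb ((fun x => x + v) : bV -> bV) A.
  by move=> mA _; rewrite /pushforward; exact/esym/leb_shift.
have jc : rint leb setT (fun x : bV => f ((x : V) + v)).
  apply/integrableP; split.
    apply/measurable_EFinP; apply: (measurableT_comp _ ms).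
    exact: (rint_meas jf).
  have /integrableP[_] := jf; apply: le_lt_trans.
  rewrite [leRHS](eq_measure_integral _ E) [leRHS]ge0_integral_pushforward//.
  by apply: measurableT_comp => //; apply/measurable_EFinP; exact: (rint_meas jf).
split => //; rewrite /Rintegral; congr fine.
rewrite [RHS](eq_measure_integral _ E) [RHS]integral_pushforward//.
by apply/measurable_EFinP; exact: (rint_meas jf).
Qed.

End LebesgueFacts.

Section DirectionalDerivatives.
Context {R : realType} {V : normedModType R}.
Implicit Types (F : V -> R) (x v : V).

Let quotE F x v t :
  (fun h : R => h^-1 *: (F (h *: v + (x + t *: v)) - F (x + t *: v))) =
  (fun h : R => h^-1 *: (F (x + (h *: 1 + t) *: v) - F (x + t *: v))).
Proof.
apply/funext => h; congr (_ *: (F _ - _)).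
by rewrite [h *: 1]mulr1 scalerDl addrCA.
Qed.

Lemma is_derive_line F x v t l : is_derive (x + t *: v) v F l ->
  is_derive t (1 : R) (fun s : R => F (x + s *: v)) l.
Proof.
move=> [d e]; have E := quotE F x v t; split.
  by rewrite /derivable -E; exact: d.
by rewrite /derive -E; exact: e.
Qed.

Lemma line_is_derive F x v l :
  is_derive (0 : R) (1 : R) (fun s : R => F (x + s *: v)) l -> is_derive x v F l.
Proof.
move=> [d e]; have E := quotE F x v 0; rewrite scale0r addr0 in E; split.
  by rewrite /derivable E; move: d; rewrite /derivable scale0r addr0.
by rewrite /derive E; move: e; rewrite /derive scale0r addr0.
Qed.

(** Restriction to the line through [x] along [v] reduces the chain rule to one variable; only the
    derivative of [F] in the direction [v] is required. *)
Lemma is_derive_comp (h : R -> R) F x v (l m : R) :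
  is_derive (F x) (1 : R) h m -> is_derive x v F l ->
  is_derive x v (fun y => h (F y)) (m * l).
Proof.
move=> dh dF; apply: line_is_derive.
have dF' : is_derive x v F l by [].
have /is_derive_line d1 : is_derive (x + 0 *: v) v F l by rewrite scale0r addr0.
have dh' : is_derive ((fun s : R => F (x + s *: v)) 0) (1 : R) h m.
  by rewrite scale0r addr0.
have := is_derive1_comp dh' d1.
by rewrite mulrC.
Qed.

Lemma is_derive_near F G x v l : (\forall y \near x, F y = G y) ->
  is_derive x v F l -> is_derive x v G l.
Proof.
move=> FG [d e].
have E : (\forall h \near (0:R)^', h^-1 *: (F (h *: v + x) - F x) = h^-1 *: (G (h *: v + x) - G x)).
  have Gx := nbhs_singleton FG; rewrite -Gx.
  have c : (fun h : R => h *: v + x) @ (0 : R) --> x.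
    rewrite -[X in _ --> X]add0r -(scale0r v); apply: cvgD; last exact: cvg_cst.
    by apply: cvgZr_tmp; exact: cvg_id.
  have : \forall h \near (0 : R), F (h *: v + x) = G (h *: v + x) by exact: c _ FG.
  by move=> H; apply: cvg_within; apply: filterS H => h /= ->.
have c1 : (fun h : R => h^-1 *: (F (h *: v + x) - F x)) @ 0^' --> l.
  by rewrite -e; exact: d.
have c2 : (fun h : R => h^-1 *: (G (h *: v + x) - G x)) @ 0^' --> l.
  by apply: cvg_trans c1; exact: near_eq_cvg.
split; first by apply/cvg_ex; exists l.
exact/cvg_lim.
Qed.

Lemma is_derive_dist_le F v M x (h : R) : 0 <= h ->
  (forall y, derivable F y v) -> (forall y, `|'D_v F y| <= M) ->
  `|F (x + h *: v) - F x| <= M * h.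
Proof.
rewrite le_eqVlt => /predU1P[<-|h0] dF DM.
  by rewrite scale0r addr0 subrr normr0 mulr0.
pose f (s : R) := F (x + s *: v).
have df s : is_derive s (1 : R) f ('D_v F (x + s *: v)).
  by apply: is_derive_line; exact: derivableP.
have [] := @MVT _ f (fun s => 'D_v F (x + s *: v)) 0 h h0.
- apply: continuous_subspaceT => s.
  by apply: differentiable_continuous; apply/derivable1_diffP; case: (df s).
- move=> c _; rewrite /f scale0r addr0 subr0 => ->.
  by rewrite normrM (gtr0_norm h0) ler_pM2r.
Qed.

End DirectionalDerivatives.

Section IntegralOfDerivative.
Context {R : realType} {d : nat}.
Notation V := 'rV[R]_d.
Notation bV := (borelRV R d).
Notation leb := (@leb R d).

(* Translation invariance makes every difference quotient of [F] integrate to 0. *)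
Lemma integral_derive0 (F : V -> R) (v : V) (K M r : R) :
  measurable_fun (setT : set bV) F -> 0 < r ->
  (forall x, derivable F x v) -> (forall x, `|'D_v F x| <= M) ->
  (forall x, `|F x| <= K) -> (forall x, ~ ball 0 r x -> F x = 0) ->
  rint leb (setT : set bV) ('D_v F) /\ \int[leb]_(x in (setT : set bV)) 'D_v F x = 0.
Proof.
move=> mF r0 dF DM FK F0.
have M0 : 0 <= M by apply: le_trans (normr_ge0 _) (DM 0).
have v1 : 0 <= `|v| by [].
(* The steps 1/(n+1) are at most 1, so all difference quotients vanish outside this ball; a multiple
   of its indicator is the majorant. *)
pose B : set bV := ball (0 : V) (r + `|v|).
have rv0 : 0 < r + `|v| by rewrite ltr_wpDr.
have mB : measurable B by apply: measurable_open; exact: ball_open.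
have rB c : rint leb (setT : set bV) (fun x : bV => c * \1_B x).
  apply: rintZ => //; apply/integrableP; split.
    by apply/measurable_EFinP; exact: measurable_indic.
  have eB : leb B = (((r + `|v|) *+ 2) ^+ d)%:E := leb_ball 0 rv0.
  rewrite (eq_integral (fun x : bV => (\1_B x)%:E)).
    have fB : (leb B < +oo)%E by rewrite eB ltry.
    by rewrite integral_indic// setIT; exact: fB.
  by move=> x _; rewrite /= ger0_norm.
have Bout (x : V) : ~ B x -> ~ ball 0 r x.
  move=> nB xr; apply: nB; apply: le_ball xr; by rewrite lerDl.
have rF : rint leb (setT : set bV) (F : bV -> R).
  apply: (rint_le measurableT mF _ (rB K)) => x _.
  rewrite indicE; have [xB|xB] := boolP (x \in B); first by rewrite mulr1.
  rewrite F0 ?normr0 ?mulr0//; apply: Bout.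
  by move: xB; rewrite notin_setE.
pose q (n : nat) (x : V) := n.+1%:R * (F (x + n.+1%:R^-1 *: v) - F x).
have iq n : rint leb (setT : set bV) (q n) /\ \int[leb]_(x in (setT : set bV)) q n x = 0.
  have [j1 e1] := rint_shift (n.+1%:R^-1 *: v) rF.
  have j2 := rintB measurableT j1 rF.
  split; first exact: (rintZ measurableT).
  rewrite (RintegralZl _ measurableT j2) (RintegralB measurableT j1 rF).
  by apply/eqP; rewrite mulf_eq0 subr_eq0; apply/orP; right; apply/eqP.
have qB n (x : bV) : `|q n x| <= M * \1_B x.
  rewrite indicE; have [xB|xB] := boolP (x \in B).
    rewrite mulr1 /q normrM ger0_norm//.
    have n0 : (0 : R) <= n.+1%:R^-1 by rewrite invr_ge0.
    have := is_derive_dist_le x n0 dF DM.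
    by rewrite -ler_pdivlMl// mulrC.
  have xB' : ~ B x by move: xB; rewrite notin_setE.
  rewrite /q (F0 x); last exact: Bout.
  rewrite F0 ?subrr ?mulr0 ?normr0// => h; apply: xB'.
  move: h; rewrite /B -!ball_normE /ball_ /= !sub0r !normrN => h.
  have -> : x = x + n.+1%:R^-1 *: v - n.+1%:R^-1 *: v by rewrite addrK.
  apply: (le_lt_trans (ler_normB _ _)); apply: ltr_leD => //.
  rewrite normrZ ger0_norm ?invr_ge0//; apply: ler_piMl => //.
  by rewrite invf_le1// ler1n.
have cq (x : V) : q n x @[n --> \oo] --> 'D_v F x.
  have c1 : (fun h : R => h^-1 *: (F (h *: v + x) - F x)) @ 0^' --> 'D_v F x by exact: dF.
  have c2 : (n.+1%:R^-1 : R) @[n --> \oo] --> 0^'.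
    move=> U [e /= e0 eU]; have := @cvg_harmonic R.
    move=> /cvgrPdist_lt/(_ e e0); apply: filterS => n /= h.
    by apply: eU; rewrite /ball_ /= ?invr_eq0 ?pnatr_eq0.
  have := cvg_comp _ _ c2 c1; apply: cvg_trans; apply: near_eq_cvg; apply: nearW => n /=.
  by rewrite invrK /q (addrC x).
have [jD cD] := Rdct (mu := leb) (D := (setT : set bV)) measurableT (f_ := q) (f := 'D_v F)
  (fun n => rint_meas (iq n).1)
  (measurable_fun_cvg (fun n => rint_meas (iq n).1) (fun x _ => cq x))
  (fun x _ => cq x) (rB M) (fun n x _ => qB n x).
split => //.
apply: (cvg_unique _ cD); first exact: Rhausdorff.
by apply: cvg_near_cst; apply: nearW => n; rewrite (iq n).2.
Qed.

End IntegralOfDerivative.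

(** * Test functions *)

Section FlatFunctions.
Context {R : realType}.
Variable ka : R.
Hypothesis ka0 : 0 < ka.

(** Derivatives of exp(-ka/x), extended by zero, are combinations of these functions. The rate [ka]
    stays a parameter: large for barriers, tending to 0 for approximating indicators. *)
Definition flat (m : nat) (x : R) : R :=
  if 0 < x then x^-1 ^+ m * expR (- (ka * x^-1)) else 0.

Lemma flat_le0 m x : x <= 0 -> flat m x = 0.
Proof. by rewrite /flat ltNge => ->. Qed.

Lemma flatE m x : 0 < x -> flat m x = x^-1 ^+ m * flat 0 x.
Proof. by rewrite /flat => ->; rewrite expr0 mul1r. Qed.

Lemma flat_ge0 m x : 0 <= flat m x.
Proof.
rewrite /flat; case: ifP => // x0; rewrite mulr_ge0 ?expR_ge0//.
by rewrite exprn_ge0// invr_ge0 ltW.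
Qed.

Lemma flat0_le1 x : flat 0 x <= 1.
Proof.
rewrite /flat; case: ifP => // x0; rewrite expr0 mul1r expR_le1 oppr_le0.
by rewrite mulr_ge0 ?invr_ge0 ?ltW.
Qed.

(** The exponential beats every power of 1/x; a quadratic bound is what makes the derivative at 0
    exist and vanish. *)
Lemma flat_quad m : exists C, forall x, `|flat m x| <= C * x ^+ 2.
Proof.
exists ((m + 2)`!%:R * ka^-1 ^+ (m + 2)) => x.
have C0 : 0 <= (m + 2)`!%:R * ka^-1 ^+ (m + 2).
  by rewrite mulr_ge0// exprn_ge0// invr_ge0 ltW.
rewrite (ger0_norm (flat_ge0 m x)) /flat; case: ifP => x0; last first.
  by rewrite mulr_ge0// sqr_ge0.
have kx0 : 0 <= ka * x^-1 by rewrite mulr_ge0 ?invr_ge0 ?ltW.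
have h := pow_le_expR (m + 2) kx0.
have e0 := expR_gt0 (ka * x^-1).
rewrite expRN -(@ler_pM2r _ ((ka * x^-1) ^+ (m + 2))); last first.
  by rewrite exprn_gt0// mulr_gt0// invr_gt0.
apply: (@le_trans _ _ (x^-1 ^+ m * (m + 2)`!%:R)).
  rewrite -mulrA; apply: ler_wpM2l; first by rewrite exprn_ge0// invr_ge0 ltW.
  by rewrite ler_pdivrMl// [leRHS]mulrC.
rewrite exprMn [X in X <= _]mulrC !exprD !exprVn.
move: (ltW e0) => _; have xm : x ^+ m != 0 by rewrite expf_neq0// gt_eqF.
have km : ka ^+ m != 0 by rewrite expf_neq0// gt_eqF.
rewrite le_eqVlt; apply/orP; left; apply/eqP; move: (_`!%:R) (x ^+ m) (ka ^+ m) xm km => a b c b0 c0.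
by field; rewrite (gt_eqF x0) (gt_eqF ka0) b0 c0.
Qed.

Lemma is_derive_flat m x :
  is_derive x (1 : R) (flat m) (ka * flat m.+2 x - m%:R * flat m.+1 x).
Proof.
have [x0|x0|x0] := ltgtP 0 x.
- have E : \forall y \near x, y^-1 ^+ m * expR (- (ka * y^-1)) = flat m y.
    have : nbhs x `]0, +oo[%classic by apply: open_nbhs_nbhs; split; [exact: interval_open|rewrite /= in_itv /= x0].
    by apply: filterS => y; rewrite /= in_itv /= andbT /flat => ->.
  apply: (is_derive_near E).
  have dV : is_derive x (1 : R) (fun y : R => y^-1) (- x ^- 2).
    have := @is_deriveV R id x 1 1 (lt0r_neq0 x0) _; rewrite [_ *: 1]mulr1; apply.
  have dX : is_derive x (1 : R) (fun y : R => y^-1 ^+ m) (- (m%:R * x^-1 ^+ m.+1)).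
    case: m {E} => [|m].
      rewrite mul0r oppr0.
      have -> : (fun y : R => y^-1 ^+ 0) = cst 1 by apply/funext => y; rewrite expr0.
      exact: is_derive_cst.
    have := is_deriveX m.+1 dV; rewrite /GRing.scale /= => h.
    have -> : (fun y : R => y^-1 ^+ m.+1) = (fun y : R => y^-1) ^+ m.+1.
      by apply/funext => y; elim: m.+1 {h} => [|n IH]; [rewrite !expr0|rewrite !exprS {1}IH].
    apply: (is_derive_eq h).
    by rewrite mulrN -mulrA [in RHS]exprS [in RHS]exprS !exprVn expr2 invfM; ring.
  have dE : is_derive x (1 : R) (fun y : R => expR (- (ka * y^-1))) (ka * x^-1 ^+ 2 * expR (- (ka * x^-1))).
    have d1 : is_derive x (1 : R) (fun y : R => - (ka * y^-1)) (ka * x^-1 ^+ 2).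
      have d0 : is_derive x (1 : R) (- (ka *: (fun y : R => y^-1))) (- (ka *: - x ^- 2)).
        exact: is_deriveN.
      by apply: (is_derive_eq d0); rewrite /GRing.scale /= mulrN opprK exprVn.
    have d2 := @is_derive_comp R R expR (fun y : R => - (ka * y^-1)) x 1 _ _ (is_derive_expR _) d1.
    by apply: (is_derive_eq d2); rewrite mulrC.
  have dM : is_derive x (1 : R) (fun y : R => y^-1 ^+ m * expR (- (ka * y^-1))) _ := is_deriveM dX dE.
  apply: (is_derive_eq dM).
  rewrite /GRing.scale /= /flat x0 !exprS; move: (expR _) (x^-1 ^+ m) => e a.
  by rewrite expr0; ring.
- rewrite !flat_le0 ?(ltW x0)// !mulr0 subr0.
  have E : \forall y \near x, (cst 0 : R -> R) y = flat m y.
    have : nbhs x `]-oo, 0[%classic by apply: open_nbhs_nbhs; split; [exact: interval_open|rewrite /= in_itv /= x0].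
    by apply: filterS => y; rewrite /= in_itv /= => y0; rewrite flat_le0// ltW.
  by apply: (is_derive_near E); exact: is_derive_cst.
- rewrite -x0 !flat_le0// !mulr0 subr0.
  have [C hC] := flat_quad m.
  have c : (fun h : R => h^-1 *: (flat m (h *: 1 + 0) - flat m 0)) @ 0^' --> (0 : R).
    apply/norm_cvg0P; apply: (@squeeze_cvgr _ _ _ _ (fun=> 0) (fun h => C * `|h|)).
    + near=> h; have h0 : h != 0 by near: h; exact: nbhs_dnbhs_neq.
      rewrite normr_ge0 /= [h *: 1]mulr1 addr0 (flat_le0 _ (lexx 0)) subr0 /GRing.scale /= normrM normfV.
      rewrite ler_pdivrMl ?normr_gt0//; apply: (le_trans (hC h)).
      by rewrite [leRHS]mulrCA -[X in _ <= _ * X]expr2 real_normK ?num_real.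
    + exact: cvg_cst.
    + rewrite -[X in _ --> X](mulr0 C) -[X in _ --> C * X](@normr0 R R); apply: cvgMl_tmp.
      by apply: cvg_norm; apply: cvg_within_filter; exact: cvg_id.
  by split; [apply/cvg_ex; exists 0|exact/cvg_lim].
Unshelve. all: by end_near. Qed.

End FlatFunctions.

Lemma flat0_cvg (R : realType) (x : R) : 0 < x -> flat n.+1%:R^-1 0 x @[n --> \oo] --> (1 : R).
Proof.
move=> x0.
have E : (fun n : nat => flat n.+1%:R^-1 0 x) = (fun n => expR (- (n.+1%:R^-1 * x^-1))).
  by apply/funext => n; rewrite /flat x0 expr0 mul1r.
rewrite E -[X in _ --> X](@expR0 R); apply: continuous_cvg; first exact: continuous_expR.
rewrite -[X in _ --> X]oppr0 -[X in _ --> - X](mul0r x^-1); apply: cvgN.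
by apply: cvgMr_tmp; exact: cvg_harmonic.
Qed.

Section SmoothFunctions.
Context {R : realType} {d : nat}.
Notation V := 'rV[R]_d.
Implicit Types (f g : V -> R) (k : nat) (i j : 'I_d).
Notation Ck k := (@Ck R d k setT).
Notation Cinfty := (@Cinfty R d setT).
Notation basis := (@basis_vec R d).

Lemma Ck_cont k f : Ck k f -> continuous f.
Proof. by case: k => [|k] [h _] x; exact: h. Qed.
Arguments Ck_cont {k f} _ x _ _.

Lemma CkW k f : Ck k.+1 f -> Ck k f.
Proof.
elim: k f => [|k IH] f [h1 h2]; split=> // i; have [h3 h4] := h2 i; split => //.
exact: IH.
Qed.

Lemma CkS k f (D : 'I_d -> V -> R) : continuous f ->
  (forall i x, is_derive x (basis i) f (D i x)) -> (forall i, Ck k (D i)) -> Ck k.+1 f.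
Proof.
move=> cf df h; split=> [x _|i]; first exact: cf.
split=> [x _|]; first by case: (df i x).
have -> : pd i f = D i by apply/funext => x; rewrite /pd; case: (df i x).
exact: h.
Qed.

Lemma Ck_derive k f i x : Ck k.+1 f -> is_derive x (basis i) f (pd i f x).
Proof. by move=> [_ /(_ i)[h _]]; apply: DeriveDef => //; exact: h. Qed.

Lemma Ck_pd k f i : Ck k.+1 f -> Ck k (pd i f).
Proof. by move=> [_ /(_ i)[_]]. Qed.

Lemma Ck_cst k c : Ck k (cst c).
Proof.
elim: k c => [|k IH] c; first by split; [move=> x _; exact: cst_continuous|].
apply: (@CkS _ _ (fun _ => cst 0)); last by move=> _; exact: IH.
exact: cst_continuous.
Qed.

Lemma Ck_coord k i : Ck k (fun x => x ord0 i).
Proof.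
have cc : continuous (fun x : V => x ord0 i) by move=> x; exact: coord_continuous.
case: k => [|k]; first by split => // x _; exact: cc.
apply: (@CkS _ _ (fun j => cst (basis j ord0 i))) => // [j x|j]; last exact: Ck_cst.
have E : (fun h : R => h^-1 *: ((h *: basis j + x) ord0 i - x ord0 i)) @ 0^' --> basis j ord0 i.
  apply: cvg_near_cst; near=> h; have h0 : h != 0 by near: h; exact: nbhs_dnbhs_neq.
  by rewrite 2!mxE addrK /GRing.scale /= mulKf.
by split; [apply/cvg_ex; eexists; exact: E|exact/cvg_lim].
Unshelve. all: by end_near. Qed.

Lemma CkD k f g : Ck k f -> Ck k g -> Ck k (fun x => f x + g x).
Proof.
move=> hf hg; have cc : continuous (fun x => f x + g x).
  by move=> x; exact: (cvgD (Ck_cont hf x) (Ck_cont hg x)).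
elim: k f g hf hg cc => [|k IH] f g hf hg cc; first by split; [move=> x _; exact: cc|].
have cc' i : continuous (fun x => pd i f x + pd i g x).
  by move=> x; exact: (cvgD (Ck_cont (Ck_pd i hf) x) (Ck_cont (Ck_pd i hg) x)).
apply: (@CkS _ _ (fun i x => pd i f x + pd i g x)) => [//|i x|i].
- have d1 := Ck_derive i x hf; have d2 := Ck_derive i x hg; exact: is_deriveD.
- by apply: IH => //; exact: Ck_pd.
Qed.

Lemma CkM k f g : Ck k f -> Ck k g -> Ck k (fun x => f x * g x).
Proof.
elim: k f g => [|k IH] f g hf hg; have cc : continuous (fun x => f x * g x).
- by move=> x; exact: (cvgM (Ck_cont hf x) (Ck_cont hg x)).
- by split; [move=> x _; exact: cc|].
- by move=> x; exact: (cvgM (Ck_cont hf x) (Ck_cont hg x)).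
apply: (@CkS _ _ (fun i x => f x * pd i g x + g x * pd i f x)) => [//|i x|i].
- have d1 := Ck_derive i x hf; have d2 := Ck_derive i x hg; exact: is_deriveM.
- by apply: CkD; apply: IH; (exact: CkW || exact: Ck_pd).
Qed.

Lemma Ck_flat ka m k f : 0 < ka -> Ck k f -> Ck k (fun x => flat ka m (f x)).
Proof.
move=> ka0; have cF n : continuous (flat ka n).
  move=> y; apply: differentiable_continuous; apply/derivable1_diffP.
  by case: (is_derive_flat ka0 n y).
have cc n : continuous f -> continuous (fun x => flat ka n (f x)).
  by move=> cf x; apply: (@continuous_comp _ _ _ f (flat ka n)); [exact: cf|exact: cF].
elim: k m f cc => [|k IH] m f cc hf.
  by split => // x _; apply: cc; exact: (Ck_cont hf).
pose D n x := ka * flat ka n.+2 (f x) - n%:R * flat ka n.+1 (f x).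
apply: (@CkS _ _ (fun i x => D m x * pd i f x)) => [|i x|i].
- by apply: cc; exact: (Ck_cont hf).
- exact: (is_derive_comp (is_derive_flat ka0 m (f x)) (Ck_derive i x hf)).
- apply: CkM; last exact: Ck_pd.
  have hf' := CkW hf.
  have -> : D m = fun x => cst ka x * flat ka m.+2 (f x) + cst (- m%:R) x * flat ka m.+1 (f x).
    by apply/funext => x; rewrite /D /= mulNr.
  by apply: CkD; apply: CkM; (exact: Ck_cst || exact: IH).
Qed.

Lemma Cinfty_cst c : Cinfty (cst c). Proof. by move=> k; exact: Ck_cst. Qed.
Lemma Cinfty_coord i : Cinfty (fun x => x ord0 i). Proof. by move=> k; exact: Ck_coord. Qed.
Lemma CinftyD f g : Cinfty f -> Cinfty g -> Cinfty (fun x => f x + g x).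
Proof. by move=> hf hg k; exact: CkD. Qed.
Lemma CinftyM f g : Cinfty f -> Cinfty g -> Cinfty (fun x => f x * g x).
Proof. by move=> hf hg k; exact: CkM. Qed.
Lemma CinftyZ c f : Cinfty f -> Cinfty (fun x => c * f x).
Proof. by move=> hf k; apply: (CkM (Ck_cst k c)). Qed.
Lemma Cinfty_flat ka m f : 0 < ka -> Cinfty f -> Cinfty (fun x => flat ka m (f x)).
Proof. by move=> ka0 hf k; exact: Ck_flat. Qed.
Lemma Cinfty_pd i f : Cinfty f -> Cinfty (pd i f).
Proof. by move=> hf k; exact: Ck_pd. Qed.
Lemma Cinfty_cont f : Cinfty f -> continuous f.
Proof. by move=> hf; exact: (Ck_cont (hf 0%N)). Qed.
Lemma Cinfty_derive f i x : Cinfty f -> is_derive x (basis i) f (pd i f x).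
Proof. by move=> hf; exact: (Ck_derive i x (hf 1%N)). Qed.
Lemma Cinfty_sum (I : Type) (s : seq I) (f : I -> V -> R) :
  (forall a : I, Cinfty (f a)) -> Cinfty (fun x => \sum_(a <- s) f a x).
Proof.
move=> hf; elim: s => [|a s IH].
  by have -> : (fun x => \sum_(b <- [::]) f b x) = cst 0; [apply/funext => x; rewrite big_nil|exact: Cinfty_cst].
have -> : (fun x => \sum_(b <- a :: s) f b x) = fun x => f a x + \sum_(b <- s) f b x.
  by apply/funext => x; rewrite big_cons.
exact: CinftyD.
Qed.

End SmoothFunctions.

(** * Euclidean balls *)

Section EuclideanBalls.
Context {R : realType} {d : nat}.
Notation V := 'rV[R]_d.
Notation bV := (borelRV R d).
Notation Cinfty := (@Cinfty R d setT).

(** Squared Euclidean distance. Unlike the maximum norm it is smooth, so it can enter test functions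
    and barriers. *)
Definition sqd (z y : V) : R := \sum_i (y ord0 i - z ord0 i) ^+ 2.
Definition eball (z : V) (r : R) : set V := [set y | sqd z y < r ^+ 2].
Definition cball (z : V) (r : R) : set V := [set y | sqd z y <= r ^+ 2].

Lemma sqd_ge0 z y : 0 <= sqd z y.
Proof. by apply: sumr_ge0 => i _; exact: sqr_ge0. Qed.

Lemma sqdxx z : sqd z z = 0.
Proof. by rewrite /sqd big1// => i _; rewrite subrr expr0n. Qed.

Lemma eball_center z r : 0 < r -> eball z r z.
Proof. by move=> r0; rewrite /eball /= sqdxx exprn_gt0. Qed.

Lemma cball_coord (z : V) (r : R) (y : V) i : 0 <= r -> cball z r y -> `|y ord0 i - z ord0 i| <= r.
Proof.
move=> r0 h; rewrite -(@ler_sqr _ `|_|) ?nnegrE// real_normK ?num_real//.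
apply: le_trans h; rewrite /sqd (bigD1 i)//= lerDl.
by apply: sumr_ge0 => j _; exact: sqr_ge0.
Qed.

Lemma eball_sub_cball z r : eball z r `<=` cball z r.
Proof. by move=> y /ltW. Qed.

Lemma eballS z r s : 0 <= r -> r <= s -> eball z r `<=` eball z s.
Proof.
move=> r0 rs y h; apply: (lt_le_trans h).
by rewrite ler_sqr ?nnegrE ?(le_trans r0).
Qed.

(** [d.+1] makes the estimate strict: d / (d+1)^2 < 1. *)
Lemma sqd_lt (z y : V) (r : R) : 0 < r -> (forall i, `|y ord0 i - z ord0 i| <= r / d.+1%:R) -> eball z r y.
Proof.
move=> r0 h; rewrite /eball /=.
apply: (@le_lt_trans _ _ (\sum_(i < d) (r / d.+1%:R) ^+ 2)).
  apply: ler_sum => i _; rewrite -real_normK ?num_real// ler_sqr ?nnegrE//.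
  by rewrite divr_ge0// ltW.
have d0 : (0 : R) < d.+1%:R by rewrite ltr0n.
rewrite sumr_const card_ord -[ltLHS]mulr_natl exprMn mulrCA -[ltRHS]mulr1.
rewrite ltr_pM2l ?exprn_gt0// exprVn ltr_pdivrMr ?exprn_gt0// mul1r.
apply: (@lt_le_trans _ _ d.+1%:R); first by rewrite ltr_nat.
by rewrite expr2 ler_peMr ?ler1n// ltW.
Qed.

Lemma Cinfty_sqd z : Cinfty (sqd z).
Proof.
apply: (@Cinfty_sum R d 'I_d (index_enum _) (fun i y => (y ord0 i - z ord0 i) ^+ 2)) => i.
have h : Cinfty (fun y : V => y ord0 i + cst (- z ord0 i) y).
  by apply: CinftyD; [exact: Cinfty_coord|exact: Cinfty_cst].
have -> : (fun y : V => (y ord0 i - z ord0 i) ^+ 2) =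
    (fun y => (y ord0 i + cst (- z ord0 i) y) * (y ord0 i + cst (- z ord0 i) y)).
  by apply/funext => y; rewrite expr2.
exact: CinftyM.
Qed.

Lemma open_eball z r : open (eball z r).
Proof.
have -> : eball z r = sqd z @^-1` [set x | x < r ^+ 2] by [].
apply: open_comp => [y _|]; last exact: open_lt.
exact: (Cinfty_cont (Cinfty_sqd z)).
Qed.

Lemma measurable_eball z r : measurable (eball z r : set bV).
Proof. by apply: measurable_open; exact: open_eball. Qed.

Lemma compact_cball z r : 0 <= r -> compact (cball z r).
Proof.
move=> r0; apply: bounded_closed_compact.
  exists (`|z| + r); split => [|M zM y yz]; first exact: num_real.
  apply: le_trans (ltW zM).
  have -> : y = z + (y - z) by rewrite addrC subrK.
  apply: (le_trans (ler_normD _ _)); rewrite lerD2l.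
  rewrite [leLHS]mx_normrE; apply: bigmax_le => // -[i j] _ /=; rewrite !ord1 !mxE.
  exact: cball_coord.
have -> : cball z r = sqd z @^-1` [set x | x <= r ^+ 2] by [].
apply: closed_comp => [y _|]; last exact: closed_le.
exact: (Cinfty_cont (Cinfty_sqd z)).
Qed.

Lemma ballP (x y : V) e : 0 < e -> ball x e y <-> forall i, `|y ord0 i - x ord0 i| < e.
Proof.
move=> e0; split=> [[_ h] i|h]; first by have := h ord0 i; rewrite /ball /= distrC.
by split => // i0 i; rewrite ord1 /ball /= distrC.
Qed.

Lemma cball_sub (U : set V) x : open U -> U x ->
  exists2 r, 0 < r & cball x r `<=` U.
Proof.
move=> oU Ux; have /nbhs_ballP[e /= e0 xU] : nbhs x U by exact: open_nbhs_nbhs.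
exists (e / 2); first by rewrite divr_gt0.
move=> y h; apply: xU; apply/ballP => // i.
apply: (@le_lt_trans _ _ (e / 2)); last by rewrite ltr_pdivrMr// ltr_pMr// ltr1n.
by apply: cball_coord => //; rewrite ltW// divr_gt0.
Qed.

Definition qball (qk : 'rV[rat]_d * nat) : set V :=
  eball (map_mx ratr qk.1) qk.2.+1%:R^-1.

Lemma qball_cover (U : set V) x : open U -> U x -> exists qk, qball qk x /\
  cball (map_mx ratr qk.1) qk.2.+1%:R^-1 `<=` U.
Proof.
move=> oU Ux; have /nbhs_ballP[e /= e0 xU] : nbhs x U by exact: open_nbhs_nbhs.
have [k ke] : exists k, k.+1%:R^-1 < e / 2.
  have e20 : 0 < e / 2 by rewrite divr_gt0.
  exists (Num.trunc (e / 2)^-1).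
  by rewrite invf_plt ?posrE// truncnS_gt // invr_ge0 ltW.
have k0 : (0 : R) < k.+1%:R^-1 by rewrite invr_gt0.
set r := k.+1%:R^-1 : R.
have qP i : exists q : rat, `|x ord0 i - ratr q| < r / d.+1%:R.
  have rd0 : 0 < r / d.+1%:R by rewrite divr_gt0.
  have : x ord0 i - r / d.+1%:R < x ord0 i + r / d.+1%:R.
    by rewrite ltrBlDr -addrA ltrDl addr_gt0.
  move=> /rat_in_itvoo[q]; rewrite in_itv/= => /andP[q1 q2]; exists q.
  by rewrite distrC ltr_distl q1 q2.
pose q := \row_i sval (cid (qP i)).
have qE i : `|x ord0 i - (map_mx ratr q : V) ord0 i| < r / d.+1%:R.
  by rewrite !mxE; exact: (svalP (cid (qP i))).
exists (q, k); split; first by apply: sqd_lt => // i; exact/ltW/qE.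
move=> y h; apply: xU; apply/ballP => // i /=.
rewrite (splitr e); apply: (le_lt_trans (ler_distD ((map_mx ratr q : V) ord0 i) _ _)).
have h1 : `|y ord0 i - (map_mx ratr q : V) ord0 i| <= r by apply: cball_coord => //; exact: ltW.
have h2 : `|(map_mx ratr q : V) ord0 i - x ord0 i| <= r.
  rewrite distrC; apply: (le_trans (ltW (qE i))).
  by rewrite ler_pdivrMr ?ltr0n// ler_peMr ?ler1n// ltW.
by apply: ltrD; [exact: le_lt_trans ke|exact: le_lt_trans ke].
Qed.

End EuclideanBalls.

(** * Density of test functions *)

Section TestFunctions.
Context {R : realType} {d : nat}.
Notation V := 'rV[R]_d.
Notation bV := (borelRV R d).
Notation Cinfty := (@Cinfty R d setT).
Notation leb := (@leb R d).
Variable Om : set V.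
Hypotheses (oOm : open Om) (bOm : bounded_set Om).
Notation test := (test_function Om).
Implicit Types (f g psi eta : V -> R).

Let mOm : measurable (Om : set bV). Proof. exact: measurable_open. Qed.
Let fOm : (leb Om < +oo)%E. Proof. exact: leb_bounded. Qed.

Lemma test_cont psi : test psi -> continuous psi.
Proof. by move=> [h _]; exact: Cinfty_cont. Qed.

Lemma test_out psi : test psi -> forall x, ~ Om x -> psi x = 0.
Proof. by move=> [_ [K [_ KO h]]] x nO; apply: h => /KO. Qed.

Lemma test_bounded psi : test psi -> exists M, forall x, `|psi x| <= M.
Proof.
move=> [h [K [cK _ K0]]].
have cf : {within K, continuous psi}.
  by apply: continuous_subspaceT; exact: Cinfty_cont.
have := compact_bounded (continuous_compact cf cK) => -[M [_ hM]].
exists (`|M| + 1) => x; have [Kx|nK] := pselect (K x); last first.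
  by rewrite K0// normr0 addr_ge0.
by apply: (hM (`|M| + 1)); [rewrite ltr_pwDr// ler_norm|exists x].
Qed.

Lemma test_pd psi i : test psi -> test (pd i psi).
Proof.
move=> [h [K [cK KO K0]]]; split; first exact: Cinfty_pd.
exists K; split => // x nK.
have cl : closed K by apply: compact_closed => //; exact: norm_hausdorff.
have E : \forall y \near x, (cst 0 : V -> R) y = psi y.
  have : nbhs x (~` K) by apply: open_nbhs_nbhs; split => //; exact: closed_openC.
  by apply: filterS => y /K0.
have [_ <-] := is_derive_near E (is_derive_cst (0 : R) x (@basis_vec R d i)).
by [].
Qed.

Lemma test_mul eta psi : Cinfty eta -> test psi -> test (fun x => eta x * psi x).
Proof.
move=> he [h [K [cK KO K0]]]; split; first exact: CinftyM.
by exists K; split => // x nK; rewrite K0// mulr0.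
Qed.

Lemma testD psi eta : test psi -> test eta -> test (fun x => psi x + eta x).
Proof.
move=> [h [K [cK KO K0]]] [h' [K' [cK' KO' K0']]]; split; first exact: CinftyD.
exists (K `|` K'); split; first exact: compactU.
  by move=> x [/KO|/KO'].
by move=> x /not_orP[nK nK']; rewrite K0// K0'// addr0.
Qed.

Lemma testZ c psi : test psi -> test (fun x => c * psi x).
Proof. by move=> h; apply: (test_mul (Cinfty_cst c)). Qed.

Lemma test0 : test (fun=> 0).
Proof. by split; [exact: Cinfty_cst|exists set0; split => //; exact: compact0]. Qed.

Lemma L2_cst (c : R) : L2O Om (cst c).
Proof. by apply: (L2_bounded mOm fOm (M := `|c|)). Qed.

Lemma L2_contb f M : (forall x, Om x -> {for x, continuous f}) ->
  (forall x, Om x -> `|f x| <= M) -> L2O Om f.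
Proof. by move=> cf fM; apply: (L2_bounded mOm fOm (M := M)) => //; exact: measurable_cont. Qed.

Lemma test_L2 psi : test psi -> L2O Om psi.
Proof.
move=> h; have [M hM] := test_bounded h.
by apply: (@L2_contb _ M) => x _; [exact: test_cont|exact: hM].
Qed.

Lemma L2_rint f : L2O Om f -> rint leb (Om : set bV) f.
Proof.
move=> h; apply: (rint_eq mOm _ (rint_mul mOm h (L2_cst 1))) => x _.
by rewrite mulr1.
Qed.

Lemma rint_test f psi : rint leb (Om : set bV) f -> test psi ->
  rint leb (Om : set bV) (fun x => f x * psi x).
Proof.
move=> jf tp; have [M hM] := test_bounded tp.
apply: (rint_le mOm _ _ (rintZ mOm M (rint_norm jf))).
  by apply: measurable_funM; [exact: rint_meas jf|exact: (L2_meas (test_L2 tp))].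
by move=> x _; rewrite normrM mulrC; apply: ler_wpM2r.
Qed.

Lemma bump_test m (ka : R) (z : V) (r : R) : 0 < ka -> 0 <= r -> cball z r `<=` Om ->
  test (fun y => flat ka m (r ^+ 2 - sqd z y)).
Proof.
move=> ka0 r0 sub; split.
  apply: Cinfty_flat => //.
  have := CinftyD (Cinfty_cst (r ^+ 2)) (CinftyZ (-1) (Cinfty_sqd z)).
  by congr Defs.Cinfty; apply/funext => y /=; rewrite mulN1r.
exists (cball z r); split => //; first exact: compact_cball.
by move=> y /negP; rewrite -ltNge => h; apply: flat_le0; rewrite subr_le0 ltW.
Qed.

Lemma ae_mono2 (P Q S : V -> Prop) : (forall x, P x -> Q x -> S x) ->
  {ae leb, forall x, P x} -> {ae leb, forall x, Q x} -> {ae leb, forall x, S x}.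
Proof. exact: (@filterS2 _ _ (ae_filter_ringOfSetsType leb)). Qed.

Lemma ae_mono (P Q : V -> Prop) : (forall x, P x -> Q x) ->
  {ae leb, forall x, P x} -> {ae leb, forall x, Q x}.
Proof. exact: (@filterS _ _ (ae_filter_ringOfSetsType leb)). Qed.

Lemma ae_all (P : V -> Prop) : (forall x, P x) -> {ae leb, forall x, P x}.
Proof. by move=> h; apply: ae_mono (@filterT _ _ (ae_filter_ringOfSetsType leb)) => x _. Qed.

(** Indicators that are bounded pointwise limits of smooth functions. Such sets form a pi-system, by
    products, and contain all Euclidean balls. *)
Definition smooth_lim (U : set V) :=
  exists eta : nat -> V -> R, [/\ forall k, Cinfty (eta k),
    forall k x, `|eta k x| <= 1 & forall x, eta k x @[k --> \oo] --> (\1_U x : R)].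

Lemma smooth_limT : smooth_lim setT.
Proof.
exists (fun _ => cst 1); split => [k|k x|x]; first exact: Cinfty_cst.
  by rewrite normr1.
by rewrite indicE mem_set//; exact: cvg_cst.
Qed.

Lemma smooth_limI A B : smooth_lim A -> smooth_lim B -> smooth_lim (A `&` B).
Proof.
move=> [e [e1 e2 e3]] [f [f1 f2 f3]]; exists (fun k x => e k x * f k x); split.
- by move=> k; exact: CinftyM.
- by move=> k x; rewrite normrM; apply: mulr_ile1.
- move=> x; rewrite indicI /=; apply: cvgM; [exact: e3|exact: f3].
Qed.

Lemma bump_cvg (z : V) (r : R) (y : V) : flat k.+1%:R^-1 0 (r ^+ 2 - sqd z y) @[k --> \oo] --> (\1_(eball z r) y : R).
Proof.
rewrite indicE; have [h|h] := boolP (y \in eball z r).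
  by apply: flat0_cvg; move: h; rewrite inE subr_gt0.
apply: cvg_near_cst; apply: nearW => k; apply: flat_le0.
by move: h; rewrite notin_setE subr_le0 /eball /= => /negP; rewrite -leNgt.
Qed.

Lemma smooth_lim_eball (z : V) (r : R) : smooth_lim (eball z r).
Proof.
exists (fun k y => flat k.+1%:R^-1 0 (r ^+ 2 - sqd z y)); split.
- move=> k; apply: Cinfty_flat => //.
  have := CinftyD (Cinfty_cst (r ^+ 2)) (CinftyZ (-1) (Cinfty_sqd z)).
  by congr Defs.Cinfty; apply/funext => y /=; rewrite mulN1r.
- by move=> k x; rewrite ger0_norm ?flat_ge0// flat0_le1.
- by move=> x; exact: bump_cvg.
Qed.

(* Sets on which [g], cut off by a ball, integrates to 0 form a lambda-system. *)
Lemma test_dense g : rint leb (Om : set bV) g ->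
  (forall eta, test eta -> \int[leb]_(x in (Om : set bV)) (g x * eta x) = 0) ->
  {ae leb, forall x, Om x -> g x = 0}.
Proof.
move=> jg h; have mg := rint_meas jg.
(* On one ball, multiplication by bumps turns smooth functions into test functions; as the rate of
   the bumps tends to 0 they recover the indicator of the ball. *)
have ball0 z r : 0 < r -> cball z r `<=` Om ->
    {ae leb, forall x, Om x -> eball z r x -> g x = 0}.
  move=> r0 sub; pose B := eball z r.
  have mB : measurable (B : set bV) by exact: measurable_eball.
  pose I (E : set bV) : R := \int[leb]_(x in (Om : set bV)) (g x * (\1_E x * \1_B x)).
  have b1 (E : set V) x : `|\1_E x * \1_B x : R| <= 1.
    by rewrite ger0_norm// mulr_ile1.
  have mi (E : set bV) : measurable E -> measurable_fun (Om : set bV) (fun x => g x * (\1_E x * \1_B x)).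
    by move=> mE; apply: measurable_funM => //; apply: measurable_funM; exact: measurable_indic.
  have le1 (e : R) x : `|e| <= 1 -> `|g x * e| <= `|g x|.
    by move=> e1; rewrite normrM; exact: ler_piMr.
  have ji (E : set bV) : measurable E -> rint leb (Om : set bV) (fun x => g x * (\1_E x * \1_B x)).
    move=> mE; apply: (rint_le mOm (mi _ mE) _ (rint_norm jg)) => x _.
    exact: le1.
  have IG U : smooth_lim U -> measurable (U : set bV) -> I U = 0.
    move=> [e [e1 e2 e3]] mU.
    have te k : test (fun x => e k x * flat k.+1%:R^-1 0 (r ^+ 2 - sqd z x)).
      by apply: test_mul => //; apply: bump_test => //; exact: ltW.
    have el k x : `|e k x * flat k.+1%:R^-1 0 (r ^+ 2 - sqd z x)| <= 1.
      by rewrite normrM; apply: mulr_ile1 => //; rewrite ger0_norm ?flat_ge0// flat0_le1.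
    have [_ c] := Rdct (mu := leb) mOm
      (f_ := fun k x => g x * (e k x * flat k.+1%:R^-1 0 (r ^+ 2 - sqd z x)))
      (f := fun x => g x * (\1_U x * \1_B x)) (g := fun x => `|g x|)
      (fun k => rint_meas (rint_test jg (te k))) (mi _ mU)
      (fun x _ => cvgMl_tmp (cvgM (e3 x) (@bump_cvg z r x)))
      (rint_norm jg)
      (fun k x _ => le1 _ x (el k x)).
    apply: (cvg_unique _ c); first exact: Rhausdorff.
    by apply: cvg_near_cst; apply: nearW => k; exact: h.
  (* Rational Euclidean balls form a countable base, so the pi-system generates the Borel sets. *)
  have qm : [set A | open A] `<=` <<s [set U : set bV | smooth_lim U /\ measurable U]>>.
    move=> U oU.
    pose J : set ('rV[rat]_d * nat) := [set qk | qball qk `<=` U].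
    have -> : U = \bigcup_(qk in J) qball qk.
      apply/seteqP; split => [x Ux|x [qk Jqk]]; last exact: Jqk.
      have [qk [qx qU]] := qball_cover oU Ux; exists qk => //.
      by apply: subset_trans qU; exact: eball_sub_cball.
    rewrite bigcup_mkcond.
    apply: (@countable_bigcupT_measurable _ (g_sigma_algebraType [set U : set bV | smooth_lim U /\ measurable U])).
      exact: countableP.
    move=> qk; case: ifP => // _; apply: sub_sigma_algebra; split.
      exact: smooth_lim_eball.
    exact: measurable_eball.
  have key : [set E | measurable (E : set bV)] `<=` [set E | measurable (E : set bV) /\ I E = 0].
    apply: (@subset_trans _ <<s [set U : set bV | smooth_lim U /\ measurable U]>>).
      apply: smallest_sub => //; exact: smallest_sigma_algebra.
    apply: lambda_system_subset; [| |by move=> U [sU mU]; split => //; exact: IG|by []].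
      by move=> A B' [sA mA] [sB mB']; split; [exact: smooth_limI|exact: measurableI].
    split => //.
    - by split => //; apply: IG => //; exact: smooth_limT.
    - move=> A A' A'A [mA IA] [mA' IA']; split; first exact: measurableD.
      rewrite -[RHS](subrr (0 : R)) -{1}IA -IA' /I -(RintegralB mOm (ji _ mA) (ji _ mA')).
      apply: eq_Rintegral => x _; rewrite -mulrBr -mulrBl; congr (_ * (_ * _)).
      rewrite !indicE in_setD; have [xA'|] := boolP (x \in A'); rewrite /= ?andbT ?subr0 ?andbF//.
      by rewrite mem_set ?subrr//; apply: A'A; rewrite -inE.
    - move=> F ndF hF; have mF n : measurable (F n : set bV) := (hF n).1.
      have mU : measurable (\bigcup_n F n : set bV) by exact: bigcup_measurable.
      split => //.
      have cI x : (\1_(F n) x : R) @[n --> \oo] --> (\1_(\bigcup_n F n) x : R).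
        apply: cvg_near_cst; have [[n _ Fn]|nF] := pselect ((\bigcup_n F n) x).
          exists n => // m /= nm; rewrite !indicE !mem_set//; first by exists n.
          by have /subsetPset := ndF _ _ nm; apply.
        apply: nearW => n; rewrite !indicE !memNset// => Fn; apply: nF; by exists n.
      have [_ c] := Rdct (mu := leb) mOm
        (f_ := fun k x => g x * (\1_(F k) x * \1_B x))
        (f := fun x => g x * (\1_(\bigcup_n F n) x * \1_B x)) (g := fun x => `|g x|)
        (fun k => mi _ (mF k)) (mi _ mU)
        (fun x _ => cvgMl_tmp (cvgMr_tmp (cI x)))
        (rint_norm jg) (fun k x _ => le1 _ x (b1 _ x)).
      apply: (cvg_unique _ c); first exact: Rhausdorff.
      by apply: cvg_near_cst; apply: nearW => n; exact: (hF n).2.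
  (* On the two sign sets the integrands have constant sign, so vanishing integrals force [g] to
     vanish almost everywhere on the ball. *)
  pose E1 : set bV := Om `&` [set x | 0 < g x]; pose E2 : set bV := Om `&` [set x | g x < 0].
  have mE1 : measurable E1.
    have -> : E1 = Om `&` g @^-1` `]0, +oo[.
      by apply/seteqP; split => x [Ox /=]; rewrite in_itv /= andbT.
    by apply: mg.
  have mE2 : measurable E2.
    have -> : E2 = Om `&` g @^-1` `]-oo, 0[.
      by apply/seteqP; split => x [Ox /=]; rewrite in_itv /=.
    by apply: mg.
  have [_ I1] := key _ mE1; have [_ I2] := key _ mE2.
  have a1 := Rintegral0_ae mOm (rint_meas (ji _ mE1)) _ (ji _ mE1) I1.
  have j2 := rintN (ji _ mE2).
  have a2 := Rintegral0_ae mOm (rint_meas j2) _ j2 _.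
  have {}a1 : {ae leb, forall x, Om x -> g x * (\1_E1 x * \1_B x) = 0}.
    apply: a1 => x Ox; rewrite indicE; have [|_] := boolP (x \in E1); last by rewrite mul0r mulr0.
    by rewrite inE => -[_ /= g0]; rewrite mul1r mulr_ge0// ltW.
  have {}a2 : {ae leb, forall x, Om x -> - (g x * (\1_E2 x * \1_B x)) = 0}.
    have n2 : \int[leb]_(x in (Om : set bV)) - (g x * (\1_E2 x * \1_B x)) = 0.
      by apply: (etrans (RintegralN mOm (ji _ mE2))); apply/eqP; rewrite oppr_eq0; exact/eqP.
    apply: a2; last exact: n2.
    move=> x Ox; rewrite indicE; have [|_] := boolP (x \in E2); last by rewrite mul0r mulr0 oppr0.
    by rewrite inE => -[_ /= g0]; rewrite mul1r -mulNr mulr_ge0// oppr_ge0 ltW.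
  apply: ae_mono2 a1 a2 => x h1 h2 Ox Bx.
  move: (h1 Ox) (h2 Ox); rewrite !indicE (mem_set Bx) !mulr1.
  have [g0|g0|//] := ltgtP (g x) 0.
    by rewrite [x \in E2]mem_set// mulr1 => _ /eqP; rewrite oppr_eq0 => /eqP.
  by rewrite [x \in E1]mem_set// mulr1.
pose J : set ('rV[rat]_d * nat) := [set qk | cball (map_mx ratr qk.1) qk.2.+1%:R^-1 `<=` Om].
have a n : {ae leb, forall x, if (unpickle n : option ('rV[rat]_d * nat)) is Some qk then
    J qk -> Om x -> qball qk x -> g x = 0 else True}.
  case: unpickle => [qk|]; last exact: ae_all.
  have [Jqk|nJ] := pselect (J qk); last by apply: ae_all.
  have q0 : (0 : R) < qk.2.+1%:R^-1 by rewrite invr_gt0.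
  by apply: ae_mono (ball0 _ _ q0 Jqk).
have := ae_foralln a; apply: ae_mono => x hx Ox; have [qk [qx qO]] := qball_cover oOm Ox.
by have := hx (pickle qk); rewrite pickleK; apply.
Qed.

End TestFunctions.

(** * The elliptic operator in weak form *)

Section NormFacts.
Context d (T : measurableType d) (R : realType).
Variables (mu : {measure set T -> \bar R}) (D : set T).
Hypothesis mD : measurable D.
Notation L2 := (L2 mu D).
Notation inr := (inner mu D).
Notation nm := (nrm mu D).

Lemma nrmD f g : L2 f -> L2 g -> nm (fun x => f x + g x) <= nm f + nm g.
Proof.
move=> Lf Lg; have Lfg := L2D mD Lf Lg.
rewrite -(@ler_sqr _ _ (nm f + nm g)) ?nnegrE ?addr_ge0 ?nrm_ge0//.
rewrite nrm_sqr (innerDl mD Lf Lg Lfg) (innerDr mD Lf Lf Lg) (innerDr mD Lg Lf Lg).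
rewrite (innerC mu D g f) sqrrD !nrm_sqr.
have := inner_le_nrm mD Lf Lg; move: (inr _ _) (inr f g) (inr g g) (nm f * nm g) => a b e p h.
by rewrite mulr2n; lra.
Qed.

Lemma nrmZ (k : R) f : L2 f -> nm (fun x => k * f x) = `|k| * nm f.
Proof.
move=> Lf; have Lk := L2Z mD k Lf.
rewrite /nrm (innerZl mD k Lf Lk) (innerZr mD k Lf Lf) mulrA -expr2 sqrtrM ?sqr_ge0//.
by rewrite sqrtr_sqr.
Qed.

Lemma nrm_le (f g : T -> R) : L2 g -> measurable_fun D f -> (forall x, D x -> `|f x| <= `|g x|) ->
  nm f <= nm g.
Proof.
move=> Lg mf fg; have Lf := L2_le mD mf fg Lg.
rewrite /nrm ler_wsqrtr// !inner_sqr; apply: le_Rintegral => //; first exact: L2_sqr.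
  exact: L2_sqr.
move=> x Dx; rewrite -(real_normK (num_real (f x))) -(real_normK (num_real (g x))).
by rewrite ler_sqr ?nnegrE// fg.
Qed.

Lemma nrm_bmul (b : T -> R) M f : L2 f -> measurable_fun D b ->
  (forall x, D x -> `|b x| <= M) -> 0 <= M -> nm (fun x => b x * f x) <= M * nm f.
Proof.
move=> Lf mb bM M0; rewrite -(ger0_norm M0) -(nrmZ M Lf); apply: nrm_le.
- exact: L2Z.
- by apply: measurable_funM => //; exact: L2_meas Lf.
- by move=> x Dx; rewrite !normrM (ger0_norm M0); apply: ler_wpM2r => //; exact: bM.
Qed.

Lemma nrm_ae f g : measurable_fun D f -> measurable_fun D g ->
  {ae mu, forall x, D x -> f x = g x} -> nm f = nm g.
Proof.
move=> mf mg fg; rewrite /nrm !inner_sqr; congr Num.sqrt.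
apply: (Rintegral_ae_eq mD); [exact: measurable_funX|exact: measurable_funX|].
by apply: filterS fg => x h Dx; rewrite h.
Qed.

Lemma Rintegral_eq0 (f : T -> R) : (forall x, D x -> f x = 0) -> \int[mu]_(x in D) f x = 0.
Proof.
move=> f0; transitivity (\int[mu]_(x in D) (0 : R)).
  by apply: eq_Rintegral => x; rewrite inE; exact: f0.
by rewrite (Rintegral_cst mu mD) mul0r.
Qed.

Lemma nrm_lim_le (f_ : nat -> T -> R) f (b : nat -> R) :
  (forall n, nm (fun x => f_ n x - f x) <= b n) -> b n @[n --> \oo] --> 0 ->
  nm (fun x => f_ n x - f x) @[n --> \oo] --> 0.
Proof.
move=> h b0; apply: (squeeze_cvgr _ (cvg_cst 0) b0).
by apply: nearW => n; rewrite nrm_ge0 h.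
Qed.

End NormFacts.

Section WeakOperator.
Context {R : realType} {d : nat}.
Notation V := 'rV[R]_d.
Notation bV := (borelRV R d).
Notation leb := (@leb R d).
Variable Om : set V.
Hypotheses (oOm : open Om) (bOm : bounded_set Om).
Notation test := (test_function Om).
Notation inr := (inner leb (Om : set bV)).
Notation nm := (nrm leb (Om : set bV)).
Notation L2 := (L2 leb (Om : set bV)).
Variables (A : V -> 'M[R]_d) (c : V -> R) (L th : R).
Hypothesis L0 : 0 <= L.
Hypothesis cA : forall i j x, Om x -> {for x, continuous (fun y => A y i j)}.
Hypothesis bA : forall i j x, Om x -> `|A x i j| <= L.
Hypothesis sA : forall i j x, Om x -> A x i j = A x j i.
Hypothesis th0 : 0 < th.
Hypothesis ellA : forall x (xi : 'I_d -> R), Om x ->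
  th * (\sum_i xi i ^+ 2) <= \sum_i \sum_j A x i j * xi j * xi i.
Hypothesis cc : forall x, Om x -> {for x, continuous c}.
Hypothesis bc : forall x, Om x -> 0 <= c x <= L.
Implicit Types (f g h u v w eta : V -> R) (G : 'I_d -> V -> R) (psi : nat -> V -> R).

Let mOm : measurable (Om : set bV). Proof. exact: measurable_open. Qed.
Let fOm : (leb Om < +oo)%E. Proof. exact: leb_bounded. Qed.
Let mA i j : measurable_fun (Om : set bV) (fun x => A x i j).
Proof. by apply: measurable_cont => // x; exact: cA. Qed.
Let mc : measurable_fun (Om : set bV) c.
Proof. exact: measurable_cont. Qed.
Let bc' x : Om x -> `|c x| <= L.
Proof. by move=> /bc/andP[c0 cL]; rewrite ger0_norm. Qed.

Lemma L2A i j f : L2 f -> L2 (fun x => A x i j * f x).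
Proof. by move=> Lf; apply: (L2_bmul mOm (mA i j) _ Lf) => x; exact: bA. Qed.

Lemma L2c f : L2 f -> L2 (fun x => c x * f x).
Proof. by move=> Lf; apply: (L2_bmul mOm mc bc' Lf). Qed.

Definition bform G G' : R := \sum_i \sum_j inr (fun x => A x i j * G j x) (G' i).

Definition approx w G (psi : nat -> V -> R) :=
  [/\ forall k, test (psi k), nm (fun x => psi k x - w x) @[k --> \oo] --> 0 &
      forall i, nm (fun x => pd i (psi k) x - G i x) @[k --> \oo] --> 0].

(* [w] is in H^1_0, with weak gradient [G], and [- div (A grad w) + c w = h] weakly. *)
Definition wkA w h := [/\ L2 w, L2 h & exists G psi,
  [/\ forall i, L2 (G i), approx w G psi &
    forall eta, test eta ->
      bform G (fun i => pd i eta) + inr (fun x => c x * w x) eta = inr h eta]].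

Lemma bform_cvg G G' (H : nat -> 'I_d -> V -> R) : (forall i, L2 (G i)) ->
  (forall i, L2 (G' i)) -> (forall k i, L2 (H k i)) ->
  (forall i, nm (fun x => H k i x - G' i x) @[k --> \oo] --> 0) ->
  bform G (H k) @[k --> \oo] --> bform G G'.
Proof.
move=> LG LG' LH hc; apply: cvg_bigsum => i _; apply: cvg_bigsum => j _.
rewrite innerC; under eq_cvg do rewrite innerC.
by apply: (inner_cvg mOm) => //; exact: L2A.
Qed.

Lemma test_L2' eta : test eta -> L2 eta. Proof. exact: test_L2. Qed.

(* The weak form extends from test functions to their limits. *)
Lemma weak_form w h G v G' psi : L2 w -> L2 h -> (forall i, L2 (G i)) ->
  (forall eta, test eta ->
      bform G (fun i => pd i eta) + inr (fun x => c x * w x) eta = inr h eta) ->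
  L2 v -> (forall i, L2 (G' i)) -> approx v G' psi ->
  bform G G' + inr (fun x => c x * w x) v = inr h v.
Proof.
move=> Lw Lh LG weak Lv LG' [tp pv pG].
have c1 : bform G (fun i => pd i (psi k)) @[k --> \oo] --> bform G G'.
  apply: bform_cvg => // k i; exact/test_L2'/test_pd.
have c2 f : L2 f -> inr f (psi k) @[k --> \oo] --> inr f v.
  move=> Lf; rewrite innerC; under eq_cvg do rewrite innerC.
  by apply: (inner_cvg mOm) => // k; exact: test_L2'.
have c3 : bform G (fun i => pd i (psi k)) + inr (fun x => c x * w x) (psi k) @[k --> \oo] -->
    bform G G' + inr (fun x => c x * w x) v.
  by apply: cvgD; [exact: c1|exact: (c2 _ (L2c Lw))].
have E : (fun k => bform G (fun i => pd i (psi k)) + inr (fun x => c x * w x) (psi k)) =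
    (fun k => inr h (psi k)) by apply/funext => k; exact: weak.
by rewrite E in c3; apply: (cvg_unique _ c3 (c2 _ Lh)); exact: Rhausdorff.
Qed.

(** Each equation is tested with the solution of the other, and the form is symmetric. *)
Lemma wkA_sym u h v k : wkA u h -> wkA v k -> inr h v = inr k u.
Proof.
move=> [Lu Lh [G [psi [LG ap weak]]]] [Lv Lk [G' [psi' [LG' ap' weak']]]].
rewrite -(weak_form Lu Lh LG weak Lv LG' ap') -(weak_form Lv Lk LG' weak' Lu LG ap).
congr (_ + _); last first.
  rewrite /inner; apply: eq_Rintegral => x _; ring.
rewrite /bform exchange_big; apply: eq_bigr => i _; apply: eq_bigr => j _.
by apply: eq_Rintegral => x; rewrite inE => Ox; rewrite (sA j i Ox); ring.
Qed.

Lemma wkA_lin (a b : R) w h w' h' : wkA w h -> wkA w' h' ->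
  wkA (fun x => a * w x + b * w' x) (fun x => a * h x + b * h' x).
Proof.
move=> [Lu Lh [G [psi [LG [tp pw pG] weak]]]] [Lv Lk [G' [psi' [LG' [tp' pw' pG'] weak']]]].
have LC f g : L2 f -> L2 g -> L2 (fun x => a * f x + b * g x).
  by move=> Lf Lg; apply: (L2D mOm); exact: L2Z.
have CV (f_ g_ : nat -> V -> R) f g : (forall k, L2 (f_ k)) -> (forall k, L2 (g_ k)) ->
    L2 f -> L2 g -> nm (fun x => f_ k x - f x) @[k --> \oo] --> 0 ->
    nm (fun x => g_ k x - g x) @[k --> \oo] --> 0 ->
    nm (fun x => (a * f_ k x + b * g_ k x) - (a * f x + b * g x)) @[k --> \oo] --> 0.
  move=> Lf_ Lg_ Lf Lg cf cg.
  have B k : nm (fun x => (a * f_ k x + b * g_ k x) - (a * f x + b * g x)) <=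
      `|a| * nm (fun x => f_ k x - f x) + `|b| * nm (fun x => g_ k x - g x).
    have L1 := L2B mOm (Lf_ k) Lf; have L3 := L2B mOm (Lg_ k) Lg.
    rewrite -(nrmZ mOm a L1) -(nrmZ mOm b L3).
    apply: le_trans (nrmD mOm (L2Z mOm a L1) (L2Z mOm b L3)).
    rewrite le_eqVlt; apply/orP; left; apply/eqP; congr nrm; apply/funext => x; ring.
  have C : `|a| * nm (fun x => f_ k x - f x) + `|b| * nm (fun x => g_ k x - g x)
      @[k --> \oo] --> `|a| * 0 + `|b| * 0.
    by apply: cvgD; exact: cvgMl_tmp.
  rewrite !mulr0 addr0 in C; exact: (nrm_lim_le B C).
split; [exact: LC|exact: LC|].
exists (fun i x => a * G i x + b * G' i x), (fun k x => a * psi k x + b * psi' k x); split.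
- by move=> i; exact: LC.
- split.
  + by move=> k; apply: testD; exact: testZ.
  + by apply: CV => // k; exact: test_L2'.
  + move=> i; rewrite (_ : (fun k => _) = (fun k => nm (fun x =>
        (a * pd i (psi k) x + b * pd i (psi' k) x) - (a * G i x + b * G' i x)))).
      by apply: CV => // k; apply/test_L2'/test_pd.
    apply/funext => k; congr nrm; apply/funext => x; congr (_ - _).
    have d1 := Cinfty_derive i x (tp k).1; have d2 := Cinfty_derive i x (tp' k).1.
    have d3 : is_derive x (@basis_vec R d i) (a *: psi k + b *: psi' k)
      (a *: pd i (psi k) x + b *: pd i (psi' k) x) by exact: is_deriveD.
    by case: d3.
- move=> eta te; have Le := test_L2' te; have Lp i := test_L2' (test_pd i te).
  rewrite (innerDl mOm (L2Z mOm a Lh) (L2Z mOm b Lk) Le) (innerZl mOm a Lh Le) (innerZl mOm b Lk Le).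
  rewrite -weak// -weak'//.
  have -> : inr (fun x => c x * (a * w x + b * w' x)) eta =
      a * inr (fun x => c x * w x) eta + b * inr (fun x => c x * w' x) eta.
    rewrite -(innerZl mOm a (L2c Lu) Le) -(innerZl mOm b (L2c Lv) Le).
    rewrite -(innerDl mOm (L2Z mOm a (L2c Lu)) (L2Z mOm b (L2c Lv)) Le).
    by apply: inner_eq => // x _; ring.
  have -> : bform (fun i x => a * G i x + b * G' i x) (fun i => pd i eta) =
      a * bform G (fun i => pd i eta) + b * bform G' (fun i => pd i eta).
    rewrite /bform !mulr_sumr -big_split; apply: eq_bigr => i _.
    rewrite !mulr_sumr -big_split; apply: eq_bigr => j _ /=.
    rewrite -(innerZl mOm a (L2A i j (LG j)) (Lp i)) -(innerZl mOm b (L2A i j (LG' j)) (Lp i)).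
    rewrite -(innerDl mOm (L2Z mOm a (L2A i j (LG j))) (L2Z mOm b (L2A i j (LG' j))) (Lp i)).
    by apply: inner_eq => // x _; ring.
  ring.
Qed.

Lemma wkA0 : wkA (fun=> 0) (fun=> 0).
Proof.
have Z : L2 (fun=> 0) by exact: L20.
have n0 : nm (fun=> 0 - 0) = 0 by rewrite subr0 /nrm inner_sqr (Rintegral_eq0 _ mOm) ?sqrtr0// => x _; rewrite expr0n.
split => //; exists (fun _ _ => 0), (fun _ _ => 0); split => //.
- split; first by move=> k; exact: test0.
    by apply: cvg_near_cst; apply: nearW => k.
  move=> i; apply: cvg_near_cst; apply: nearW => k.
  rewrite -[RHS]n0; congr nrm; apply/funext => x; congr (_ - _).
  by rewrite /pd derive_cst.
- move=> eta te; have I0 g : inr (fun=> 0) g = 0.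
    by rewrite /inner (Rintegral_eq0 _ mOm)// => x _; rewrite mul0r.
  rewrite I0 (_ : (fun x => c x * 0) = fun=> 0); last by apply/funext => x; rewrite mulr0.
  rewrite I0 addr0 /bform big1// => i _; rewrite big1// => j _.
  by rewrite (_ : (fun x => A x i j * 0) = fun=> 0) ?I0//; apply/funext => x; rewrite mulr0.
Qed.

Lemma weak_pd_unique i f g g' : L2 g -> L2 g' -> weak_pd Om i f g -> weak_pd Om i f g' ->
  {ae leb, forall x, Om x -> g x = g' x}.
Proof.
move=> Lg Lg' h h'; have LB := L2B mOm Lg Lg'.
have := test_dense oOm bOm (L2_rint oOm bOm LB).
move=> H; apply: ae_mono (H _) => [x e Ox|eta te].
  by apply/eqP; rewrite -subr_eq0; apply/eqP; exact: e.
have e1 := h _ te; have e2 := h' _ te; have Le := test_L2' te.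
have := innerBl mOm Lg Lg' Le; rewrite /inner => ->.
apply/eqP; rewrite subr_eq0 -eqr_opp; apply/eqP.
exact: (etrans (esym e1) e2).
Qed.

Lemma opA_wkA f h : opA Om A c f h -> wkA f h.
Proof.
move=> [[_ [G1 [[Lf hG1] [psi [tp pf pG]]]]] [Lh [G [W [[_ hG] hW hae]]]]].
have LG i : L2 (G i) := (hG i).1; have LG1 i : L2 (G1 i) := (hG1 i).1.
have LW i : L2 (W i) := (hW i).1.
split => //; exists G, psi; split => //.
- split => //; first by apply/(L2cvgP mOm) => // k; exact: test_L2'.
  (* The gradient provided by [H10] and the one in the equation are given separately and have to be
     identified. *)
  move=> i; have e : {ae leb, forall x, Om x -> G1 i x = G i x}.
    by apply: (@weak_pd_unique i f) => //; [exact: (hG1 i).2|exact: (hG i).2].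
  have := pG i; move/(L2cvgP mOm) => H.
  have Lp k : L2 (pd i (psi k)) by exact/test_L2'/test_pd.
  have {}H := H Lp (LG1 i).
  rewrite (_ : (fun k => _) = (fun k => nm (fun x => pd i (psi k) x - G1 i x)))//.
  apply/funext => k; apply: (nrm_ae mOm).
  + exact: (L2_meas (L2B mOm (Lp k) (LG i))).
  + exact: (L2_meas (L2B mOm (Lp k) (LG1 i))).
  + by apply: ae_mono e => x e Ox; rewrite e.
- move=> eta te; have Le := test_L2' te; have Lp i := test_L2' (test_pd i te).
  have e1 i : \sum_j inr (fun x => A x i j * G j x) (pd i eta) = - inr (W i) eta.
    rewrite -(inner_suml mOm _ (fun j _ => L2A i j (LG j)) (Lp i)).
    exact: (hW i).2.
  rewrite /bform (eq_bigr _ (fun i _ => e1 i)) sumrN -(inner_suml mOm _ (fun j _ => LW j) Le)//.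
  have LS : L2 (fun x => \sum_(i < d) W i x) by apply: (L2_sum mOm) => i _; exact: LW.
  rewrite -(innerNl mOm LS Le) -(innerDl mOm (L2N mOm LS) (L2c Lf) Le).
  apply: (Rintegral_ae_eq mOm).
  + apply: measurable_funM; last exact: L2_meas Le.
    exact: (L2_meas (L2D mOm (L2N mOm LS) (L2c Lf))).
  + by apply: measurable_funM; [exact: (L2_meas Lh)|exact: (L2_meas Le)].
  + by apply: ae_mono hae => x e Ox; rewrite e.
Qed.

Section Truncation.
Variables K eps : R.
Hypotheses (K0 : 0 <= K) (eps0 : 0 < eps).

(* A smooth approximation of the positive part of [s - K]. *)
Definition trunc (s : R) : R := (s - K) * flat eps 0 (s - K).
Definition dtrunc (s : R) : R := flat eps 0 (s - K) + (s - K) * (eps * flat eps 2 (s - K)).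

Lemma trunc_le0 s : s <= K -> trunc s = 0.
Proof. by move=> sK; rewrite /trunc flat_le0 ?mulr0// subr_le0. Qed.

Lemma trunc_ge0 s : 0 <= trunc s.
Proof.
have [/trunc_le0 ->//|Ks] := leP s K.
by rewrite mulr_ge0 ?flat_ge0// subr_ge0 ltW.
Qed.

Lemma is_derive_trunc s : is_derive s (1 : R) trunc (dtrunc s).
Proof.
have d1 : is_derive s (1 : R) (fun s : R => s - K) 1.
  have d0 : is_derive s (1 : R) (id - cst K) (1 - 0) by exact: is_deriveB.
  by apply: (is_derive_eq d0); rewrite subr0.
have d2 := @is_derive_comp R R (flat eps 0) (fun s => s - K) s 1 1 _ (is_derive_flat eps0 0 (s - K)) d1.
have d3 : is_derive s (1 : R) (fun s => (s - K) * flat eps 0 (s - K)) _ := is_deriveM d1 d2.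
by apply: (is_derive_eq d3); rewrite /GRing.scale /= /dtrunc mul0r subr0 !mulr1 addrC.
Qed.

(** With y = eps/x the derivative is (1 + y) exp(-y). *)
Lemma dtrunc01 s : 0 <= dtrunc s <= 1.
Proof.
rewrite /dtrunc; have [sK|Ks] := leP s K.
  by rewrite !flat_le0 ?subr_le0// !mulr0 addr0 lexx ler01.
have x0 : 0 < s - K by rewrite subr_gt0.
rewrite (flatE _ 2 x0) /flat x0 expr0 mul1r; move: (s - K) x0 => x x0.
have -> : expR (- (eps / x)) + x * (eps * (x^-1 ^+ 2 * expR (- (eps / x)))) =
    (1 + eps / x) * expR (- (eps / x)).
  by move: (expR _) => e; field; rewrite gt_eqF.
have y0 : 0 <= eps / x by rewrite divr_ge0// ltW.
rewrite mulr_ge0 ?expR_ge0 ?addr_ge0//= expRN ler_pdivrMr ?expR_gt0// mul1r.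
exact: expR_ge1Dx.
Qed.

Lemma trunc_lip a b : `|trunc a - trunc b| <= `|a - b|.
Proof.
wlog ba : a b / b <= a => [H|].
  by have [/H//|/ltW/H] := leP b a; rewrite distrC (distrC a).
have ab0 : 0 <= a - b by rewrite subr_ge0.
have df y : derivable trunc y 1 by case: (is_derive_trunc y).
have bd y : `|'D_1 trunc y| <= 1.
  have [_ ->] := is_derive_trunc y; have /andP[h1 h2] := dtrunc01 y.
  by rewrite ger0_norm.
have := is_derive_dist_le b ab0 df bd.
rewrite mul1r [_ *: 1]mulr1 (addrC b) subrK => /le_trans; apply.
exact: ler_norm.
Qed.

Lemma trunc_sqr_le s : trunc s ^+ 2 <= (s - K) * trunc s.
Proof.
have [sK|Ks] := leP s K; first by rewrite trunc_le0// expr2 !mulr0.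
rewrite expr2; apply: ler_wpM2r; first exact: trunc_ge0.
by apply: ler_piMr; [rewrite subr_ge0 ltW|exact: flat0_le1].
Qed.

Lemma trunc_approx s : s - K <= trunc s + eps.
Proof.
have [sK|Ks] := leP s K.
  by rewrite (le_trans (_ : s - K <= 0)) ?subr_le0// addr_ge0 ?trunc_ge0// ltW.
have x0 : 0 < s - K by rewrite subr_gt0.
rewrite /trunc /flat x0 expr0 mul1r; move: (s - K) x0 => x x0.
have h : 1 - eps / x <= expR (- (eps / x)) by exact: expR_ge1Dx.
have : x * (1 - eps / x) <= x * expR (- (eps / x)) by rewrite ler_pM2l.
have -> : x * (1 - eps / x) = x - eps by field; rewrite gt_eqF.
by rewrite lerBlDr.
Qed.

Lemma trunc_test eta : test eta -> test (fun x => trunc (eta x)) /\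
  forall i x, pd i (fun x => trunc (eta x)) x = dtrunc (eta x) * pd i eta x.
Proof.
move=> te; split; last first.
  move=> i x; have d1 := Cinfty_derive i x te.1.
  by case: (is_derive_comp (is_derive_trunc (eta x)) d1).
have [he [C [cC CO C0]]] := te; split; last first.
  by exists C; split => // x nC; rewrite C0//; exact: trunc_le0.
have hK : Cinfty setT (fun x => eta x + cst (- K) x) by apply: CinftyD => //; exact: Cinfty_cst.
exact: (CinftyM hK (Cinfty_flat 0 eps0 hK)).
Qed.

Lemma measurable_trunc_comp f : measurable_fun (Om : set bV) f ->
  measurable_fun (Om : set bV) (fun x => trunc (f x)).
Proof.
move=> mf; apply: (measurableT_comp _ mf); apply: continuous_measurable_fun => y.
apply: differentiable_continuous; apply/derivable1_diffP; by case: (is_derive_trunc y).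
Qed.

Lemma measurable_dtrunc_comp f : measurable_fun (Om : set bV) f ->
  measurable_fun (Om : set bV) (fun x => dtrunc (f x)).
Proof.
have cf n : continuous (flat eps n).
  move=> y; apply: differentiable_continuous; apply/derivable1_diffP.
  by case: (is_derive_flat eps0 n y).
move=> mf; have mfK : measurable_fun (Om : set bV) (fun x => f x - K) by exact: measurable_funB.
have mfl n : measurable_fun (Om : set bV) (fun x => flat eps n (f x - K)).
  by apply: (measurableT_comp _ mfK); apply: continuous_measurable_fun; exact: cf.
by apply: measurable_funD => //; apply: measurable_funM => //; exact: measurable_funM.
Qed.

Lemma L2_trunc w : L2 w -> L2 (fun x => trunc (w x)).
Proof.
move=> Lw; apply: (L2_le mOm (g := w)) => //.
  exact: (measurable_trunc_comp (L2_meas Lw)).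
move=> x _; have := trunc_lip (w x) 0; rewrite (trunc_le0 K0) !subr0.
exact.
Qed.

(* Testing with [trunc (psi k)] rather than its limit: the diffusion term is
   nonnegative up to the error made in replacing [grad w] by [grad psi k]. *)
Lemma core_ge0 w h : wkA w h -> 0 <= inr (fun x => h x - c x * w x) (fun x => trunc (w x)).
Proof.
move=> [Lw Lh [G [psi [LG [tp pw pG] weak]]]].
have Lp k : L2 (psi k) by exact: test_L2'.
have Ld k i : L2 (pd i (psi k)) by exact/test_L2'/test_pd.
have Lhc := L2B mOm Lh (L2c Lw).
pose eta k x := trunc (psi k x).
have te k : test (eta k) := (trunc_test (tp k)).1.
have Le k : L2 (eta k) by exact: test_L2'.
have Lt := L2_trunc Lw.
pose n k i := nm (fun x => pd i (psi k) x - G i x).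
(* A bound for the diffusion term in which the gradient [G] is replaced by its distance to the
   gradient of [psi k]. *)
pose err k := \sum_i \sum_j L * n k j * (n k i + nm (G i)).
have err0 : - err k @[k --> \oo] --> 0.
  have : err k @[k --> \oo] --> \sum_(i < d) \sum_(j < d) L * 0 * (0 + nm (G i)).
    apply: cvg_bigsum => i _; apply: cvg_bigsum => j _.
    apply: cvgM; first by apply: cvgMl_tmp; exact: pG.
    by apply: cvgD; [exact: pG|exact: cvg_cst].
  rewrite big1 => [H|i _]; last by rewrite big1// => j _; rewrite mulr0 mul0r.
  by rewrite -oppr0; exact: cvgN.
have c1 : inr (fun x => h x - c x * w x) (eta k) @[k --> \oo] -->
    inr (fun x => h x - c x * w x) (fun x => trunc (w x)).
  rewrite innerC; under eq_cvg do rewrite innerC.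
  apply: (inner_cvg mOm) => //; apply: (nrm_lim_le _ pw) => k.
  apply: (nrm_le mOm); [exact: (L2B mOm)|exact: (L2_meas (L2B mOm (Le k) Lt))|].
  by move=> x _; exact: trunc_lip.
apply: (ler_cvg_to err0 c1); apply: nearW => k.
have -> : inr (fun x => h x - c x * w x) (eta k) = bform G (fun i => pd i (eta k)).
  by rewrite (innerBl mOm Lh (L2c Lw) (Le k)) -weak// addrK.
pose g x := dtrunc (psi k x).
have mg : measurable_fun (Om : set bV) g by apply: measurable_dtrunc_comp; exact: (L2_meas (Lp k)).
have g01 x : 0 <= g x <= 1 by exact: dtrunc01.
have g1 x : Om x -> `|g x| <= 1 by move=> _; case/andP: (g01 x) => a b; rewrite ger0_norm.
have Lg i : L2 (fun x => g x * pd i (psi k) x) by exact: (L2_bmul mOm mg g1 (Ld k i)).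
have -> : bform G (fun i => pd i (eta k)) = bform G (fun i x => g x * pd i (psi k) x).
  apply: eq_bigr => i _; apply: eq_bigr => j _; apply: eq_Rintegral => x _.
  by rewrite (trunc_test (tp k)).2.
have LB j : L2 (fun x => G j x - pd j (psi k) x) by exact: (L2B mOm).
have -> : bform G (fun i x => g x * pd i (psi k) x) =
    bform (fun j => pd j (psi k)) (fun i x => g x * pd i (psi k) x) +
    bform (fun j x => G j x - pd j (psi k) x) (fun i x => g x * pd i (psi k) x).
  rewrite /bform -big_split; apply: eq_bigr => i _; rewrite -big_split; apply: eq_bigr => j _ /=.
  rewrite -(innerDl mOm (L2A i j (Ld k j)) (L2A i j (LB j)) (Lg i)).
  by apply: inner_eq => // x _; ring.
(* The first form is the integral of a nonnegative factor times an elliptic quadratic form; the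
   second is the error. *)
rewrite -[leLHS]add0r; apply: lerD.
  pose q i j x := (A x i j * pd j (psi k) x) * (g x * pd i (psi k) x).
  have jq i j : rint leb (Om : set bV) (q i j) by apply: (rint_mul mOm); [exact: L2A|exact: Lg].
  have -> : bform (fun j => pd j (psi k)) (fun i x => g x * pd i (psi k) x) =
      \int[leb]_(x in (Om : set bV)) \sum_i \sum_j q i j x.
    rewrite (Rintegral_sum mOm _ (fun i _ => rint_sum mOm _ (fun j _ => jq i j))).
    by apply: eq_bigr => i _; rewrite (Rintegral_sum mOm _ (fun j _ => jq i j)).
  apply: Rintegral_ge0 => x Ox.
  have -> : \sum_i \sum_j q i j x = g x * (\sum_i \sum_j A x i j * pd j (psi k) x * pd i (psi k) x).
    rewrite mulr_sumr; apply: eq_bigr => i _; rewrite mulr_sumr; apply: eq_bigr => j _.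
    by rewrite /q; ring.
  apply: mulr_ge0; first by case/andP: (g01 x).
  apply: le_trans (ellA (fun i => pd i (psi k) x) Ox).
  by apply: mulr_ge0; [exact: ltW|apply: sumr_ge0 => i _; exact: sqr_ge0].
rewrite /err -sumrN; apply: ler_sum => i _; rewrite -sumrN; apply: ler_sum => j _.
have h1 := CauchySchwarz mOm (L2A i j (LB j)) (Lg i).
have h2 : nm (fun x => A x i j * (G j x - pd j (psi k) x)) <= L * n k j.
  have -> : n k j = nm (fun x => G j x - pd j (psi k) x).
    rewrite /n -[LHS]mul1r -(@normrN1 R) -(nrmZ mOm (-1) (L2B mOm (Ld k j) (LG j))).
    congr nrm; apply/funext => x; ring.
  by apply: (nrm_bmul mOm) => // x; exact: bA.
have h3 : nm (fun x => g x * pd i (psi k) x) <= n k i + nm (G i).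
  apply: (@le_trans _ _ (1 * nm (pd i (psi k)))); first exact: (nrm_bmul mOm).
  rewrite mul1r; have := nrmD mOm (L2B mOm (Ld k i) (LG i)) (LG i).
  apply: le_trans; rewrite le_eqVlt; apply/orP; left; apply/eqP; congr nrm.
  by apply/funext => x; rewrite subrK.
have h4 := ler_pM (nrm_ge0 _ _ _) (nrm_ge0 _ _ _) h2 h3.
have := le_trans h1 h4; rewrite ler_norml => /andP[+ _].
exact.
Qed.

End Truncation.

(* The error [g] allows for applying this to partial sums of eigenfunction expansions. *)
Lemma max_principle w h (m K : R) g eta : wkA w h -> 0 < m -> 0 <= K -> L2 g ->
  {ae leb, forall x, Om x -> h x + m * w x <= m * K + g x} ->
  L2 eta -> {ae leb, forall x, Om x -> 0 <= eta x} ->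
  inr (fun x => w x - K) eta <= nm g * nm eta / m.
Proof.
move=> hw m0 K0 Lg hle Le e0; have [Lw Lh _] := hw.
have LK : L2 (fun=> K) by exact: L2_cst.
have L1 : L2 (fun=> 1) by exact: L2_cst.
have LwK := L2B mOm Lw LK.
(* With t the truncation, [core_ge0] and the assumed inequality give m (w - K, t) <= (g, t), while
   (t, t) <= (w - K, t). *)
have nT eps : 0 < eps -> nm (fun x => trunc K eps (w x)) <= nm g / m.
  move=> eps0; have Lt := L2_trunc K0 eps0 Lw; set t := fun x => trunc K eps (w x).
  have h1 := core_ge0 K0 eps0 hw; rewrite -/t in h1.
  have h2 : inr (fun x => h x - c x * w x) t <= inr g t - m * inr (fun x => w x - K) t.
    rewrite -(innerZl mOm m LwK Lt) -(innerBl mOm Lg (L2Z mOm m LwK) Lt).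
    apply: (le_Rintegral_ae mOm).
    - by apply: (rint_mul mOm) => //; apply: (L2B mOm) => //; exact: L2c.
    - by apply: (rint_mul mOm) => //; apply: (L2B mOm) => //; exact: L2Z.
    - apply: ae_mono hle => x hx Ox; have {}hx := hx Ox.
      have [wK|wK] := leP (w x) K; first by rewrite /t trunc_le0// !mulr0.
      apply: ler_wpM2r; first exact: trunc_ge0.
      have c0 : 0 <= c x * w x by rewrite mulr_ge0//; [case/andP: (bc Ox)|rewrite (le_trans K0)// ltW].
      by rewrite mulrBr; lra.
  have h3 : inr t t <= inr (fun x => w x - K) t.
    rewrite inner_sqr; apply: le_Rintegral => //.
    - exact: L2_sqr.
    - exact: (rint_mul mOm).
    - by move=> x _; exact: trunc_sqr_le.
  have h4 := inner_le_nrm mOm Lg Lt; rewrite -nrm_sqr in h3.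
  have n0 := nrm_ge0 leb (Om : set bV) t; rewrite ler_pdivlMr// mulrC.
  have h5 : m * nm t ^+ 2 <= nm g * nm t.
    apply: (@le_trans _ _ (m * inr (fun x => w x - K) t)); first by rewrite ler_pM2l.
    by apply: le_trans h4; rewrite -subr_ge0; exact: le_trans h1 h2.
  have [t0|t0] := leP (nm t) 0.
    by rewrite (@le_anti _ _ (nm t) 0) ?t0 ?n0// mulr0 nrm_ge0.
  by move: h5; rewrite expr2 mulrA ler_pM2r.
have I0 : 0 <= inr (fun=> 1) eta.
  apply: (inner_nonneg mOm) => //; exact: ae_all.
apply/ler_addgt0Pl => del del0.
(* The smoothing costs at most [eps] times the integral of [eta], hence at most [del]; the added 1
   avoids a division by zero. *)
pose eps := del / (inr (fun=> 1) eta + 1).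
have I1 : 0 < inr (fun=> 1) eta + 1 by rewrite ltr_wpDl.
have eps0 : 0 < eps by rewrite divr_gt0.
have Lt := L2_trunc K0 eps0 Lw.
apply: (@le_trans _ _ (inr (fun x => trunc K eps (w x) + eps * 1) eta)).
  apply: (le_Rintegral_ae mOm).
  - exact: (rint_mul mOm).
  - by apply: (rint_mul mOm) => //; apply: (L2D mOm) => //; exact: L2Z.
  - apply: ae_mono e0 => x ex Ox; apply: ler_wpM2r; first exact: ex.
    by rewrite mulr1; exact: trunc_approx.
rewrite (innerDl mOm Lt (L2Z mOm eps L1) Le) (innerZl mOm eps L1 Le) addrC; apply: lerD.
  rewrite /eps mulrAC ler_pdivrMr// ler_pM2l// lerDl//.
apply: le_trans (inner_le_nrm mOm Lt Le) _.
rewrite mulrAC; apply: ler_wpM2r; [exact: nrm_ge0|exact: nT].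
Qed.

End WeakOperator.

(** * Barriers and resolvents *)

Section Barrier.
Context {R : realType} {d : nat}.
Notation V := 'rV[R]_d.
Notation bV := (borelRV R d).
Notation leb := (@leb R d).
Variable Om : set V.
Hypotheses (oOm : open Om) (bOm : bounded_set Om).
Notation test := (test_function Om).
Notation inr := (inner leb (Om : set bV)).
Notation nm := (nrm leb (Om : set bV)).
Notation L2 := (L2 leb (Om : set bV)).
Notation basis := (@basis_vec R d).
Variables (A : V -> 'M[R]_d) (c : V -> R) (L th : R).
Hypothesis L0 : 0 <= L.
Hypothesis cA : forall i j x, Om x -> {for x, continuous (fun y => A y i j)}.
Hypothesis bA : forall i j x, Om x -> `|A x i j| <= L.
Hypothesis dA : forall k i j x, Om x -> derivable (fun y => A y i j) x (basis k).
Hypothesis cdA : forall k i j x, Om x -> {for x, continuous (pd k (fun y => A y i j))}.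
Hypothesis bdA : forall k i j x, Om x -> `|pd k (fun y => A y i j) x| <= L.
Hypothesis cc : forall x, Om x -> {for x, continuous c}.
Hypothesis bc : forall x, Om x -> 0 <= c x <= L.
Hypothesis th0 : 0 < th.
Hypothesis ellA : forall x (xi : 'I_d -> R), Om x ->
  th * (\sum_i xi i ^+ 2) <= \sum_i \sum_j A x i j * xi j * xi i.

Let mOm : measurable (Om : set bV). Proof. exact: measurable_open. Qed.

(** Integration by parts in disguise: [F * eta], zero outside [Om], has a bounded derivative on the
    whole space although [F] is controlled only inside [Om]. *)
Lemma integral_div0 (i : 'I_d) (F E eta : V -> R) (K M : R) : test eta ->
  (forall x, Om x -> {for x, continuous F}) -> (forall x, Om x -> `|F x| <= K) ->
  (forall x, Om x -> is_derive x (basis i) (fun y => F y * eta y) (E x)) ->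
  (forall x, Om x -> `|E x| <= M) -> \int[leb]_(x in (Om : set bV)) E x = 0.
Proof.
move=> te cF bF dF bE; have [he [C [cC CO C0]]] := te.
have [N bN] := test_bounded te.
have eta_out := test_out te.
pose H y := F y * eta y.
have H0 y : ~ Om y -> H y = 0 by move=> nO; rewrite /H eta_out// mulr0.
have dout x : ~ Om x -> is_derive x (basis i) H 0.
  move=> nO; have cl : closed C by apply: compact_closed => //; exact: norm_hausdorff.
  have E' : \forall y \near x, (cst 0 : V -> R) y = H y.
    have : nbhs x (~` C) by apply: open_nbhs_nbhs; split; [exact: closed_openC|move=> /CO].
    by apply: filterS => y /C0 e; rewrite /H e mulr0.
  exact: (is_derive_near E' (is_derive_cst _ _ _)).
pose D := E \_ Om.
have dH x : is_derive x (basis i) H (D x).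
  rewrite /D patchE; case: ifPn => [|]; first by rewrite inE; exact: dF.
  by rewrite notin_setE; exact: dout.
have [r [r0 Or]] : exists r, 0 < r /\ forall x, Om x -> ball 0 r x.
  have [M1 [_ BM1]] := bOm; exists (`|M1| + 2); split; first by rewrite ltr_wpDl.
  move=> x Ox; rewrite -ball_normE /ball_ /= sub0r normrN.
  apply: (@le_lt_trans _ _ (`|M1| + 1)); last by rewrite ltrD2l ltr1n.
  by apply: BM1 => //; rewrite ltr_pwDr// ler_norm.
have mH : measurable_fun (setT : set bV) H.
  have -> : H = H \_ Om.
    by apply/funext => y; rewrite patchE; case: ifPn => //; rewrite notin_setE => /H0.
  apply: (proj1 (measurable_restrictT (D := (Om : set bV)) H mOm)).
  apply: measurable_cont => // x Ox; apply: continuousM; [exact: cF|exact: (test_cont te)].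
have M0 : 0 <= `|M| by [].
have bD x : `|'D_(basis i) H x| <= `|M|.
  have [_ ->] := dH x; rewrite /D patchE; case: ifPn => [|_]; last by rewrite normr0.
  by rewrite inE => Ox; apply: le_trans (bE x Ox) (ler_norm _).
have bH x : `|H x| <= `|K| * `|N|.
  have [Ox|nO] := pselect (Om x); last by rewrite H0// normr0 mulr_ge0.
  rewrite /H normrM; apply: ler_pM => //; first by apply: le_trans (bF x Ox) (ler_norm _).
  by apply: le_trans (bN x) (ler_norm _).
have derH x : derivable H x (basis i) by case: (dH x).
have [jD] := integral_derive0 mH r0 derH bD bH (fun x nx => H0 x (fun Ox => nx (Or x Ox))).
rewrite /Rintegral => e0; rewrite -[RHS]e0; congr fine.
rewrite integral_mkcond; apply: eq_integral => x _.
by have [_ ->] := dH x; rewrite /D restrict_EFin.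
Qed.

(** The operator with its divergence expanded, for smooth [b]. *)
Definition strongA (b : V -> R) x : R :=
  - (\sum_i \sum_j (pd i (fun y => A y i j) x * pd j b x + A x i j * pd i (pd j b) x)) +
  c x * b x.

Lemma wkA_test b : test b -> wkA Om A c b (strongA b).
Proof.
move=> tb; have tp j := test_pd j tb; have tpp i j := test_pd i (tp j).
have Lb := test_L2 oOm bOm tb.
have cont f x : test f -> {for x, continuous f} by move=> tf; exact: (test_cont tf).
have [N bN] : exists N, 0 <= N /\ (forall x, `|b x| <= N) /\ (forall j x, `|pd j b x| <= N) /\
    (forall i j x, `|pd i (pd j b) x| <= N).
  have [N1 h1] := test_bounded tb.
  have /choice[N2 h2] := fun j => test_bounded (tp j).
  have /choice[N3 h3] : forall ij, exists M, forall x, `|pd ij.1 (pd ij.2 b) x| <= M.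
    by move=> [i j]; exact: test_bounded.
  exists (`|N1| + \sum_j `|N2 j| + \sum_ij `|N3 ij|); split; last split; last split.
  - by rewrite !addr_ge0// sumr_ge0.
  - move=> x; apply: (le_trans (h1 x)); rewrite -addrA; apply: (le_trans (ler_norm _)).
    by rewrite lerDl addr_ge0// sumr_ge0.
  - move=> j x; apply: (le_trans (h2 j x)); apply: (le_trans (ler_norm _)).
    rewrite (bigD1 j)//= addrCA -!addrA lerDl !addr_ge0// sumr_ge0//.
  - move=> i j x; apply: (le_trans (h3 (i, j) x)); apply: (le_trans (ler_norm _)).
    rewrite (bigD1 (i, j) (F := fun ij => `|N3 ij|))//= addrCA lerDl !addr_ge0// sumr_ge0//.
case: bN => N0 [bN [bN1 bN2]].
pose T i j x := pd i (fun y => A y i j) x * pd j b x + A x i j * pd i (pd j b) x.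
have LT i j : L2 (T i j).
  apply: (L2_contb oOm bOm (M := L * N + L * N)) => x Ox.
    apply: (@continuousD _ _ _ (fun x => pd i (fun y => A y i j) x * pd j b x) (fun x => A x i j * pd i (pd j b) x)).
      by apply: continuousM; [exact: cdA|exact: cont].
    by apply: continuousM; [exact: cA|exact: cont].
  apply: (le_trans (ler_normD _ _)); rewrite !normrM; apply: lerD; apply: ler_pM => //.
  - exact: bdA.
  - exact: bA.
have Lc : L2 (fun x => c x * b x) by exact: (L2c oOm cc bc Lb).
have LS : L2 (fun x => \sum_i \sum_j T i j x).
  by apply: (L2_sum mOm) => i _; apply: (L2_sum mOm) => j _.
have LA : L2 (strongA b) by apply: (L2D mOm) => //; exact: (L2N mOm).
have n0 f : nm (fun x => f x - f x) = 0.
  rewrite /nrm inner_sqr (Rintegral_eq0 _ mOm) ?sqrtr0// => x _.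
  by rewrite subrr expr0n.
split => //; exists (fun j => pd j b), (fun=> b); split.
- by move=> j; exact: test_L2.
- split => //; first by rewrite n0; exact: cvg_cst.
  by move=> i; rewrite n0; exact: cvg_cst.
move=> eta te; have Le := test_L2 oOm bOm te; have Lp i := test_L2 oOm bOm (test_pd i te).
have [N' bN'] := test_bounded te; have /choice[N2 bN2'] := fun j => test_bounded (test_pd j te).
have key i j : inr (fun x => A x i j * pd j b x) (pd i eta) = - inr (T i j) eta.
  have LAb : L2 (fun x => A x i j * pd j b x).
    by apply: (L2A oOm cA bA); exact: test_L2.
  have := @integral_div0 i (fun x => A x i j * pd j b x)
    (fun x => T i j x * eta x + A x i j * pd j b x * pd i eta x) eta (L * N)
    ((L * N + L * N) * `|N'| + L * N * `|N2 i|) te.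
  rewrite (RintegralD mOm (rint_mul mOm (LT i j) Le) (rint_mul mOm LAb (Lp i))) => h.
  apply/eqP; rewrite -addr_eq0 addrC; apply/eqP; apply: h.
  + by move=> x Ox; apply: continuousM; [exact: cA|exact: cont].
  + by move=> x Ox; rewrite normrM; apply: ler_pM => //; exact: bA.
  + move=> x Ox.
    have d1 : is_derive x (basis i) (fun y => A y i j) (pd i (fun y => A y i j) x).
      by apply: DeriveDef => //; exact: dA.
    have d2 := Cinfty_derive i x (tp j).1; have d3 := Cinfty_derive i x te.1.
    have d4 : is_derive x (basis i) (fun y => A y i j * pd j b y) _ := is_deriveM d1 d2.
    have d5 : is_derive x (basis i) (fun y => A y i j * pd j b y * eta y) _ := is_deriveM d4 d3.
    by apply: (is_derive_eq d5); rewrite /GRing.scale /= /T; ring.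
  + move=> x Ox; apply: (le_trans (ler_normD _ _)); rewrite !normrM; apply: lerD; apply: ler_pM => //.
    * apply: (le_trans (ler_normD _ _)); rewrite !normrM; apply: lerD; apply: ler_pM => //.
        exact: bdA.
      exact: bA.
    * by apply: le_trans (bN' x) (ler_norm _).
    * by apply: ler_pM => //; exact: bA.
    * by apply: le_trans (bN2' i x) (ler_norm _).
have -> : bform Om A (fun j => pd j b) (fun i => pd i eta) = - inr (fun x => \sum_i \sum_j T i j x) eta.
  rewrite (inner_suml mOm _ (fun i _ => L2_sum mOm _ (fun j _ => LT i j)) Le) -sumrN.
  apply: eq_bigr => i _; rewrite (inner_suml mOm _ (fun j _ => LT i j) Le) -sumrN.
  by apply: eq_bigr => j _; exact: key.
by rewrite -(innerNl mOm LS Le) -(innerDl mOm (L2N mOm LS) Lc Le).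
Qed.

Section Bump.
Variables (z : V) (r rho : R).
Hypotheses (r0 : 0 < r) (rrho : r < rho) (sub : cball z rho `<=` Om).

Let rho0 : 0 < rho. Proof. exact: lt_trans rrho. Qed.

Definition bump (ka : R) (y : V) : R := flat ka 0 (rho ^+ 2 - sqd z y).

Lemma is_derive_sqd i (y : V) : is_derive y (basis i) (sqd z) (2 * (y ord0 i - z ord0 i)).
Proof.
apply: line_is_derive.
have -> : (fun s : R => sqd z (y + s *: basis i)) =
    (fun s : R => (sqd z y + (2 * (y ord0 i - z ord0 i)) * s) + s * s).
  apply/funext => s; rewrite /sqd.
  rewrite (bigD1 i)//= [in RHS](bigD1 i)//= !mxE !eqxx /= mulr1.
  rewrite (eq_bigr (fun j => (y ord0 j - z ord0 j) ^+ 2)); first by ring.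
  by move=> j ji; rewrite !mxE (negPf ji) andbF mulr0 addr0.
have d0 : is_derive (0 : R) (1 : R) (id : R -> R) 1 by exact: is_derive_id.
have dc : is_derive (0 : R) (1 : R) (cst (sqd z y) : R -> R) 0 by exact: is_derive_cst.
have d1 : is_derive (0 : R) (1 : R) (fun s : R => s * s) _ := is_deriveM d0 d0.
have d2 : is_derive (0 : R) (1 : R) (fun s : R => (2 * (y ord0 i - z ord0 i)) * s) _ :=
  is_deriveZ (2 * (y ord0 i - z ord0 i)) d0.
have d3 : is_derive (0 : R) (1 : R) (fun s : R => sqd z y + (2 * (y ord0 i - z ord0 i)) * s) _ :=
  is_deriveD dc d2.
have d4 : is_derive (0 : R) (1 : R) (fun s : R => (sqd z y + (2 * (y ord0 i - z ord0 i)) * s) + s * s) _ :=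
  is_deriveD d3 d1.
by apply: (is_derive_eq d4); rewrite /GRing.scale /=; ring.
Qed.

Variable ka : R.
Hypothesis ka0 : 0 < ka.
Notation fl m y := (flat ka m (rho ^+ 2 - sqd z y)).

Lemma bump_isTest : test (bump ka).
Proof. by apply: bump_test => //; exact: ltW. Qed.

Lemma is_derive_flat_sqd m i y : is_derive y (basis i) (fun y => fl m y)
  ((ka * fl m.+2 y - m%:R * fl m.+1 y) * (- 2 * (y ord0 i - z ord0 i))).
Proof.
have d1 : is_derive y (basis i) (fun y => rho ^+ 2 - sqd z y) (- 2 * (y ord0 i - z ord0 i)).
  have ds := is_derive_sqd i y.
  have dc : is_derive y (basis i) (cst (rho ^+ 2) : V -> R) 0 by exact: is_derive_cst.
  have d0 : is_derive y (basis i) (fun y => rho ^+ 2 - sqd z y) _ := is_deriveB dc ds.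
  by apply: (is_derive_eq d0); ring.
exact: (is_derive_comp (is_derive_flat ka0 m _) d1).
Qed.

Lemma pd_bump i y : pd i (bump ka) y = - 2 * ka * fl 2 y * (y ord0 i - z ord0 i).
Proof. by case: (is_derive_flat_sqd 0 i y) => _; rewrite /pd => ->; rewrite mul0r subr0; ring. Qed.

Lemma pd2_bump i j y : pd i (pd j (bump ka)) y =
  (4 * ka ^+ 2 * fl 4 y - 8 * ka * fl 3 y) * ((y ord0 i - z ord0 i) * (y ord0 j - z ord0 j)) -
  2 * ka * fl 2 y * (i == j)%:R.
Proof.
have -> : pd j (bump ka) = (fun y => fl 2 y * ((- 2 * ka) * (y ord0 j + cst (- z ord0 j) y))).
  by apply/funext => x; rewrite pd_bump /=; ring.
have d1 := is_derive_flat_sqd 2 i y.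
have d2 := Cinfty_derive i y (CinftyZ (- 2 * ka) (CinftyD (@Cinfty_coord R d j) (Cinfty_cst (- z ord0 j)))).
have d3 : is_derive y (basis i) (fun y => fl 2 y * ((- 2 * ka) * (y ord0 j + cst (- z ord0 j) y))) _ :=
  is_deriveM d1 d2.
case: d3 => _; rewrite /pd => ->.
have -> : 'D_(basis i) (fun x : V => (- 2 * ka) * (x ord0 j + cst (- z ord0 j) x)) y = (- 2 * ka) * (i == j)%:R.
  have l : is_derive (0 : R) (1 : R) (fun s : R => (- 2 * ka) * ((y + s *: basis i) ord0 j + cst (- z ord0 j) (y + s *: basis i)))
      ((- 2 * ka) * (i == j)%:R).
    have -> : (fun s : R => (- 2 * ka) * ((y + s *: basis i) ord0 j + cst (- z ord0 j) (y + s *: basis i))) =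
        (fun s : R => ((- 2 * ka) * (y ord0 j - z ord0 j)) + ((- 2 * ka) * (i == j)%:R) * s).
      by apply/funext => s; rewrite !mxE /= (eq_sym j i); ring.
    have d0 : is_derive (0 : R) (1 : R) (id : R -> R) 1 by exact: is_derive_id.
    have dc : is_derive (0 : R) (1 : R) (cst ((- 2 * ka) * (y ord0 j - z ord0 j)) : R -> R) 0 by exact: is_derive_cst.
    have dl : is_derive (0 : R) (1 : R) (fun s : R => ((- 2 * ka) * (i == j)%:R) * s) _ :=
      is_deriveZ ((- 2 * ka) * (i == j)%:R) d0.
    have dD : is_derive (0 : R) (1 : R) (fun s : R => ((- 2 * ka) * (y ord0 j - z ord0 j)) + ((- 2 * ka) * (i == j)%:R) * s) _ :=
      is_deriveD dc dl.
    by apply: (is_derive_eq dD); rewrite /GRing.scale /= add0r mulr1.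
  by case: (@line_is_derive R _ (fun x : V => (- 2 * ka) * (x ord0 j + cst (- z ord0 j) x)) y (basis i) _ l).
rewrite /GRing.scale /=; case: (i == j); rewrite /= ?mulr1 ?mulr0; ring.
Qed.

End Bump.

End Barrier.

Section BarrierInequality.
Context {R : realType} {d : nat}.
Notation V := 'rV[R]_d.
Variable Om : set V.
Variables (A : V -> 'M[R]_d) (c : V -> R) (L th : R).
Hypothesis L0 : 0 <= L.
Hypothesis bA : forall i j x, Om x -> `|A x i j| <= L.
Hypothesis bdA : forall k i j x, Om x -> `|pd k (fun y => A y i j) x| <= L.
Hypothesis bc : forall x, Om x -> 0 <= c x <= L.
Hypothesis th0 : 0 < th.
Hypothesis ellA : forall x (xi : 'I_d -> R), Om x ->
  th * (\sum_i xi i ^+ 2) <= \sum_i \sum_j A x i j * xi j * xi i.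
Variables (z : V) (r rho : R).
Hypotheses (r0 : 0 < r) (rrho : r < rho).

Let rho0 : 0 < rho. Proof. exact: lt_trans rrho. Qed.
(** On the large ball [M1] bounds the first-order factor and [M2] the quadratic form of [A] at x -
    z; [q0] is a lower bound of rho^2 - |x - z|^2 on the inner ball. *)
Let M1 : R := (d * d)%:R * (L * (rho + 1)).
Let M2 : R := (d * d)%:R * (L * rho ^+ 2).
Let q0 : R := rho ^+ 2 - r ^+ 2.

Let q0_gt0 : 0 < q0.
Proof. by rewrite /q0 subr_gt0 ltr_sqr ?nnegrE ?(ltW r0) ?(ltW rho0). Qed.
Let M1_ge0 : 0 <= M1.
Proof. by rewrite !mulr_ge0// addr_ge0// ltW. Qed.
Let M2_ge0 : 0 <= M2.
Proof. by rewrite !mulr_ge0 ?exprn_ge0 ?(ltW rho0). Qed.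

Lemma sum2_le (f : 'I_d -> 'I_d -> R) M : (forall i j, `|f i j| <= M) ->
  `|\sum_i \sum_j f i j| <= (d * d)%:R * M.
Proof.
move=> h; apply: (le_trans (ler_norm_sum _ _ _)).
apply: (@le_trans _ _ (\sum_(i < d) d%:R * M)).
  apply: ler_sum => i _; apply: (le_trans (ler_norm_sum _ _ _)).
  apply: (@le_trans _ _ (\sum_(j < d) M)); first by apply: ler_sum.
  by rewrite sumr_const card_ord mulr_natl.
by rewrite sumr_const card_ord -[leLHS]mulr_natl natrM mulrA.
Qed.

(** Away from the inner ball the good term is of order ka^2 and the quadratic form is at least th
    r^2. The first condition keeps half of that term, namely 2 ka^2 th r^2; the second and third
    make the first-order and the zeroth-order terms at most ka^2 th r^2 each. On the inner ball the
    crude bound [B] suffices. *)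
Lemma barrier_ineq (ka m B : R) x : 0 < ka -> 0 <= m ->
  4 * rho ^+ 2 <= ka -> 2 * rho ^+ 4 * M1 <= ka * th * r ^+ 2 ->
  (L + m) * rho ^+ 8 <= ka ^+ 2 * th * r ^+ 2 ->
  2 * ka * M1 / q0 ^+ 2 + 8 * ka * M2 / q0 ^+ 3 + L + m <= B -> Om x ->
  strongA A c (bump z rho ka) x + m * bump z rho ka x <= B * \1_(eball z r) x.
Proof.
move=> ka0 m0 h1 h2 h3 h4 Ox.
have W0 : 0 <= 2 * ka * M1 / q0 ^+ 2 + 8 * ka * M2 / q0 ^+ 3 + L + m.
  rewrite !addr_ge0//.
    apply: divr_ge0; last by rewrite exprn_ge0// ltW.
    by apply: mulr_ge0; [rewrite mulr_ge0 ?(ltW ka0)|exact: M1_ge0].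
  apply: divr_ge0; last by rewrite exprn_ge0// ltW.
  by apply: mulr_ge0; [rewrite mulr_ge0 ?(ltW ka0)|exact: M2_ge0].
have B0 := le_trans W0 h4.
pose y i := x ord0 i - z ord0 i.
pose Dv := \sum_i \sum_j (pd i (fun y => A y i j) x * y j + A x i j * (i == j)%:R).
pose Q := \sum_i \sum_j A x i j * y j * y i.
pose q := rho ^+ 2 - sqd z x.
have E : strongA A c (bump z rho ka) x = 2 * ka * flat ka 2 q * Dv -
    (4 * ka ^+ 2 * flat ka 4 q - 8 * ka * flat ka 3 q) * Q + c x * flat ka 0 q.
  rewrite /strongA; congr (_ + _); rewrite /Dv /Q !mulr_sumr -sumrB -sumrN; apply: eq_bigr => i _.
  rewrite !mulr_sumr -sumrB -sumrN; apply: eq_bigr => j _.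
  by rewrite (pd_bump z rho ka0) (pd2_bump z rho ka0) -/q -/(y i) -/(y j); ring.
have ind0 : 0 <= \1_(eball z r) x :> R by [].
rewrite E -[bump z rho ka x]/(flat ka 0 q).
have [qn|qp] := leP q 0.
  have BI : 0 <= B * \1_(eball z r) x by exact: mulr_ge0.
  have F0 n : flat ka n q = 0 by exact: flat_le0.
  by apply: le_trans BI; rewrite !F0 !(mulr0, mul0r, subrr, addr0, oppr0).
have sE : sqd z x = rho ^+ 2 - q by rewrite /q; ring.
have s0 := sqd_ge0 z x.
have yrho i : `|y i| <= rho.
  by apply: cball_coord; [exact: ltW|rewrite /cball /= -subr_ge0 ltW].
have bDv : Dv <= M1.
  apply: le_trans (ler_norm _) _; apply: sum2_le => i j.
  apply: (le_trans (ler_normD _ _)); rewrite !normrM mulrDr mulr1; apply: lerD.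
    by apply: ler_pM => //; exact: bdA.
  apply: (@le_trans _ _ (L * 1)); last by rewrite mulr1.
  apply: ler_pM => //; first exact: bA.
  by case: (i == j); rewrite /= ?normr1 ?normr0.
have bQ2 : Q <= M2.
  apply: le_trans (ler_norm _) _; apply: sum2_le => i j.
  rewrite !normrM -mulrA expr2; apply: ler_pM => //; first exact: bA.
  by apply: ler_pM.
have bQ1 : th * sqd z x <= Q by exact: ellA.
have Q0 : 0 <= Q by apply: le_trans bQ1; rewrite mulr_ge0// ltW.
have /andP[c0 cL] := bc Ox.
rewrite (flatE ka 2 qp) (flatE ka 3 qp) (flatE ka 4 qp); have e0 := flat_ge0 ka 0 q; have e1 := flat0_le1 ka0 q.
move: (flat ka 0 q) e0 e1 => e e0 e1.
have qrho : q <= rho ^+ 2 by rewrite /q gerBl.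
have qn0 : q != 0 by rewrite gt_eqF.
have [sr|sr] := ltP (sqd z x) (r ^+ 2).
  rewrite indicE mem_set// mulr1.
  have qq0 : q0 <= q by rewrite /q0 /q lerD2l lerN2 ltW.
  apply: (@le_trans _ _ (e * (2 * ka * M1 / q0 ^+ 2 + 8 * ka * M2 / q0 ^+ 3 + L + m))); last first.
    by apply: le_trans h4; apply: ler_piMl.
  have -> : 2 * ka * (q^-1 ^+ 2 * e) * Dv - (4 * ka ^+ 2 * (q^-1 ^+ 4 * e) - 8 * ka * (q^-1 ^+ 3 * e)) * Q +
      c x * e + m * e = e * (2 * ka * (q^-1 ^+ 2 * Dv) - (4 * ka ^+ 2 * q^-1 ^+ 4 * Q) +
      8 * ka * (q^-1 ^+ 3 * Q) + c x + m) by ring.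
  apply: ler_wpM2l => //; apply: lerD => //; apply: lerD => //.
  have qi : 0 <= q^-1 <= q0^-1 by rewrite invr_ge0 (ltW qp) /= lef_pV2.
  have /andP[qi0 qi1] := qi.
  have qi2 := le_trans qi0 qi1.
  have i2 : q^-1 ^+ 2 <= q0^-1 ^+ 2 by exact: lerXn2r.
  have i3 : q^-1 ^+ 3 <= q0^-1 ^+ 3 by exact: lerXn2r.
  apply: lerD.
    apply: (@le_trans _ _ (2 * ka * (q^-1 ^+ 2 * Dv))).
      by rewrite gerBl !mulr_ge0// ?exprn_ge0// ltW.
    rewrite -exprVn -[leRHS]mulrA; apply: ler_wpM2l; first by rewrite mulr_ge0// ltW.
    apply: (@le_trans _ _ (q^-1 ^+ 2 * M1)); first by apply: ler_wpM2l => //; rewrite exprn_ge0.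
    by rewrite mulrC; apply: ler_wpM2l.
  rewrite -exprVn -[leRHS]mulrA; apply: ler_wpM2l; first by rewrite mulr_ge0// ltW.
  by rewrite (mulrC M2); apply: ler_pM => //; rewrite exprn_ge0.
rewrite indicE memNset; last by rewrite /eball /= ltNge sr.
rewrite mulr0.
have -> : 2 * ka * (q^-1 ^+ 2 * e) * Dv - (4 * ka ^+ 2 * (q^-1 ^+ 4 * e) - 8 * ka * (q^-1 ^+ 3 * e)) * Q +
      c x * e + m * e = - ((e * q^-1 ^+ 4) * ((4 * ka ^+ 2 - 8 * ka * q) * Q - 2 * ka * q ^+ 2 * Dv - (c x + m) * q ^+ 4)).
  by field.
rewrite oppr_le0; apply: mulr_ge0; first by rewrite mulr_ge0// exprn_ge0// invr_ge0 ltW.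
have kq : 2 * ka ^+ 2 <= 4 * ka ^+ 2 - 8 * ka * q.
  have : ka * (4 * q) <= ka * ka.
    rewrite ler_pM2l//; apply: le_trans h1; by rewrite ler_pM2l.
  by rewrite expr2; lra.
have t1 : 2 * ka ^+ 2 * (th * r ^+ 2) <= (4 * ka ^+ 2 - 8 * ka * q) * Q.
  apply: ler_pM => //; first by rewrite mulr_ge0// exprn_ge0// ltW.
    by rewrite mulr_ge0// ?exprn_ge0// ltW.
  by apply: le_trans bQ1; rewrite ler_pM2l.
have q4 : q ^+ 4 <= rho ^+ 8.
  have -> : rho ^+ 8 = (rho ^+ 2) ^+ 4 by rewrite -exprM.
  by apply: lerXn2r => //; rewrite nnegrE ?exprn_ge0// ltW.
have q2 : q ^+ 2 <= rho ^+ 4.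
  have -> : rho ^+ 4 = (rho ^+ 2) ^+ 2 by rewrite -exprM.
  by apply: lerXn2r => //; rewrite nnegrE ?exprn_ge0// ltW.
have t2 : 2 * ka * q ^+ 2 * Dv <= ka ^+ 2 * th * r ^+ 2.
  apply: (@le_trans _ _ (ka * (2 * rho ^+ 4 * M1))); last first.
    by rewrite -[leRHS]mulrA expr2 -(mulrA ka ka) ler_pM2l// mulrA.
  apply: (@le_trans _ _ (2 * ka * q ^+ 2 * M1)).
    by apply: ler_wpM2l => //; rewrite !mulr_ge0// ?exprn_ge0// ltW.
  have -> : 2 * ka * q ^+ 2 * M1 = ka * (2 * q ^+ 2 * M1) by ring.
  rewrite ler_pM2l//; apply: ler_wpM2r => //; by rewrite ler_pM2l.
have t3 : (c x + m) * q ^+ 4 <= ka ^+ 2 * th * r ^+ 2.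
  apply: le_trans h3; apply: ler_pM => //; first by rewrite addr_ge0.
    by rewrite exprn_ge0// ltW.
  by rewrite lerD2r.
by move: t1 t2 t3; rewrite -(mulrA (ka ^+ 2)) -(mulrA 2 (ka ^+ 2)); move: (ka ^+ 2 * (th * r ^+ 2)) => X; lra.
Qed.

(* The bump must decay at rate [sqrt m] to be a subsolution outside the ball. *)
Lemma barrier_exists : exists C C' m0 : R, [/\ 0 < C, 0 < C', 0 < m0 &
  forall m x, m0 <= m -> Om x ->
    strongA A c (bump z rho (C * Num.sqrt m)) x + m * bump z rho (C * Num.sqrt m) x <=
    C' * m * \1_(eball z r) x].
Proof.
(* With ka = C sqrt m and C^2 = X the third condition reads (L + m) rho^8 <= 2 m rho^8, true for m
   >= L. *)
pose X := 2 * rho ^+ 8 / (th * r ^+ 2).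
have tr0 : 0 < th * r ^+ 2 by rewrite mulr_gt0// exprn_gt0.
have X0 : 0 < X by rewrite divr_gt0// mulr_gt0// exprn_gt0.
pose C := Num.sqrt X.
have C0 : 0 < C by rewrite sqrtr_gt0.
have CX : C ^+ 2 = X by rewrite sqr_sqrtr// ltW.
(* Obtained from the required bound by sqrt m <= m and L + m <= 2 m. *)
pose C' := C * (2 * M1 / q0 ^+ 2 + 8 * M2 / q0 ^+ 3) + 2.
(* The sizes of sqrt m at which the first two conditions on ka = C sqrt m become true. *)
pose a1 := 4 * rho ^+ 2 / C; pose a2 := 2 * rho ^+ 4 * M1 / (C * (th * r ^+ 2)).
have a10 : 0 <= a1 by rewrite divr_ge0// ?(ltW C0)// mulr_ge0// exprn_ge0// ltW.
have a20 : 0 <= a2.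
  apply: divr_ge0; last by apply/ltW/mulr_gt0.
  by apply: mulr_ge0; [rewrite mulr_ge0 ?exprn_ge0 ?(ltW rho0)|exact: M1_ge0].
have D0 : 0 <= 2 * M1 / q0 ^+ 2 + 8 * M2 / q0 ^+ 3.
  apply: addr_ge0; apply: divr_ge0; try by rewrite exprn_ge0// ltW.
    by apply: mulr_ge0; [|exact: M1_ge0].
  by apply: mulr_ge0; [|exact: M2_ge0].
exists C, C', (1 + L + a1 ^+ 2 + a2 ^+ 2); split => //.
- by apply: (@lt_le_trans _ _ 2) => //; rewrite lerDr mulr_ge0// ltW.
- by apply: (@lt_le_trans _ _ 1) => //; rewrite -!addrA lerDl !addr_ge0// sqr_ge0.
move=> m x hm Ox.
have m1 : 1 <= m by apply: le_trans hm; rewrite -!addrA lerDl !addr_ge0// sqr_ge0.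
have mL : L <= m by apply: le_trans hm; rewrite (addrC 1) -!addrA lerDl !addr_ge0// sqr_ge0.
have ma1 : a1 ^+ 2 <= m.
  by apply: le_trans hm; rewrite addrAC lerDr !addr_ge0// sqr_ge0.
have ma2 : a2 ^+ 2 <= m by apply: le_trans hm; rewrite lerDr !addr_ge0// sqr_ge0.
have m0 : 0 < m by apply: lt_le_trans m1.
have sm0 : 0 < Num.sqrt m by rewrite sqrtr_gt0.
have smm : Num.sqrt m ^+ 2 = m by rewrite sqr_sqrtr// ltW.
have sm a : 0 <= a -> a ^+ 2 <= m -> a <= Num.sqrt m.
  by move=> a0 am; rewrite -(@ler_sqr _ a) ?nnegrE// ?smm// ltW.
have sm1 : Num.sqrt m <= m.
  by rewrite -[leRHS]smm expr2 ler_peMl ?(ltW sm0)//; apply: sm => //; rewrite expr1n.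
apply: barrier_ineq => //.
- exact: mulr_gt0.
- exact: ltW.
- by rewrite -ler_pdivrMl// mulrC; apply: sm.
- have := sm _ a20 ma2; rewrite /a2 ler_pdivrMr ?mulr_gt0// => h.
  by apply: (le_trans h); rewrite le_eqVlt; apply/orP; left; apply/eqP; ring.
- rewrite exprMn CX smm /X.
  have -> : 2 * rho ^+ 8 / (th * r ^+ 2) * m * th * r ^+ 2 = (2 * m) * rho ^+ 8.
    by field; rewrite (gt_eqF th0) (gt_eqF r0).
  by rewrite ler_pM2r ?exprn_gt0//; lra.
- have -> : 2 * (C * Num.sqrt m) * M1 / q0 ^+ 2 + 8 * (C * Num.sqrt m) * M2 / q0 ^+ 3 =
      C * (2 * M1 / q0 ^+ 2 + 8 * M2 / q0 ^+ 3) * Num.sqrt m by field; rewrite gt_eqF.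
  have h : C * (2 * M1 / q0 ^+ 2 + 8 * M2 / q0 ^+ 3) * Num.sqrt m <=
      C * (2 * M1 / q0 ^+ 2 + 8 * M2 / q0 ^+ 3) * m.
    by apply: ler_wpM2l => //; rewrite mulr_ge0// ltW.
  by rewrite /C' mulrDl; lra.
Qed.

End BarrierInequality.

(** * Uniform bounds for the coefficients *)

Section Coefficients.
Context {R : realType} {d : nat}.
Notation V := 'rV[R]_d.
Variable Om : set V.
Hypotheses (oOm : open Om) (bOm : bounded_set Om).

Lemma closure_continuous (f : V -> R) : {within closure Om, continuous f} ->
  (forall x, Om x -> {for x, continuous f}) /\ exists M, forall x, Om x -> `|f x| <= M.
Proof.
move=> cf; split.
  move=> x Ox.
  have c1 := continuous_subspaceW (@subset_closure _ Om) cf.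
  by move: c1; rewrite continuous_open_subspace// => /(_ x); apply; rewrite inE.
have cC : compact (closure Om).
  apply: bounded_closed_compact; last exact: closed_closure.
  have [M [_ hM]] := bOm; exists (M + 1); split; first exact: num_real.
  move=> N MN; have Ms : M < N by apply: lt_trans MN; rewrite ltrDl.
  have cl : closed [set x : V | `|x| <= N].
    have -> : [set x : V | `|x| <= N] = (fun x : V => `|x|) @^-1` [set r | r <= N] by [].
    apply: closed_comp; last exact: closed_le.
    by move=> x _; exact: norm_continuous.
  move=> x; have := closure_subset (B := [set x : V | `|x| <= N]).
  by move=> h /h; rewrite -(closure_id _).1//; apply => y Oy; exact: hM.
have := compact_bounded (continuous_compact cf cC) => -[M [_ hM]].
exists (`|M| + 1) => x Ox.
by apply: (hM (`|M| + 1)); [rewrite ltr_pwDr// ler_norm|exists x => //; exact: subset_closure].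
Qed.

Lemma coefficient_bounds (A : V -> 'M[R]_d) (c : V -> R) :
  elliptic_coefficients Om A c -> exists L th : R,
  [/\ 0 <= L /\ 0 < th,
    (forall i j x, Om x -> {for x, continuous (fun y => A y i j)}) /\
    (forall i j x, Om x -> `|A x i j| <= L) /\
    (forall i j x, Om x -> A x i j = A x j i),
    (forall k i j x, Om x -> derivable (fun y => A y i j) x (@basis_vec R d k)) /\
    (forall k i j x, Om x -> {for x, continuous (pd k (fun y => A y i j))}) /\
    (forall k i j x, Om x -> `|pd k (fun y => A y i j) x| <= L),
    (forall x, Om x -> {for x, continuous c}) /\ (forall x, Om x -> 0 <= c x <= L) &
    forall x (xi : 'I_d -> R), Om x ->
      th * (\sum_i xi i ^+ 2) <= \sum_i \sum_j A x i j * xi j * xi i].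
Proof.
move=> [CA sym [th [th0 ell]] cc c0].
have sub := @subset_closure _ Om.
have /choice[L1 h1] : forall ij : 'I_d * 'I_d, exists M, forall x, Om x -> `|A x ij.1 ij.2| <= M.
  by move=> ij; case: (CA ij.1 ij.2) => /closure_continuous[_].
have hp k i j : (forall x, Om x -> {for x, continuous (pd k (fun y => A y i j))}) /\
    exists M, forall x, Om x -> `|pd k (fun y => A y i j) x| <= M.
  have [_ /(_ k)[_ [g [/closure_continuous[cg [M hM]] pg]]]] := CA i j; split; last first.
    by exists M => x Ox; rewrite pg//; exact: hM.
  move=> x Ox; have := cg x Ox; rewrite /prop_for /continuous_at pg//.
  apply: cvg_trans; apply: (@near_eq_cvg _ _ (nbhs x) (nbhs_filter x)).
  apply: (@filterS V (nbhs x) (nbhs_filter x) Om) => [y Oy|]; first by rewrite pg.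
  exact: open_nbhs_nbhs.
have /choice[L2 h2] : forall kij : 'I_d * ('I_d * 'I_d), exists M, forall x, Om x ->
    `|pd kij.1 (fun y => A y kij.2.1 kij.2.2) x| <= M.
  by move=> [k [i j]]; case: (hp k i j).
have [ccO [L3 h3]] := closure_continuous cc.
pose L := \sum_ij `|L1 ij| + \sum_kij `|L2 kij| + `|L3|.
exists L, th; split.
- by split => //; rewrite !addr_ge0// sumr_ge0.
- split; last split.
  + by move=> i j; case: (CA i j) => /closure_continuous[].
  + move=> i j x Ox; apply: (le_trans (h1 (i, j) x Ox)); apply: (le_trans (ler_norm _)).
    by rewrite /L (bigD1 (i, j) (F := fun ij => `|L1 ij|))//= -!addrA lerDl !addr_ge0// sumr_ge0.
  + by move=> i j x Ox; rewrite -[in RHS](sym x (sub _ Ox)) mxE.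
- split; last split.
  + by move=> k i j x Ox; have [_ /(_ k)[h _]] := CA i j; exact: h.
  + by move=> k i j; case: (hp k i j).
  + move=> k i j x Ox; apply: (le_trans (h2 (k, (i, j)) x Ox)); apply: (le_trans (ler_norm _)).
    rewrite /L (bigD1 (k, (i, j)) (F := fun kij => `|L2 kij|))//= (addrC (\sum_ij _)) -!addrA lerDl.
    by rewrite !addr_ge0// sumr_ge0.
- split => // x Ox; rewrite c0//=; last exact: sub.
  apply: (le_trans (ler_norm _)); apply: (le_trans (h3 x Ox)); apply: (le_trans (ler_norm _)).
  by rewrite /L lerDr addr_ge0// sumr_ge0.
- move=> x xi Ox; have := ell x (\row_i xi i) (sub _ Ox).
  have -> : \sum_i (\row_i xi i : V) ord0 i ^+ 2 = \sum_i xi i ^+ 2.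
    by apply: eq_bigr => i _; rewrite mxE.
  move=> /le_trans; apply; rewrite le_eqVlt; apply/orP; left; apply/eqP.
  rewrite mxE exchange_big; apply: eq_bigr => j _; rewrite !mxE mulr_suml; apply: eq_bigr => i _.
  by rewrite !mxE; ring.
Qed.

End Coefficients.

(** * Comparison principles for resolvents *)

Section Resolvent.
Context {R : realType} {d : nat}.
Notation V := 'rV[R]_d.
Notation bV := (borelRV R d).
Notation leb := (@leb R d).
Variable Om : set V.
Hypotheses (oOm : open Om) (bOm : bounded_set Om).
Notation inr := (inner leb (Om : set bV)).
Notation nm := (nrm leb (Om : set bV)).
Notation L2 := (L2 leb (Om : set bV)).
Variables (A : V -> 'M[R]_d) (c : V -> R) (L th : R).
Hypothesis L0 : 0 <= L.
Hypothesis cA : forall i j x, Om x -> {for x, continuous (fun y => A y i j)}.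
Hypothesis bA : forall i j x, Om x -> `|A x i j| <= L.
Hypothesis th0 : 0 < th.
Hypothesis ellA : forall x (xi : 'I_d -> R), Om x ->
  th * (\sum_i xi i ^+ 2) <= \sum_i \sum_j A x i j * xi j * xi i.
Hypothesis cc : forall x, Om x -> {for x, continuous c}.
Hypothesis bc : forall x, Om x -> 0 <= c x <= L.
Variables (lam : nat -> R) (phi : nat -> V -> R).
Hypothesis lam0 : forall n, 0 < lam n.
Hypothesis eig : forall n, wkA Om A c (phi n) (fun x => lam n * phi n x).
Hypothesis orth : forall m n, inr (phi m) (phi n) = (m == n)%:R.
Hypothesis compl : forall f, L2 f ->
  L2cvg leb (Om : set bV) (fun N x => \sum_(n < N) inr f (phi n) * phi n x) f.
Notation pair := (pair leb (Om : set bV) phi).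
Notation co := (co leb (Om : set bV) phi).
Notation S := (@S _ bV R phi).
Notation pm := (pm leb (Om : set bV) phi).

Let mOm : measurable (Om : set bV). Proof. exact: measurable_open. Qed.
Let Lphi n : L2 (phi n). Proof. by case: (eig n). Qed.

Lemma wkA_S x N : wkA Om A c (S x N) (S (fun n => lam n * x n) N).
Proof.
elim: N => [|N IH].
  have -> : S x 0 = fun=> 0 by apply/funext => t; rewrite /S big_ord0.
  have -> : S (fun n => lam n * x n) 0 = fun=> 0 by apply/funext => t; rewrite /S big_ord0.
  exact: wkA0.
have -> : S x N.+1 = fun t => 1 * S x N t + x N * phi N t.
  by apply/funext => t; rewrite /S big_ord_recr /= mul1r.
have -> : S (fun n => lam n * x n) N.+1 =
    fun t => 1 * S (fun n => lam n * x n) N t + x N * (lam N * phi N t).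
  by apply/funext => t; rewrite /S big_ord_recr /=; ring.
exact: (wkA_lin oOm bOm cA bA cc bc).
Qed.

Variable m : R.
Hypothesis m0 : 0 < m.
Let res x (n : nat) := (m + lam n)^-1 * x n.

Let resE x N t : S (fun n => lam n * res x n) N t + m * S (res x) N t = S x N t.
Proof.
rewrite /S mulr_sumr -big_split; apply: eq_bigr => n _ /=; rewrite /res.
by field; rewrite gt_eqF// addr_gt0.
Qed.

Let bres : bseq (fun n => (m + lam n)^-1).
Proof.
exists m^-1 => n; rewrite ger0_norm ?invr_ge0 ?addr_ge0 ?(ltW m0) ?(ltW (lam0 n))//.
by rewrite lef_pV2 ?posrE ?addr_gt0// lerDl ltW.
Qed.

Let pres x chi : l2b x -> L2 chi -> inr (S (res x) N) chi @[N --> \oo] --> pair (res x) chi.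
Proof.
move=> lx Lc; have := pair_cvg mOm Lphi orth (l2bM bres lx) Lc.
apply: cvg_trans; apply: near_eq_cvg; apply: nearW => N.
by rewrite (inner_S mOm Lphi (res x) N Lc).
Qed.

Let LS x N : L2 (S x N). Proof. exact: (L2_S mOm Lphi). Qed.

Let err_cvg (n : nat -> R) chi : n N @[N --> \oo] --> 0 -> n N * nm chi / m @[N --> \oo] --> 0.
Proof.
move=> h; have : n N * (nm chi / m) @[N --> \oo] --> 0 * (nm chi / m) by apply: cvgMr_tmp.
by rewrite mul0r; under eq_cvg do rewrite mulrA.
Qed.

(** Maximum principle at level 0 for minus the partial sum of the resolvent. The error is the
    negative part of [S x N], whose norm tends to 0 by [nv_neg]. *)
Lemma pm_resolvent : pm (fun n => (m + lam n)^-1).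
Proof.
split => // x nx; have [lx _] := nx; split; first exact: l2bM.
move=> chi Lc c0; rewrite -oppr_le0.
have c1 : - inr (S (res x) N) chi @[N --> \oo] --> - pair (res x) chi.
  by apply: cvgN; exact: pres.
apply: (ler_cvg_to c1 (@err_cvg _ chi (nv_neg mOm Lphi orth nx))); apply: nearW => N.
(* Only a change of sign is wanted, hence the second coefficient 0. *)
have W := wkA_lin oOm bOm cA bA cc bc (-1) 0 (wkA_S (res x) N) (wkA_S (res x) N).
have Ln : L2 (negp (S x N)) by exact: L2_negp.
have := max_principle oOm bOm L0 cA bA th0 ellA cc bc W m0 (lexx 0) Ln _ Lc c0.
rewrite -(innerNl mOm (LS _ N) Lc) => H; apply: le_trans (H _); last first.
  apply: ae_all => t Ot; rewrite mulr0 add0r.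
  have -> : -1 * S (fun n => lam n * res x n) N t + 0 * S (fun n => lam n * res x n) N t +
      m * (-1 * S (res x) N t + 0 * S (res x) N t) =
      - (S (fun n => lam n * res x n) N t + m * S (res x) N t) by ring.
  by rewrite resE /negp le_max lexx.
by rewrite le_eqVlt; apply/orP; left; apply/eqP; apply: inner_eq => // t _; ring.
Qed.

(** Maximum principle at level [K]; the error is [S (co f) N - f], which tends to 0 by
    completeness. *)
Lemma resolvent_le (K : R) f chi : 0 <= K -> L2 f ->
  {ae leb, forall x, Om x -> f x <= m * K} ->
  L2 chi -> {ae leb, forall x, Om x -> 0 <= chi x} ->
  pair (fun n => (m + lam n)^-1 * co f n) chi <= inr (fun=> K) chi.
Proof.
move=> K0 Lf fK Lc c0; have lx := l2b_co mOm Lphi orth Lf.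
have LK : L2 (fun=> K) by exact: L2_cst.
rewrite -subr_le0.
have c1 : inr (S (res (co f)) N) chi - inr (fun=> K) chi @[N --> \oo] -->
    pair (res (co f)) chi - inr (fun=> K) chi.
  by apply: cvgB; [exact: pres|exact: cvg_cst].
apply: (ler_cvg_to c1 (@err_cvg _ chi (compl_nrm mOm Lphi compl Lf))); apply: nearW => N.
have Lg : L2 (fun t => S (co f) N t - f t) by exact: (L2B mOm).
have := max_principle oOm bOm L0 cA bA th0 ellA cc bc (wkA_S (res (co f)) N) m0 K0 Lg _ Lc c0.
rewrite -(innerBl mOm (LS _ N) LK Lc); apply.
by apply: ae_mono fK => t h Ot; rewrite resE; have := h Ot; lra.
Qed.

(** Maximum principle at level 0 for the subsolution [v] minus the partial sum of the resolvent. *)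
Lemma resolvent_ge v k f chi : wkA Om A c v k -> L2 f ->
  {ae leb, forall x, Om x -> k x + m * v x <= f x} ->
  L2 chi -> {ae leb, forall x, Om x -> 0 <= chi x} ->
  inr v chi <= pair (fun n => (m + lam n)^-1 * co f n) chi.
Proof.
move=> W Lf kf Lc c0; have lx := l2b_co mOm Lphi orth Lf; have [Lv _ _] := W.
rewrite -subr_le0.
have c1 : inr v chi - inr (S (res (co f)) N) chi @[N --> \oo] -->
    inr v chi - pair (res (co f)) chi.
  by apply: cvgB; [exact: cvg_cst|exact: pres].
apply: (ler_cvg_to c1 (@err_cvg _ chi (compl_nrm mOm Lphi compl Lf))); apply: nearW => N.
have Lg : L2 (fun t => S (co f) N t - f t) by exact: (L2B mOm).
have Lg' : L2 (fun t => -1 * (S (co f) N t - f t)) by exact: L2Z.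
have W2 := wkA_lin oOm bOm cA bA cc bc 1 (-1) W (wkA_S (res (co f)) N).
have := max_principle oOm bOm L0 cA bA th0 ellA cc bc W2 m0 (lexx 0) Lg' _ Lc c0.
rewrite (nrmZ mOm (-1) Lg) normrN1 mul1r -(innerBl mOm Lv (LS _ N) Lc) => H.
apply: le_trans (H _).
  by rewrite le_eqVlt; apply/orP; left; apply/eqP; apply: inner_eq => // t _; ring.
apply: ae_mono kf => t h Ot; have := h Ot; have := resE (co f) N t.
by move=> e; rewrite -e mulr0 add0r; lra.
Qed.

End Resolvent.

(** * Spreading of positivity *)

Section RateChoice.
Context {R : realType}.

(** For p = X^2 >= 1 and al < 1 one has sqrt(p^al) <= X, whereas p tau/2 >= (K + 1) X for large X.
    The spare factor exp(-X) absorbs C p. *)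
Lemma choose_rate (al K C m0 tau : R) : 0 < al < 1 -> 0 <= K -> 0 < C -> 0 <= m0 -> 0 < tau ->
  exists p : R, [/\ 0 < p, m0 <= p `^ al &
    expR (- (p * tau / 2)) * ((p / 2) `^ al)^-1 <
    expR (- (K * Num.sqrt (p `^ al))) / (C * p `^ al)].
Proof.
move=> /andP[al0 al1] K0 C0 m00 tau0.
(* The summands serve in turn for p/2 >= 1, X tau/2 >= K + 1, C p < X^3/6 <= exp X, and p^al >=
   m0. *)
pose X := 2 + 2 * (K + 1) / tau + 6 * C + m0 `^ al^-1.
have h1 : 0 <= 2 * (K + 1) / tau by rewrite divr_ge0 ?(ltW tau0)// mulr_ge0// addr_ge0.
have h2 : 0 <= m0 `^ al^-1 by exact: powR_ge0.
have X2 : 2 <= X by rewrite /X; lra.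
have X0 : 0 < X by lra.
have Xt : K + 1 <= X * tau / 2.
  have : 2 * (K + 1) / tau <= X by rewrite /X; lra.
  by rewrite ler_pdivrMr//; lra.
have XC : 6 * C < X by rewrite /X; lra.
have Xm : m0 `^ al^-1 <= X by rewrite /X; lra.
have Xp : 4 <= X ^+ 2 by rewrite expr2; nra.
have XX : X <= X ^+ 2 by rewrite expr2; nra.
have Xp0 : 0 < X ^+ 2 by lra.
clearbody X; exists (X ^+ 2); set p := X ^+ 2 in Xp XX Xp0 *.
have m1 : p `^ al <= p.
  by rewrite -[leRHS](powRr1 (ltW Xp0)); apply: ler_powR; [lra|exact: ltW].
have m2 : 1 <= (p / 2) `^ al.
  have e1 : 1 = 1 `^ al :> R by rewrite powR1.
  by rewrite [leLHS]e1; apply: ge0_ler_powR; rewrite ?nnegrE; lra.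
have m3 : m0 <= p `^ al.
  have e : m0 = (m0 `^ al^-1) `^ al by rewrite -powRrM mulVf ?gt_eqF// powRr1.
  by rewrite [leLHS]e; apply: ge0_ler_powR; rewrite ?nnegrE; lra.
have mp : 0 < p `^ al by exact: powR_gt0.
have s1 : Num.sqrt (p `^ al) <= X.
  by rewrite -[leRHS](ger0_norm (ltW X0)) -sqrtr_sqr; apply: ler_wsqrtr.
split => //.
have l1 : expR (- (p * tau / 2)) * ((p / 2) `^ al)^-1 <= expR (- (K * X) - X).
  rewrite -[leRHS]mulr1; apply: ler_pM; rewrite ?expR_ge0 ?invr_ge0 ?powR_ge0//; last first.
    by rewrite invf_le1// (lt_le_trans ltr01 m2).
  rewrite ler_expR; have : X * (K + 1) <= X * (X * tau / 2) by rewrite ler_pM2l.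
  by rewrite /p; lra.
have l2 : expR (- (K * X)) / (C * p) <= expR (- (K * Num.sqrt (p `^ al))) / (C * p `^ al).
  have C0' := ltW C0; have Xp0' := ltW Xp0.
  apply: ler_pM; [exact: expR_ge0|by rewrite invr_ge0; apply: mulr_ge0| |].
    by rewrite ler_expR lerN2; apply: ler_wpM2l.
  by rewrite lef_pV2 ?posrE ?mulr_gt0//; apply: ler_wpM2l => //; exact: ltW.
apply: (le_lt_trans l1); apply: (lt_le_trans _ l2).
rewrite ltr_pdivlMr ?mulr_gt0// expRD -mulrA [ltRHS](esym (mulr1 _)) ltr_pM2l ?expR_gt0//.
rewrite expRN mulrC ltr_pdivrMr ?expR_gt0// mul1r.
have := pow_le_expR 3 (ltW X0); rewrite (_ : 3`!%:R = 6 :> R)// => e3.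
have : 6 * C * p < X * p by rewrite ltr_pM2r.
have -> : X * p = X ^+ 3 by rewrite /p; ring.
lra.
Qed.

(** Makes the constant of [pm_ee_lower] uniform over all times up to [T]. *)
Lemma gk_div_le (al t T : R) : 0 < al < 1 -> 0 < t -> t <= T ->
  gk (1 - al) T / T <= gk (1 - al) t / t.
Proof.
move=> /andP[al0 al1] t0 tT; have T0 := lt_le_trans t0 tT.
apply: ler_pM; rewrite ?invr_ge0 ?(ltW T0) ?gk_ge0 ?subr_gt0//; last by rewrite lef_pV2.
rewrite /gk ler_wpM2r ?invr_ge0 ?(ltW (Gamma_gt0 _)) ?subr_gt0//.
have -> : 1 - al - 1 = - al by ring.
rewrite !powRN lef_pV2 ?posrE ?powR_gt0//; apply: ge0_ler_powR; rewrite ?nnegrE ?(ltW al0) ?(ltW t0) ?(ltW T0)//.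
Qed.

End RateChoice.

Section LowerBounds.
Context {R : realType} {d : nat}.
Notation V := 'rV[R]_d.
Notation bV := (borelRV R d).
Notation leb := (@leb R d).
Variable Om : set V.
Hypotheses (oOm : open Om) (bOm : bounded_set Om).
Notation inr := (inner leb (Om : set bV)).
Notation L2 := (L2 leb (Om : set bV)).
Let mOm : measurable (Om : set bV). Proof. exact: measurable_open. Qed.

Lemma L2_indic (B : set V) : measurable (B : set bV) -> L2 (\1_B : V -> R).
Proof.
move=> mB; apply: (L2_bounded mOm (leb_bounded mOm bOm) (M := 1)).
  exact: (@measurable_indic _ bV R (Om : set bV) B mB).
by move=> x _; rewrite indicE; case: (_ \in _); rewrite ?normr1 ?normr0.
Qed.

(** The test function is the negative part of [f - k], cut off to [B]. *)
Lemma ae_lower (f : V -> R) (B : set V) (k : R) : measurable (B : set bV) ->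
  B `<=` Om -> L2 f ->
  (forall chi : V -> R, L2 chi -> (forall x, 0 <= chi x) -> (forall x, ~ B x -> chi x = 0) ->
    k * inr (fun=> 1) chi <= inr f chi) ->
  {ae leb, forall x, B x -> k <= f x}.
Proof.
move=> mB BO Lf H; have Lk : L2 (fun=> k) by exact: (L2_cst oOm bOm).
have L1 : L2 (fun=> 1) by exact: (L2_cst oOm bOm).
have Lg : L2 (fun x => f x - k) by exact: (L2B mOm).
pose chi := fun x : V => (\1_B x : R) * negp (fun x : bV => f x - k) x.
have Lc : L2 chi.
  apply: (L2_bmul mOm (M := 1)); last exact: L2_negp.
    exact: (@measurable_indic _ bV R (Om : set bV) B mB).
  by move=> x _; rewrite indicE; case: (_ \in _); rewrite ?normr1 ?normr0.
have c0 x : 0 <= chi x by rewrite mulr_ge0 ?negp_ge0// indicE.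
have cB x : ~ B x -> chi x = 0.
  by move=> nB; rewrite /chi indicE memNset// mul0r.
have := H chi Lc c0 cB; rewrite -(innerZl mOm k L1 Lc) -subr_ge0.
rewrite -(innerBl mOm Lf (L2Z mOm k L1) Lc).
have -> : inr (fun x => f x - k * 1) chi = inr (fun x => -1 * chi x) chi.
  rewrite /inner; apply: eq_Rintegral => x _; rewrite /chi indicE mulr1.
  case: (_ \in _); rewrite ?mul1r ?mul0r ?mulr0//= /negp.
  by case: leP => _; ring.
rewrite (innerZl mOm _ Lc Lc) mulN1r oppr_ge0 => le0.
have e0 : inr chi chi = 0 by apply/eqP; rewrite eq_le le0 inner_ge0.
have m2 := L2_meas Lc.
have j2 := L2_sqr Lc.
have i2 : \int[leb]_(x in (Om : set bV)) (chi x ^+ 2) = 0 by rewrite -inner_sqr.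
have := Rintegral0_ae mOm (rint_meas j2) (fun x _ => sqr_ge0 (chi x)) j2 i2.
apply: ae_mono => x hx Bx; have /eqP := hx (BO _ Bx).
rewrite sqrf_eq0 /chi indicE mem_set// mul1r /negp => /eqP h.
by have : - (f x - k) <= 0; [rewrite -[leRHS]h le_max lexx|lra].
Qed.

(** By continuity a violation would hold on a nonempty open set, and such a set has positive
    measure. *)
Lemma cont_lower (f : V -> R) (B : set V) (k : R) : open B -> B `<=` Om ->
  (forall x, Om x -> {for x, continuous f}) ->
  {ae leb, forall x, B x -> k <= f x} -> forall x, B x -> k <= f x.
Proof.
move=> oB BO cf h x Bx; rewrite leNgt; apply/negP => fx.
pose W := [set y | B y /\ f y < k].
have oW : open W.
  rewrite openE => y [By fy]; rewrite /interior.
  have n1 : nbhs y B by exact: open_nbhs_nbhs.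
  have n2 : nbhs y [set z | f z < k].
    have nk : nbhs (f y) [set z | z < k] by exact: lt_nbhsl.
    exact: (cf y (BO y By) _ nk).
  exact: filterI n1 n2.
have W0 : W !=set0 by exists x.
have [N [mN N0 sub]] := h.
have := leb_open_gt0 oW W0; rewrite ltNge => /negP; apply.
rewrite -N0; apply: le_measure; rewrite ?inE//; first exact: measurable_open.
by move=> y [By fy]; apply: sub => /(_ By); rewrite leNgt fy.
Qed.

End LowerBounds.

Section Spreading.
Context {R : realType} {d : nat}.
Notation V := 'rV[R]_d.
Notation bV := (borelRV R d).
Notation leb := (@leb R d).
Notation lebR := (@lebesgue_measure R).
Notation mR := (measurableTypeR R).
Variable Om : set V.
Hypotheses (oOm : open Om) (bOm : bounded_set Om).
Notation inr := (inner leb (Om : set bV)).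
Notation L2 := (L2 leb (Om : set bV)).
Variables (lam : nat -> R) (phi : nat -> V -> R) (al : R).
Hypothesis al01 : 0 < al < 1.
Hypothesis lam0 : forall n, 0 < lam n.
Hypothesis Lphi : forall n, L2 (phi n).
Hypothesis orth : forall m n, inr (phi m) (phi n) = (m == n)%:R.
Hypothesis compl : forall f, L2 f ->
  L2cvg leb (Om : set bV) (fun N x => \sum_(n < N) inr f (phi n) * phi n x) f.
Notation pair := (pair leb (Om : set bV) phi).
Notation co := (co leb (Om : set bV) phi).
Notation nv := (nv leb (Om : set bV) phi).
Notation pm := (pm leb (Om : set bV) phi).
Notation ind z r := (\1_(eball z r) : V -> R).
Hypothesis pm_res : forall m, 0 < m -> pm (fun n => (m + lam n)^-1).
Hypothesis res_le : forall (z : V) (r m : R) (chi : V -> R), 0 < m -> L2 chi ->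
  (forall x, 0 <= chi x) ->
  pair (fun n => (m + lam n)^-1 * co (ind z r) n) chi <= m^-1 * inr (fun=> 1) chi.
Hypothesis ball_ge : forall (z : V) (r rr : R), 0 < r -> r < rr -> cball z rr `<=` Om ->
  exists C C' m0 : R, [/\ 0 <= C, 0 < C', 0 <= m0 & forall (m : R) (chi : V -> R),
    m0 <= m -> 0 < m -> L2 chi -> (forall x, 0 <= chi x) ->
    (forall x, ~ eball z (rr / 2) x -> chi x = 0) ->
    expR (- (C * Num.sqrt m)) / (C' * m) * inr (fun=> 1) chi <=
    pair (fun n => (m + lam n)^-1 * co (ind z r) n) chi].
Variables (T : R) (b : nat -> R) (u : R -> V -> R).
Hypothesis nb : nv b.
Hypothesis Lu : forall t, 0 < t < T -> L2 (u t).
Hypothesis cou : forall t n, 0 < t < T -> co (u t) n = ee al (lam n) t * b n.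
Hypothesis cu : forall t, 0 < t < T -> forall x, Om x -> {for x, continuous (u t)}.

Let mOm : measurable (Om : set bV). Proof. exact: measurable_open. Qed.
Let L1 : L2 (fun=> 1). Proof. exact: (L2_cst oOm bOm). Qed.
Let Lind z r : L2 (ind z r). Proof. exact: (L2_indic oOm bOm (measurable_eball z r)). Qed.

Lemma u_ge0 t : 0 < t < T -> {ae leb, forall x, Om x -> 0 <= u t x}.
Proof.
move=> tT; have /andP[t0 _] := tT; apply: (nv_ge0 mOm Lphi compl (Lu tT)).
apply: (nv_eq (x := fun n => ee al (lam n) t * b n)) => [n|]; first by rewrite cou.
by have [_] := pm_ee mOm Lphi orth al01 lam0 pm_res t0; apply.
Qed.

(** In the time integral of [u] over (0,t1), the times outside [S] are discarded because [u] is
    nonnegative there. *)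
Lemma EE_lower (S : set mR) (t1 delta : R) (g : V -> R) : measurable S ->
  S `<=` `]0, t1[%classic -> 0 < t1 < T -> 0 <= delta -> L2 g ->
  (forall s, S s -> {ae leb, forall x, Om x -> delta * g x <= u s x}) ->
  nv (fun n => EE al (lam n) t1 * b n - delta * fine (lebR S) * co g n).
Proof.
move=> mS SI /andP[t10 t1T] delta0 Lg H; have [lb _] := nb.
pose I : set mR := `]0%R, t1[%classic.
have mI : measurable I by exact: measurable_itv.
have IT s : I s -> 0 < s < T.
  by rewrite /I /= in_itv /= => /andP[-> h]; exact: lt_trans h t1T.
have j1 : rint lebR I (fun=> 1).
  by apply: (rint_eq mI _ (rint_gk ltr01 t10)) => s _; rewrite gk1.
have ee01 l s : 0 < l -> I s -> 0 <= ee al l s <= 1.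
  by move=> l0 /IT/andP[s0 _]; rewrite ee_ge0// ee_le1// ltW.
have me l : measurable_fun I (ee al l).
  by apply: (measurable_funS mP _ (measurable_ee al01 l)) => s /IT/andP[s0 _]; exact/PE.
have je l : 0 < l -> rint lebR I (ee al l).
  move=> l0; apply: (rint_le mI (me l) _ j1) => s Is.
  by have /andP[h1 h2] := ee01 _ _ l0 Is; rewrite ger0_norm.
have bE : bseq (fun n => EE al (lam n) t1).
  exists (\int[lebR]_(s in I) 1) => n; rewrite (EE_int al01 _ t10) ger0_norm.
    by apply: (le_Rintegral_ae mI (je _ (lam0 n)) j1); apply: aeW => s /(ee01 _ _ (lam0 n))/andP[].
  by apply: Rintegral_ge0 => s /(ee01 _ _ (lam0 n))/andP[].
have lE := l2bM bE lb; have lg := l2b_co mOm Lphi orth Lg.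
have lk := l2bZ (delta * fine (lebR S)) lg.
split; first by have := l2bD lE (l2bZ (-1) lk); congr l2b; apply/funext => n; rewrite mulN1r.
move=> chi Lc c0.
have F1 n : measurable_fun I (fun s => ee al (lam n) s) by exact: me.
have F2 s n : I s -> `|ee al (lam n) s| <= 1.
  by move=> Is; have /andP[h1 h2] := ee01 _ _ (lam0 n) Is; rewrite ger0_norm.
have [jh eh] := pair_int mOm Lphi orth (F := fun s n => ee al (lam n) s) mI F1 j1 F2 lb Lc.
have hE s : I s -> pair (fun n => ee al (lam n) s * b n) chi = inr (u s) chi.
  move=> /IT sT; rewrite -(parseval mOm Lphi compl (Lu sT) Lc); congr pair.
  by apply/funext => n; rewrite cou.
rewrite (pairB mOm Lphi orth lE lk Lc) (pairZ mOm Lphi orth _ lg Lc).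
rewrite (parseval mOm Lphi compl Lg Lc) subr_ge0.
have -> : (fun n => EE al (lam n) t1 * b n) =
    (fun n => \int[lebR]_(s in I) ee al (lam n) s * b n).
  by apply/funext => n; rewrite (EE_int al01 _ t10).
rewrite eh; have mi := @measurable_indic _ mR R I S mS.
have ji : rint lebR I (\1_S : mR -> R).
  apply: (rint_le mI mi _ j1) => s _.
  by rewrite indicE; case: (_ \in _); rewrite ?normr1 ?normr0.
have -> : delta * fine (lebR S) * inr g chi =
    \int[lebR]_(s in I) (delta * inr g chi * (\1_S s : R)).
  rewrite (RintegralZl _ mI ji) mulrAC; congr (_ * _).
  by rewrite /Rintegral integral_indic// setIidl.
apply: (le_Rintegral_ae mI (rintZ mI _ ji) jh); apply: aeW => s Is; rewrite hE// indicE.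
have Ls := Lu (IT _ Is).
case: (boolP (s \in S)) => [/set_mem Ss|_] /=; last first.
  by rewrite mulr0; apply: (inner_nonneg mOm Ls Lc) c0; exact: u_ge0 (IT _ Is).
rewrite mulr1 -(innerZl mOm delta Lg Lc) -subr_ge0 -(innerBl mOm Ls (L2Z mOm delta Lg) Lc).
apply: (inner_nonneg mOm (L2B mOm Ls (L2Z mOm delta Lg)) Lc) c0.
by apply: ae_mono (H s Ss) => x h Ox; rewrite subr_ge0 h.
Qed.

(* [ee(t) b] dominates [k FF(t - t1) EE(t1) b], then [EE(t1) b] dominates a multiple
   of the indicator of the ball, and [FF(tau)] dominates the resolvent
   [(A + p^al)^-1] up to an error exponentially small in [p]; on the indicator the
   resolvent is bounded below by a barrier which is only [exp (- C p^(al/2))]. *)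
Lemma spread (S : set mR) (t1 t2 delta : R) (z : V) (r rr : R) : measurable S ->
  S `<=` `]0, t1[%classic -> (0 < lebR S)%E -> 0 < t1 -> t1 < t2 -> t2 < T -> 0 < delta ->
  0 < r -> r < rr -> cball z rr `<=` Om ->
  (forall s, S s -> {ae leb, forall x, eball z r x -> delta <= u s x}) ->
  exists2 delta', 0 < delta' & forall t, t2 <= t < T -> forall x, eball z (rr / 2) x -> delta' <= u t x.
Proof.
move=> mS SI S0 t10 t12 t2T delta0 r0 rrr sub H.
have t1T : 0 < t1 < T by rewrite t10 (lt_trans t12 t2T).
have rr0 : 0 < rr by exact: lt_trans rrr.
have T0 : 0 < T by lra.
have H' s : S s -> {ae leb, forall x, Om x -> delta * ind z r x <= u s x}.
  move=> Ss; have sT : 0 < s < T.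
    by have := SI _ Ss; rewrite /= in_itv /= => /andP[-> h]; lra.
  apply: (ae_mono2 _ (H s Ss) (u_ge0 sT)) => x h1 h2 Ox; rewrite indicE.
  by case: (boolP (x \in eball z r)) => [/set_mem Bx|_]; rewrite ?mulr1 ?mulr0; [exact: h1|exact: h2].
have nvE := EE_lower mS SI t1T (ltW delta0) (Lind z r) H'.
have Sfin : lebR S \is a fin_num.
  rewrite ge0_fin_numE//; apply: (@le_lt_trans _ _ (lebR (`]0%R, t1[%classic : set mR))).
    by apply: le_measure; rewrite ?inE.
  by rewrite lebesgue_measure_itv /= lte_fin t10 -EFinB ltry.
have fS : 0 < fine (lebR S) by rewrite -lte_fin fineK.
move: nvE; set ka := delta * _ => nvE.
have ka0 : 0 < ka by exact: mulr_gt0.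
have [C [C' [m0 [C0 C'0 m00 hb]]]] := ball_ge r0 rrr sub.
have tau0 : 0 < t2 - t1 by rewrite subr_gt0.
have [p [p0 m0p hp]] := choose_rate al01 C0 C'0 m00 tau0.
move: hp; set E := expR (- (p * _ / 2)); set eta := expR _ / _ => hp.
have mp : 0 < p `^ al by exact: powR_gt0.
have p2 : 0 < p / 2 by rewrite divr_gt0.
have mp2 : 0 < (p / 2) `^ al by exact: powR_gt0.
have /andP[al0 al1] := al01.
have T1 : t1 < T by lra.
(* Value at time [T] of the factor from [pm_ee_lower], a lower bound for it at all times
   considered. *)
pose kmin := al * gk (1 - al) T / T.
have kmin0 : 0 < kmin by rewrite /kmin divr_gt0// mulr_gt0// gk_gt0// subr_gt0.
pose de := kmin * ka * (eta - E * ((p / 2) `^ al)^-1).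
exists de => [|t /andP[t2t tT]]; first by apply: mulr_gt0; [exact: mulr_gt0|rewrite subr_gt0].
have tau1 : 0 < t - t1 by lra.
have t0T : 0 < t < T by lra.
have B2 : eball z (rr / 2) `<=` Om.
  move=> x /eball_sub_cball Bx; apply: sub; apply: le_trans Bx _.
  by rewrite ler_sqr ?nnegrE; lra.
have cut := cu t0T.
apply: (cont_lower (@open_eball R d z (rr / 2)) B2 cut).
apply: (ae_lower oOm bOm (measurable_eball z (rr / 2)) B2 (Lu t0T)) => chi Lc c0 cB.
have c0' : {ae leb, forall x, Om x -> 0 <= chi x} by exact: ae_all.
set k := al * gk (1 - al) t / t.
have kk : kmin <= k.
  have tT' : t <= T by lra.
  have tp : 0 < t by lra.
  have := ler_wpM2l (ltW al0) (gk_div_le al01 tp tT').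
  by rewrite (mulrA al (gk (1 - al) T)) (mulrA al (gk (1 - al) t)).
have k0 : 0 <= k by lra.
have [_ /(_ _ nb) nv1] := pm_ee_lower mOm Lphi orth al01 lam0 pm_res t10 tau1.
have et : t1 + (t - t1) = t by lra.
rewrite et in nv1.
have [_ /(_ _ nvE) nv2] := pm_FF mOm Lphi orth al01 lam0 pm_res tau1.
have tt : t2 - t1 <= t - t1 by lra.
have Lg := Lind z r.
have ng : nv (co (ind z r)).
  by apply: (nv_co mOm Lphi orth compl Lg); apply: ae_all => x _; rewrite indicE.
(* FF(t - t1) is lowered to FF(t2 - t1), so that the rate [p], chosen for t2 - t1, gives one
   constant for every t >= t2. *)
have [_ /(_ _ ng) nv3] := pm_FF_mono mOm Lphi orth al01 lam0 pm_res tau0 tt.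
have [_ /(_ _ ng) nv4] := pm_FF_lower mOm Lphi orth al01 lam0 pm_res tau0 p0.
have k1 : 0 <= k * ka by rewrite mulr_ge0// ltW.
(* The weights make the four differences telescope to [u t] minus a multiple of the split resolvent
   of the indicator. *)
have nvs := nvD mOm Lphi orth (nvD mOm Lphi orth nv1 (nvZ mOm Lphi orth k0 nv2))
  (nvD mOm Lphi orth (nvZ mOm Lphi orth k1 nv3) (nvZ mOm Lphi orth k1 nv4)).
have lg := l2b_co mOm Lphi orth Lg.
have lu := l2b_co mOm Lphi orth (Lu t0T).
have l1 := l2bM (pm_res mp).1 lg.
have l2 := l2bM (pm_res mp2).1 lg.
have {nvs} nvs : nv (fun n => co (u t) n - (k * ka * ((p `^ al + lam n)^-1 * co (ind z r) n)
   - k * ka * E * (((p / 2) `^ al + lam n)^-1 * co (ind z r) n))).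
  apply: nv_eq nvs => n; rewrite cou// /k -/E.
  rewrite [lam n + p `^ al]addrC [lam n + (p / 2) `^ al]addrC; ring.
have := nvs.2 chi Lc c0'.
have la := l2bZ (k * ka) l1; have lb := l2bZ (k * ka * E) l2.
have lab : l2b (fun n => k * ka * ((p `^ al + lam n)^-1 * co (ind z r) n)
   - k * ka * E * (((p / 2) `^ al + lam n)^-1 * co (ind z r) n)).
  by have := l2bD la (l2bZ (-1) lb); congr l2b; apply/funext => n; rewrite mulN1r.
rewrite (pairB mOm Lphi orth lu lab Lc) (pairB mOm Lphi orth la lb Lc).
rewrite (pairZ mOm Lphi orth (k * ka) l1 Lc) (pairZ mOm Lphi orth (k * ka * E) l2 Lc).
rewrite (parseval mOm Lphi compl (Lu t0T) Lc).
have := hb _ _ m0p mp Lc c0 cB; have := res_le z r mp2 Lc c0.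
have I1 : 0 <= inr (fun=> 1) chi.
  by apply: (inner_nonneg mOm L1 Lc) c0'; apply: ae_all => x _; exact: ler01.
have E0 : 0 <= E by exact: expR_ge0.
set P1 := pair (fun n => (p `^ al + lam n)^-1 * co (ind z r) n) chi.
set P2 := pair (fun n => ((p / 2) `^ al + lam n)^-1 * co (ind z r) n) chi.
rewrite -/eta; move: P1 P2 (inr (fun=> 1) chi) I1 => P1 P2 I1 I10 h2 h1 h3.
have a1 : k * ka * (eta * I1) <= k * ka * P1 by exact: ler_wpM2l.
have a2 : k * ka * E * P2 <= k * ka * E * (((p / 2) `^ al)^-1 * I1).
  by apply: ler_wpM2l => //; exact: mulr_ge0.
have a3 : kmin * (ka * (eta - E * ((p / 2) `^ al)^-1) * I1) <=
    k * (ka * (eta - E * ((p / 2) `^ al)^-1) * I1).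
  apply: ler_wpM2r => //; apply: mulr_ge0 => //; apply: mulr_ge0; first exact: ltW.
  by rewrite subr_ge0 ltW.
rewrite /de; move: a1 a2 a3 h3; lra.
Qed.

End Spreading.

Section BallResolvent.
Context {R : realType} {d : nat}.
Notation V := 'rV[R]_d.
Notation bV := (borelRV R d).
Notation leb := (@leb R d).
Notation basis := (@basis_vec R d).
Variable Om : set V.
Hypotheses (oOm : open Om) (bOm : bounded_set Om).
Notation inr := (inner leb (Om : set bV)).
Notation L2 := (L2 leb (Om : set bV)).
Variables (A : V -> 'M[R]_d) (c : V -> R) (L th : R).
Hypothesis L0 : 0 <= L.
Hypothesis cA : forall i j x, Om x -> {for x, continuous (fun y => A y i j)}.
Hypothesis bA : forall i j x, Om x -> `|A x i j| <= L.
Hypothesis dA : forall k i j x, Om x -> derivable (fun y => A y i j) x (basis k).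
Hypothesis cdA : forall k i j x, Om x -> {for x, continuous (pd k (fun y => A y i j))}.
Hypothesis bdA : forall k i j x, Om x -> `|pd k (fun y => A y i j) x| <= L.
Hypothesis th0 : 0 < th.
Hypothesis ellA : forall x (xi : 'I_d -> R), Om x ->
  th * (\sum_i xi i ^+ 2) <= \sum_i \sum_j A x i j * xi j * xi i.
Hypothesis cc : forall x, Om x -> {for x, continuous c}.
Hypothesis bc : forall x, Om x -> 0 <= c x <= L.
Variables (lam : nat -> R) (phi : nat -> V -> R).
Hypothesis lam0 : forall n, 0 < lam n.
Hypothesis eig : forall n, wkA Om A c (phi n) (fun x => lam n * phi n x).
Hypothesis orth : forall m n, inr (phi m) (phi n) = (m == n)%:R.
Hypothesis compl : forall f, L2 f ->
  L2cvg leb (Om : set bV) (fun N x => \sum_(n < N) inr f (phi n) * phi n x) f.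
Notation pair := (pair leb (Om : set bV) phi).
Notation co := (co leb (Om : set bV) phi).
Notation ind z r := (\1_(eball z r) : V -> R).

Let mOm : measurable (Om : set bV). Proof. exact: measurable_open. Qed.
Let Lind z r : L2 (ind z r).
Proof. exact: (L2_indic oOm bOm (measurable_eball z r)). Qed.

Lemma resolvent_ball_le (z : V) (r m : R) (chi : V -> R) : 0 < m -> L2 chi ->
  (forall x, 0 <= chi x) ->
  pair (fun n => (m + lam n)^-1 * co (ind z r) n) chi <= m^-1 * inr (fun=> 1) chi.
Proof.
move=> m0 Lc c0; have L1 : L2 (fun=> 1) by exact: (L2_cst oOm bOm).
have f1 : {ae leb, forall x, Om x -> ind z r x <= m * m^-1}.
  have h x : ind z r x <= 1 by rewrite indicE; case: (x \in _); rewrite ?lexx ?ler01.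
  by apply: ae_all => x _; rewrite mulfV ?gt_eqF//; exact: h.
have mi : 0 <= m^-1 by rewrite invr_ge0 ltW.
have c0' : {ae leb, forall x, Om x -> 0 <= chi x} by exact: ae_all.
have := resolvent_le oOm bOm L0 cA bA th0 ellA cc bc lam0 eig orth compl m0 mi (Lind z r) f1 Lc c0'.
move=> /le_trans; apply; rewrite -(innerZl mOm m^-1 L1 Lc).
by rewrite le_eqVlt; apply/orP; left; apply/eqP; apply: inner_eq => // x _; rewrite mulr1.
Qed.

(** The barrier divided by C' m is a subsolution for the indicator of the inner ball, so it bounds
    the resolvent from below. *)
Lemma resolvent_ball_ge (z : V) (r rr : R) : 0 < r -> r < rr -> cball z rr `<=` Om ->
  exists C C' m0 : R, [/\ 0 <= C, 0 < C', 0 <= m0 & forall (m : R) (chi : V -> R),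
    m0 <= m -> 0 < m -> L2 chi -> (forall x, 0 <= chi x) ->
    (forall x, ~ eball z (rr / 2) x -> chi x = 0) ->
    expR (- (C * Num.sqrt m)) / (C' * m) * inr (fun=> 1) chi <=
    pair (fun n => (m + lam n)^-1 * co (ind z r) n) chi].
Proof.
move=> r0 rrr sub; have rr0 := lt_trans r0 rrr.
have [C [C' [m0 [C0 C'0 m00 H]]]] := barrier_exists L0 bA bdA bc th0 ellA z r0 rrr.
(* On the half ball rr^2 - |x - z|^2 is at least 3/4 rr^2, which controls the exponent of the
   bump. *)
pose Q := (3 / 4 * rr ^+ 2)^-1; have q0 : 0 < 3 / 4 * rr ^+ 2 by rewrite mulr_gt0// exprn_gt0.
have Q0 : 0 < Q by rewrite invr_gt0.
exists (C * Q), C', m0; split; rewrite ?(ltW m00) ?mulr_ge0 ?(ltW C0) ?(ltW Q0)//.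
move=> m chi m0m mp Lc c0 cB; have L1 : L2 (fun=> 1) by exact: (L2_cst oOm bOm).
have sm : 0 < Num.sqrt m by rewrite sqrtr_gt0.
have ka0 : 0 < C * Num.sqrt m by exact: mulr_gt0.
have tb : test_function Om (bump z rr (C * Num.sqrt m)) by exact: bump_isTest r0 rrr sub _ ka0.
have W := wkA_test oOm bOm cA bA dA cdA bdA cc bc tb.
have Cm : 0 < C' * m by exact: mulr_gt0.
have W' := wkA_lin oOm bOm cA bA cc bc (C' * m)^-1 0 W W.
have c0' : {ae leb, forall x, Om x -> 0 <= chi x} by exact: ae_all.
have hf : {ae leb, forall x, Om x ->
    (C' * m)^-1 * strongA A c (bump z rr (C * Num.sqrt m)) x + 0 * strongA A c (bump z rr (C * Num.sqrt m)) x +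
    m * ((C' * m)^-1 * bump z rr (C * Num.sqrt m) x + 0 * bump z rr (C * Num.sqrt m) x) <= ind z r x}.
  apply: ae_all => x Ox; have := H m x m0m Ox.
  rewrite -ler_pdivrMl// => h; apply: le_trans h.
  by rewrite le_eqVlt; apply/orP; left; apply/eqP; ring.
have := resolvent_ge oOm bOm L0 cA bA th0 ellA cc bc lam0 eig orth compl mp W' (Lind z r) hf Lc c0'.
apply: le_trans; have [Lv _ _] := W'.
rewrite -(innerZl mOm _ L1 Lc) -subr_ge0 -(innerBl mOm Lv (L2Z mOm _ L1) Lc).
apply: Rintegral_ge0 => x Ox.
have [Bx|nB] := pselect (eball z (rr / 2) x); last by rewrite (cB x nB) mulr0.
apply: mulr_ge0 => //; rewrite subr_ge0 mul0r addr0 mulr1 mulrC ler_pM2l ?invr_gt0//.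
rewrite /eball /= in Bx; have Bq : 3 / 4 * rr ^+ 2 < rr ^+ 2 - sqd z x.
  by move: Bx; rewrite expr_div_n; move: (sqd z x) (rr ^+ 2) => X Y; lra.
have Bp : 0 < rr ^+ 2 - sqd z x by exact: lt_trans Bq.
rewrite /bump /flat Bp expr0 mul1r ler_expR lerN2 [leRHS]mulrAC; apply: ler_wpM2l; first exact: ltW.
by rewrite /Q lef_pV2 ?posrE// ltW.
Qed.

End BallResolvent.

(** * From one ball to the whole domain *)

Section Positivity.
Context {R : realType} {d : nat}.
Notation V := 'rV[R]_d.
Notation bV := (borelRV R d).
Notation leb := (@leb R d).
Notation lebR := (@lebesgue_measure R).
Notation mR := (measurableTypeR R).
Variable Om : set V.
Hypotheses (oOm : open Om) (bOm : bounded_set Om) (kOm : connected Om).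
Notation nm := (nrm leb (Om : set bV)).
Notation L2 := (L2 leb (Om : set bV)).
Variables (T : R) (u : R -> V -> R).
Hypothesis Lu : forall t, 0 < t < T -> L2 (u t).
Hypothesis cu : forall t, 0 < t < T -> forall x, Om x -> {for x, continuous (u t)}.
Hypothesis tu : L2_time_continuous Om T u.
Hypothesis u_ge0 : forall t, 0 < t < T -> {ae leb, forall x, Om x -> 0 <= u t x}.
Hypothesis u_neq0 : forall t, 0 < t < T -> ~ {ae leb, forall x, Om x -> u t x = 0}.
Hypothesis spread : forall (S : set mR) (t1 t2 delta : R) (z : V) (r rr : R), measurable S ->
  S `<=` `]0, t1[%classic -> (0 < lebR S)%E -> 0 < t1 -> t1 < t2 -> t2 < T -> 0 < delta ->
  0 < r -> r < rr -> cball z rr `<=` Om ->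
  (forall s, S s -> {ae leb, forall x, eball z r x -> delta <= u s x}) ->
  exists2 delta', 0 < delta' & forall t, t2 <= t < T -> forall x, eball z (rr / 2) x -> delta' <= u t x.

Let mOm : measurable (Om : set bV). Proof. exact: measurable_open. Qed.

Lemma seed_point s : 0 < s < T -> exists x, Om x /\ 0 < u s x.
Proof.
move=> sT; apply: contrapT => h; apply: (u_neq0 sT).
apply: ae_mono (u_ge0 sT) => x ge0 Ox; apply/eqP; rewrite eq_le ge0// andbT leNgt.
by apply/negP => lt; apply: h; exists x.
Qed.

(** Countably many candidates for a first ball with a lower bound: rational centre, inverse integer
    radius, inverse integer bound. *)
Definition seed := ('rV[rat]_d * nat * nat)%type.
Definition seed_z (q : seed) : V := map_mx ratr q.1.1.
Definition seed_r (q : seed) : R := q.1.2.+1%:R^-1.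
Definition seed_c (q : seed) : R := q.2.+1%:R^-1.

Lemma seed_exists s : 0 < s < T -> exists q : seed,
  cball (seed_z q) (seed_r q) `<=` Om /\
  forall x, eball (seed_z q) (seed_r q) x -> seed_c q <= u s x.
Proof.
move=> sT; have [x [Ox ux]] := seed_point sT.
pose W := [set y | Om y /\ u s x / 2 < u s y].
have oW : open W.
  rewrite openE => y [Oy uy]; rewrite /interior.
  have n1 : nbhs y Om by exact: open_nbhs_nbhs.
  have nk : nbhs (u s y) [set z | u s x / 2 < z] by exact: lt_nbhsr.
  have n2 : nbhs y [set z | u s x / 2 < u s z] by exact: (cu sT Oy nk).
  exact: filterI n1 n2.
have Wx : W x by split => //; rewrite ltr_pdivrMr// ltr_pMr// ltr1n.
have [qk [_ sub]] := qball_cover oW Wx.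
have u2 : 0 < u s x / 2 by rewrite divr_gt0.
have [j hj] : exists j : nat, j.+1%:R^-1 < u s x / 2.
  exists (Num.trunc (u s x / 2)^-1).
  by rewrite invf_plt ?posrE// truncnS_gt // invr_ge0 ltW.
exists (qk, j); split => [y|y] h; first by case: (sub y h).
have [_ h2] := sub _ (eball_sub_cball h); exact: ltW (lt_trans hj h2).
Qed.

(* Vanishes exactly when [u s >= seed_c q] almost everywhere on the ball, and is
   continuous in [s]: this makes [seed_set] measurable. *)
Definition deficit (q : seed) (s : R) : R :=
  nm (fun x => (\1_(eball (seed_z q) (seed_r q)) x : R) * negp (fun x : bV => u s x - seed_c q) x).

Let mind z r : measurable_fun (Om : set bV) (\1_(eball z r) : bV -> R).
Proof. exact: (@measurable_indic _ bV R (Om : set bV) _ (measurable_eball z r)). Qed.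
Let ind1 z r (x : bV) : Om x -> `|(\1_(eball z r) x : R)| <= 1.
Proof. by move=> _; rewrite indicE; case: (_ \in _); rewrite ?normr1 ?normr0. Qed.

Let Ldef q s : 0 < s < T ->
  L2 (fun x => (\1_(eball (seed_z q) (seed_r q)) x : R) * negp (fun x : bV => u s x - seed_c q) x).
Proof.
move=> sT; apply: (L2_bmul mOm (M := 1)); [exact: mind|exact: ind1|].
by apply: (L2_negp mOm); apply: (L2B mOm (Lu sT)); exact: (L2_cst oOm bOm).
Qed.

Lemma deficit_lip q s s' : 0 < s < T -> 0 < s' < T ->
  deficit q s <= deficit q s' + nm (fun x => u s x - u s' x).
Proof.
move=> sT s'T; set B := eball (seed_z q) (seed_r q).
have LB := L2B mOm (Ldef q sT) (Ldef q s'T).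
have e := nrmD mOm (Ldef q s'T) LB.
have -> : deficit q s = nm (fun x =>
   (\1_B x : R) * negp (fun x : bV => u s' x - seed_c q) x +
   ((\1_B x : R) * negp (fun x : bV => u s x - seed_c q) x -
    (\1_B x : R) * negp (fun x : bV => u s' x - seed_c q) x)).
  by rewrite /deficit; congr nrm; apply/funext => x; rewrite addrCA subrr addr0.
apply: (le_trans e); rewrite lerD2l.
apply: (nrm_le mOm); [exact: (L2B mOm (Lu sT) (Lu s'T))|exact: L2_meas LB|].
move=> x Ox; rewrite -mulrBr normrM.
apply: (@le_trans _ _ (1 * `|negp (fun x : bV => u s x - seed_c q) x - negp (fun x : bV => u s' x - seed_c q) x|)).
  by apply: ler_wpM2r => //; exact: ind1.
rewrite mul1r /negp; set X := u s x; set Y := u s' x.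
have := ler_norm (X - Y); have := ler_norm (Y - X); rewrite (distrC Y X) => h1 h2.
rewrite ler_norml; apply/andP; split.
  by case: (leP (- (X - _)) 0) => h3; case: (leP (- (Y - _)) 0) => h4; lra.
by case: (leP (- (X - _)) 0) => h3; case: (leP (- (Y - _)) 0) => h4; lra.
Qed.

Lemma deficit_eq0 q s : 0 < s < T -> deficit q s = 0 ->
  cball (seed_z q) (seed_r q) `<=` Om ->
  {ae leb, forall x, eball (seed_z q) (seed_r q) x -> seed_c q <= u s x}.
Proof.
move=> sT d0 sub; have L := Ldef q sT.
have i2 : deficit q s ^+ 2 = 0 by rewrite d0 expr0n.
rewrite /deficit nrm_sqr inner_sqr in i2.
have := Rintegral0_ae mOm (rint_meas (L2_sqr L)) (fun x _ => sqr_ge0 _) (L2_sqr L) i2.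
apply: ae_mono => x hx Bx; have /eqP := hx (sub _ (eball_sub_cball Bx)).
rewrite sqrf_eq0 indicE mem_set// mul1r /negp => /eqP h.
by have : - (u s x - seed_c q) <= 0; [rewrite -[leRHS]h le_max lexx|lra].
Qed.

Lemma deficit_measurable q : measurable_fun (`]0%R, T[%classic : set mR) (deficit q).
Proof.
apply: open_continuous_measurable_fun; first exact: interval_open.
move=> s; rewrite inE /= in_itv /= => sT.
apply/cvgrPdist_lt => e e0.
have h := tu sT.
have n1 : \forall s' \near s, (L2dist2O Om (u s') (u s) < (e ^+ 2)%:E)%E.
  have := h [set x | (x < (e ^+ 2)%:E)%E]; apply; apply: open_nbhs_nbhs.
  by split; [exact: open_ereal_lt_ereal|rewrite /= lte_fin exprn_gt0].
have n2 : \forall s' \near s, 0 < s' < T.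
  by have := @near_in_itvoo R 0 T s; rewrite in_itv /=; apply.
near=> s'; have s'T : 0 < s' < T by near: s'; exact: n2.
have : (L2dist2O Om (u s') (u s) < (e ^+ 2)%:E)%E by near: s'; exact: n1.
rewrite /L2dist2O (L2dist2E mOm (Lu s'T) (Lu sT)) lte_fin.
rewrite -nrm_sqr ltr_sqr ?nnegrE ?nrm_ge0 ?(ltW e0)// => lt.
have l1 := deficit_lip q s'T sT; have l2 := deficit_lip q sT s'T.
have en : nm (fun x => u s x - u s' x) = nm (fun x => u s' x - u s x).
  rewrite /nrm; congr Num.sqrt; apply: eq_Rintegral => x _; ring.
by rewrite ltr_norml; apply/andP; split; lra.
Unshelve. all: by end_near.
Qed.

Definition seed_set (q : seed) (ts : R) : set mR :=
  [set s | 0 < s < ts /\ deficit q s = 0 /\ cball (seed_z q) (seed_r q) `<=` Om].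

Lemma measurable_seed_set q ts : ts <= T -> measurable (seed_set q ts).
Proof.
move=> tsT; have [sub|nsub] := pselect (cball (seed_z q) (seed_r q) `<=` Om); last first.
  by rewrite (_ : seed_set q ts = set0)// -subset0 => s [_ [_]].
have -> : seed_set q ts = `]0%R, ts[%classic `&` ((`]0%R, T[%classic : set mR) `&` deficit q @^-1` [set 0]).
  apply/seteqP; split => s /=; rewrite !in_itv /=.
    move=> [/andP[h1 h2] [h3 _]]; rewrite h1 h2; split => //; split => //=.
    exact: lt_le_trans tsT.
  by move=> [h1 [_ h2]].
apply: measurableI => //; apply: deficit_measurable => //; exact: measurable_set1.
Qed.

(** Every time in (0,ts) belongs to some seed set; were these countably many sets all null, so would
    be the interval. *)
Lemma seed_measure ts : 0 < ts -> ts <= T -> exists q, (0 < lebR (seed_set q ts))%E.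
Proof.
move=> ts0 tsT; apply: contrapT => h.
have z q : lebR (seed_set q ts) = 0%E.
  apply/eqP; rewrite eq_le measure_ge0 andbT leNgt; apply/negP => lt; apply: h; by exists q.
pose F n := if unpickle n is Some q then seed_set q ts else set0.
have nF n : lebR.-negligible (F n).
  rewrite /F; case: unpickle => [q|]; last exact: negligible_set0.
  by apply/negligibleP; [exact: measurable_seed_set|exact: z].
have := negligible_bigcup nF => -[N [mN N0 sub]].
have I0 : (lebR (`]0%R, ts[%classic : set mR) <= 0)%E.
  rewrite -N0; apply: le_measure; rewrite ?inE//.
  move=> s; rewrite /= in_itv /= => sts; apply: sub.
  have sT : 0 < s < T by case/andP: sts => -> h1; exact: lt_le_trans tsT.
  have [q [sq hq]] := seed_exists sT; exists (pickle q); first by [].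
  rewrite /F pickleK; split => //; split => //.
  rewrite /deficit /nrm inner_sqr Rintegral_eq0 ?sqrtr0// => x Ox.
  rewrite indicE; case: (boolP (x \in _)) => [/set_mem Bx|_]; last by rewrite mul0r expr0n.
  have -> : negp (fun x : bV => u s x - seed_c q) x = 0; last by rewrite mulr0 expr0n.
  by rewrite /negp; apply/max_idPr; have := hq x Bx; lra.
by move: I0; rewrite lebesgue_measure_itv /= lte_fin ts0 -EFinB lee_fin; lra.
Qed.

Theorem strict_positivity t x : 0 < t < T -> Om x -> 0 < u t x.
Proof.
move=> tT Ox; have /andP[t0 t0T] := tT.
pose ts := t / 2; have ts0 : 0 < ts by rewrite divr_gt0.
have tst : ts < t by rewrite /ts; lra.
have tsT : ts < T by lra.
(* The first ball is sought before ts = t/2; afterwards every starting time [t'] beyond [ts] is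
   allowed. The bound may degenerate as [t'] tends to [ts], so a spreading step stays within the
   same definition whatever time it consumes. *)
pose Z := [set z | Om z /\ exists2 r, 0 < r & forall t', ts < t' < T ->
  exists2 delta, 0 < delta & forall s, t' <= s < T -> forall y, eball z r y -> delta <= u s y].
suff ZO : Z = Om.
  have [_ [r r0 hr]] : Z x by rewrite ZO.
  have ht : ts < t < T by rewrite tst.
  have [delta delta0 hd] := hr t ht.
  apply: (lt_le_trans delta0); apply: hd; [by rewrite lexx|exact: eball_center].
apply: kOm.
- have [q hq] := seed_measure ts0 (ltW tsT).
  have r0 : 0 < seed_r q by rewrite invr_gt0.
  have r2 : 0 < seed_r q / 2 by rewrite divr_gt0.
  have [s [sts [_ sub]]] : seed_set q ts !=set0.
    by apply/set0P/eqP => e; move: hq; rewrite e measure0 ltxx.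
  exists (seed_z q); split.
    by apply: sub; apply: eball_sub_cball; exact: eball_center.
  (* [spread] is applied with inner radius half the outer one and returns the same half ball, now at
     all times from [t'] on. *)
  exists (seed_r q / 2) => // t' /andP[tst' t'T].
  have r21 : seed_r q / 2 < seed_r q by lra.
  have sS : seed_set q ts `<=` `]0, ts[%classic by move=> s' [h _]; rewrite /= in_itv.
  apply: (spread (measurable_seed_set q (ltW tsT)) sS hq ts0 tst' t'T _ r2 r21 sub (delta := seed_c q)).
    by rewrite invr_gt0.
  move=> s' [/andP[s1 s2] [dq _]].
  have s'T : 0 < s' < T by rewrite s1 (lt_trans s2).
  apply: ae_mono (deficit_eq0 s'T dq sub) => y h By; apply: h.
  by apply: eballS By; lra.
- exists Z; last by rewrite setIidr// => z [].
  rewrite openE => z [Oz [r r0 hr]]; rewrite /interior.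
  have oW : open (eball z r `&` Om) by apply: openI => //; exact: (@open_eball R d z r).
  have nW : nbhs z (eball z r `&` Om).
    by apply: open_nbhs_nbhs; split => //; split => //; exact: eball_center.
  apply: filterS nW => y [By Oy]; split => //.
  have [r2 r20 sub] := cball_sub oW (conj By Oy).
  exists r2 => // t' ht'; have [delta delta0 hd] := hr _ ht'; exists delta => // s hs w Bw.
  by apply: hd => //; have [] := sub _ (eball_sub_cball Bw).
(* Relative closedness: some [y] of [Z] is so close to [z] that spreading around [y] to radius
   [rr / 2] reaches a neighbourhood of [z]. *)
- exists (closure Z); first exact: closed_closure.
  apply/seteqP; split => z; first by move=> [Oz h]; split => //; apply: subset_closure; split.
  move=> [Oz cZ]; split => //.
  have /nbhs_ballP[e /= e0 zO] : nbhs z Om by exact: open_nbhs_nbhs.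
  pose rr := e / 3; have rr0 : 0 < rr by rewrite divr_gt0.
  pose eps := rr / 2 / d.+1%:R; have eps0 : 0 < eps by rewrite !divr_gt0.
  have epsr : eps <= rr / 2 by rewrite ler_pdivrMr// ler_pMr ?divr_gt0// ler1n.
  have [y [[Oy [r r0 hr]] /ballP yz]] := cZ _ (nbhsx_ballx z eps eps0).
  have {}yz i : `|y ord0 i - z ord0 i| < eps by exact: yz.
  have sub : cball y rr `<=` Om.
    move=> w Bw; apply: zO; apply/ballP => // i.
    have h1 := cball_coord i (ltW rr0) Bw; have h2 := yz i.
    have -> : w ord0 i - z ord0 i = (w ord0 i - y ord0 i) + (y ord0 i - z ord0 i) by ring.
    apply: (le_lt_trans (ler_normD _ _)); rewrite /rr in h1 epsr *; lra.
  have Bz : eball y (rr / 2) z.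
    by apply: sqd_lt; [rewrite divr_gt0|move=> i; rewrite distrC; exact/ltW/yz].
  have [r2 r20 sub2] := cball_sub (@open_eball R d y (rr / 2)) Bz.
  exists r2 => // t' /andP[t'1 t'2].
  (* The bound near [y] is used on the interval (t3,t1), which fits strictly between [ts] and
     [t']. *)
  pose t1 := (ts + t') / 2; pose t3 := (ts + t1) / 2.
  have h3 : ts < t3 < T by apply/andP; rewrite /t3 /t1; split; lra.
  have [delta delta0 hd] := hr _ h3.
  pose r' := Num.min r (rr / 2).
  have r'0 : 0 < r' by rewrite lt_min r0 divr_gt0.
  have r'rr : r' < rr by rewrite gt_min; apply/orP; right; lra.
  have t31 : t3 < t1 by rewrite /t3 /t1; lra.
  have S0 : (0 < lebR (`]t3, t1[%classic : set mR))%E.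
    by rewrite lebesgue_measure_itv /= lte_fin t31 -EFinB lte_fin subr_gt0.
  have SI : (`]t3, t1[%classic : set mR) `<=` `]0, t1[%classic.
    by move=> s; rewrite /= !in_itv /= => /andP[a1 ->]; rewrite andbT; case/andP: h3; lra.
  have mS : measurable (`]t3, t1[%classic : set mR) by [].
  have hS s : (`]t3, t1[%classic : set mR) s -> {ae leb, forall x, eball y r' x -> delta <= u s x}.
    rewrite /= in_itv /= => /andP[a1 a2]; apply: ae_all => w Bw.
    apply: hd; first by apply/andP; split; [lra|rewrite /t1 in a2; lra].
    by apply: eballS Bw; [exact: ltW|rewrite ge_min lexx].
  have t10 : 0 < t1 by rewrite /t1; lra.
  have t1t' : t1 < t' by rewrite /t1; lra.
  have [delta' delta'0 hd'] := spread mS SI S0 t10 t1t' t'2 delta0 r'0 r'rr sub hS.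
  exists delta' => // s hs w Bw; apply: hd' => //; exact: sub2 (eball_sub_cball Bw).
Qed.

End Positivity.

(** * Eigenfunction coefficients of the solution *)

Section SolutionCoefficients.
Context {R : realType}.
Notation lebR := (@lebesgue_measure R).
Notation mR := (measurableTypeR R).

Lemma ae_continuous_eq0 (T : R) (g : R -> R) :
  (forall t, 0 < t < T -> {for t, continuous g}) ->
  {ae lebR, forall t : mR, 0 < t < T -> g t = 0} -> forall t, 0 < t < T -> g t = 0.
Proof.
move=> cg h t tT; apply/eqP; apply: contrapT => /negP gt.
have g0 : 0 < `|g t| by rewrite normr_gt0.
have n1 : \forall s \near t, `|g t - g s| < `|g t|.
  by move/cvgrPdist_lt: (cg t tT); exact.
have n2 : \forall s \near t, 0 < s < T.
  by have := @near_in_itvoo R 0 T t; rewrite in_itv /=; apply.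
have /nbhs_ballP[e /= e0 sube] : nbhs t [set s | `|g t - g s| < `|g t| /\ 0 < s < T] by exact: filterI n1 n2.
have [N [mN N0 sub]] := h.
pose lo : R := t - e; pose hi : R := t + e.
have lohi : lo < hi by rewrite /lo /hi; lra.
have : (lebR (`]lo, hi[%classic : set mR) <= 0)%E.
  rewrite -N0; apply: le_measure; rewrite ?inE//.
  move=> s; rewrite /= in_itv /= => st; apply: sub => hs.
  have [gs sT] : `|g t - g s| < `|g t| /\ 0 < s < T.
    by apply: sube; rewrite /ball /= distrC ltr_distl.
  by move: gs; rewrite hs// subr0 ltxx.
by rewrite lebesgue_measure_itv /= lte_fin lohi -EFinB lee_fin; lra.
Qed.

Context {d : nat}.
Notation V := 'rV[R]_d.
Notation bV := (borelRV R d).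
Notation leb := (@leb R d).
Variable Om : set V.
Hypothesis oOm : open Om.
Notation inr := (inner leb (Om : set bV)).
Notation nm := (nrm leb (Om : set bV)).
Notation L2 := (L2 leb (Om : set bV)).
Let mOm : measurable (Om : set bV). Proof. exact: measurable_open. Qed.

Lemma inner_time_continuous (T : R) (u : R -> V -> R) (v : V -> R) :
  (forall t, 0 < t < T -> L2 (u t)) -> L2_time_continuous Om T u -> L2 v ->
  forall t, 0 < t < T -> {for t, continuous (fun s => inr (u s) v)}.
Proof.
move=> Lu tu Lv t tT; apply/cvgrPdist_lt => e e0.
have n0 := nrm_ge0 leb (Om : set bV) v.
pose q := e / (nm v + 1); have q0 : 0 < q by rewrite divr_gt0// ltr_wpDl.
have n1 : \forall s \near t, (L2dist2O Om (u s) (u t) < (q ^+ 2)%:E)%E.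
  have := tu t tT [set x | (x < (q ^+ 2)%:E)%E]; apply; apply: open_nbhs_nbhs.
  by split; [exact: open_ereal_lt_ereal|rewrite /= lte_fin exprn_gt0].
have n2 : \forall s \near t, 0 < s < T.
  by have := @near_in_itvoo R 0 T t; rewrite in_itv /=; apply.
near=> s; have sT : 0 < s < T by near: s; exact: n2.
have : (L2dist2O Om (u s) (u t) < (q ^+ 2)%:E)%E by near: s; exact: n1.
have LB := L2B mOm (Lu s sT) (Lu t tT).
rewrite /L2dist2O (L2dist2E mOm (Lu s sT) (Lu t tT)) lte_fin.
rewrite -nrm_sqr ltr_sqr ?nnegrE ?nrm_ge0 ?(ltW q0)// => lt.
rewrite distrC -(innerBl mOm (Lu s sT) (Lu t tT) Lv).
apply: (le_lt_trans (CauchySchwarz mOm LB Lv)).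
have q1 : q * (nm v + 1) = e by rewrite /q divfK// gt_eqF// ltr_wpDl.
rewrite -q1; apply: (@le_lt_trans _ _ (q * nm v)); first by apply: ler_wpM2r => //; exact: ltW.
by rewrite ltr_pM2l// ltrDl.
Unshelve. all: by end_near.
Qed.

Variables (A : V -> 'M[R]_d) (c : V -> R) (lam : nat -> R) (phi : nat -> V -> R).
Hypothesis bOm : bounded_set Om.
Hypothesis ell : elliptic_coefficients Om A c.
Hypothesis eigs : eigensystem Om A c lam phi.

Lemma eigenvalue_gt0 n : 0 < lam n.
Proof.
have l1 : 0 < lam 1%N by exact: lt_trans (eig_pos eigs) (eig_simple eigs).
case: n => [|n]; first exact: eig_pos eigs.
by elim: n => // n; move=> /lt_le_trans; apply; exact: eig_nondecr eigs n.
Qed.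

Lemma opA_sym f h g k : opA Om A c f h -> opA Om A c g k -> inr h g = inr k f.
Proof.
have [L [th [_ [cA [bA sA]] _ [cc bc] _]]] := coefficient_bounds oOm bOm ell.
move=> /(opA_wkA oOm bOm cA bA cc bc) Wf /(opA_wkA oOm bOm cA bA cc bc) Wg.
exact: (wkA_sym oOm bOm cA bA sA cc bc Wf Wg).
Qed.

Lemma opA_L2 f h : opA Om A c f h -> L2 f /\ L2 h.
Proof. by move=> [[_ [G [[Lf _] _]]] [Lh _]]. Qed.

(** The Volterra equation is solved for w = -(Au, phi n) = -lam (u, phi n), the function supplied by
    the definition of the fractional derivative as square integrable and as the argument of J^al.
    Dividing by [lam n] then gives the coefficient of [u]. *)
Lemma solution_coefficients (al T : R) (a : V -> R) (u : R -> V -> R) :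
  0 < al < 1 -> 0 < T -> L2 a -> solution Om A c al T a u -> L2_time_continuous Om T u ->
  forall t n, 0 < t < T -> inr (u t) (phi n) = ee al (lam n) t * inr a (phi n).
Proof.
move=> al01 T0 La [Au [hA hF]] tu t n tT.
have Ephi := eig_eq eigs n; have [Lp _] := opA_L2 Ephi.
have Lu s : 0 < s < T -> L2 (u s) by move=> /hA /opA_L2[].
have ln := eigenvalue_gt0 n.
have Auu s : 0 < s < T -> inr (Au s) (phi n) = lam n * inr (u s) (phi n).
  move=> sT; rewrite (opA_sym (hA s sT) Ephi) (innerZl mOm _ Lp (Lu s sT)).
  by congr (_ * _); exact: innerC.
have [_ Lw hf] := hF _ Ephi.1.
pose w : mR -> R := fun s => - inr (Au s) (phi n).
have hw : {ae lebR, forall s : mR, 0 < s < T ->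
    w s = - lam n * inr a (phi n) - lam n * conv (gk al) w s}.
  apply: (@filterS _ _ (ae_filter_ringOfSetsType lebR) _ _ _ hf) => s hs sT; have : s \in `]0, T[ by rewrite in_itv.
  move=> /hs; rewrite /innerO (innerBl mOm (Lu s sT) La Lp) => e.
  (* [RL_integral] unfolds to the convolution with [gk al]. *)
  have -> : conv (gk al) w s = inr (u s) (phi n) - inr a (phi n) by rewrite e.
  by rewrite /w Auu//; ring.
have hee := mild_unique al01 ln T0 Lw hw.
have L0 : {ae lebR, forall s : mR, 0 < s < T ->
    inr (u s) (phi n) - ee al (lam n) s * inr a (phi n) = 0}.
  apply: filterS hee => s hs sT; have e : w s = - lam n * inr a (phi n) * ee al (lam n) s := hs sT.
  rewrite /w Auu// in e; have {}e : lam n * (inr (u s) (phi n) - ee al (lam n) s * inr a (phi n)) = 0 by lra.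
  by move/eqP: e; rewrite mulf_eq0 gt_eqF//= => /eqP.
have cg s : 0 < s < T ->
    {for s, continuous (fun s => inr (u s) (phi n) - ee al (lam n) s * inr a (phi n))}.
  move=> sT; have /andP[s0 _] := sT; have /andP[al0 _] := al01.
  have ce : {for s, continuous (ee al (lam n) : R -> R)}.
    exact: (@ML_continuous R al al0 (alt (lam n)) 1 s (geo_alt _) ltr01 s0).
  apply: cvgB; first exact: (inner_time_continuous Lu tu Lp sT).
  by apply: cvgM; [exact: ce|exact: cvg_cst].
by apply/eqP; rewrite -subr_eq0; apply/eqP; exact: (ae_continuous_eq0 cg L0 tT).
Qed.

End SolutionCoefficients.

(* The continuity hypotheses on u only fix its representative, in time (as an
   L^2(Omega)-valued function) and in space, so that u > 0 makes sense at every
   point. *)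
Theorem theorem3p4 (R : realType) (d : nat) (hd : (0 < d)%N)
  (alpha T beta : R) (halpha : 0 < alpha < 1) (hT : 0 < T)
  (hbeta0 : 0 <= beta) (hbeta : d%:R / 4 - 1 < beta)
  (Omega : set 'rV[R]_d)
  (hdom : bounded_domain Omega) (hbdry : smooth_boundary Omega)
  (A : 'rV[R]_d -> 'M[R]_d) (c : 'rV[R]_d -> R)
  (hell : elliptic_coefficients Omega A c)
  (lam : nat -> R) (phi : nat -> 'rV[R]_d -> R)
  (heig : eigensystem Omega A c lam phi)
  (a : 'rV[R]_d -> R)
  (ha : dom_powA Omega lam phi beta a)
  (ha_ge0 : {ae (@leb R d), forall x, Omega x -> 0 <= a x})
  (ha_neq0 : ~ {ae (@leb R d), forall x, Omega x -> a x = 0})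
  (u : R -> 'rV[R]_d -> R)
  (hu : solution Omega A c alpha T a u)
  (hu_time : L2_time_continuous Omega T u)
  (hu_space : forall t, 0 < t < T ->
     forall x, Omega x -> {for x, continuous (u t)}) :
  forall t x, 0 < t < T -> Omega x -> 0 < u t x.
Proof.
have [oOm kOm bOm _] := hdom; have [La _] := ha.
have mOm := measurable_open oOm.
have [L [th [[L0 th0] [cA [bA sA]] [dA [cdA bdA]] [cc bc] ellA]]] := coefficient_bounds oOm bOm hell.
have lam0 := eigenvalue_gt0 heig.
have eig n := opA_wkA oOm bOm cA bA cc bc (eig_eq heig n).
have Lphi n : L2 (@leb R d) (Omega : set (borelRV R d)) (phi n) by case: (eig n).
have orth : forall m n, inner leb (Omega : set (borelRV R d)) (phi m) (phi n) = (m == n)%:R.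
  exact: eig_orthonormal heig.
have compl := eig_complete heig.
have [Au [hA _]] := hu.
have Lu t : 0 < t < T -> L2 (@leb R d) (Omega : set (borelRV R d)) (u t).
  by move=> /hA /opA_L2[].
have cou t n (tT : 0 < t < T) :=
  solution_coefficients oOm bOm hell heig halpha hT La hu hu_time n tT.
have pm_res m (m0 : 0 < m) := pm_resolvent oOm bOm L0 cA bA th0 ellA cc bc lam0 eig orth m0.
have res_le := resolvent_ball_le oOm bOm L0 cA bA th0 ellA cc bc lam0 eig orth compl.
have ball_ge := resolvent_ball_ge oOm bOm L0 cA bA dA cdA bdA th0 ellA cc bc lam0 eig orth compl.
have na := nv_co mOm Lphi orth compl La ha_ge0.
have uge0 := u_ge0 oOm halpha lam0 Lphi orth compl pm_res na Lu cou.
have spr := spread oOm bOm halpha lam0 Lphi orth compl pm_res res_le ball_ge na Lu cou hu_space.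
apply: (strict_positivity oOm bOm kOm Lu hu_space hu_time uge0 _ spr) => t tT u0.
apply: ha_neq0.
(* If [u t] vanished, the strictly positive factors [ee alpha (lam n) t] would force every
   coefficient of [a] to vanish, and then [a] itself by Parseval. *)
have a0 n : co leb (Omega : set (borelRV R d)) phi a n = 0.
  have := cou t n tT; have -> : inner leb (Omega : set (borelRV R d)) (u t) (phi n) = 0.
    have m1 := L2_meas (Lu t tT).
    rewrite /inner (Rintegral_ae_eq mOm (g := fun=> 0)); first exact: Rintegral_eq0.
    - by apply: measurable_funM => //; exact: L2_meas (Lphi n).
    - exact: measurable_cst.
    - by apply: ae_mono u0 => x h Ox; rewrite h// mul0r.
  move=> /esym/eqP; rewrite mulf_eq0 gt_eqF ?ee_gt0//=; last by case/andP: tT.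
  by move=> /eqP.
have e0 : inner leb (Omega : set (borelRV R d)) a a = 0.
  rewrite -(parseval mOm Lphi compl La La) /pair.
  rewrite (_ : (fun N => _) = (fun=> 0)); first by rewrite lim_cst.
  by apply/funext => N; rewrite big1// => n _; rewrite a0 mul0r.
rewrite inner_sqr in e0.
have := Rintegral0_ae mOm (rint_meas (L2_sqr La)) (fun x _ => sqr_ge0 _) (L2_sqr La) e0.
by apply: ae_mono => x h Ox; have /eqP := h Ox; rewrite sqrf_eq0 => /eqP.
Qed.
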